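(* Let $U=\{z\in\mathbb{C}:|z|<1\}$, let $f:U\to\mathscr{R}(f)$ be a meromorphic function, where $\mathscr{R}(f)$ is the Riemann surface over the $w$-plane onto which $f$ maps $U$, and let $z_1,z_2\in U$ be points such that $f'(z_k)\neq 0$, $k=1,2$, and the projections $w_k=\mathrm{pr}\,f(z_k)$ satisfy $w_1\neq w_2$, $w_k\neq\infty$, $k=1,2$. Suppose that any Jordan curve on the surface $\mathscr{R}(f)$ that passes through either of the points $f(z_1)$, $f(z_2)$ but not through the ramification points of $\mathscr{R}(f)$, and that lies over a curve from the family $\Delta(w_1,w_2)$, is one-sheeted. Then $$ \mathrm{Re}\left\{\sum_{k=1}^2\frac{S_f(z_k)(w_2-w_1)^2}{6(f'(z_k))^2}+\frac{2(w_2-w_1)^2}{f'(z_1)f'(z_2)(z_1-z_2)^2}+\frac{2|w_2-w_1|^2}{f'(z_1)\overline{f'(z_2)}(1-z_1\overline{z}_2)^2}\right\} $$ $$ \le 2+\frac{|w_2-w_1|^2}{|f'(z_1)|^2(1-|z_1|^2)^2}+\frac{|w_2-w_1|^2}{|f'(z_2)|^2(1-|z_2|^2)^2}. $$ This estimate is sharp: equality is attained, for example, for the functions of the form $$ f(z)=\frac{z(1+\lambda^2)-i\lambda z^2-i\lambda}{\lambda z^2-i(1+\lambda^2)z+\lambda} $$ and the points $z_1=-\lambda$, $z_2=\lambda$, $0<\lambda<1$. Each of these extremal functions $f$ maps $U$ conformally and univalently onto the (extended) $w$-plane slit along an arc of the circle $|w|=1$, with $f(-\lambda)=-1$, $f(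\lambda)=1$.
   Context: Riemann surface of $f$: a (nonconstant) meromorphic function on $U$ with values in $\overline{\mathbb{C}}_w$ (the extended $w$-plane) is regarded as a conformal bijection $f:U\to\mathscr{R}(f)$ onto its Riemann surface $\mathscr{R}(f)$ spread over the $w$-plane, equipped with the projection $\mathrm{pr}:\mathscr{R}(f)\to\overline{\mathbb{C}}_w$; the composition $\mathrm{pr}\circ f$ is the given meromorphic function in the usual sense. Each point of $\mathscr{R}(f)$ has a neighborhood that is either a univalent disk or a finite-sheeted disk with a unique ramification point at its center; the ramification points are the images of the points of $U$ at which $\mathrm{pr}\circ f$ is not locally injective. Derivatives of $f$ denote derivatives of $\mathrm{pr}\circ f$, and the Schwarzian derivative is $$S_f(z)=\left(\frac{f''(z)}{f'(z)}\right)'-\frac12\left(\frac{f''(z)}{f'(z)}\right)^2.$$ Family $\Delta(w_1,w_2)$: for distinct $w_1,w_2\in\mathbb{C}$ and real $t\neq0$, the equation $$\left|\left(\frac{2w-w_1-w_2}{w_2-w_1}\right)^2-1-it\right|=|t|$$ defines a pair of closed Jordan curves in the $w$-plane, symmetric to each other with respect to the point $(w_1+w_2)/2$. $\Delta(w_1,w_2)$ is the family of all these curves as $t$ runs over $(-\infty,\infty)\setminus\{0\}$. A curve on $\mathscr{R}(f)$ ''lies over'' a plane curve $\gamma$ if its projection under $\mathrm{pr}$ is contained in $\gamma$. Jordan curves on $\mathscr{R}(f)$ are simple curves, not necessarily closed (arcs are allowed). One-sheeted: a set $\Lambda\subset\mathscr{R}(f)$ is one-sheeted if different points of $\Lambda$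 have different projections, i.e. $W',W''\in\Lambda$, $W'\neq W''$ implies $\mathrm{pr}\,W'\neq\mathrm{pr}\,W''$. *)

(* Defs.v *)
From HB Require Import structures.
From mathcomp Require Import all_boot all_order all_algebra complex.
From mathcomp Require Import all_classical all_reals all_analysis.

Set Implicit Arguments.
Unset Strict Implicit.
Unset Printing Implicit Defensive.

Import Order.TTheory GRing.Theory Num.Theory.
Import numFieldNormedType.Exports.

Local Open Scope classical_set_scope.
Local Open Scope ring_scope.

(* The metric topology of [R[i]], and [R[i]] as a normed space over itself:   *)
(* [derivable] and [derive1] below are complex differentiability and the      *)
(* complex derivative.                                                        *)
HB.instance Definition _ (R : rcfType) := NormedModule.copy R[i] R[i]^o.

(* The extended plane; the point at infinity is [None].                       *)
Definition sphere (R : realType) : topologicalType :=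
  one_point_compactification R[i].

Definition fin_pt (R : realType) (w : R[i]) : sphere R := Some w.

Definition infty (R : realType) : sphere R := None.

Definition unit_disk (R : realType) : set R[i] := [set z | `|z| < 1].

Definition holomorphic_at (R : realType) (g : R[i] -> R[i]) (z : R[i]) :=
  \forall u \near z, derivable g u 1.

Definition inv_sphere (R : realType) (w : R[i]) : sphere R :=
  if w == 0 then infty R else fin_pt w^-1.

(* A map into the sphere is meromorphic at [z] if near [z] it is [g], or      *)
(* [1 / g] with [g] vanishing at most at [z], for some holomorphic [g].       *)
Definition meromorphic_at (R : realType) (F : R[i] -> sphere R) (z : R[i]) :=
  exists g : R[i] -> R[i], holomorphic_at g z /\
    ((\forall u \near z, F u = fin_pt (g u)) \/
     (\forall u \near z, F u = inv_sphere (g u)) /\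
     (\forall u \near z^', g u != 0)).

Definition meromorphic_on (R : realType) (D : set R[i])
    (F : R[i] -> sphere R) :=
  forall z, D z -> meromorphic_at F z.

(* Nonvanishing derivative in one of the charts [w], [1 / w] of the sphere.   *)
Definition conformal_at (R : realType) (F : R[i] -> sphere R) (z : R[i]) :=
  exists g : R[i] -> R[i], [/\ holomorphic_at g z, derive1 g z != 0 &
    (\forall u \near z, F u = fin_pt (g u)) \/
    (\forall u \near z, F u = inv_sphere (g u))].

Definition conformal_on (R : realType) (D : set R[i]) (F : R[i] -> sphere R) :=
  forall z, D z -> conformal_at F z.

(* Plane-valued representative of [F], with the junk value 0 at the poles.    *)
Definition finite_part (R : realType) (F : R[i] -> sphere R) : R[i] -> R[i] :=
  fun z => odflt 0 (F z).

Definition deriv (R : realType) (F : R[i] -> sphere R) : R[i] -> R[i] :=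
  derive1 (finite_part F).

Definition schwarzian (R : realType) (F : R[i] -> sphere R) (z : R[i]) : R[i] :=
  let T := fun u => derive1n 2 (finite_part F) u / derive1 (finite_part F) u in
  derive1 T z - 2^-1 * T z ^+ 2.

(* The Riemann surface of [F : U -> sphere] is realised as the graph of [F]   *)
(* over the unit disk, inside [R[i] * sphere R]: the conformal bijection of   *)
(* [U] onto it is [lift F], with inverse the first projection, and [pr] is    *)
(* the projection to the sphere.  Since meromorphic maps are continuous, the  *)
(* subspace topology of the graph is the one making [lift F] a homeomorphism. *)
Definition lift (R : realType) (F : R[i] -> sphere R) (z : R[i]) :
  R[i] * sphere R := (z, F z).

Definition surface (R : realType) (F : R[i] -> sphere R) :
  set (R[i] * sphere R) := lift F @` @unit_disk R.

Definition pr (R : realType) (W : R[i] * sphere R) : sphere R := W.2.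

Definition locally_injective_at (R : realType) (F : R[i] -> sphere R)
    (z : R[i]) :=
  exists2 V : set R[i], nbhs z V & set_inj V F.

Definition ramification (R : realType) (F : R[i] -> sphere R) :
    set (R[i] * sphere R) :=
  lift F @` [set z | unit_disk z /\ ~ locally_injective_at F z].

Definition simple_arc (R : realType) (T : topologicalType) (J : set T) :=
  exists c : R -> T, [/\ {within `[0, 1], continuous c},
    set_inj `[0, 1] c & J = c @` `[0, 1]].

Definition simple_closed_curve (R : realType) (T : topologicalType)
    (J : set T) :=
  exists c : R -> T, [/\ {within `[0, 1], continuous c}, c 0 = c 1,
    set_inj `[0, 1[ c & J = c @` `[0, 1]].

(* Simple curves, closed or not.  A non-compact simple curve is an increasing *)
(* union of simple arcs, so it adds nothing to conditions tested on finitely  *)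
(* many of its points, such as [one_sheeted].                                 *)
Definition jordan_curve (R : realType) (T : topologicalType) (J : set T) :=
  simple_arc R J \/ simple_closed_curve R J.

Definition one_sheeted (R : realType) (L : set (R[i] * sphere R)) :=
  forall W' W'', L W' -> L W'' -> W' <> W'' -> pr W' <> pr W''.

Definition level_curves (R : realType) (w1 w2 : R[i]) (t : R) : set R[i] :=
  [set w | `|((2 * w - w1 - w2) / (w2 - w1)) ^+ 2 - 1 - 'i * t%:C%C|
           = `|t%:C%C|].

(* For each [t] the level set is a pair of disjoint closed Jordan curves,     *)
(* its connected components; the family consists of the individual curves.    *)
Definition Delta (R : realType) (w1 w2 : R[i]) : set (set R[i]) :=
  [set G | exists t : R, exists w : R[i],
    [/\ t != 0, level_curves w1 w2 t w &
        G = connected_component (level_curves w1 w2 t) w]].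

Definition lies_over (R : realType) (J : set (R[i] * sphere R))
    (G : set R[i]) :=
  @pr R @` J `<=` @fin_pt R @` G.

Definition admissible (R : realType) (F : R[i] -> sphere R)
    (z1 z2 w1 w2 : R[i]) : Prop :=
  [/\ meromorphic_on (@unit_disk R) F,
      unit_disk z1 /\ unit_disk z2,
      [/\ F z1 = fin_pt w1, F z2 = fin_pt w2 & w1 <> w2],
      deriv F z1 != 0 /\ deriv F z2 != 0 &
      forall J : set (R[i] * sphere R),
        jordan_curve R J -> J `<=` surface F ->
        J (lift F z1) \/ J (lift F z2) ->
        J `&` ramification F = set0 ->
        (exists2 G, Delta w1 w2 G & lies_over J G) ->
        one_sheeted J].

Definition schwarzian_lhs (R : realType) (F : R[i] -> sphere R)
    (z1 z2 w1 w2 : R[i]) : R[i] :=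
  'Re (schwarzian F z1 * (w2 - w1) ^+ 2 / (6 * deriv F z1 ^+ 2)
     + schwarzian F z2 * (w2 - w1) ^+ 2 / (6 * deriv F z2 ^+ 2)
     + 2 * (w2 - w1) ^+ 2 / (deriv F z1 * deriv F z2 * (z1 - z2) ^+ 2)
     + 2 * `|w2 - w1| ^+ 2
         / (deriv F z1 * (deriv F z2)^* * (1 - z1 * z2^*) ^+ 2)).

Definition schwarzian_rhs (R : realType) (F : R[i] -> sphere R)
    (z1 z2 w1 w2 : R[i]) : R[i] :=
  2 + `|w2 - w1| ^+ 2 / (`|deriv F z1| ^+ 2 * (1 - `|z1| ^+ 2) ^+ 2)
    + `|w2 - w1| ^+ 2 / (`|deriv F z2| ^+ 2 * (1 - `|z2| ^+ 2) ^+ 2).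

Definition extremal (R : realType) (lam : R) (z : R[i]) : sphere R :=
  let l : R[i] := lam%:C%C in
  let num := z * (1 + l ^+ 2) - 'i * l * z ^+ 2 - 'i * l in
  let den := l * z ^+ 2 - 'i * (1 + l ^+ 2) * z + l in
  if den == 0 then infty R else fin_pt (num / den).

Definition unit_circle (R : realType) : set R[i] := [set w | `|w| = 1].

(* Main.v *)
(* Put om = (2 f - w1 - w2) / (w2 - w1) and g = 1 / (om^2 - 1).  The curves of Delta(w1, w2) are
   level lines Im g = const <> 0, and g has simple poles at z1 and z2, with residues al_1, al_2.
   Compare g with p(z) = sum_k al_k / (z - z_k) - conj(al_k) z / (1 - conj(z_k) z), whose real part
   vanishes on |z| = 1: for a suitable constant be_k the coordinate h = g + be_k satisfies
   p = h + d_k / h + O(h^-2) at z_k, and the inequality says that Re (d_1 + d_2) <= 0.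
   Continue the inverse of h from the pole along the horizontal rays coming from +oo and from -oo.
   By hypothesis both continuations agree where they meet, since otherwise two such rays and the
   pole would form a Jordan curve over a curve of Delta(w1, w2) that is not one-sheeted.  So each
   pole yields a univalent map phi into the disk from a plane with horizontal slits, whose ends lie
   over |z| = 1.  Let P = p o phi.  On every horizontal line |P'|^2 >= 2 d(Re P)/dx - 1, and Re P is
   small at the ends of the slit, which bounds the Dirichlet integral of P, cut off at |P| ~ M, from
   below by a quantity involving Re d_k / M^2.  From above, the integrals for both poles sum to at
   most the cut-off Dirichlet integral of p over the disk, which the divergence theorem evaluates
   because Re p = 0 on the circle.  Letting M tend to infinity gives Re (d_1 + d_2) <= 0.
   The extremal functions are a Moebius map after z + 1 / z, hence injective. *)
From HB Require Import structures.
Require Import Defs.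
From mathcomp Require Import all_boot all_order all_algebra complex.
From mathcomp Require Import all_classical all_reals all_analysis.
From mathcomp Require Import measurable_realfun.
From mathcomp Require Import ring lra.
Set Implicit Arguments.
Unset Strict Implicit.
Unset Printing Implicit Defensive.
Import Order.TTheory GRing.Theory Num.Theory.
Import numFieldNormedType.Exports.
Local Open Scope classical_set_scope.
Local Open Scope ring_scope.

(* [lra] preprocesses every hypothesis and let-body of the context, which dominates its running time. *)
Ltac order_lra_except protect :=
  repeat match goal with X := _ |- _ => clearbody X end;
  repeat match goal with X : ?T |- _ => protect X; lazymatch type of T with Prop => lazymatch T with
    | is_true (Order.le _ _) => fail
    | is_true (Order.lt _ _) => fail
    | @eq (Real.sort _) _ _ => fail
    | _ => clear X end end end; lra.
Ltac order_lra := first [order_lra_except ltac:(fun _ => idtac) | lra].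

(** * Complex differentiation *)

(** Both energies are of order M^2 and their leading parts agree exactly, so the inequality sits in
    a term of order 1, and every error must be O(1/M) after integration. Hence a cut-off with
    Lipschitz derivative and an error of order M^-3 at each point. The agreement has a reason. In
    the disk, integration by parts, with Re p = 0 removing the boundary term, turns the energy into
    the integral of a density in p alone, [wsum], supported near the two poles, where p itself is a
    coordinate. On a line of the h-plane, integration by parts turns the cut-off into the same
    density. The two energies may be added because the images are disjoint: where Im g <> 0 the
    value om is never imaginary, and the continuation from z1 stays in Re om < 0, that from z2 in Re
    om > 0. In each half g determines f, so distinct endpoints with equal g have equal projections,
    which one-sheetedness forbids. Rays at the height of a critical value of g could stop inside the
    disk; the critical values at stake are countable, so these lines have measure zero. *)

Section ComplexNorm.
Context {R : realType}.
Local Notation C := R[i].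
Implicit Types (z w : C) (r : R).

(** Modulus with values in [R], so that estimates take place in a totally ordered field; the norm of
    [R[i]] takes its values in [R[i]]. *)
Definition nm z : R := complex.Re `|z|.

Lemma normE z : `|z| = (nm z)%:C%C.
Proof. by rewrite /nm normc_def. Qed.

Lemma nmE z : nm z = Num.sqrt (complex.Re z ^+ 2 + complex.Im z ^+ 2).
Proof. by rewrite /nm normc_def. Qed.

Lemma nm_sqr z : nm z ^+ 2 = complex.Re z ^+ 2 + complex.Im z ^+ 2.
Proof. by rewrite nmE sqr_sqrtr // addr_ge0 // sqr_ge0. Qed.

Lemma nm_ge0 z : 0 <= nm z.
Proof. by rewrite nmE sqrtr_ge0. Qed.

Lemma nm0 : nm 0 = 0.
Proof. by rewrite /nm normr0. Qed.

Lemma nm1 : nm 1 = 1.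
Proof. by rewrite /nm normr1. Qed.

Lemma nm_eq0 z : (nm z == 0) = (z == 0).
Proof.
rewrite -(normr_eq0 z) normE; apply/eqP/eqP => [->//|].
by move/(@complexI R).
Qed.

Lemma nm_gt0 z : (0 < nm z) = (z != 0).
Proof. by rewrite lt_def nm_ge0 andbT nm_eq0. Qed.

Lemma nmM z w : nm (z * w) = nm z * nm w.
Proof. by apply: complexI; rewrite rmorphM /= -!normE normrM. Qed.

Lemma nmV z : nm z^-1 = (nm z)^-1.
Proof. by apply: complexI; rewrite fmorphV /= -!normE normfV. Qed.

Lemma nm_div z w : nm (z / w) = nm z / nm w.
Proof. by rewrite nmM nmV. Qed.

Lemma nmX z n : nm (z ^+ n) = nm z ^+ n.
Proof. by elim: n => [|n IH]; rewrite ?expr0 ?nm1 // !exprS nmM IH. Qed.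

Lemma nmN z : nm (- z) = nm z.
Proof. by rewrite /nm normrN. Qed.

Lemma nmBC z w : nm (z - w) = nm (w - z).
Proof. by rewrite -nmN opprB. Qed.

Lemma nmD z w : nm (z + w) <= nm z + nm w.
Proof. by rewrite -lecR rmorphD /= -!normE ler_normD. Qed.

Lemma nmB z w : nm (z - w) <= nm z + nm w.
Proof. by rewrite -(nmN w) nmD. Qed.

Lemma nmBD v z w : nm (z - w) <= nm (z - v) + nm (v - w).
Proof. by rewrite (le_trans _ (nmD _ _)) // addrA subrK. Qed.

Lemma nm_sub_ge z w : nm z - nm w <= nm (z - w).
Proof. by rewrite lerBlDr (le_trans _ (nmD _ _)) // subrK. Qed.

Lemma nm_real r : nm r%:C%C = `|r|.
Proof. by rewrite nmE /= expr0n addr0 sqrtr_sqr. Qed.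

Lemma Re_le_nm z : `|complex.Re z| <= nm z.
Proof. by rewrite nmE -sqrtr_sqr ler_wsqrtr // lerDl sqr_ge0. Qed.

Lemma Im_le_nm z : `|complex.Im z| <= nm z.
Proof. by rewrite nmE -sqrtr_sqr ler_wsqrtr // lerDr sqr_ge0. Qed.

Lemma nm_le_ReIm z : nm z <= `|complex.Re z| + `|complex.Im z|.
Proof.
rewrite -(@ler_pXn2r _ 2) ?nnegrE ?nm_ge0 ?addr_ge0 // nm_sqr sqrrD !real_normK ?num_real //.
by rewrite addrAC lerDl mulrn_wge0 // mulr_ge0.
Qed.

Lemma ReD z w : complex.Re (z + w) = complex.Re z + complex.Re w.
Proof. by case: z w => [a b] []. Qed.
Lemma ImD z w : complex.Im (z + w) = complex.Im z + complex.Im w.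
Proof. by case: z w => [a b] []. Qed.
Lemma ReN z : complex.Re (- z) = - complex.Re z.
Proof. by case: z. Qed.
Lemma ImN z : complex.Im (- z) = - complex.Im z.
Proof. by case: z. Qed.
Lemma ReM z w :
  complex.Re (z * w) = complex.Re z * complex.Re w - complex.Im z * complex.Im w.
Proof. by case: z w => [a b] []. Qed.
Lemma ImM z w :
  complex.Im (z * w) = complex.Re z * complex.Im w + complex.Im z * complex.Re w.
Proof. by case: z w => [a b] []. Qed.

Definition ReImE := (ReD, ImD, ReN, ImN, ReM, ImM).

Lemma cplx_eq z w : complex.Re z = complex.Re w -> complex.Im z = complex.Im w ->
  z = w.
Proof. by case: z w => [a b] [c d] /= -> ->. Qed.

Lemma eta_C z : (complex.Re z +i* complex.Im z)%C = z.
Proof. by case: z. Qed.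

Lemma conjCE z : z^* = (complex.Re z -i* complex.Im z)%C.
Proof. by case: z. Qed.

Lemma nmJ z : nm z^* = nm z.
Proof. by rewrite !nmE conjCE /= sqrrN. Qed.

Lemma mulCJ z : z * z^* = (nm z ^+ 2)%:C%C.
Proof. by rewrite conjCE nm_sqr; apply: cplx_eq; rewrite ReImE /=; ring. Qed.

Lemma pair_nm (x y : R) : nm (x +i* y)%C <= `|x| + `|y|.
Proof. exact: nm_le_ReIm. Qed.

End ComplexNorm.

Section ComplexDerivative.
Context {R : realType}.
Local Notation C := R[i].
Implicit Types (F G : C -> C) (z w l : C).

Definition ccont F z := forall e : R, 0 < e ->
  exists2 d : R, 0 < d & forall w, nm (w - z) < d -> nm (F w - F z) < e.

(** Multiplied out, so that [w = z] needs no exception and remainders add and compose without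
    division. *)
Definition cder F z l := forall e : R, 0 < e ->
  exists2 d : R, 0 < d & forall w, nm (w - z) < d ->
    nm (F w - F z - l * (w - z)) <= e * nm (w - z).

Lemma cder_cont F z l : cder F z l -> ccont F z.
Proof.
move=> H e e0; have [d d0 Hd] := H 1 ltr01.
have K0 : 0 < 1 + nm l by rewrite ltr_wpDr ?nm_ge0.
exists (Num.min d (e / (1 + nm l))); first by rewrite lt_min d0 divr_gt0.
move=> w; rewrite lt_min => /andP[/Hd H1 H2].
have -> : F w - F z = (F w - F z - l * (w - z)) + l * (w - z) by ring.
apply: le_lt_trans (nmD _ _) _.
rewrite nmM; move: H2; rewrite ltr_pdivlMr // => H2.
by rewrite mul1r in H1; rewrite mulrDr mulr1 mulrC in H2; lra.
Qed.

Lemma cder_id z : cder id z 1.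
Proof. by move=> e e0; exists 1 => // w _; rewrite mul1r subrr nm0 mulr_ge0 ?nm_ge0 ?ltW. Qed.

Lemma cder_cst c z : cder (fun=> c) z 0.
Proof. by move=> e e0; exists 1 => // w _; rewrite mul0r !subrr nm0 mulr_ge0 ?nm_ge0 ?ltW. Qed.

Lemma cder_ext F G z l : (exists2 d : R, 0 < d & forall w, nm (w - z) < d -> F w = G w) ->
  cder F z l -> cder G z l.
Proof.
move=> [d d0 FG] H e e0; have [d' d'0 Hd] := H e e0.
exists (Num.min d d'); first by rewrite lt_min d0.
move=> w; rewrite lt_min => /andP[/FG <- /Hd].
by rewrite (FG z) // subrr nm0.
Qed.

Lemma ccont_ext F G z : (exists2 d : R, 0 < d & forall w, nm (w - z) < d -> F w = G w) ->
  ccont F z -> ccont G z.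
Proof.
move=> [d d0 FG] H e e0; have [d' d'0 Hd] := H e e0.
exists (Num.min d d'); first by rewrite lt_min d0.
move=> w; rewrite lt_min => /andP[/FG <- /Hd].
by rewrite (FG z) // subrr nm0.
Qed.

Lemma cderD F G z l m : cder F z l -> cder G z m -> cder (fun w => F w + G w) z (l + m).
Proof.
move=> HF HG e e0; have e2 : 0 < e / 2 by rewrite divr_gt0.
have [d d0 Hd] := HF _ e2; have [d' d'0 Hd'] := HG _ e2.
exists (Num.min d d'); first by rewrite lt_min d0.
move=> w; rewrite lt_min => /andP[/Hd H1 /Hd' H2].
have -> : F w + G w - (F z + G z) - (l + m) * (w - z) =
  (F w - F z - l * (w - z)) + (G w - G z - m * (w - z)) by ring.
apply: le_trans (nmD _ _) _; lra.
Qed.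

Lemma cderZ c F z l : cder F z l -> cder (fun w => c * F w) z (c * l).
Proof.
move=> HF e e0; have K0 : 0 < 1 + nm c by rewrite ltr_wpDr ?nm_ge0.
have [d d0 Hd] := HF _ (divr_gt0 e0 K0); exists d => // w /Hd H1.
have -> : c * F w - c * F z - c * l * (w - z) = c * (F w - F z - l * (w - z)) by ring.
rewrite nmM; apply: le_trans (ler_wpM2l (nm_ge0 c) H1) _.
rewrite mulrA ler_wpM2r ?nm_ge0 // mulrCA -[leRHS]mulr1 ler_wpM2l ?(ltW e0) //.
by rewrite ler_pdivrMr // mul1r lerDr.
Qed.

Lemma cderN F z l : cder F z l -> cder (fun w => - F w) z (- l).
Proof.
move=> /(cderZ (-1)); rewrite mulN1r => H; apply: cder_ext H.
by exists 1 => // w _; rewrite mulN1r.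
Qed.

Lemma cderB F G z l m : cder F z l -> cder G z m -> cder (fun w => F w - G w) z (l - m).
Proof. by move=> HF /cderN; apply: cderD. Qed.

Lemma cder_bound F z l : cder F z l -> exists2 d : R, 0 < d &
  forall w, nm (w - z) < d -> nm (F w - F z) <= (1 + nm l) * nm (w - z).
Proof.
move=> /(_ 1 ltr01)[d d0 H]; exists d => // w /H H1.
have -> : F w - F z = (F w - F z - l * (w - z)) + l * (w - z) by ring.
by apply: le_trans (nmD _ _) _; rewrite nmM mulrDl; lra.
Qed.

Lemma cder_comp F G z l m : cder F z l -> cder G (F z) m ->
  cder (fun w => G (F w)) z (m * l).
Proof.
move=> HF HG e e0.
have [d1 d10 H1] := cder_bound HF.
have K0 : 0 < 1 + nm l by rewrite ltr_wpDr ?nm_ge0.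
have K1 : 0 < 1 + nm m by rewrite ltr_wpDr ?nm_ge0.
have [d2 d20 H2] := HG (e / 2 / (1 + nm l)) (divr_gt0 (divr_gt0 e0 (ltr0n _ 2)) K0).
have [d3 d30 H3] := HF (e / 2 / (1 + nm m)) (divr_gt0 (divr_gt0 e0 (ltr0n _ 2)) K1).
exists (Num.min (Num.min d1 d3) (d2 / (1 + nm l))); first by rewrite !lt_min d10 d30 divr_gt0.
move=> w; rewrite !lt_min -andbA => /and3P[/H1 A1 /H3 A3]; rewrite ltr_pdivlMr // => A2.
have /H2 B : nm (F w - F z) < d2 by apply: le_lt_trans A2; rewrite mulrC.
have -> : G (F w) - G (F z) - m * l * (w - z) =
  (G (F w) - G (F z) - m * (F w - F z)) + m * (F w - F z - l * (w - z)) by ring.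
apply: le_trans (nmD _ _) _; rewrite nmM.
have n0 := nm_ge0 (w - z).
have B1 : nm (G (F w) - G (F z) - m * (F w - F z)) <= e / 2 * nm (w - z).
  apply: le_trans B _; apply: le_trans (ler_wpM2l _ A1) _; first by rewrite divr_ge0 ?ltW ?divr_gt0.
  by rewrite mulrA divfK // gt_eqF.
have B2 : nm m * nm (F w - F z - l * (w - z)) <= e / 2 * nm (w - z).
  apply: le_trans (ler_wpM2l (nm_ge0 m) A3) _.
  rewrite mulrA ler_wpM2r // mulrCA -[leRHS]mulr1 ler_wpM2l ?ltW ?divr_gt0 //.
  by rewrite ltr_pdivrMr // mul1r ltrDr.
lra.
Qed.

Lemma cderM F G z l m : cder F z l -> cder G z m ->
  cder (fun w => F w * G w) z (l * G z + F z * m).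
Proof.
move=> HF HG.
(* polarisation reduces the product rule to squares, via the chain rule *)
have sq a : cder (fun w : C => w * w) a (2 * a).
  move=> e e0; exists e => // w H.
  have -> : w * w - a * a - 2 * a * (w - a) = (w - a) * (w - a) by ring.
  by rewrite nmM ler_wpM2r ?nm_ge0 // ltW.
have := cderZ (4^-1) (cderB (cder_comp (cderD HF HG) (sq _)) (cder_comp (cderB HF HG) (sq _))).
have -> : 4^-1 * (2 * (F z + G z) * (l + m) - 2 * (F z - G z) * (l - m)) = l * G z + F z * m
  by field.
by apply: cder_ext; exists 1 => // w _; field.
Qed.

Lemma cder_inv z : z != 0 -> cder (fun w : C => w^-1) z (- (z ^+ 2)^-1).
Proof.
move=> z0 e e0; have n0 : 0 < nm z by rewrite nm_gt0.
exists (Num.min (nm z / 2) (e * nm z ^+ 3 / 2)).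
  by rewrite lt_min divr_gt0 // divr_gt0 // mulr_gt0 // exprn_gt0.
move=> w; rewrite lt_min => /andP[H1 H2].
have nw : nm z / 2 <= nm w by have := nm_sub_ge z w; rewrite nmBC; lra.
have w0 : w != 0 by rewrite -nm_gt0; apply: lt_le_trans nw; rewrite divr_gt0.
have -> : w^-1 - z^-1 - - (z ^+ 2)^-1 * (w - z) = (w - z) * ((w - z) / (z ^+ 2 * w)).
  by field; rewrite w0 z0.
rewrite nmM mulrC ler_wpM2r ?nm_ge0 //.
rewrite nm_div nmM nmX ler_pdivrMr ?mulr_gt0 ?exprn_gt0 ?nm_gt0 //.
apply: le_trans (ltW H2) _.
have -> : e * nm z ^+ 3 / 2 = e * (nm z ^+ 2 * (nm z / 2)) by ring.
by rewrite ler_wpM2l ?(ltW e0) // ler_wpM2l // exprn_ge0 ?nm_ge0.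
Qed.

Lemma nm_small z : (forall e : R, 0 < e -> nm z <= e) -> z = 0.
Proof.
move=> H; apply/eqP; rewrite -nm_eq0; apply: contraT => n0.
have p0 : 0 < nm z by rewrite lt_def n0 nm_ge0.
have := H (nm z / 2) (divr_gt0 p0 (ltr0n _ 2)); lra.
Qed.

Lemma cder_unique F z l m : cder F z l -> cder F z m -> l = m.
Proof.
move=> H1 H2; apply/eqP; rewrite -subr_eq0; apply/eqP; apply: nm_small => e e0.
have e2 : 0 < e / 2 by rewrite divr_gt0.
have [d d0 Hd] := H1 _ e2; have [d' d'0 Hd'] := H2 _ e2.
set k := Num.min d d' / 2; have k0 : 0 < k by rewrite divr_gt0 // lt_min d0.
have kd : nm (z + k%:C%C - z) = k by rewrite addrC addKr nm_real gtr0_norm.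
have m0 : 0 < Num.min d d' by rewrite lt_min d0.
have /Hd A1 : nm (z + k%:C%C - z) < d by rewrite kd (@lt_le_trans _ _ (Num.min d d')) ?ge_min ?lexx // /k; lra.
have /Hd' A2 : nm (z + k%:C%C - z) < d' by rewrite kd (@lt_le_trans _ _ (Num.min d d')) ?ge_min ?lexx ?orbT // /k; lra.
rewrite -(ler_pM2r k0) -{1}kd -nmM.
have -> : (l - m) * (z + k%:C%C - z) = (F (z + k%:C%C) - F z - m * (z + k%:C%C - z)) -
  (F (z + k%:C%C) - F z - l * (z + k%:C%C - z)) by ring.
rewrite kd in A1 A2; apply: le_trans (nmB _ _) _; lra.
Qed.

Lemma cder_invf F z l : cder F z l -> F z != 0 ->
  cder (fun w => (F w)^-1) z (- l / F z ^+ 2).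
Proof. by move=> H /cder_inv /(cder_comp H); rewrite mulNr mulrC mulNr. Qed.

Lemma cder_div F G z l m : cder F z l -> cder G z m -> G z != 0 ->
  cder (fun w => F w / G w) z ((l * G z - F z * m) / G z ^+ 2).
Proof.
move=> HF HG G0; have := cderM HF (cder_invf HG G0).
by congr cder; field.
Qed.

Lemma cderX F z l n : cder F z l -> cder (fun w => F w ^+ n.+1) z (n.+1%:R * F z ^+ n * l).
Proof.
move=> H; elim: n => [|n IH].
  by rewrite expr0 mulr1 mul1r; apply: cder_ext H; exists 1.
have := cderM H IH; have -> : l * F z ^+ n.+1 + F z * (n.+1%:R * F z ^+ n * l) =
  n.+2%:R * F z ^+ n.+1 * l by rewrite -[n.+2]addn1 natrD exprS; ring.
by apply: cder_ext; exists 1 => // w _; rewrite -exprS.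
Qed.

End ComplexDerivative.

(** * Curves in the plane: derivatives and integrals along a real parameter *)

Section RealToComplex.
Context {R : realType}.
Local Notation C := R[i].
Local Notation mu := (@lebesgue_measure R).
Implicit Types (k : R -> C) (a b t : R) (f : R -> R).

Lemma continuous_eps f t : (forall e : R, 0 < e -> exists2 d : R, 0 < d &
    forall s, `|s - t| < d -> `|f s - f t| < e) -> {for t, continuous f}.
Proof.
move=> H; apply/cvgrPdist_lt => /= e e0; have [d d0 Hd] := H e e0.
exists d => //= s; rewrite /= distrC => /Hd H1; by rewrite distrC.
Qed.

Lemma is_derive_eps f t l : (forall e : R, 0 < e -> exists2 d : R, 0 < d &
    forall s, `|s - t| < d -> `|f s - f t - l * (s - t)| <= e * `|s - t|) ->
  is_derive t 1 f l.
Proof.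
move=> H.
suff L : h^-1 *: ((f \o shift t) (h *: 1) - f t) @[h --> 0^'] --> l.
  by apply: DeriveDef; [apply: cvgP L | apply: cvg_lim L].
apply/cvgrPdist_le => /= e e0; have [d d0 Hd] := H e e0.
exists d => //= h /=; rewrite sub0r normrN => hd h0.
have := Hd (h + t); rewrite addrK => /(_ hd) Hh.
have nh : 0 < `|h| by rewrite normr_gt0.
rewrite /shift /= -(ler_pM2r nh) -normrM mulrBl [_%:A]mulr1 distrC.
suff -> : h^-1 *: (f (h + t) - f t) * h = f (h + t) - f t by [].
by rewrite -[_ *: _]/(_ * _) mulrC mulrA divff // mul1r.
Qed.

Definition rcont k t := forall e : R, 0 < e -> exists2 d : R, 0 < d &
  forall s, `|s - t| < d -> nm (k s - k t) < e.

Definition rder k t (l : C) := forall e : R, 0 < e -> exists2 d : R, 0 < d &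
  forall s, `|s - t| < d -> nm (k s - k t - (s - t)%:C%C * l) <= e * `|s - t|.

Lemma rcont_Re k t : rcont k t -> {for t, continuous (fun s => complex.Re (k s))}.
Proof.
move=> H; apply: continuous_eps => e /H[d d0 Hd]; exists d => // s /Hd.
by apply: le_lt_trans; rewrite -ReN -ReD Re_le_nm.
Qed.

Lemma rcont_Im k t : rcont k t -> {for t, continuous (fun s => complex.Im (k s))}.
Proof.
move=> H; apply: continuous_eps => e /H[d d0 Hd]; exists d => // s /Hd.
by apply: le_lt_trans; rewrite -ImN -ImD Im_le_nm.
Qed.

Lemma rder_Re k t l : rder k t l -> is_derive t 1 (fun s => complex.Re (k s)) (complex.Re l).
Proof.
move=> H; apply: is_derive_eps => e /H[d d0 Hd]; exists d => // s /Hd.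
apply: le_trans; apply: le_trans (Re_le_nm _); rewrite !ReImE /= mul0r subr0.
by rewrite [(s - t) * _]mulrC.
Qed.

Lemma rder_Im k t l : rder k t l -> is_derive t 1 (fun s => complex.Im (k s)) (complex.Im l).
Proof.
move=> H; apply: is_derive_eps => e /H[d d0 Hd]; exists d => // s /Hd.
apply: le_trans; apply: le_trans (Im_le_nm _); rewrite !ReImE /= mul0r addr0.
by rewrite [(s - t) * _]mulrC.
Qed.

Lemma rder_cont k t l : rder k t l -> rcont k t.
Proof.
move=> H e e0; have [d d0 Hd] := H 1 ltr01.
have K0 : 0 < 1 + nm l by rewrite ltr_wpDr ?nm_ge0.
exists (Num.min d (e / (1 + nm l))); first by rewrite lt_min d0 divr_gt0.
move=> s; rewrite lt_min => /andP[/Hd H1]; rewrite ltr_pdivlMr // => H2.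
have -> : k s - k t = (k s - k t - (s - t)%:C%C * l) + (s - t)%:C%C * l by ring.
apply: le_lt_trans (nmD _ _) _; rewrite nmM nm_real.
by rewrite mul1r in H1; rewrite mulrDr mulr1 in H2; lra.
Qed.

Lemma cder_rder (F : C -> C) k t l m : rder k t l -> cder F (k t) m ->
  rder (fun s => F (k s)) t (m * l).
Proof.
move=> Hk HF e e0.
have K0 : 0 < 1 + nm l by rewrite ltr_wpDr ?nm_ge0.
have K1 : 0 < 1 + nm m by rewrite ltr_wpDr ?nm_ge0.
have e20 : 0 < e / 2 by rewrite divr_gt0.
have [d1 d10 H1] := HF (e / 2 / (1 + nm l)) (divr_gt0 e20 K0).
have [d2 d20 H2] := rder_cont Hk d10.
have [d3 d30 H3] := Hk (e / 2 / (1 + nm m)) (divr_gt0 e20 K1).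
have [d4 d40 H4] := Hk 1 ltr01.
exists (Num.min (Num.min d2 d3) d4); first by rewrite !lt_min d20 d30.
move=> s; rewrite !lt_min -andbA => /and3P[/H2/H1 A1 /H3 A3 /H4 A4].
have -> : F (k s) - F (k t) - (s - t)%:C%C * (m * l) =
  (F (k s) - F (k t) - m * (k s - k t)) + m * (k s - k t - (s - t)%:C%C * l) by ring.
have B4 : nm (k s - k t) <= (1 + nm l) * `|s - t|.
  have -> : k s - k t = (k s - k t - (s - t)%:C%C * l) + (s - t)%:C%C * l by ring.
  apply: le_trans (nmD _ _) _; rewrite nmM nm_real mulrDl (mulrC (nm l)); lra.
apply: le_trans (nmD _ _) _; rewrite nmM.
have B1 : nm (F (k s) - F (k t) - m * (k s - k t)) <= e / 2 * `|s - t|.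
  apply: le_trans A1 _; apply: le_trans (ler_wpM2l _ B4) _; first by rewrite divr_ge0 ?ltW.
  by rewrite mulrA divfK // gt_eqF.
have B2 : nm m * nm (k s - k t - (s - t)%:C%C * l) <= e / 2 * `|s - t|.
  apply: le_trans (ler_wpM2l (nm_ge0 m) A3) _.
  rewrite mulrA ler_wpM2r // mulrCA -[leRHS]mulr1 ler_wpM2l ?ltW //.
  by rewrite ltr_pdivrMr // mul1r ltrDr.
lra.
Qed.

Lemma ccont_rcont (F : C -> C) k t : rcont k t -> ccont F (k t) -> rcont (fun s => F (k s)) t.
Proof. by move=> Hk HF e /HF[d /Hk[d' d'0 H'] H]; exists d' => // s /H'/H. Qed.

Lemma rder_line (z0 u : C) t : rder (fun s => z0 + s%:C%C * u) t u.
Proof.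
move=> e e0; exists 1 => // s _.
have -> : z0 + s%:C%C * u - (z0 + t%:C%C * u) - (s - t)%:C%C * u = 0.
  by rewrite rmorphB /=; ring.
by rewrite nm0 mulr_ge0 // ltW.
Qed.

Lemma rder_h (y : R) t : rder (fun s => (s +i* y)%C) t 1.
Proof.
have := @rder_line (0 +i* y)%C 1 t; congr rder; apply/funext => s.
by apply: cplx_eq; rewrite /= ?ReImE /=; ring.
Qed.

Lemma rder_v (x : R) t : rder (fun s => (x +i* s)%C) t 'i%C.
Proof.
have := @rder_line (x +i* 0)%C 'i%C t; congr rder; apply/funext => s.
by apply: cplx_eq; rewrite /= ?ReImE /=; ring.
Qed.

(** The real mean value theorem is applied to the component of [F] in the direction of the increment
    [F w - F z], that is to [Re (u * F)] along the segment, with [u] the conjugate of that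
    increment. *)
Lemma cderMVT (F F' : C -> C) (z w : C) (K : R) :
  (forall t, 0 <= t <= 1 -> cder F (z + t%:C%C * (w - z)) (F' (z + t%:C%C * (w - z))) /\
     nm (F' (z + t%:C%C * (w - z))) <= K) ->
  nm (F w - F z) <= K * nm (w - z).
Proof.
move=> H; set u := (F w - F z)^*.
pose h t := complex.Re (u * F (z + t%:C%C * (w - z))).
have dh t : 0 <= t <= 1 ->
    is_derive t 1 h (complex.Re (u * F' (z + t%:C%C * (w - z)) * (w - z))).
  move=> /H[Ht _]; apply: rder_Re.
  have := cder_rder (@rder_line z (w - z) t) (cderZ u Ht).
  by congr rder.
have ch : {within `[0, 1], continuous h}.
  apply: derivable_within_continuous => t; rewrite in_itv /= => /dh.
  by move=> /@ex_derive.
have [c] := MVT ltr01 (fun t ht => dh t (subset_itv_oo_cc ht)) ch.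
rewrite in_itv /= => /andP[c0 c1]; rewrite subr0 mulr1 /h mul0r addr0 mul1r.
have -> : z + (w - z) = w by ring.
rewrite -ReN -ReD -mulrBr => E.
have [_ Hc] := H c (introT andP (conj (ltW c0) (ltW c1))).
have E2 : complex.Re (u * (F w - F z)) = nm (F w - F z) ^+ 2 by rewrite /u mulrC mulCJ.
have [->|n0] := eqVneq (nm (F w - F z)) 0.
  by rewrite mulr_ge0 ?nm_ge0 // (le_trans _ Hc) ?nm_ge0.
have p0 : 0 < nm (F w - F z) by rewrite lt_def n0 nm_ge0.
rewrite -(ler_pM2l p0) -expr2 -E2 E.
apply: le_trans (ler_norm _) _; apply: le_trans (Re_le_nm _) _.
by rewrite !nmM nmJ -mulrA ler_wpM2l ?nm_ge0 // ler_wpM2r ?nm_ge0.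
Qed.

Definition cint k a b : C :=
  ((\int[mu]_(t in `[a, b]) complex.Re (k t)) +i* (\int[mu]_(t in `[a, b]) complex.Im (k t)))%C.

Definition rconts k a b := forall t, a <= t <= b -> rcont k t.

Lemma within_eps f a b : (forall t, a <= t <= b -> {for t, continuous f}) ->
  {within `[a, b], continuous f}.
Proof.
move=> H; apply: continuous_in_subspaceT => t; rewrite inE /= in_itv /= => /H; exact.
Qed.

Lemma cont_integrable f a b : (forall t, a <= t <= b -> {for t, continuous f}) ->
  mu.-integrable `[a, b] (EFin \o f).
Proof.
move=> H; apply: continuous_compact_integrable; first exact: segment_compact.
exact: within_eps.
Qed.

Lemma rconts_int k a b : rconts k a b ->
  mu.-integrable `[a, b] (EFin \o (fun t => complex.Re (k t))) /\
  mu.-integrable `[a, b] (EFin \o (fun t => complex.Im (k t))).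
Proof. by move=> H; split; apply: cont_integrable => t /H; [apply: rcont_Re|apply: rcont_Im]. Qed.

Lemma rcontZ c k t : rcont k t -> rcont (fun s => c * k s) t.
Proof.
move=> H e e0; have K0 : 0 < 1 + nm c by rewrite ltr_wpDr ?nm_ge0.
have [d d0 Hd] := H _ (divr_gt0 e0 K0); exists d => // s /Hd.
rewrite ltr_pdivlMr // => A; rewrite -mulrBr nmM.
by apply: le_lt_trans A; rewrite mulrC ler_wpM2l ?nm_ge0 // lerDr.
Qed.

Lemma cintD k1 k2 a b : rconts k1 a b -> rconts k2 a b ->
  cint (fun t => k1 t + k2 t) a b = cint k1 a b + cint k2 a b.
Proof.
move=> H1 H2; have [A1 B1] := rconts_int H1; have [A2 B2] := rconts_int H2.
by apply: cplx_eq; rewrite ReImE /= -RintegralD //; apply: eq_Rintegral => t _; rewrite ReImE.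
Qed.

Lemma cintZ c k a b : rconts k a b -> cint (fun t => c * k t) a b = c * cint k a b.
Proof.
move=> H; have [A B] := rconts_int H.
have Z r f : mu.-integrable `[a, b] (EFin \o f) -> mu.-integrable `[a, b] (EFin \o (fun x => r * f x)).
  by move=> I; apply: (integrableZl _ r I).
apply: cplx_eq; rewrite ReImE /= -!RintegralZl // -?RintegralB -?RintegralD //; try exact: Z;
  by apply: eq_Rintegral => t _; rewrite ReImE.
Qed.

Lemma cint_split k a c b : a <= c <= b -> rconts k a b ->
  cint k a b = cint k a c + cint k c b.
Proof.
move=> /andP[ac cb] H; have [A B] := rconts_int H.
have S f : mu.-integrable `[a, b] (EFin \o f) ->
   (\int[mu]_(t in `[a, b]) f t = \int[mu]_(t in `[a, c]) f t + \int[mu]_(t in `[c, b]) f t)%R.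
  move=> I; have := @Rintegral_itvB _ f (BLeft a) (BRight b) c I.
  rewrite !bnd_simp => /(_ ac cb) /(canRL (subrK _)) ->.
  rewrite addrC; congr (_ + _); apply: Rintegral_itv_obnd_cbnd.
  apply: integrableS I => //; apply: subset_itvr; rewrite bnd_simp //.
by apply: cplx_eq; rewrite ReImE /= -S.
Qed.

(** The factor 2 comes from bounding the real and imaginary parts separately; later uses want a
    bound only up to a constant factor. *)
Lemma cint_le k a b M : a <= b -> rconts k a b -> (forall t, a <= t <= b -> nm (k t) <= M) ->
  nm (cint k a b) <= 2 * (M * (b - a)).
Proof.
move=> ab H HM; have [A B] := rconts_int H.
have S f : mu.-integrable `[a, b] (EFin \o f) -> (forall t, a <= t <= b -> `|f t| <= M) ->
    `|\int[mu]_(t in `[a, b]) f t|%R <= M * (b - a).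
  move=> I Hf; apply: le_trans (le_normr_Rintegral _ I) _ => //.
  have -> : M * (b - a) = (\int[mu]_(t in `[a, b]) M)%R.
    rewrite Rintegral_cst //= lebesgue_measure_itv /= lte_fin.
    by move: ab; rewrite le_eqVlt => /predU1P[->|->] //; rewrite ltxx subrr.
  apply: le_Rintegral => //; first exact: (integrable_abse I).
    by apply: (@cont_integrable (cst M)) => t _; exact: cst_continuous.
apply: le_trans (nm_le_ReIm _) _ => /=.
rewrite mulr2n mulrDl mul1r lerD // S // => t /HM; apply: le_trans; [exact: Re_le_nm|exact: Im_le_nm].
Qed.

Lemma cint_FTC K k a b : a <= b -> rconts k a b -> (forall t, a <= t <= b -> rder K t (k t)) ->
  cint k a b = K b - K a.
Proof.
rewrite le_eqVlt => /predU1P[<- _ _|ab Hk HK].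
  by apply: cplx_eq; rewrite /= set_itv1 Rintegral_set1 subrr.
have S f F : (forall t, a <= t <= b -> {for t, continuous f}) ->
  (forall t, a <= t <= b -> is_derive t 1 F (f t)) ->
  (\int[mu]_(t in `[a, b]) f t = F b - F a)%R.
  move=> cf dF; rewrite /Rintegral (continuous_FTC2 (F := F)) //.
  - exact: within_eps.
  - have cF t : a <= t <= b -> {for t, continuous F}.
      by move=> /dF [/derivable1_diffP/differentiable_continuous].
    split.
    + by move=> t /subset_itv_oo_cc; rewrite in_itv /= => /dF[].
    + by apply: cvg_at_right_filter; apply: cF; rewrite lexx ltW.
    + by apply: cvg_at_left_filter; apply: cF; rewrite lexx ltW.
  - move=> t /subset_itv_oo_cc; rewrite in_itv /= => /dF D.
    by rewrite derive1E; apply: derive_val.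
apply: cplx_eq; rewrite !ReImE /=.
  apply: (S (fun t => complex.Re (k t)) (fun t => complex.Re (K t))) => t tab.
    exact: rcont_Re (Hk t tab).
  exact: rder_Re (HK t tab).
apply: (S (fun t => complex.Im (k t)) (fun t => complex.Im (K t))) => t tab.
  exact: rcont_Im (Hk t tab).
exact: rder_Im (HK t tab).
Qed.

Lemma eq_cint k1 k2 a b : (forall t, a <= t <= b -> k1 t = k2 t) -> cint k1 a b = cint k2 a b.
Proof.
by move=> H; apply: cplx_eq => /=; apply: eq_Rintegral => t; rewrite inE /= in_itv /= => /H ->.
Qed.

End RealToComplex.

(** * Cauchy theory *)

Ltac blra := repeat (apply/andP; split); order_lra.

Section Goursat.
Context {R : realType}.
Local Notation C := R[i].
Implicit Types (F G : C -> C) (x y : R).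

Definition hint F x0 x1 y : C := cint (fun x => F (x +i* y)%C) x0 x1.
Definition vint F x y0 y1 : C := cint (fun y => F (x +i* y)%C) y0 y1.
(** The counterclockwise integral of [F dz] over the boundary of a rectangle: [dz] is [dx] on the
    horizontal and [i dy] on the vertical sides. *)
Definition bint F x0 x1 y0 y1 : C :=
  hint F x0 x1 y0 - hint F x0 x1 y1 + 'i%C * (vint F x1 y0 y1 - vint F x0 y0 y1).

Definition onrect (P : C -> Prop) x0 x1 y0 y1 :=
  forall x y, x0 <= x <= x1 -> y0 <= y <= y1 -> P (x +i* y)%C.

Lemma onrect_sub (P Q : C -> Prop) x0 x1 y0 y1 x0' x1' y0' y1' :
  (forall z, P z -> Q z) -> x0 <= x0' -> x1' <= x1 -> y0 <= y0' -> y1' <= y1 ->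
  onrect P x0 x1 y0 y1 -> onrect Q x0' x1' y0' y1'.
Proof.
move=> PQ h1 h2 h3 h4 H x y /andP[a b] /andP[c d]; apply: PQ; apply: H.
  by rewrite (le_trans h1 a) (le_trans b h2).
by rewrite (le_trans h3 c) (le_trans d h4).
Qed.

Definition onh (P : C -> Prop) x0 x1 y0 y1 :=
  forall x y, x0 <= x <= x1 -> y = y0 \/ y = y1 -> P (x +i* y)%C.
Definition onv (P : C -> Prop) x0 x1 y0 y1 :=
  forall x y, x = x0 \/ x = x1 -> y0 <= y <= y1 -> P (x +i* y)%C.
Definition onbd P x0 x1 y0 y1 := onh P x0 x1 y0 y1 /\ onv P x0 x1 y0 y1.

Lemma onrect_bd P x0 x1 y0 y1 : x0 <= x1 -> y0 <= y1 ->
  onrect P x0 x1 y0 y1 -> onbd P x0 x1 y0 y1.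
Proof.
move=> hx hy H; split=> x y.
  by move=> xx [] ->; apply: H => //; rewrite ?lexx ?hy.
by move=> [] -> yy; apply: H => //; rewrite ?lexx ?hx.
Qed.

Lemma rconts_h F x0 x1 y0 y1 y : onh (ccont F) x0 x1 y0 y1 -> y = y0 \/ y = y1 ->
  rconts (fun x => F (x +i* y)%C) x0 x1.
Proof.
move=> H yy x xx; apply: (@ccont_rcont _ F (fun x => (x +i* y)%C)); last exact: H.
exact: rder_cont (rder_h y x).
Qed.

Lemma rconts_v F x0 x1 y0 y1 x : onv (ccont F) x0 x1 y0 y1 -> x = x0 \/ x = x1 ->
  rconts (fun y => F (x +i* y)%C) y0 y1.
Proof.
move=> H xx y yy; apply: (@ccont_rcont _ F (fun y => (x +i* y)%C)); last exact: H.
exact: rder_cont (rder_v x y).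
Qed.

Section Rectangle.
Variables x0 x1 y0 y1 : R.
Hypotheses (x01 : x0 <= x1) (y01 : y0 <= y1).


Let l1 (a b : R) : a = a \/ a = b. Proof. by left. Qed.
Let l2 (a b : R) : b = a \/ b = b. Proof. by right. Qed.

Lemma bintD F G : onbd (ccont F) x0 x1 y0 y1 -> onbd (ccont G) x0 x1 y0 y1 ->
  bint (fun z => F z + G z) x0 x1 y0 y1 = bint F x0 x1 y0 y1 + bint G x0 x1 y0 y1.
Proof.
move=> [HF1 HF2] [HG1 HG2]; rewrite /bint /hint /vint !cintD; first ring.
all: by first [apply: (rconts_h HF1)|apply: (rconts_h HG1)|apply: (rconts_v HF2)|apply: (rconts_v HG2)]; by [left|right].
Qed.

Lemma bintZ c F : onbd (ccont F) x0 x1 y0 y1 ->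
  bint (fun z => c * F z) x0 x1 y0 y1 = c * bint F x0 x1 y0 y1.
Proof.
move=> [HF1 HF2]; rewrite /bint /hint /vint !cintZ; first ring.
all: by first [apply: (rconts_h HF1)|apply: (rconts_v HF2)]; by [left|right].
Qed.

Lemma eq_bint F G : onbd (fun z => F z = G z) x0 x1 y0 y1 ->
  bint F x0 x1 y0 y1 = bint G x0 x1 y0 y1.
Proof.
move=> [H1 H2]; rewrite /bint /hint /vint; congr (_ - _ + _ * (_ - _)); apply: eq_cint => t tt;
  by first [apply: H1 => //; by [left|right]|apply: H2 => //; by [left|right]].
Qed.

Lemma bint_le F M : onbd (ccont F) x0 x1 y0 y1 -> onbd (fun z => nm (F z) <= M) x0 x1 y0 y1 ->
  nm (bint F x0 x1 y0 y1) <= 4 * M * ((x1 - x0) + (y1 - y0)).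
Proof.
move=> [HF1 HF2] [HM1 HM2]; rewrite /bint.
have A y : y = y0 \/ y = y1 -> nm (hint F x0 x1 y) <= 2 * (M * (x1 - x0)).
  by move=> yy; apply: cint_le => // [|t tt]; [exact: (rconts_h HF1)|exact: HM1].
have B x : x = x0 \/ x = x1 -> nm (vint F x y0 y1) <= 2 * (M * (y1 - y0)).
  by move=> yy; apply: cint_le => // [|t tt]; [exact: (rconts_v HF2)|exact: HM2].
apply: le_trans (nmD _ _) _; rewrite nmM.
have -> : nm 'i%C = 1 :> R by rewrite nmE /= expr0n add0r expr1n sqrtr1.
have := nmB (hint F x0 x1 y0) (hint F x0 x1 y1).
have := nmB (vint F x1 y0 y1) (vint F x0 y0 y1).
have := A _ (l1 _ _); have := A _ (l2 _ _); have := B _ (l1 _ _); have := B _ (l2 _ _); order_lra.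
Qed.

Lemma bint_prim F G : onbd (ccont F) x0 x1 y0 y1 -> onbd (fun z => cder G z (F z)) x0 x1 y0 y1 ->
  bint F x0 x1 y0 y1 = 0.
Proof.
move=> [HF1 HF2] [HG1 HG2].
have A y : y = y0 \/ y = y1 -> hint F x0 x1 y = G (x1 +i* y)%C - G (x0 +i* y)%C.
  move=> yy; rewrite /hint (cint_FTC (K := fun x => G (x +i* y)%C)) //; first exact: (rconts_h HF1).
  by move=> t tt; rewrite -[F _]mulr1; apply: (@cder_rder _ G _ t) (rder_h y t) _; apply: HG1.
have B x : x = x0 \/ x = x1 -> 'i%C * vint F x y0 y1 = G (x +i* y1)%C - G (x +i* y0)%C.
  move=> xx; rewrite /vint -cintZ; last exact: (rconts_v HF2).
  rewrite (cint_FTC (K := fun y => G (x +i* y)%C)) //.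
    by move=> t tt; apply: rcontZ; apply: (rconts_v HF2).
  by move=> t tt; rewrite mulrC; apply: (@cder_rder _ G _ t) (rder_v x t) _; apply: HG2.
by rewrite /bint mulrBr !A ?B; [ring|by [left|right]..].
Qed.

Lemma bint_splitx F x : onh (ccont F) x0 x1 y0 y1 -> x0 <= x <= x1 ->
  bint F x0 x1 y0 y1 = bint F x0 x y0 y1 + bint F x x1 y0 y1.
Proof.
move=> HF xx; have E y : y = y0 \/ y = y1 -> hint F x0 x1 y = hint F x0 x y + hint F x x1 y.
  by move=> yy; apply: cint_split => //; exact: (rconts_h HF).
by rewrite /bint !E; [ring|by [left|right]..].
Qed.

Lemma bint_splity F y : onv (ccont F) x0 x1 y0 y1 -> y0 <= y <= y1 ->
  bint F x0 x1 y0 y1 = bint F x0 x1 y0 y + bint F x0 x1 y y1.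
Proof.
move=> HF yy; have E x : x = x0 \/ x = x1 -> vint F x y0 y1 = vint F x y0 y + vint F x y y1.
  by move=> xx; apply: cint_split => //; exact: (rconts_v HF).
by rewrite /bint !E; [ring|by [left|right]..].
Qed.

End Rectangle.

Lemma exists_pow2 (r e : R) : 0 <= r -> 0 < e -> exists n, r / 2 ^+ n < e.
Proof.
move=> r0 e0; have p := divr_ge0 r0 (ltW e0).
exists (Num.bound (r / e)); rewrite ltr_pdivrMr ?exprn_gt0 // mulrC -ltr_pdivrMr //.
apply: lt_trans (archi_boundP p) _.
by rewrite -natrX ltr_nat ltn_expl.
Qed.

Lemma last_quarter (K a b c d : R) : 4 * K <= a + b + (c + d) -> a < K -> b < K -> c < K -> K <= d.
Proof. lra. Qed.

Lemma quarter F a b w h K : 0 <= w -> 0 <= h ->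
  onrect (ccont F) a (a + (w + w)) b (b + (h + h)) ->
  4 * K <= nm (bint F a (a + (w + w)) b (b + (h + h))) ->
  exists a' b', [/\ a' = a \/ a' = a + w, b' = b \/ b' = b + h &
    K <= nm (bint F a' (a' + w) b' (b' + h))].
Proof.
move=> wp hp CF; have [C1 C2] := onrect_bd (ler_wpDr (addr_ge0 wp wp) (lexx a)) (ler_wpDr (addr_ge0 hp hp) (lexx b)) CF.
rewrite (@bint_splity _ _ _ _ _ (b + h)) //; last by blra.
have Cs x0 x1 y0 y1 : a <= x0 -> x1 <= a + (w + w) -> b <= y0 -> y1 <= b + (h + h) ->
  onrect (ccont F) x0 x1 y0 y1 by move=> *; apply: onrect_sub CF.
have S y0 y1 : b <= y0 -> y0 <= y1 -> y1 <= b + (h + h) -> bint F a (a + (w + w)) y0 y1 =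
    bint F a (a + w) y0 y1 + bint F (a + w) (a + (w + w)) y0 y1.
  move=> *; apply: bint_splitx => //; last by blra.
  by apply: (onrect_bd _ _ (Cs _ _ _ _ _ _ _ _)).1 => //; clear -wp; order_lra.
rewrite !S; try by clear -wp hp; order_lra.
set B1 := bint F a (a + w) b (b + h).
set B2 := bint F (a + w) (a + (w + w)) b (b + h).
set B3 := bint F a (a + w) (b + h) (b + (h + h)).
set B4 := bint F (a + w) (a + (w + w)) (b + h) (b + (h + h)) => T0.
have T : 4 * K <= nm B1 + nm B2 + (nm B3 + nm B4).
  apply: le_trans T0 _; apply: le_trans (nmD _ _) _; apply: lerD; exact: nmD.
have [L1|L1] := leP K (nm B1); first by exists a, b; split; [left|left|].
have [L2|L2] := leP K (nm B2).
  by exists (a + w), b; rewrite -addrA; split; [right|left|].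
have [L3|L3] := leP K (nm B3).
  by exists a, (b + h); rewrite -(addrA b); split; [left|right|].
exists (a + w), (b + h); rewrite -(addrA b) -(addrA a); split; [by right|by right|].
exact: last_quarter T L1 L2 L3.
Qed.

(** Bisection: some quarter keeps at least a quarter of the modulus of the integral. At the common
    point of the nested rectangles [F] is affine up to [e] times the distance. The affine part has a
    primitive, and the remainder contributes at most a multiple of [e] times the squared size, which
    also shrinks by 4 at each step. *)
Lemma goursat F (F' : C -> C) x0 x1 y0 y1 : x0 <= x1 -> y0 <= y1 ->
  onrect (fun z => cder F z (F' z)) x0 x1 y0 y1 -> bint F x0 x1 y0 y1 = 0.
Proof.
move=> x01 y01 HF.
have CF : onrect (ccont F) x0 x1 y0 y1.
  by apply: onrect_sub HF => // z; apply: cder_cont.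
set W := x1 - x0; set H := y1 - y0; set eta := nm (bint F x0 x1 y0 y1).
have W0 : 0 <= W by rewrite subr_ge0.
have H0 : 0 <= H by rewrite subr_ge0.
pose w n := W / 2 ^+ n; pose h n := H / 2 ^+ n.
have wS n : w n = w n.+1 + w n.+1 by rewrite /w exprS; field; rewrite expf_neq0 // pnatr_eq0.
have hS n : h n = h n.+1 + h n.+1 by rewrite /h exprS; field; rewrite expf_neq0 // pnatr_eq0.
have w0 n : 0 <= w n by rewrite divr_ge0 // exprn_ge0.
have h0 n : 0 <= h n by rewrite divr_ge0 // exprn_ge0.
pose St n (p : R * R) := [/\ x0 <= p.1 /\ p.1 + w n <= x1, y0 <= p.2 /\ p.2 + h n <= y1 &
  eta / 4 ^+ n <= nm (bint F p.1 (p.1 + w n) p.2 (p.2 + h n))].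
(* Totalised for [choice]: a state violating [St] is sent to the junk value [(0, 0)]. *)
have step (q : nat * (R * R)) : exists p', St q.1 q.2 -> [/\ St q.1.+1 p',
    q.2.1 <= p'.1 /\ p'.1 + w q.1.+1 <= q.2.1 + w q.1 &
    q.2.2 <= p'.2 /\ p'.2 + h q.1.+1 <= q.2.2 + h q.1].
  case: q => n [a b] /=.
  have [[[/= a1 a2] [/= b1 b2] /= Hn]|no] := pselect (St n (a, b)); last by exists (0, 0) => /no.
  have wn := wS n; have hn := hS n; have wp := w0 n.+1; have hp := h0 n.+1.
  have e4 : 4 * (eta / 4 ^+ n.+1) <= nm (bint F a (a + (w n.+1 + w n.+1)) b (b + (h n.+1 + h n.+1))).
    rewrite -wn -hn; apply: le_trans Hn; rewrite exprS le_eqVlt; apply/orP; left; apply/eqP; field.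
    by rewrite expf_neq0 // pnatr_eq0.
  have CF' : onrect (ccont F) a (a + (w n.+1 + w n.+1)) b (b + (h n.+1 + h n.+1)).
    by apply: onrect_sub CF => //; rewrite -?wn -?hn.
  have [a' [b' [Ha Hb HK]]] := quarter wp hp CF' e4.
  clear -a1 a2 b1 b2 wn hn wp hp Ha Hb HK.
  exists (a', b') => _; split => //=; [split => //= | | ];
    clear HK; case: Ha => Ha; case: Hb => Hb; subst a' b'; clear -a1 a2 b1 b2 wn hn wp hp;
    move: (w n.+1) (w n) (h n.+1) (h n) a2 b2 wn hn wp hp => w' w1 h' h1 *; order_lra.
have [f Hf] := choice step.
pose p := fix p n := if n is m.+1 then f (m, p m) else (x0, y0).
have Sp n : St n (p n).
  elim: n => [|n IH]; last by have [] := Hf (n, p n) IH.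
  rewrite /St /= /w /h !expr0 !divr1 /W /H; split; try order_lra.
  by rewrite !(addrC _ (_ - _)) !subrK.
have m1 n k : (p n).1 <= (p (n + k)%N).1 /\ (p (n + k)%N).1 + w (n + k)%N <= (p n).1 + w n.
  elim: k => [|k [IH1 IH2]]; first by rewrite addn0.
  by rewrite addnS; have [/= _ [u v] _] := Hf (_, p (n + k)%N) (Sp _); split; order_lra.
have m2 n k : (p n).2 <= (p (n + k)%N).2 /\ (p (n + k)%N).2 + h (n + k)%N <= (p n).2 + h n.
  elim: k => [|k [IH1 IH2]]; first by rewrite addn0.
  by rewrite addnS; have [/= _ _ [u v]] := Hf (_, p (n + k)%N) (Sp _); split; order_lra.
pose a := sup (range (fun n => (p n).1)); pose b := sup (range (fun n => (p n).2)).
have aP n : (p n).1 <= a <= (p n).1 + w n.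
  apply/andP; split.
    apply: ub_le_sup; last by exists n.
    exists x1 => _ [k _ <-]; have [[u v] _ _] := Sp k; have := w0 k; order_lra.
  apply: ge_sup; first by exists (p 0).1, 0%N.
  move=> _ [k _ <-]; have [kn|nk] := leqP k n.
    by have [] := m1 k (n - k)%N; rewrite subnKC //; have := w0 n; order_lra.
  by have [] := m1 n (k - n)%N; rewrite subnKC ?(ltnW nk) //; have := w0 k; order_lra.
have bP n : (p n).2 <= b <= (p n).2 + h n.
  apply/andP; split.
    apply: ub_le_sup; last by exists n.
    exists y1 => _ [k _ <-]; have [_ [u v] _] := Sp k; have := h0 k; order_lra.
  apply: ge_sup; first by exists (p 0).2, 0%N.
  move=> _ [k _ <-]; have [kn|nk] := leqP k n.
    by have [] := m2 k (n - k)%N; rewrite subnKC //; have := h0 n; order_lra.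
  by have [] := m2 n (k - n)%N; rewrite subnKC ?(ltnW nk) //; have := h0 k; order_lra.
apply: nm_small => e e0; rewrite -/eta.
(* Divisor for the accuracy of the affine approximation: 4 comes from [bint_le], the square from
   perimeter times diameter, and [+ 1] covers a degenerate rectangle. *)
have K0 : 0 < 4 * (W + H + 1) ^+ 2 by rewrite mulr_gt0 // exprn_gt0 //; order_lra.
have [z0 zx] : exists z0 : C, z0 = (a +i* b)%C by eexists.
have [d d0 Hd] : exists2 d : R, 0 < d & forall z, nm (z - z0) < d ->
    nm (F z - F z0 - F' z0 * (z - z0)) <= e / (4 * (W + H + 1) ^+ 2) * nm (z - z0).
  rewrite zx; apply: (HF a b); last exact: divr_gt0.
    by have := aP 0%N; rewrite /w expr0 divr1 /= /W; move=> /andP[u v]; apply/andP; split; order_lra.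
  by have := bP 0%N; rewrite /h expr0 divr1 /= /H; move=> /andP[u v]; apply/andP; split; order_lra.
have [n Hn] := exists_pow2 (addr_ge0 W0 H0) d0.
have wh : w n + h n < d by rewrite /w /h -mulrDl.
have [[u1 u2] [v1 v2] HSt] := Sp n.
have an := aP n; have bn := bP n.
set x := (p n).1 in u1 u2 HSt an *; set y := (p n).2 in v1 v2 HSt bn *.
have wn0 := w0 n; have hn0 := h0 n.
have xw : x <= x + w n by order_lra.
have yh : y <= y + h n by order_lra.
pose A z := F z0 + F' z0 * (z - z0).
(* A primitive of the affine part [A], whose boundary integral therefore vanishes and can be
   subtracted. *)
pose P z := F z0 * z + F' z0 * (2^-1 * ((z - z0) * (z - z0))).
have dA z : cder A z (0 + F' z0 * (1 - 0)).
  apply: cderD; first exact: cder_cst.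
  apply: cderZ; apply: cderB; [exact: cder_id|exact: cder_cst].
have dP z : cder P z (A z).
  have := cderD (cderZ (F z0) (@cder_id _ z)) (cderZ (F' z0) (cderZ 2^-1
   (cderM (cderB (@cder_id _ z) (@cder_cst _ z0 z)) (cderB (@cder_id _ z) (@cder_cst _ z0 z))))).
  by congr cder; rewrite /A; field.
have EA : bint A x (x + w n) y (y + h n) = 0.
  by apply: (@bint_prim _ _ _ _ xw yh A P); apply: onrect_bd => //;
    move=> s t _ _; first exact: cder_cont (dA _); exact: dP.
have EE : bint F x (x + w n) y (y + h n) =
    bint (fun z => F z + (-1) * A z) x (x + w n) y (y + h n).
  rewrite bintD //.
  - rewrite bintZ //; first by rewrite EA; ring.
    by apply: onrect_bd => // s t _ _; exact: cder_cont (dA _).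
  - by apply: onrect_bd => //; apply: onrect_sub CF.
  - by apply: onrect_bd => // s t _ _; apply: cder_cont (cderZ _ (dA _)).
have BD : nm (bint F x (x + w n) y (y + h n)) <=
   4 * (e / (4 * (W + H + 1) ^+ 2) * (w n + h n)) * ((x + w n - x) + (y + h n - y)).
  rewrite EE; apply: bint_le => //; apply: onrect_bd => //.
    move=> s t ss tt; apply: cder_cont.
    apply: cderD (cderZ _ (dA _)); apply: HF; clear -u1 u2 v1 v2 ss tt;
      move: (w n) (h n) u2 v2 ss tt => w' h' u2 v2 /andP[? ?] /andP[? ?]; blra.
  move=> s t /andP[s1 s2] /andP[t1 t2].
  have nz : nm ((s +i* t)%C - z0) <= w n + h n.
    rewrite zx; apply: le_trans (pair_nm _ _) _; move/andP: an => [an1 an2]; move/andP: bn => [bn1 bn2].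
    by clear -an1 an2 bn1 bn2 s1 s2 t1 t2; move: (w n) (h n) a b an1 an2 bn1 bn2 s1 s2 t1 t2 => w' h' a b *;
      apply: lerD; rewrite ler_norml; blra.
  have -> : F (s +i* t)%C + -1 * A (s +i* t)%C = F (s +i* t)%C - F z0 - F' z0 * ((s +i* t)%C - z0).
    by rewrite /A; ring.
  apply: le_trans (Hd _ _) _; first exact: le_lt_trans wh.
  by rewrite ler_wpM2l // divr_ge0 ?ltW.
have {}BD := le_trans HSt BD.
have q0 : 0 < 4 ^+ n :> R by rewrite exprn_gt0.
have wE : w n + h n = (W + H) / 2 ^+ n by rewrite /w /h -mulrDl.
have q4 : 4 ^+ n = 2 ^+ n * 2 ^+ n :> R by rewrite -exprMn; congr (_ ^+ _); ring.
have q2 : 2 ^+ n != 0 :> R by rewrite expf_neq0.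
have S1 : W + H + 1 != 0 by rewrite gt_eqF //; clear -W0 H0; order_lra.
clearbody W H.
have {}BD : eta <= e * ((W + H) ^+ 2 / (W + H + 1) ^+ 2).
  rewrite ler_pdivrMr // in BD; apply: le_trans BD _.
  have -> : x + w n - x + (y + h n - y) = w n + h n by ring.
  rewrite wE q4 le_eqVlt; apply/orP; left; apply/eqP; field.
  by rewrite ?q2 ?S1.
apply: le_trans BD _; rewrite -[leRHS]mulr1 ler_wpM2l ?(ltW e0) // ler_pdivrMr.
  by rewrite mul1r; clear -W0 H0; nra.
by rewrite exprn_gt0 //; clear -W0 H0; order_lra.
Qed.

End Goursat.

(** * Cauchy's formula on squares and its consequences *)

Section Cauchy.
Context {R : realType}.
Local Notation C := R[i].
Implicit Types (F G K : C -> C) (x y : R) (a b z : C).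

Lemma ccontM F G z : ccont F z -> ccont G z -> ccont (fun w => F w * G w) z.
Proof.
move=> HF HG e e0.
have A0 : 0 < 1 + nm (F z) + nm (G z) by have := nm_ge0 (F z); have := nm_ge0 (G z); order_lra.
set k := Num.min 1 (e / (1 + nm (F z) + nm (G z))).
have k0 : 0 < k by rewrite lt_min ltr01 divr_gt0.
have [d d0 Hd] := HF k k0; have [d' d'0 Hd'] := HG k k0.
exists (Num.min d d'); first by rewrite lt_min d0.
move=> w; rewrite lt_min => /andP[/Hd A /Hd' B].
have -> : F w * G w - F z * G z = (F w - F z) * (G w - G z) + ((F w - F z) * G z + F z * (G w - G z)).
  by ring.
have k1 : k <= 1 by rewrite ge_min lexx.
have k2 : k * (1 + nm (F z) + nm (G z)) <= e by rewrite -ler_pdivlMr // ge_min lexx orbT.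
apply: le_lt_trans (nmD _ _) _; rewrite nmM.
have := nmD ((F w - F z) * G z) (F z * (G w - G z)); rewrite !nmM => T.
have a0 := nm_ge0 (F w - F z); have b0 := nm_ge0 (G w - G z).
have f0 := nm_ge0 (F z); have g0 := nm_ge0 (G z).
have t1 : nm (F w - F z) * nm (G w - G z) <= 1 * nm (G w - G z).
  by rewrite ler_wpM2r // (le_trans (ltW A)).
have t2 : nm (F w - F z) * nm (G z) <= k * nm (G z) by rewrite ler_wpM2r // ltW.
have t3 : nm (F z) * nm (G w - G z) <= nm (F z) * k by rewrite ler_wpM2l // ltW.
clear -t1 t2 t3 T B k2; rewrite !mulrDr mulr1 in k2.
rewrite (mulrC (nm (F z)) k) in t3; order_lra.
Qed.

Lemma ccontD F G z : ccont F z -> ccont G z -> ccont (fun w => F w + G w) z.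
Proof.
move=> HF HG e e0; have e2 : 0 < e / 2 by rewrite divr_gt0.
have [d d0 Hd] := HF _ e2; have [d' d'0 Hd'] := HG _ e2.
exists (Num.min d d'); first by rewrite lt_min d0.
move=> w; rewrite lt_min => /andP[/Hd A /Hd' B].
have -> : F w + G w - (F z + G z) = (F w - F z) + (G w - G z) by ring.
apply: le_lt_trans (nmD _ _) _; order_lra.
Qed.

Lemma ccont_comp F G z : ccont F z -> ccont G (F z) -> ccont (fun w => G (F w)) z.
Proof. by move=> HF HG e /HG[d /HF[d' d'0 H'] H]; exists d' => // s /H'/H. Qed.

Lemma ccont_cst c z : ccont (fun=> c) z.
Proof. exact: cder_cont (cder_cst _ _). Qed.

Lemma ccont_invf F z : ccont F z -> F z != 0 -> ccont (fun w => (F w)^-1) z.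
Proof. by move=> H /cder_inv/cder_cont; apply: (ccont_comp H). Qed.

Lemma ccont_pole a n z : z != a -> ccont (fun w => ((w - a) ^+ n)^-1) z.
Proof.
move=> za; apply: ccont_invf; last by rewrite expf_neq0 // subr_eq0.
elim: n => [|n IH]; first by apply: ccont_ext (ccont_cst 1 z); exists 1 => // w _; rewrite expr0.
apply: (@ccont_ext _ (fun w => (w - a) * (w - a) ^+ n)).
  by exists 1 => // w _; rewrite exprS.
by apply: ccontM IH; exact: cder_cont (cderB (cder_id _) (cder_cst _ _)).
Qed.

Lemma invCE z : z^-1 = ((complex.Re z / nm z ^+ 2) -i* (complex.Im z / nm z ^+ 2))%C.
Proof. by rewrite nm_sqr; case: z. Qed.

Lemma cint_Re_ge (k : R -> C) s t m : s <= t -> rconts k s t -> (forall r, s <= r <= t -> m <= complex.Re (k r)) ->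
  m * (t - s) <= complex.Re (cint k s t).
Proof.
move=> st Hk Hm; have [A _] := rconts_int Hk.
have -> : m * (t - s) = (\int[lebesgue_measure]_(r in `[s, t]) m)%R.
  rewrite Rintegral_cst //= lebesgue_measure_itv /= lte_fin.
  by move: st; rewrite le_eqVlt => /predU1P[->|->] //; rewrite ltxx subrr.
apply: le_Rintegral => //.
by apply: (@cont_integrable _ (cst m)) => r _; exact: cst_continuous.
Qed.

Lemma cint_Im_ge (k : R -> C) s t m : s <= t -> rconts k s t -> (forall r, s <= r <= t -> m <= complex.Im (k r)) ->
  m * (t - s) <= complex.Im (cint k s t).
Proof.
move=> st Hk Hm.
have := @cint_Re_ge (fun r => - 'i%C * k r) s t m st.
rewrite cintZ // => H; have {H} := H _ _.
have E (w : C) : complex.Re (- 'i%C * w) = complex.Im w by rewrite !ReImE /=; ring.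
by rewrite E; apply => [r rr|r rr]; [apply: rcontZ; exact: Hk|rewrite E; exact: Hm].
Qed.

(** The rectangles left over around the small square do not contain [a], so Goursat's theorem
    removes them one by one. *)
Lemma bint_puncture F F' x0 x1 y0 y1 a e : 0 < e ->
  x0 <= complex.Re a - e -> complex.Re a + e <= x1 ->
  y0 <= complex.Im a - e -> complex.Im a + e <= y1 ->
  onrect (fun z => z != a -> cder F z (F' z)) x0 x1 y0 y1 ->
  bint F x0 x1 y0 y1 =
  bint F (complex.Re a - e) (complex.Re a + e) (complex.Im a - e) (complex.Im a + e).
Proof.
move=> e0 h1 h2 h3 h4 H; set a1 := complex.Re a in h1 h2 *; set a2 := complex.Im a in h3 h4 *.
have ne x y : (x != a1) || (y != a2) -> (x +i* y)%C != a.
  by rewrite /a1 /a2; apply: contraTneq => <-; rewrite !eqxx.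
have G s0 s1 t0 t1 : x0 <= s0 -> s0 <= s1 -> s1 <= x1 -> y0 <= t0 -> t0 <= t1 -> t1 <= y1 ->
   (s1 < a1) || (a1 < s0) || (t1 < a2) || (a2 < t0) -> bint F s0 s1 t0 t1 = 0.
  move=> ? ? ? ? ? ? dis; apply: (@goursat _ F F') => // x y /andP[? ?] /andP[? ?].
  apply: H; [blra|blra|apply: ne].
  case/orP: dis => [/orP[/orP[|]|]|] lt; apply/orP;
    by [left; rewrite lt_eqF // (le_lt_trans _ lt)|left; rewrite gt_eqF // (lt_le_trans lt)|
        right; rewrite lt_eqF // (le_lt_trans _ lt)|right; rewrite gt_eqF // (lt_le_trans lt)].
have Cc x y : x0 <= x <= x1 -> y0 <= y <= y1 -> (x != a1) || (y != a2) -> ccont F (x +i* y)%C.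
  by move=> ? ? ?; apply: cder_cont; apply: H => //; exact: ne.
have ya y : y = y0 \/ y = y1 -> y0 <= y <= y1 /\ y != a2.
  by move=> [] ->; split; try blra; rewrite ?lt_eqF ?gt_eqF //; order_lra.
rewrite (@bint_splitx _ x0 x1 y0 y1 F (a1 - e)); last by blra.
  rewrite (G x0 (a1 - e)); [|order_lra|order_lra|order_lra|order_lra|order_lra|order_lra|by apply/orP; left; apply/orP; left; apply/orP; left; order_lra].
  rewrite add0r (@bint_splitx _ (a1 - e) x1 y0 y1 F (a1 + e)); last by blra.
    rewrite (G (a1 + e) x1); [|order_lra|order_lra|order_lra|order_lra|order_lra|order_lra|by apply/orP; left; apply/orP; left; apply/orP; right; order_lra].
    rewrite addr0 (@bint_splity _ (a1 - e) (a1 + e) y0 y1 F (a2 - e)); last by blra.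
      rewrite (G _ _ y0 (a2 - e)); [|order_lra|order_lra|order_lra|order_lra|order_lra|order_lra|by apply/orP; left; apply/orP; right; order_lra].
      rewrite add0r (@bint_splity _ (a1 - e) (a1 + e) (a2 - e) y1 F (a2 + e)); last by blra.
        by rewrite (G _ _ (a2 + e) y1) ?addr0 //; try order_lra; apply/orP; right; order_lra.
      move=> x y xx yy; apply: Cc.
      - by case: xx => ->; blra.
      - by move: yy => /andP[? ?]; blra.
      - by apply/orP; left; case: xx => ->; rewrite neq_lt; apply/orP; [left|right]; order_lra.
    move=> x y xx yy; apply: Cc => //.
    - by case: xx => ->; blra.
    - by apply/orP; left; case: xx => ->; rewrite neq_lt; apply/orP; [left|right]; order_lra.
  move=> x y /andP[? ?] /ya[? yn]; apply: Cc => //; first by blra.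
  by rewrite yn orbT.
move=> x y xx /ya[? yn]; apply: Cc => //.
by rewrite yn orbT.
Qed.


(** Differentiability bounds the quotient near [a], so its integral over the square of half-side [e]
    about [a] is [O(e)], while by [bint_puncture] it does not depend on [e]. *)
Lemma cauchy_vanish F F' x0 x1 y0 y1 a :
  x0 < complex.Re a < x1 -> y0 < complex.Im a < y1 ->
  onrect (fun z => cder F z (F' z)) x0 x1 y0 y1 ->
  bint (fun z => (F z - F a) / (z - a)) x0 x1 y0 y1 = 0.
Proof.
move=> /andP[ax0 ax1] /andP[ay0 ay1] H.
set a1 := complex.Re a in ax0 ax1 *; set a2 := complex.Im a in ay0 ay1 *.
have Ha : cder F a (F' a) by rewrite -(eta_C a); apply: H; blra.
have [d d0 Hd] := cder_bound Ha.
have K0 : 0 < 1 + nm (F' a) by rewrite ltr_wpDr ?nm_ge0.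
apply: nm_small => e0 ep.
pose m := Num.min (Num.min (a1 - x0) (x1 - a1)) (Num.min (a2 - y0) (y1 - a2)).
have m0 : 0 < m by rewrite !lt_min !subr_gt0 ax0 ax1 ay0 ay1.
pose e := Num.min (Num.min m (d / 3)) (e0 / (16 * (1 + nm (F' a)))).
have e1 : 0 < e by rewrite !lt_min !subr_gt0 ax0 ax1 ay0 ay1 !divr_gt0 // mulr_gt0.
have : e <= m by rewrite /e ge_min ge_min lexx.
rewrite !le_min => /andP[/andP[m1 m2] /andP[m3 m4]].
have ed : e <= d / 3 by rewrite /e ge_min ge_min lexx orbT.
have ee : e * (16 * (1 + nm (F' a))) <= e0.
  by rewrite -ler_pdivlMr ?mulr_gt0 // /e ge_min lexx orbT.
pose G z := (F z - F a) / (z - a).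
have dG z : cder F z (F' z) -> z != a ->
    cder G z (((F' z - 0) * (z - a) - (F z - F a) * (1 - 0)) / (z - a) ^+ 2).
  move=> Hz za; apply: cder_div; last by rewrite subr_eq0.
    exact: cderB Hz (cder_cst _ _).
  exact: cderB (cder_id _) (cder_cst _ _).
clearbody e; rewrite (@bint_puncture G (fun z => ((F' z - 0) * (z - a) - (F z - F a) * (1 - 0)) / (z - a) ^+ 2)
  _ _ _ _ a e) //; rewrite -/a1 -/a2; [|order_lra|order_lra|order_lra|order_lra|]; last first.
  by move=> x y xx yy za; apply: dG => //; apply: H.
have bd (P : C -> Prop) : (forall x y, a1 - e <= x <= a1 + e -> a2 - e <= y <= a2 + e ->
    (x +i* y)%C != a -> P (x +i* y)%C) -> onbd P (a1 - e) (a1 + e) (a2 - e) (a2 + e).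
  move=> HP; split => x y.
    move=> xx yy; apply: HP => //; first by case: yy => ->; blra.
    apply: contraTneq xx => E; have {E} : y = a2 by rewrite /a2 -E.
    by case: yy => ->; order_lra.
  move=> xx yy; apply: HP => //; first by case: xx => ->; blra.
  apply: contraTneq yy => E; have {E} : x = a1 by rewrite /a1 -E.
  by case: xx => ->; order_lra.
have B : nm (bint G (a1 - e) (a1 + e) (a2 - e) (a2 + e)) <=
    4 * (1 + nm (F' a)) * ((a1 + e - (a1 - e)) + (a2 + e - (a2 - e))).
  apply: bint_le; [order_lra|order_lra|apply: bd|apply: bd].
  - move=> x y xx yy za; apply: cder_cont (dG _ _ za).
    by apply: H; move: xx yy => /andP[? ?] /andP[? ?]; blra.
  - move=> x y xx yy za; rewrite nm_div ler_pdivrMr ?nm_gt0 ?subr_eq0 //.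
    apply: Hd; rewrite -(eta_C a) -/a1 -/a2.
    apply: le_lt_trans (pair_nm _ _) _ => /=.
    have : `|x - a1| <= e by rewrite ler_norml; move: xx => /andP[? ?]; blra.
    have : `|y - a2| <= e by rewrite ler_norml; move: yy => /andP[? ?]; blra.
    order_lra.
apply: le_trans B _; apply: le_trans ee; rewrite le_eqVlt; apply/orP; left; apply/eqP; ring.
Qed.

Definition bsq F z0 (s : R) :=
  bint F (complex.Re z0 - s) (complex.Re z0 + s) (complex.Im z0 - s) (complex.Im z0 + s).

(** Contains the boundary of the square of half-side [s], whose corners lie at distance
    [sqrt 2 * s]; hypotheses on a contour can thus be stated with the modulus alone. *)
Definition annulus z0 (s : R) z := s <= nm (z - z0) <= 2 * s.

Lemma annulus_bd (P : C -> Prop) z0 (s : R) : 0 < s -> (forall z, annulus z0 s z -> P z) ->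
  onbd P (complex.Re z0 - s) (complex.Re z0 + s) (complex.Im z0 - s) (complex.Im z0 + s).
Proof.
move=> s0 H.
have A x y : `|x - complex.Re z0| <= s -> `|y - complex.Im z0| <= s ->
    s <= `|x - complex.Re z0| \/ s <= `|y - complex.Im z0| -> P (x +i* y)%C.
  move=> hx hy hxy; apply: H; rewrite /annulus; set z := (_ - z0).
  have := Re_le_nm z; have := Im_le_nm z; have := nm_le_ReIm z.
  rewrite {2 4}/z {2 3}/z !ReImE /= => *; apply/andP; split; last by order_lra.
  by case: hxy => ?; order_lra.
have B (x c : R) : c - s <= x <= c + s -> `|x - c| <= s by move=> /andP[? ?]; rewrite ler_norml; blra.
have D (x c : R) : x = c - s \/ x = c + s -> s <= `|x - c| /\ `|x - c| <= s.
  move=> E; have -> : `|x - c| = s; last by [].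
  case: E => ->.
    by have -> : c - s - c = - s by [ring]; rewrite normrN gtr0_norm.
  by rewrite addrC addKr gtr0_norm.
split=> x y.
  by move=> /B hx /D[? ?]; apply: A => //; right.
by move=> /D[? ?] /B ?; apply: A => //; left.
Qed.

Lemma bsqD F G z0 (s : R) : 0 < s -> (forall z, annulus z0 s z -> ccont F z) ->
  (forall z, annulus z0 s z -> ccont G z) ->
  bsq (fun z => F z + G z) z0 s = bsq F z0 s + bsq G z0 s.
Proof. by move=> s0 HF HG; apply: bintD; try order_lra; apply: annulus_bd. Qed.

Lemma bsqZ c F z0 (s : R) : 0 < s -> (forall z, annulus z0 s z -> ccont F z) ->
  bsq (fun z => c * F z) z0 s = c * bsq F z0 s.
Proof. by move=> s0 HF; apply: bintZ; try order_lra; apply: annulus_bd. Qed.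

Lemma eq_bsq F G z0 (s : R) : 0 < s -> (forall z, annulus z0 s z -> F z = G z) ->
  bsq F z0 s = bsq G z0 s.
Proof. by move=> s0 HF; apply: eq_bint; try order_lra; apply: annulus_bd. Qed.

Lemma bsq_le F z0 (s M : R) : 0 < s -> (forall z, annulus z0 s z -> ccont F z) ->
  (forall z, annulus z0 s z -> nm (F z) <= M) -> nm (bsq F z0 s) <= 16 * M * s.
Proof.
move=> s0 HF HM; have -> : 16 * M * s = 4 * M * ((complex.Re z0 + s - (complex.Re z0 - s)) +
  (complex.Im z0 + s - (complex.Im z0 - s))) by ring.
by apply: bint_le; try order_lra; apply: annulus_bd.
Qed.

(** Cauchy integral of order [n] without the factor [1 / (2 pi i)]; the integral of the constant 1
    takes over the normalisation. *)
Definition cauchyT K z0 s n a := bsq (fun z => K z * ((z - a) ^+ n)^-1) z0 s.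

(** Second-order remainder of [(z - a)^-n] as a function of [a], factored explicitly. The orders 1
    and 2 serve to differentiate a Cauchy integral twice; 16 and 128 come from [|z - a| >= s / 2]
    and [|z - b| >= s / 4]. *)
Lemma kernel_bound (s : R) n : 0 < s -> n = 1%N \/ n = 2%N -> exists2 B : R, 0 <= B &
  forall z a b, s / 2 <= nm (z - a) -> s / 4 <= nm (z - b) ->
  nm (((z - b) ^+ n)^-1 - ((z - a) ^+ n)^-1 - n%:R * (b - a) * ((z - a) ^+ n.+1)^-1) <=
  B * nm (b - a) ^+ 2.
Proof.
move=> s0 Hn; exists (16 / s ^+ 3 + 128 / s ^+ 4).
  by apply: addr_ge0; apply: divr_ge0 => //; apply: exprn_ge0; exact: ltW.
move=> z a b; set u := z - a; set v := z - b => hu hv.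
have E : b - a = u - v by rewrite /u /v; ring.
have n0 := nm_ge0 (b - a).
have u0' : 0 < nm u by apply: lt_le_trans hu; rewrite divr_gt0.
have v0' : 0 < nm v by apply: lt_le_trans hv; rewrite divr_gt0.
have u0 : u != 0 by rewrite -nm_gt0.
have v0 : v != 0 by rewrite -nm_gt0.
have iu : (nm u)^-1 <= 2 / s by rewrite -[2 / s]invrK lef_pV2 ?posrE ?invr_gt0 ?divr_gt0 // invf_div.
have iv : (nm v)^-1 <= 4 / s by rewrite -[4 / s]invrK lef_pV2 ?posrE ?invr_gt0 ?divr_gt0 // invf_div.
have iu0 : 0 <= (nm u)^-1 by rewrite invr_ge0 nm_ge0.
have iv0 : 0 <= (nm v)^-1 by rewrite invr_ge0 nm_ge0.
have s2 : 0 <= 2 / s by rewrite divr_ge0 // ltW.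
have s4 : 0 <= 4 / s by rewrite divr_ge0 // ltW.
have q3 : 0 <= 16 / s ^+ 3 by apply: divr_ge0 => //; apply: exprn_ge0; exact: ltW.
have q4 : 0 <= 128 / s ^+ 4 by apply: divr_ge0 => //; apply: exprn_ge0; exact: ltW.
have sn : s != 0 by rewrite gt_eqF.
have h2 : 0 <= nm (b - a) ^+ 2 by rewrite exprn_ge0.
have uu : (nm u)^-1 * (nm u)^-1 <= 2 / s * (2 / s) by rewrite ler_pM.
have uv : (nm u)^-1 * (nm v)^-1 <= 2 / s * (4 / s) by rewrite ler_pM.
have uuv : (nm u)^-1 * (nm u)^-1 * (nm v)^-1 <= 16 / s ^+ 3.
  apply: le_trans (ler_pM _ _ uu iv) _ => //; first exact: mulr_ge0.
  by rewrite le_eqVlt; apply/orP; left; apply/eqP; field.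
case: Hn => ->.
  have -> : (v ^+ 1)^-1 - (u ^+ 1)^-1 - 1%:R * (b - a) * (u ^+ 2)^-1 = (b - a) ^+ 2 * (u^-1 * u^-1 * v^-1).
    by rewrite E; field; rewrite u0 v0.
  rewrite nmM nmX !nmM !nmV mulrC ler_wpM2r //.
  by apply: le_trans uuv _; rewrite lerDl.
have -> : (v ^+ 2)^-1 - (u ^+ 2)^-1 - 2%:R * (b - a) * (u ^+ 3)^-1 =
   (b - a) ^+ 2 * ((u^-1 * v^-1) * (u^-1 * v^-1) + 2 * ((u^-1 * u^-1) * (u^-1 * v^-1))).
  by rewrite E; field; rewrite u0 v0.
rewrite nmM nmX mulrC ler_wpM2r //.
apply: le_trans (nmD _ _) _; rewrite !nmM !nmV.
have -> : nm 2 = 2 :> R by rewrite -[RHS]gtr0_norm // -nm_real rmorph_nat.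
have A1 : (nm u)^-1 * (nm v)^-1 * ((nm u)^-1 * (nm v)^-1) <= 2 / s * (4 / s) * (2 / s * (4 / s)).
  by rewrite ler_pM // mulr_ge0.
have A2 : (nm u)^-1 * (nm u)^-1 * ((nm u)^-1 * (nm v)^-1) <= 2 / s * (2 / s) * (2 / s * (4 / s)).
  by rewrite ler_pM // mulr_ge0.
have -> : 128 / s ^+ 4 = 2 / s * (4 / s) * (2 / s * (4 / s)) + 2 * (2 / s * (2 / s) * (2 / s * (4 / s))).
  by field.
move: A1 A2 q3; clear; order_lra.
Qed.

Lemma ann_dist z0 (s : R) z a : annulus z0 s z -> nm (a - z0) < s / 2 -> s / 2 <= nm (z - a).
Proof. by move=> /andP[h _] ha; have := nmBD a z z0; rewrite ?(nmBC z a) in h *; order_lra. Qed.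

Lemma cauchyT_der K z0 (s M : R) n a : 0 < s -> n = 1%N \/ n = 2%N ->
  (forall z, annulus z0 s z -> ccont K z /\ nm (K z) <= M) -> nm (a - z0) < s / 2 ->
  cder (cauchyT K z0 s n) a (n%:R * cauchyT K z0 s n.+1 a).
Proof.
move=> s0 Hn HK ha.
have [B B0 HB] := kernel_bound s0 Hn.
have M0 : 0 <= M.
  have [|_] := HK (z0 + s%:C%C); last by apply: le_trans; rewrite nm_ge0.
  by rewrite /annulus addrC addKr nm_real gtr0_norm //; apply/andP; split => //; order_lra.
move=> e e0.
have L0 : 0 < 16 * (M * B + 1) * s by rewrite !mulr_gt0 // ltr_wpDl // mulr_ge0.
exists (Num.min (s / 4) (e / (16 * (M * B + 1) * s))).
  by rewrite lt_min !divr_gt0.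
move=> b; rewrite lt_min => /andP[b1]; rewrite ltr_pdivlMr // => b2.
have Kc z b' m : annulus z0 s z -> z != b' -> ccont (fun z => K z * ((z - b') ^+ m)^-1) z.
  by move=> hz hb; apply: ccontM; [have [] := HK z hz|exact: ccont_pole].
have za z : annulus z0 s z -> s / 2 <= nm (z - a) by move=> /ann_dist; apply.
have zb z : annulus z0 s z -> s / 4 <= nm (z - b).
  by move=> /za h; have := nmBD b z a; order_lra.
have nza z : annulus z0 s z -> z != a.
  by move=> /za h; rewrite -subr_eq0 -nm_gt0; apply: lt_le_trans h; rewrite divr_gt0.
have nzb z : annulus z0 s z -> z != b.
  by move=> /zb h; rewrite -subr_eq0 -nm_gt0; apply: lt_le_trans h; rewrite divr_gt0.
have ca m : forall z, annulus z0 s z -> ccont (fun z => K z * ((z - a) ^+ m)^-1) z.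
  by move=> z hz; apply: Kc => //; exact: nza.
have cb m : forall z, annulus z0 s z -> ccont (fun z => K z * ((z - b) ^+ m)^-1) z.
  by move=> z hz; apply: Kc => //; exact: nzb.
have cz c F : (forall z, annulus z0 s z -> ccont F z) ->
    forall z, annulus z0 s z -> ccont (fun z => c * F z) z.
  by move=> hF z hz; apply: ccontM; [exact: ccont_cst|exact: hF].
have cd F G : (forall z, annulus z0 s z -> ccont F z) -> (forall z, annulus z0 s z -> ccont G z) ->
    forall z, annulus z0 s z -> ccont (fun z => F z + G z) z.
  by move=> hF hG z hz; apply: ccontD; [exact: hF|exact: hG].
have -> : cauchyT K z0 s n b - cauchyT K z0 s n a - n%:R * cauchyT K z0 s n.+1 a * (b - a) =
   bsq (fun z => K z * ((z - b) ^+ n)^-1 + ((-1) * (K z * ((z - a) ^+ n)^-1)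
     + (- n%:R * (b - a)) * (K z * ((z - a) ^+ n.+1)^-1))) z0 s.
  rewrite bsqD //; [|exact: cb|by apply: (cd); apply: (cz); exact: ca].
  rewrite bsqD //; [|by apply: (cz); exact: ca|by apply: (cz); exact: ca].
  rewrite !bsqZ //; [|exact: ca|exact: ca].
  rewrite /cauchyT; move: (bsq _ _ _) (bsq _ _ _) (bsq _ _ _) => A1 A2 A3; ring.
apply: le_trans (@bsq_le _ _ _ (M * (B * nm (b - a) ^+ 2)) s0 _ _) _.
- by apply: (cd); [exact: cb|apply: (cd); apply: (cz); exact: ca].
- move=> z hz; have -> : K z * ((z - b) ^+ n)^-1 + (-1 * (K z * ((z - a) ^+ n)^-1)
     + - n%:R * (b - a) * (K z * ((z - a) ^+ n.+1)^-1)) =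
    K z * (((z - b) ^+ n)^-1 - ((z - a) ^+ n)^-1 - n%:R * (b - a) * ((z - a) ^+ n.+1)^-1).
    move: ((z - b) ^+ n)^-1 ((z - a) ^+ n)^-1 ((z - a) ^+ n.+1)^-1 => A1 A2 A3; ring.
  rewrite nmM; apply: ler_pM; rewrite ?nm_ge0 //; first by have [] := HK z hz.
  by apply: HB; [exact: za|exact: zb].
have -> : 16 * (M * (B * nm (b - a) ^+ 2)) * s = (nm (b - a) * (16 * (M * B) * s)) * nm (b - a) by ring.
rewrite ler_wpM2r ?nm_ge0 //; apply: le_trans (ltW b2).
by rewrite ler_wpM2l ?nm_ge0 // ler_wpM2r ?(ltW s0) // ler_wpM2l // lerDl.
Qed.

(** Each of the four sides makes a nonnegative contribution to the imaginary part, and the bottom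
    side a positive one, because [a] lies inside the square. This takes the place of the value
    [2 pi i]. *)
Lemma winding_neq0 z0 (s : R) a : 0 < s -> nm (a - z0) < s / 2 ->
  cauchyT (fun=> 1) z0 s 1 a != 0.
Proof.
move=> s0 ha.
have hK z : annulus z0 s z -> ccont (fun z => 1 * ((z - a) ^+ 1)^-1) z.
  move=> hz; apply: ccontM; first exact: ccont_cst.
  apply: ccont_pole; have h := ann_dist hz ha.
  by rewrite -subr_eq0 -nm_gt0; apply: lt_le_trans h; rewrite divr_gt0.
have [Hh Hv] := annulus_bd s0 hK.
have [Dh Dv] : onbd (fun z => s / 2 <= nm (z - a) /\ nm (z - a) <= 3 * s)
   (complex.Re z0 - s) (complex.Re z0 + s) (complex.Im z0 - s) (complex.Im z0 + s).
  apply: annulus_bd => // z hz; split; first exact: ann_dist hz ha.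
  by have := nmBD z0 z a; move: hz => /andP[_]; rewrite (nmBC z0 a); clear -ha s0; order_lra.
have aR : `|complex.Re a - complex.Re z0| < s / 2.
  by rewrite -ReN -ReD; apply: le_lt_trans ha; exact: Re_le_nm.
have aI : `|complex.Im a - complex.Im z0| < s / 2.
  by rewrite -ImN -ImD; apply: le_lt_trans ha; exact: Im_le_nm.
move: aR aI; rewrite !ltr_norml => /andP[a1 a2] /andP[a3 a4].
rewrite /cauchyT /bsq.
set x0 := complex.Re z0 - s in Hh Hv Dh Dv *; set x1 := complex.Re z0 + s in Hh Hv Dh Dv *.
set y0 := complex.Im z0 - s in Hh Hv Dh Dv *; set y1 := complex.Im z0 + s in Hh Hv Dh Dv *.
pose K z := 1 * ((z - a) ^+ 1)^-1.
have KR x y : complex.Re (K (x +i* y)%C) = (x - complex.Re a) / nm ((x +i* y)%C - a) ^+ 2.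
  by rewrite /K mul1r expr1 invCE /= !ReImE.
have KI x y : complex.Im (K (x +i* y)%C) = - ((y - complex.Im a) / nm ((x +i* y)%C - a) ^+ 2).
  by rewrite /K mul1r expr1 invCE /= !ReImE.
have x01 : x0 <= x1 by rewrite /x0 /x1; order_lra.
have y01 : y0 <= y1 by rewrite /y0 /y1; order_lra.
have B0 : s / 2 / (3 * s) ^+ 2 * (x1 - x0) <= complex.Im (hint K x0 x1 y0).
  apply: cint_Im_ge => //; first by apply: (rconts_h Hh); left.
  move=> t tt; rewrite KI -mulNr opprB.
  have [h1 h2] := Dh t y0 tt (or_introl erefl).
  have p0 : 0 < nm ((t +i* y0)%C - a) by apply: lt_le_trans h1; rewrite divr_gt0.
  apply: ler_pM; first by rewrite divr_ge0 // ltW.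
  - by rewrite invr_ge0 exprn_ge0 // mulr_ge0 // ltW.
  - by rewrite /y0; order_lra.
  - rewrite lef_pV2 ?posrE ?exprn_gt0 ?mulr_gt0 //.
    by rewrite ler_pXn2r // ?nnegrE ?nm_ge0 // mulr_ge0 // ltW.
have B1 : 0 * (x1 - x0) <= complex.Im (- 1 * hint K x0 x1 y1).
  rewrite -cintZ; last by apply: (rconts_h Hh); right.
  apply: cint_Im_ge => //; first by move=> t tt; apply: rcontZ; apply: (rconts_h Hh) => //; right.
  move=> t tt; rewrite mulN1r ImN KI opprK divr_ge0 ?exprn_ge0 ?nm_ge0 //.
  by rewrite /y1; order_lra.
have B2 : 0 * (y1 - y0) <= complex.Re (vint K x1 y0 y1).
  apply: cint_Re_ge => //; first by apply: (rconts_v Hv); right.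
  move=> t tt; rewrite KR divr_ge0 ?exprn_ge0 ?nm_ge0 //.
  by rewrite /x1; order_lra.
have B3 : 0 * (y1 - y0) <= complex.Re (- 1 * vint K x0 y0 y1).
  rewrite -cintZ; last by apply: (rconts_v Hv); left.
  apply: cint_Re_ge => //; first by move=> t tt; apply: rcontZ; apply: (rconts_v Hv) => //; left.
  move=> t tt; rewrite mulN1r ReN KR -mulNr opprB divr_ge0 ?exprn_ge0 ?nm_ge0 //.
  by rewrite /x0; order_lra.
have P0 : 0 < s / 2 / (3 * s) ^+ 2 * (x1 - x0).
  by rewrite mulr_gt0 ?divr_gt0 ?exprn_gt0 ?mulr_gt0 // /x1 /x0; order_lra.
apply/eqP => E.
have {E} : complex.Im (bint K x0 x1 y0 y1) = 0 by rewrite E.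
rewrite /bint; move: B0 B1 B2 B3 P0.
move: (hint K x0 x1 y0) (hint K x0 x1 y1) (vint K x1 y0 y1) (vint K x0 y0 y1) (_ * (x1 - x0)).
by clear => [[? ?] [? ?] [? ?] [? ?]] /= *; order_lra.
Qed.

Definition holo F F' z0 (r : R) := forall z, nm (z - z0) < r -> cder F z (F' z).

Lemma cauchy_formula F F' z0 (r s : R) a : 0 < s -> 3 * s <= r -> holo F F' z0 r -> nm (a - z0) < s / 2 ->
  F a * cauchyT (fun=> 1) z0 s 1 a = cauchyT F z0 s 1 a.
Proof.
move=> s0 sr HF ha.
have [aR aI] : `|complex.Re a - complex.Re z0| < s / 2 /\ `|complex.Im a - complex.Im z0| < s / 2.
  rewrite -!ReN -!ImN -!ReD -!ImD.
  by split; apply: le_lt_trans ha; [exact: Re_le_nm|exact: Im_le_nm].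
move: aR aI; rewrite !ltr_norml => /andP[a1 a2] /andP[a3 a4].
have nza z : annulus z0 s z -> z != a.
  by move=> /ann_dist/(_ ha) h; rewrite -subr_eq0 -nm_gt0; apply: lt_le_trans h; rewrite divr_gt0.
have cF z : annulus z0 s z -> ccont F z by move=> /andP[h1 h2]; apply: cder_cont (HF z _); order_lra.
have V : bsq (fun z => (F z - F a) / (z - a)) z0 s = 0.
  apply: (@cauchy_vanish F F'); [blra|blra|].
  move=> x y /andP[? ?] /andP[? ?]; apply: HF; rewrite -(eta_C z0).
  apply: le_lt_trans (pair_nm _ _) _ => /=.
  have : `|x - complex.Re z0| <= s by rewrite ler_norml; blra.
  have : `|y - complex.Im z0| <= s by rewrite ler_norml; blra.
  order_lra.
apply/esym/eqP; rewrite -subr_eq0 -V; apply/eqP.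
have c1 : forall z, annulus z0 s z -> ccont (fun z => F z * ((z - a) ^+ 1)^-1) z.
  by move=> z hz; apply: ccontM; [exact: cF|apply: ccont_pole; exact: nza].
have c2 : forall z, annulus z0 s z -> ccont (fun z => 1 * ((z - a) ^+ 1)^-1) z.
  by move=> z hz; apply: ccontM; [exact: ccont_cst|apply: ccont_pole; exact: nza].
have -> : cauchyT F z0 s 1 a - F a * cauchyT (fun=> 1) z0 s 1 a =
    cauchyT F z0 s 1 a + - F a * cauchyT (fun=> 1) z0 s 1 a by rewrite mulNr.
rewrite /cauchyT -bsqZ // -bsqD //; last first.
  by move=> z hz; apply: ccontM; [exact: ccont_cst|exact: c2].
by apply: eq_bsq => // z hz; rewrite expr1; ring.
Qed.

Lemma cauchy_rep F F' z0 r : 0 < r -> holo F F' z0 r -> exists s M : R,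
  [/\ 0 < s, s <= r, nm (F z0) <= M, (forall z, annulus z0 s z -> ccont F z /\ nm (F z) <= M) &
  forall a, nm (a - z0) < s / 2 -> F a * cauchyT (fun=> 1) z0 s 1 a = cauchyT F z0 s 1 a].
Proof.
move=> r0 HF; have Hz : cder F z0 (F' z0) by apply: HF; rewrite subrr nm0.
have [d d0 Hd] := cder_cont Hz ltr01.
pose s := Num.min r d / 3; have s0 : 0 < s by rewrite divr_gt0 // lt_min r0.
have sr : 3 * s <= r by rewrite /s mulrC divfK // ge_min lexx.
have sd : 3 * s <= d by rewrite /s mulrC divfK // ge_min lexx orbT.
clearbody s; exists s, (nm (F z0) + 1); split=> //; [order_lra|order_lra| |].
  move=> z /andP[h1 h2]; split; first by apply: cder_cont (HF z _); order_lra.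
  have /Hd : nm (z - z0) < d by order_lra.
  by have := nm_sub_ge (F z) (F z0); order_lra.
by move=> a; apply: cauchy_formula s0 sr HF.
Qed.

(** By the Cauchy formula [F] is a quotient of two Cauchy integrals, so [F'] is an expression in
    these integrals and their first derivatives, which are differentiable again. *)
Lemma hol_deriv F F' z0 r : 0 < r -> holo F F' z0 r ->
  exists2 r' : R, 0 < r' & exists F'', holo F' F'' z0 r'.
Proof.
move=> r0 HF; have [s [M [s0 sr M0 HM HE]]] := cauchy_rep r0 HF.
exists (s / 2); first by rewrite divr_gt0.
pose c n a := cauchyT (fun=> 1) z0 s n a; pose T n a := cauchyT F z0 s n a.
have H1 z : annulus z0 s z -> ccont (fun=> (1:C)) z /\ nm (1:C) <= 1.
  by move=> _; split; [exact: ccont_cst|rewrite nm1].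
have n1 : 1%N = 1%N \/ 1%N = 2%N by left.
have n2 : 2%N = 1%N \/ 2%N = 2%N by right.
have cN a : nm (a - z0) < s / 2 -> c 1%N a != 0 by move=> ha; apply: winding_neq0.
have dc n a : n = 1%N \/ n = 2%N -> nm (a - z0) < s / 2 -> cder (c n) a (n%:R * c n.+1 a).
  by move=> hn ha; apply: cauchyT_der H1 ha.
have dT n a : n = 1%N \/ n = 2%N -> nm (a - z0) < s / 2 -> cder (T n) a (n%:R * T n.+1 a).
  by move=> hn ha; apply: cauchyT_der HM ha.
have loc a : nm (a - z0) < s / 2 -> exists2 d : R, 0 < d & forall w, nm (w - a) < d -> nm (w - z0) < s / 2.
  move=> ha; exists (s / 2 - nm (a - z0)); first by rewrite subr_gt0.
  by move=> w; have := nmBD a w z0; order_lra.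
have FE a : nm (a - z0) < s / 2 -> F a = T 1%N a / c 1%N a.
  by move=> ha; rewrite -[T _ _](HE a ha) mulfK //; exact: cN.
pose G a := (1%:R * T 2%N a * c 1%N a - T 1%N a * (1%:R * c 2%N a)) / c 1%N a ^+ 2.
have F'E a : nm (a - z0) < s / 2 -> F' a = G a.
  move=> ha; apply: (@cder_unique _ F a); first by apply: HF; order_lra.
  have [d d0 Hd] := loc a ha.
  apply: (@cder_ext _ (fun a => T 1%N a / c 1%N a)).
    by exists d => // w /Hd/FE ->.
  by apply: cder_div; [exact: dT|exact: dc|exact: cN].
have dG a : nm (a - z0) < s / 2 -> exists l, cder G a l.
  move=> ha; eexists; apply: cder_div; last by rewrite expf_neq0 //; exact: cN.
    apply: cderB; apply: cderM.
    - by apply: cderZ; exact: dT.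
    - exact: dc.
    - exact: dT.
    - by apply: cderZ; exact: dc.
  by apply: cderX; exact: dc.
have [F'' HF''] : exists F'', forall a, nm (a - z0) < s / 2 -> cder F' a (F'' a).
  have /choice[F'' H] a : exists l, nm (a - z0) < s / 2 -> cder F' a l.
    have [ha|_] := ltP (nm (a - z0)) (s / 2); last by exists 0.
    have [l Hl] := dG a ha; exists l => _; have [d d0 Hd] := loc a ha.
    by apply: cder_ext Hl; exists d => // w /Hd/F'E ->.
  by exists F''.
by exists F''.
Qed.

(** Taking for [m] the normalised Cauchy integral of the difference quotient makes it differentiable
    at [z0] too, where the difference quotient itself is undefined. *)
Lemma hol_factor F F' z0 r : 0 < r -> holo F F' z0 r ->
  exists2 r' : R, 0 < r' & exists m m', holo m m' z0 r' /\
    forall z, nm (z - z0) < r' -> F z = F z0 + (z - z0) * m z.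
Proof.
move=> r0 HF; have [s [M [s0 sr M0 HM HE]]] := cauchy_rep r0 HF.
exists (s / 2); first by rewrite divr_gt0.
pose c a := cauchyT (fun=> 1) z0 s 1 a.
have H1 z : annulus z0 s z -> ccont (fun=> (1:C)) z /\ nm (1:C) <= 1.
  by move=> _; split; [exact: ccont_cst|rewrite nm1].
have cN a : nm (a - z0) < s / 2 -> c a != 0 by move=> ha; apply: winding_neq0.
have hz0 : nm (z0 - z0) < s / 2 by rewrite subrr nm0 divr_gt0.
pose K z := (F z - F z0) * ((z - z0) ^+ 1)^-1.
have nz b z : nm (b - z0) < s / 2 -> annulus z0 s z -> z != b.
  by move=> hb /ann_dist/(_ hb) h; rewrite -subr_eq0 -nm_gt0; apply: lt_le_trans h; rewrite divr_gt0.
have KF z : annulus z0 s z -> ccont (fun z => F z - F z0) z.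
  by move=> hz; apply: ccontD; [have [] := HM z hz|exact: ccont_cst].
have HK z : annulus z0 s z -> ccont K z /\ nm (K z) <= 2 * M / s.
  move=> hz; split.
    by apply: ccontM; [exact: KF|apply: ccont_pole; exact: nz hz].
  have [_ hM] := HM z hz; move: hz => /andP[hs _].
  rewrite /K nmM nmV expr1; apply: ler_pM; rewrite ?nm_ge0 ?invr_ge0 ?nm_ge0 //.
    by have := nmB (F z) (F z0); order_lra.
  by rewrite lef_pV2 ?posrE // (lt_le_trans s0).
pose m a := cauchyT K z0 s 1 a / c a.
have n1 : 1%N = 1%N \/ 1%N = 2%N by left.
have ca a G : nm (a - z0) < s / 2 -> (forall z, annulus z0 s z -> ccont G z) ->
    forall z, annulus z0 s z -> ccont (fun z => G z * ((z - a) ^+ 1)^-1) z.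
  by move=> ha hG z hz; apply: ccontM; [exact: hG|apply: ccont_pole; exact: nz hz].
have D a : nm (a - z0) < s / 2 -> (F a - F z0) * c a = bsq (fun z => (F z - F z0) * ((z - a) ^+ 1)^-1) z0 s.
  move=> ha; rewrite mulrBl HE // /c -mulNr /cauchyT -bsqZ //; last by apply: (ca) => // ? ?; exact: ccont_cst.
  rewrite -bsqD //.
  - by apply: eq_bsq => // z hz; ring.
  - by apply: (ca) => // z hz; have [] := HM z hz.
  - by move=> z hz; apply: ccontM; [exact: ccont_cst|apply: (ca) => // ? ?; exact: ccont_cst].
(* Since [1 / (z - a) = (1 + (a - z0) / (z - a)) / (z - z0)], the integral of [(F - F z0) / (z - a)]
   is that of [K] plus [a - z0] times the Cauchy integral of [K]; the first summand is zero. *)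
have K0 : bsq K z0 s = 0 by rewrite -D // subrr mul0r.
have KE a : nm (a - z0) < s / 2 -> F a = F z0 + (a - z0) * m a.
  move=> ha; apply: (mulIf (cN a ha)).
  have -> : (F z0 + (a - z0) * m a) * c a = F z0 * c a + (a - z0) * cauchyT K z0 s 1 a.
    by rewrite /m; field; exact: cN.
  apply/eqP; rewrite addrC -subr_eq -mulrBl D // /cauchyT -bsqZ //; last first.
    by apply: ca => // z /HK[].
  apply/eqP; rewrite -[RHS]add0r -K0 -bsqD //; first last.
  - by move=> z hz; apply: ccontM; [exact: ccont_cst|apply: (ca) => // ? /HK[]].
  - by move=> z /HK[].
  apply: eq_bsq => // z hz; rewrite /K !expr1.
  have h2 := nz a z ha hz; rewrite -subr_eq0 in h2.
  have h1 := nz z0 z hz0 hz; rewrite -subr_eq0 in h1.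
  by field; rewrite h1 h2.
have dm a : exists l, nm (a - z0) < s / 2 -> cder m a l.
  have [ha|_] := ltP (nm (a - z0)) (s / 2); last by exists 0.
  eexists => _; apply: cder_div; last exact: cN.
    exact: cauchyT_der HK ha.
  exact: cauchyT_der H1 ha.
have [m' Hm'] := choice dm.
by exists m, m'.
Qed.

End Cauchy.

(** * The holomorphic inverse function theorem *)

Section InverseFunction.
Context {R : realType}.
Local Notation C := R[i].
Implicit Types (F G : C -> C) (a b z w : C).

Lemma bolzano_weierstrass (u : nat -> C) (B : R) : (forall n, nm (u n) <= B) ->
  exists z, forall e : R, 0 < e -> forall N, exists2 n, (N <= n)%N & nm (u n - z) < e.
Proof.
move=> HB.
have cK : compact (`[- B, B]%classic `*` `[- B, B]%classic : set (R * R)).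
  by apply: compact_setX; exact: segment_compact.
pose v n : R * R := (complex.Re (u n), complex.Im (u n)).
have vK : (v @ \oo) (`[- B, B]%classic `*` `[- B, B]%classic).
  exists 0%N => // n _; split; rewrite /= in_itv /= -ler_norml.
    exact: le_trans (Re_le_nm _) (HB n).
  exact: le_trans (Im_le_nm _) (HB n).
have [[x y] [_ Hc]] := cK (v @ \oo) _ vK.
exists (x +i* y)%C => e e0 N.
have [] := Hc (v @` [set n | (N <= n)%N]) (ball (x, y) (e / 2)).
- by exists N => // n /= nN; exists n.
- by apply: nbhsx_ballx; rewrite divr_gt0.
move=> _ [[n nN <-] [/= b1 b2]]; exists n => //.
apply: le_lt_trans (nm_le_ReIm _) _; rewrite !ReImE /=.
move: b1 b2; rewrite /ball /= (distrC x) (distrC y); order_lra.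
Qed.

Lemma nm_min F F' z0 (r : R) w : 0 < r -> (forall z, nm (z - z0) <= r -> cder F z (F' z)) ->
  exists2 z, nm (z - z0) <= r & forall z', nm (z' - z0) <= r -> nm (F z - w) <= nm (F z' - w).
Proof.
move=> r0 HF; pose E := [set nm (F z - w) | z in [set z | nm (z - z0) <= r]].
have E0 : has_inf E.
  split; first by exists (nm (F z0 - w)); exists z0 => //=; rewrite subrr nm0 ltW.
  by exists 0 => _ [z _ <-]; exact: nm_ge0.
have /choice[u Hu] (n : nat) : exists z, nm (z - z0) <= r /\ nm (F z - w) < inf E + n.+1%:R^-1.
  have [|_ [z hz <-] h] := @inf_adherent _ E (n.+1%:R^-1) _ E0; first by rewrite invr_gt0.
  by exists z.
have [|z Hz] := @bolzano_weierstrass u (r + nm z0).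
  by move=> n; have [h _] := Hu n; have := nm_sub_ge (u n) z0; order_lra.
have zr : nm (z - z0) <= r.
  apply/ler_addgt0Pr => e e0; have [n _ h] := Hz e e0 0%N.
  have [h' _] := Hu n; have := nmBD (u n) z z0; rewrite (nmBC z (u n)); order_lra.
exists z => // z' hz'.
have le1 : inf E <= nm (F z' - w) by apply: ge_inf; [case: E0|exists z'].
apply: le_trans le1; apply/ler_addgt0Pr => e e0.
have e2 : 0 < e / 2 by rewrite divr_gt0.
have [d d0 Hd] := cder_cont (HF z zr) e2.
have [n Nn h] := Hz d d0 (Num.bound (e / 2)^-1).
have [_ h'] := Hu n.
have : n.+1%:R^-1 <= e / 2.
  rewrite -[leRHS]invrK lef_pV2 ?posrE ?invr_gt0 //.
  apply: ltW; apply: lt_trans (archi_boundP _) _; first by rewrite invr_ge0 ltW.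
  by rewrite ltr_nat.
have := Hd _ h; have := nmBD (F (u n)) (F z) w; rewrite (nmBC (F z) (F (u n))).
move: (n.+1%:R^-1) (inf E) h' => q m h' A1 A2 A3; order_lra.
Qed.

Lemma cder_inverse F (i : C -> C) w l (K d : R) : 0 < K -> 0 < d -> l != 0 ->
  (forall w', nm (w' - w) < d -> F (i w') = w' /\ nm (i w' - i w) <= K * nm (w' - w)) ->
  cder F (i w) l -> cder i w l^-1.
Proof.
move=> K0 d0 l0 Hi HF e e0; have nl : 0 < nm l by rewrite nm_gt0.
have [d1 d10 H1] := HF (e * nm l / K) (divr_gt0 (mulr_gt0 e0 nl) K0).
exists (Num.min d (d1 / K)); first by rewrite lt_min d0 divr_gt0.
move=> w'; rewrite lt_min => /andP[/Hi[E HK]]; rewrite ltr_pdivlMr // => h.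
have Ew : F (i w) = w by have [] := Hi w; rewrite ?subrr ?nm0.
have {}H1 := H1 (i w'); rewrite E Ew in H1.
have h2 : nm (i w' - i w) < d1 by apply: le_lt_trans HK _; rewrite mulrC.
have {}H1 := H1 h2.
have -> : i w' - i w - l^-1 * (w' - w) = - l^-1 * (w' - w - l * (i w' - i w)) by field.
rewrite nmM nmN nmV mulrC ler_pdivrMr //; apply: le_trans H1 _.
apply: le_trans (ler_wpM2l _ HK) _; first by rewrite divr_ge0 ?mulr_ge0 ?ltW.
by rewrite le_eqVlt; apply/orP; left; apply/eqP; field; rewrite gt_eqF.
Qed.

(** The mean value inequality for [F z - F' z0 * z], whose derivative is at most half of
    [nm (F' z0)] near [z0]. *)
Lemma lower_lip F F' z0 (r : R) : 0 < r -> holo F F' z0 r -> F' z0 != 0 ->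
  exists r' : R, [/\ 0 < r', r' <= r & forall a b, nm (a - z0) <= r' -> nm (b - z0) <= r' ->
    nm (F' z0) / 2 * nm (a - b) <= nm (F a - F b)] /\
    (forall a, nm (a - z0) <= r' -> nm (F' z0) / 2 <= nm (F' a)).
Proof.
move=> r0 HF F0; have [r1 r10 [F'' HF']] := hol_deriv r0 HF.
have n0 : 0 < nm (F' z0) by rewrite nm_gt0.
have n2 : 0 < nm (F' z0) / 2 by rewrite divr_gt0.
have [|d d0 Hd] := cder_cont (HF' z0 _) n2; first by rewrite subrr nm0.
pose r' := Num.min r d / 2; have r'0 : 0 < r' by rewrite divr_gt0 // lt_min r0.
have rr : 2 * r' <= r by rewrite /r' mulrC divfK // ge_min lexx.
have rd : 2 * r' <= d by rewrite /r' mulrC divfK // ge_min lexx orbT.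
clearbody r'; exists r'; split; last first.
  move=> a ha; have /Hd : nm (a - z0) < d by order_lra.
  by have := nm_sub_ge (F' z0) (F' a); rewrite (nmBC (F' a)); order_lra.
split=> //; first order_lra.
move=> a b ha hb.
have : nm ((F a - F' z0 * a) - (F b - F' z0 * b)) <= nm (F' z0) / 2 * nm (a - b).
  apply: (@cderMVT _ (fun z => F z - F' z0 * z) (fun z => F' z - F' z0 * 1)) => t /andP[t0 t1].
  set z := b + _; have hz : nm (z - z0) <= r'.
    have -> : z - z0 = (1 - t)%:C%C * (b - z0) + t%:C%C * (a - z0).
      by rewrite /z rmorphB rmorph1; ring.
    apply: le_trans (nmD _ _) _; rewrite !nmM !nm_real !ger0_norm ?subr_ge0 //.
    have : (1 - t) * nm (b - z0) <= (1 - t) * r' by rewrite ler_wpM2l // subr_ge0.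
    have : t * nm (a - z0) <= t * r' by rewrite ler_wpM2l.
    order_lra.
  split.
    apply: cderB; first by apply: HF; order_lra.
    by apply: cderZ; exact: cder_id.
  by rewrite mulr1; apply/ltW; apply: Hd; order_lra.
have := nm_sub_ge (F' z0 * (a - b)) (- ((F a - F' z0 * a) - (F b - F' z0 * b))).
have -> : F' z0 * (a - b) - - ((F a - F' z0 * a) - (F b - F' z0 * b)) = F a - F b by ring.
by rewrite nmM nmN; order_lra.
Qed.

(** Surjectivity onto a disc: minimise [nm (F z - w)] over a closed disc. The lower Lipschitz bound
    puts the minimum in the interior, and there, with a nonzero derivative, a small Newton step
    would lower a positive value. *)
Lemma inverse_function F F' z0 (r : R) : 0 < r -> holo F F' z0 r -> F' z0 != 0 ->
  exists (r' d : R) (i : C -> C), [/\ 0 < r' <= r, 0 < d,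
    (forall a b, nm (a - z0) < r' -> nm (b - z0) < r' -> F a = F b -> a = b),
    (forall a, nm (a - z0) < r' -> F' a != 0) &
    forall w, nm (w - F z0) < d ->
      [/\ nm (i w - z0) < r', F (i w) = w & cder i w (F' (i w))^-1]].
Proof.
move=> r0 HF F0; have [r1 [[r10 r1r L1] L2]] := lower_lip r0 HF F0.
pose r' := r1 / 2; have r'0 : 0 < r' by rewrite divr_gt0.
have r'1 : r' < r1 by rewrite /r'; order_lra.
set k := nm (F' z0) / 2 in L1 L2; have k0 : 0 < k by rewrite divr_gt0 // nm_gt0.
clearbody r' k.
have inj a b : nm (a - z0) < r' -> nm (b - z0) < r' -> F a = F b -> a = b.
  move=> ha hb E; have := L1 a b; rewrite E subrr nm0 => /(_ _ _)H.
  have : k * nm (a - b) <= 0 by apply: H; order_lra.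
  rewrite pmulr_rle0 // => h; apply/eqP; rewrite -subr_eq0 -nm_eq0.
  by rewrite eq_le h nm_ge0.
have nF a : nm (a - z0) < r' -> F' a != 0.
  move=> ha; rewrite -nm_gt0; apply: lt_le_trans (L2 a _) => //; order_lra.
have d0 : 0 < k * r' / 2 by rewrite divr_gt0 // mulr_gt0.
have surj w : nm (w - F z0) < k * r' / 2 -> exists2 z, nm (z - z0) < r' & F z = w.
  move=> hw; have [|z hz Hz] := @nm_min F F' z0 r' w r'0.
    by move=> z hz; apply: HF; order_lra.
  have hz0 : nm (F z - w) <= nm (F z0 - w) by apply: Hz; rewrite subrr nm0 ltW.
  have zr : nm (z - z0) < r'.
    have := L1 z z0; rewrite subrr nm0 => /(_ _ _)H.
    have {}H : k * nm (z - z0) <= nm (F z - F z0) by apply: H; order_lra.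
    have : k * nm (z - z0) < k * r'.
      have := nmBD w (F z) (F z0); rewrite (nmBC (F z0)) in hz0; order_lra.
    by rewrite ltr_pM2l.
  exists z => //; apply/eqP; rewrite -subr_eq0; apply: contraT => m0.
  have mp : 0 < nm (F z - w) by rewrite nm_gt0.
  (* Newton's direction: a step of length [t] along [v] multiplies [F - w] by [1 - t], up to an
     error of at most [t / 2] times its modulus. *)
  have Fz := nF z zr; pose v := (w - F z) / F' z.
  have v0 : 0 < nm v by rewrite nm_gt0 mulf_neq0 ?invr_eq0 // -opprB oppr_eq0.
  have e0 : 0 < nm (F z - w) / nm v / 2 by rewrite !divr_gt0.
  have [d1 d10 Hd1] := HF z (lt_le_trans zr (le_trans (ltW r'1) r1r)) _ e0.
  pose t := Num.min (1 / 2) (Num.min (d1 / nm v / 2) ((r' - nm (z - z0)) / nm v)).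
  have t0 : 0 < t by rewrite !lt_min !divr_gt0 ?subr_gt0.
  have : t <= t by []; rewrite {2}/t !le_min => /and3P[t1 t2 t3].
  rewrite !ler_pdivlMr // in t2 t3; clearbody t.
  have nt : nm (t%:C%C * v) = t * nm v by rewrite nmM nm_real gtr0_norm.
  have A1 : nm (z + t%:C%C * v - z0) <= r'.
    have -> : z + t%:C%C * v - z0 = (z - z0) + t%:C%C * v by ring.
    by apply: le_trans (nmD _ _) _; rewrite nt; order_lra.
  have zE : z + t%:C%C * v - z = t%:C%C * v by ring.
  have : nm (z + t%:C%C * v - z) < d1.
    by rewrite zE nt; have : 0 < t * nm v by [rewrite mulr_gt0]; order_lra.
  move/Hd1; rewrite zE nt => A2.
  have := Hz _ A1; have E : F (z + t%:C%C * v) - w =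
     (1 - t)%:C%C * (F z - w) + (F (z + t%:C%C * v) - F z - F' z * (t%:C%C * v)).
    by rewrite /v rmorphB rmorph1; field.
  rewrite {}E leNgt => /negP[]; apply: le_lt_trans (nmD _ _) _.
  apply: le_lt_trans (lerD (lexx _) A2) _.
  rewrite nmM nm_real ger0_norm ?subr_ge0; last by order_lra.
  have -> : nm (F z - w) / nm v / 2 * (t * nm v) = t * nm (F z - w) / 2 by field; rewrite gt_eqF.
  have : 0 < t * nm (F z - w) by rewrite mulr_gt0.
  rewrite mulrBl mul1r; order_lra.
have /choice[i Hi] w : exists z, nm (w - F z0) < k * r' / 2 -> nm (z - z0) < r' /\ F z = w.
  have [/surj[z ? ?]|_] := ltP (nm (w - F z0)) (k * r' / 2); last by exists 0.
  by exists z.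
exists r', (k * r' / 2), i; split=> //; first by rewrite r'0 /=; order_lra.
move=> w hw; have [i1 i2] := Hi w hw; split=> //.
apply: (@cder_inverse F i w _ k^-1 (k * r' / 2 - nm (w - F z0))).
- by rewrite invr_gt0.
- by rewrite subr_gt0.
- exact: nF.
- move=> w' hw'; have : nm (w' - F z0) < k * r' / 2 by have := nmBD w w' (F z0); order_lra.
  move=> /Hi[j1 j2]; split=> //; rewrite mulrC ler_pdivlMr // mulrC -{2}j2 -{2}i2.
  by apply: L1; order_lra.
- by apply: HF; order_lra.
Qed.

Lemma holo_taylor F F' z0 (r : R) : 0 < r -> holo F F' z0 r -> exists (d B : R),
  [/\ 0 < d, 0 <= B & forall z, nm (z - z0) < d ->
    nm (F' z - F' z0) <= B * nm (z - z0) /\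
    nm (F z - F z0 - F' z0 * (z - z0)) <= B * nm (z - z0) ^+ 2].
Proof.
move=> r0 HF; have [r1 r10 [F'' HF']] := hol_deriv r0 HF.
have [|d d0 Hd] := cder_bound (HF' z0 _); first by rewrite subrr nm0.
exists (Num.min r d), (1 + nm (F'' z0)); split.
- by rewrite lt_min r0.
- by rewrite addr_ge0 ?nm_ge0.
move=> z; rewrite lt_min => /andP[h1 h2]; split; first exact: Hd.
have B0 : 0 <= 1 + nm (F'' z0) by rewrite addr_ge0 ?nm_ge0.
have -> : F z - F z0 - F' z0 * (z - z0) = (F z - F' z0 * z) - (F z0 - F' z0 * z0) by ring.
rewrite expr2 mulrA.
apply: (@cderMVT _ (fun z => F z - F' z0 * z) (fun z => F' z - F' z0 * 1)) => t /andP[t0 t1].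
have E : nm (z0 + t%:C%C * (z - z0) - z0) <= nm (z - z0).
  by rewrite addrC addKr nmM nm_real ger0_norm // ler_piMl ?nm_ge0.
split.
  apply: cderB; first by apply: HF; order_lra.
  by apply: cderZ; exact: cder_id.
rewrite mulr1; apply: le_trans (Hd _ _) _; first order_lra.
by rewrite ler_wpM2l.
Qed.

End InverseFunction.

(** * Change of variables in the plane *)

Section PlaneMeasure.
Context {R : realType}.
Local Notation C := R[i].
Local Notation RT := (measurableTypeR R).
Local Notation mu := (@lebesgue_measure R).
Implicit Types (A O D : set C) (a z h : C) (r : R).

Definition cx (p : R * R) : C := (p.1 +i* p.2)%C.

Definition plane : set (RT * RT)%type -> \bar R := (mu \x mu)%E.

HB.instance Definition _ := Measure.on plane.

Let plane_sigma_finite : sigma_finite setT plane.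
Proof.
have /sigma_finiteP[F [TF ndF Foo]] := sigma_finiteT mu.
exists (fun n => F n `*` F n).
  rewrite -setXTT TF predeqE => -[x y]; split.
    move=> [/= [n _ Fnx] [k _ Gky]]; exists (maxn n k) => //; split.
    - by move: x Fnx; exact/subsetPset/ndF/leq_maxl.
    - by move: y Gky; exact/subsetPset/ndF/leq_maxr.
  by move=> [n _ []/= ? ?]; split; exists n.
move=> k; have [? ?] := Foo k.
split; first exact: measurableX.
by rewrite /plane product_measure1E// lte_mul_pinfty// ge0_fin_numE.
Qed.

HB.instance Definition _ := Measure_isSigmaFinite.Build _ _ _ plane plane_sigma_finite.

Local Notation mu2 := plane.

Definition copen A := forall z, A z -> exists2 d : R, 0 < d & forall w, nm (w - z) < d -> A w.

Lemma basis_measurable d (T : measurableType d) (I : countType) (b : I -> set T) (A : set T) :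
  (forall i, measurable (b i)) -> (forall x, A x -> exists2 i, b i x & b i `<=` A) -> measurable A.
Proof.
move=> mb H.
have -> : A = \bigcup_(i in [set: I]) (if pselect (b i `<=` A) then b i else set0).
  apply/seteqP; split => [x /H[i bx sub]|x [i _]]; last by case: pselect => // s /s.
  by exists i => //; case: pselect.
apply: countable_bigcupT_measurable; first exact: countableP.
by move=> i; case: pselect => ?; [exact: mb|exact: measurable0].
Qed.

(** Open squares with rational centre and half-side [1 / (n + 1)]: a countable basis, through which
    open sets become measurable for the product sigma-algebra. *)
Definition rsq (q : rat * rat * nat) : set (RT * RT) :=
  [set p | `|p.1 - ratr q.1.1| < q.2.+1%:R^-1] `&` [set p | `|p.2 - ratr q.1.2| < q.2.+1%:R^-1].

Lemma rsq_measurable q : measurable (rsq q).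
Proof.
have -> : rsq q = `]ratr q.1.1 - q.2.+1%:R^-1, ratr q.1.1 + q.2.+1%:R^-1[%classic `*`
    `]ratr q.1.2 - q.2.+1%:R^-1, ratr q.1.2 + q.2.+1%:R^-1[%classic.
  by apply/seteqP; split => [p [/= h1 h2]|p [/= h1 h2]]; split => //=; move: h1 h2;
    rewrite /= !in_itv /= !ltr_distl => h1 h2 //.
exact: measurableX.
Qed.

Lemma nat_small r : 0 < r -> exists n, n.+1%:R^-1 < r.
Proof.
move=> r0; exists (Num.bound r^-1); rewrite -[ltRHS]invrK ltf_pV2 ?posrE ?invr_gt0 //.
by apply: lt_trans (archi_boundP _) _; rewrite ?invr_ge0 ?(ltW r0) // ltr_nat.
Qed.

Lemma rsq_basis (p : R * R) r : 0 < r -> exists2 q, rsq q p & forall p', rsq q p' -> nm (cx p' - cx p) < r.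
Proof.
move=> r0; have [n Hn] := @nat_small (r / 4) (divr_gt0 r0 (ltr0n _ 4)).
have np : 0 < n.+1%:R^-1 :> R by rewrite invr_gt0.
have P (x : R) : exists q : rat, `|x - ratr q| < n.+1%:R^-1.
  have [|q] := @rat_in_itvoo _ (x - n.+1%:R^-1) (x + n.+1%:R^-1).
    by rewrite ltrD2l; apply: lt_trans np; rewrite oppr_lt0.
  by rewrite in_itv /= => /andP[a b]; exists q; rewrite ltr_distl; move: (n.+1%:R^-1) a b => e *; apply/andP; split; lra.
have [q1 h1] := P p.1; have [q2 h2] := P p.2.
exists (q1, q2, n); first by split.
move=> p' [/= h3 h4]; apply: le_lt_trans (pair_nm _ _) _; rewrite /=.
have := ler_distD (ratr q1) p'.1 p.1; rewrite (distrC (ratr q1)).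
have := ler_distD (ratr q2) p'.2 p.2; rewrite (distrC (ratr q2)).
move: (n.+1%:R^-1) Hn h1 h2 h3 h4 np => e *; lra.
Qed.

Lemma copen_measurable A : copen A -> measurable (cx @^-1` A).
Proof.
move=> oA; apply: (basis_measurable rsq_measurable) => p /oA[d d0 Hd].
by have [q qp Hq] := rsq_basis p d0; exists q => // p' /Hq/Hd.
Qed.

Definition copen2 (S : set (C * C)) := forall u, S u -> exists2 d : R, 0 < d &
  forall v, nm (v.1 - u.1) < d -> nm (v.2 - u.2) < d -> S v.

Lemma copen2_measurable S : copen2 S ->
  measurable [set u : (RT * RT) * (RT * RT) | S (cx u.1, cx u.2)].
Proof.
move=> oS; pose b (q : (rat * rat * nat) * (rat * rat * nat)) := rsq q.1 `*` rsq q.2.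
apply: (@basis_measurable _ _ _ b) => [q|u /oS[d d0 Hd]].
  by apply: measurableX; exact: rsq_measurable.
have [q1 q1p H1] := rsq_basis u.1 d0; have [q2 q2p H2] := rsq_basis u.2 d0.
exists (q1, q2); first by split.
by move=> v [/= /H1 h1 /H2 h2]; apply: Hd.
Qed.

Definition rcont_at (w : C -> R) z := forall e : R, 0 < e -> exists2 d : R, 0 < d &
  forall z', nm (z' - z) < d -> `|w z' - w z| < e.

Lemma rcont_at_measurable A (w : C -> R) : copen A -> (forall z, A z -> rcont_at w z) ->
  measurable_fun (cx @^-1` A) (fun p => w (cx p)).
Proof.
move=> oA cw mA; apply: (measurability _ (RGenOInfty.measurableE R)) => //.
move=> /= _ [_ [x ->] <-].
rewrite [X in measurable X](_ : _ = cx @^-1` (A `&` [set z | x < w z])); last first.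
  by apply/seteqP; split => p [Ap /=]; rewrite in_itv /= andbT.
apply: copen_measurable => z [Az /= xw].
have [d d0 Hd] := oA z Az; have [|d' d'0 Hd'] := cw z Az (w z - x); first by rewrite subr_gt0.
exists (Num.min d d'); first by rewrite lt_min d0.
move=> w'; rewrite lt_min => /andP[/Hd ? /Hd' H]; split => //=.
by move: H; rewrite ltr_norml => /andP[? ?]; lra.
Qed.

Lemma le_limn_einf (u : (\bar R)^nat) (c : \bar R) N : (forall n, (N <= n)%N -> (c <= u n)%E) ->
  (c <= limn_einf u)%E.
Proof.
move=> H; rewrite limn_einf_lim.
rewrite (cvg_lim _ (@cvg_einfs_sup _ u)) //.
apply: (@le_trans _ _ (einfs u N)); last by apply: ereal_sup_ubound; exists N.
by apply: le_ereal_inf_tmp => _ [m /= Nm <-]; exact: H.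
Qed.

Lemma limn_einf_le (u : (\bar R)^nat) (c : \bar R) : (forall n, (u n <= c)%E) ->
  (limn_einf u <= c)%E.
Proof.
move=> H; rewrite limn_einf_lim.
rewrite (cvg_lim _ (@cvg_einfs_sup _ u)) //.
apply: ge_ereal_sup => _ [n _ <-]; apply: le_trans (H n).
by apply: ereal_inf_lbound; exists n => /=.
Qed.

Definition disc a r : set (RT * RT) := [set p | nm (cx p - a) < r].

Lemma disc_measurable a r : measurable (disc a r).
Proof.
apply: (@copen_measurable [set z | nm (z - a) < r]) => z /= hz.
exists (r - nm (z - a)); first by rewrite subr_gt0.
by move=> w; have := nmBD z w a; lra.
Qed.

Lemma disc_cst_measurable a r (c : \bar R) : measurable_fun setT ((fun=> c) \_ (disc a r)).
Proof. by apply/(measurable_restrictT _ (disc_measurable a r)); exact: measurable_cst. Qed.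

(** The area of the unit disk, kept as an abstract constant; it cancels in the averages of the
    change of variables. *)
Definition omega := mu2 (disc 0 1).

Lemma sqrt_lt (u r : R) : 0 < r -> (Num.sqrt u < r) = (u < r ^+ 2).
Proof. by move=> r0; rewrite -{1}(ger0_norm (ltW r0)) -sqrtr_sqr ltr_sqrt ?exprn_gt0. Qed.

Lemma norm_lt_sqrt (u v : R) : (`|v| < Num.sqrt u) = (v ^+ 2 < u).
Proof.
have [u0|u0] := ltP 0 u; first by rewrite -sqrtr_sqr ltr_sqrt.
by rewrite ler0_sqrtr // !ltNge normr_ge0 (le_trans u0) ?sqr_ge0.
Qed.

Lemma disc_slice a r x : 0 < r -> xsection (disc a r) x =
  `]complex.Im a - Num.sqrt (r ^+ 2 - (x - complex.Re a) ^+ 2),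
    complex.Im a + Num.sqrt (r ^+ 2 - (x - complex.Re a) ^+ 2)[%classic.
Proof.
move=> r0; apply/seteqP; split => y; rewrite /xsection /disc /= inE /=;
  rewrite nmE !ReImE /= sqrt_lt // in_itv /= -ltr_distl norm_lt_sqrt; lra.
Qed.

Lemma disc_measure_int a r : 0 < r -> mu2 (disc a r) =
  (\int[mu]_x (2 * Num.sqrt (r ^+ 2 - (x - complex.Re a) ^+ 2))%:E)%E.
Proof.
move=> r0; rewrite /plane /= /product_measure1; apply: eq_integral => x _.
rewrite /= disc_slice //; set s := Num.sqrt _.
rewrite lebesgue_measure_itv /= lte_fin.
have s0 : 0 <= s by rewrite sqrtr_ge0.
case: ltP => h; first by rewrite -EFinD; congr EFin; ring.
by have -> : s = 0 by [lra]; rewrite mulr0.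
Qed.

Lemma chord_continuous (r a : R) : continuous (fun x : R => 2 * Num.sqrt (r ^+ 2 - (x - a) ^+ 2)).
Proof.
move=> x; apply: cvgM; first exact: cvg_cst.
have c : {for x, continuous (fun x : R => r ^+ 2 - (x - a) ^+ 2)}.
  apply: cvgB; first exact: cvg_cst.
  by apply: cvgM; apply: cvgB => //; exact: cvg_cst.
exact: (continuous_comp c (@sqrt_continuous R _)).
Qed.

(** Slicing gives an integral of chord lengths, and the substitution [x = r * t + Re a] scales it to
    the unit disk. *)
Lemma disc_measure a r : 0 < r -> mu2 (disc a r) = ((r ^+ 2)%:E * omega)%E.
Proof.
move=> r0; rewrite /omega !disc_measure_int //.
set a1 := complex.Re a.
pose F : R -> R := fun x => r * x + a1.
have dF (x : R) : is_derive x (1 : R) F r.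
  apply: is_derive_eps => e e0; exists 1 => // s _.
  have -> : F s - F x - r * (s - x) = 0 by rewrite /F; ring.
  by rewrite normr0 mulr_ge0 // ltW.
have F'E : derive1 F = cst r by apply/funext => x; rewrite derive1E; apply: derive_val.
pose G x := 2 * Num.sqrt (r ^+ 2 - (x - a1) ^+ 2).
have GE x : G (F x) * r = r ^+ 2 * (2 * Num.sqrt (1 ^+ 2 - (x - complex.Re 0) ^+ 2)).
  rewrite /G /F addrK exprMn -{1}[r ^+ 2]mulr1 -mulrBr.
  rewrite sqrtrM ?sqr_ge0 // sqrtr_sqr ger0_norm ?(ltW r0) // subr0 expr1n; ring.
rewrite (@increasing_ge0_integration_by_substitutionT R F G) //.
- rewrite F'E.
  rewrite -ge0_integralZl //.
  + by apply: eq_integral => x _; rewrite -EFinM; congr EFin; exact: GE.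
  + apply/measurable_EFinP; apply: continuous_measurable_fun => x.
    exact: chord_continuous.
  + by rewrite lee_fin sqr_ge0.
- by move=> x y xy; rewrite /F ltrD2r ltr_pM2l.
- by rewrite F'E => x; exact: cvg_cst.
- by rewrite F'E; exact: is_cvg_cst.
- by rewrite F'E; exact: is_cvg_cst.
- apply/cvgrNyPle => A; exists ((A - a1) / r); split => [|x hx]; first exact: num_real.
  by rewrite /F -lerBrDr mulrC -ler_pdivlMr // ltW.
- apply/cvgryPge => A; exists ((A - a1) / r); split => [|x hx]; first exact: num_real.
  by rewrite /F -lerBlDr mulrC -ler_pdivrMr // ltW.
- exact: chord_continuous.
- by move=> x; rewrite mulr_ge0 // sqrtr_ge0.
Qed.

Lemma omega_gt0 : (0 < omega)%E.
Proof.
apply: (@lt_le_trans _ _ (mu2 (`[0, 2^-1]%classic `*` `[0, 2^-1]%classic))); last first.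
  apply: le_measure; rewrite ?inE; [exact: measurableX|exact: disc_measurable|].
  move=> p [/=]; rewrite !in_itv /= => /andP[? ?] /andP[? ?]; rewrite /disc /= subr0.
  rewrite nmE -[ltRHS]sqrtr1 ltr_sqrt //=.
  by nra.
rewrite /plane /= product_measure1E //= lebesgue_measure_itv /= lte_fin invr_gt0 ltr0n /=.
by rewrite oppr0 adde0 -EFinM lte_fin mulr_gt0 // invr_gt0.
Qed.

Lemma omega_fin : (omega < +oo)%E.
Proof.
apply: (@le_lt_trans _ _ (mu2 (`[-1, 1]%classic `*` `[-1, 1]%classic))).
  apply: le_measure; rewrite ?inE; [exact: disc_measurable|exact: measurableX|].
  move=> p; rewrite /disc /= subr0 => h; split => /=; rewrite in_itv /= -ler_norml.
    exact: le_trans (Re_le_nm (cx p)) (ltW h).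
  exact: le_trans (Im_le_nm (cx p)) (ltW h).
rewrite /plane /= product_measure1E //= lebesgue_measure_itv /= lte_fin.
by case: ifP => _; rewrite -?EFinD -?EFinM ?ltry // mule0 ltry.
Qed.

Lemma cx_surj z : cx (complex.Re z, complex.Im z) = z.
Proof. exact: eta_C. Qed.

Section ChangeOfVariables.
Variables (O D : set C) (phi dphi g : C -> C) (w : C -> R).
Hypotheses (oO : copen O) (oD : copen D).
Hypothesis phiP : forall h, O h -> [/\ D (phi h), g (phi h) = h, cder phi h (dphi h), dphi h != 0
  & ccont dphi h].
Hypothesis gP : forall z, D z -> [/\ O (g z), phi (g z) = z & cder g z (dphi (g z))^-1].
Hypothesis w0 : forall z, D z -> 0 <= w z.
Hypothesis wc : forall z, D z -> rcont_at w z.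

Let lhs := (\int[mu2]_(p in cx @^-1` O) (w (phi (cx p)) * nm (dphi (cx p)) ^+ 2)%:E)%E.
Let rhs := (\int[mu2]_(p in cx @^-1` D) (w (cx p))%:E)%E.

Let mO : measurable (cx @^-1` O). Proof. exact: copen_measurable. Qed.
Let mD : measurable (cx @^-1` D). Proof. exact: copen_measurable. Qed.

Let wt : RT * RT -> \bar R := (fun p => (w (cx p))%:E) \_ (cx @^-1` D).

Let wt0 p : (0 <= wt p)%E.
Proof. by rewrite /wt patchE; case: ifP => // /set_mem Dp; rewrite lee_fin w0. Qed.

Let mwt : measurable_fun setT wt.
Proof.
apply/(measurable_restrictT _ mD); apply/measurable_EFinP.
exact: rcont_at_measurable.
Qed.

Section Epsilon.
Variable e : R.
Hypothesis e0 : 0 < e.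

(** The disc of this radius about [phi h] is, to first order, the image of the disc of radius
    [1 / (n + 1)] about [h]. *)
Let rad n h : R := nm (dphi h) / n.+1%:R.

(** Points at whose scale the linearisation of [g] holds up to the factor [1 + e]. Every point of
    [O] is good for large [n], but not uniformly, whence Fatou's lemma below. *)
Let good n : set C := [set h | O h /\ forall z, D z -> nm (z - phi h) < rad n h ->
  nm (g z - h) * nm (dphi h) <= (1 + e) * nm (z - phi h)].

Let nmc h : O h -> rcont_at (fun h => nm (dphi h)) h.
Proof.
move=> /phiP[_ _ _ _ cd] e' e'0; have [d d0 Hd] := cd e' e'0; exists d => // z /Hd.
apply: le_lt_trans; rewrite ler_norml.
by have := nm_sub_ge (dphi z) (dphi h); have := nm_sub_ge (dphi h) (dphi z);
  rewrite (nmBC (dphi h)) => *; apply/andP; split; lra.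
Qed.

Let phic h : O h -> ccont phi h.
Proof. by move=> /phiP[_ _ /cder_cont]. Qed.

Let bad n : set C := [set h | O h /\ exists z, [/\ D z, nm (z - phi h) < rad n h &
  (1 + e) * nm (z - phi h) < nm (g z - h) * nm (dphi h)]].

Lemma bad_open n : copen (bad n).
Proof.
move=> h [Oh [z [Dz h1 h2]]].
have np : 0 < n.+1%:R^-1 :> R by rewrite invr_gt0.
have n1 : n.+1%:R^-1 <= 1 :> R by rewrite invf_le1 // ler1n.
(* [k] is the slack in the two strict inequalities, and [M] bounds the rate at which their sides
   vary with [h]. *)
pose k := Num.min (rad n h - nm (z - phi h)) (nm (g z - h) * nm (dphi h) - (1 + e) * nm (z - phi h)).
pose M := 3 + e + nm (g z - h) + nm (dphi h).
have M0 : 0 < M by rewrite /M !ltr_wpDr ?nm_ge0 // ltW.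
have k0 : 0 < k by rewrite lt_min !subr_gt0 h1.
pose q := Num.min 1 (k / (2 * M)).
have q0 : 0 < q by rewrite lt_min ltr01 divr_gt0 // mulr_gt0.
have q1 : q <= 1 by rewrite ge_min lexx.
have qk : q * (2 * M) <= k by rewrite -ler_pdivlMr ?mulr_gt0 // ge_min lexx orbT.
have [d1 d10 H1] := oO Oh; have [d2 d20 H2] := nmc Oh q0; have [d3 d30 H3] := phic Oh q0.
exists (Num.min (Num.min d1 d2) (Num.min d3 q)); first by rewrite !lt_min d10 d20 d30 ltr01 divr_gt0 // mulr_gt0.
move=> h'; rewrite 3!lt_min => /andP[/andP[/H1 Oh' /H2 A2] /andP[/H3 A3 A4]].
split=> //; exists z; split => //.
  have B := nmBD (phi h) z (phi h'); rewrite (nmBC (phi h) (phi h')) in B.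
  move: A2; rewrite ltr_norml => /andP[A2 _].
  have : k <= rad n h - nm (z - phi h) by rewrite ge_min lexx.
  rewrite /rad; have : nm (dphi h) / n.+1%:R - nm (dphi h') / n.+1%:R <= q.
    by rewrite -mulrBl ler_pdivrMr ?ltr0n //; apply: le_trans (_ : q <= _); [lra|rewrite ler_peMr ?(ltW q0) // ler1n].
  have : 2 * q <= q * (2 * M).
    rewrite mulrC ler_wpM2l ?(ltW q0) // ler_peMr // /M -!addrA ler_wpDr ?ler1n //.
    by rewrite !addr_ge0 ?nm_ge0 // ltW.
  move: (nm (dphi h) / n.+1%:R) (nm (dphi h') / n.+1%:R) => u v *; lra.
have B := nmBD (phi h) z (phi h'); rewrite (nmBC (phi h) (phi h')) in B.
have B' := nmBD h' (g z) h.
have kk : k <= nm (g z - h) * nm (dphi h) - (1 + e) * nm (z - phi h) by rewrite ge_min lexx orbT.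
move: A2; rewrite ltr_norml => /andP[A2 A2'].
have C1 : (1 + e) * nm (z - phi h') <= (1 + e) * nm (z - phi h) + (1 + e) * q.
  rewrite -mulrDr ler_wpM2l //; first by rewrite addr_ge0 // ltW.
  by apply: le_trans B _; rewrite lerD2l ltW.
have C2 : (nm (g z - h) - q) * nm (dphi h) <= nm (g z - h') * nm (dphi h).
  by rewrite ler_wpM2r ?nm_ge0 //; lra.
have C3 : nm (g z - h') * (nm (dphi h) - q) <= nm (g z - h') * nm (dphi h').
  by rewrite ler_wpM2l ?nm_ge0 //; lra.
have C4 : nm (g z - h') * q <= (nm (g z - h) + 1) * q.
  by rewrite ler_wpM2r ?(ltW q0) //; have := nmBD h (g z) h'; rewrite (nmBC h h'); lra.
move: qk; rewrite /M; move: C1 C2 C3 C4 kk k0 q0 e0.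
move: (nm (g z - h)) (nm (dphi h)) (nm (g z - h')) (nm (dphi h')) (nm (z - phi h')) (nm (z - phi h)).
move=> a b c a' u v *; lra.
Qed.

Lemma good_measurable n : measurable (cx @^-1` good n).
Proof.
have -> : cx @^-1` good n = (cx @^-1` O) `\` (cx @^-1` bad n).
  apply/seteqP; split=> p /=.
    by move=> [Op H]; split=> // -[_ [z [Dz /H]]]; move=> /(_ Dz); rewrite leNgt => /negP.
  move=> [Op H]; split=> // z Dz hz; rewrite leNgt; apply/negP => h.
  by apply: H; split=> //; exists z.
apply: measurableD => //; apply: copen_measurable; exact: bad_open.
Qed.

Let near2 n : set (C * C) := [set u | [/\ O u.1, D u.2 & nm (u.2 - phi u.1) < rad n u.1]].

Lemma near2_open n : copen2 (near2 n).
Proof.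
move=> [h z] [/= Oh Dz hz].
have q0 : 0 < (rad n h - nm (z - phi h)) / 3 by rewrite divr_gt0 // subr_gt0.
set q := _ / 3 in q0.
have [d1 d10 H1] := oO Oh; have [d2 d20 H2] := nmc Oh q0; have [d3 d30 H3] := phic Oh q0.
have [d4 d40 H4] := oD Dz.
exists (Num.min (Num.min d1 d2) (Num.min d3 (Num.min d4 q))).
  by rewrite !lt_min d10 d20 d30 d40.
move=> [h' z'] /=; rewrite !lt_min => /andP[/andP[/H1 Oh' /H2 A2] /andP[/H3 A3 _]].
move=> /andP[_ /andP[_ /andP[/H4 Dz' A5]]]; split => //=.
have B := nmBD z z' (phi h'); have B' := nmBD (phi h) z (phi h').
rewrite (nmBC (phi h) (phi h')) in B'.
move: A2; rewrite ltr_norml => /andP[A2 _].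
have : nm (dphi h) / n.+1%:R - nm (dphi h') / n.+1%:R <= q.
  by rewrite -mulrBl ler_pdivrMr ?ltr0n //; apply: le_trans (_ : q <= _); [lra|rewrite ler_peMr ?(ltW q0) // ler1n].
move: A3 A5 B B' q0; rewrite /q /rad.
move: (nm (dphi h) / n.+1%:R) (nm (dphi h') / n.+1%:R) => u v *; lra.
Qed.

Let S n : set ((RT * RT) * (RT * RT)) :=
  [set u | good n (cx u.1) /\ near2 n (cx u.1, cx u.2)].

Let mS n : measurable (S n).
Proof.
have -> : S n = (cx @^-1` good n `*` setT) `&` [set u | near2 n (cx u.1, cx u.2)].
  by apply/seteqP; split => u; [move=> []|move=> [[]]].
apply: measurableI; first by apply: measurableX => //; exact: good_measurable.
exact: (copen2_measurable (S := near2 n) (near2_open (n := n))).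
Qed.

Let H n : (RT * RT) * (RT * RT) -> \bar R := (fun u => wt u.2) \_ (S n).

Let mH n : measurable_fun setT (H n).
Proof.
apply/(measurable_restrictT _ (mS n)); apply: measurable_funTS.
exact: measurableT_comp mwt measurable_snd.
Qed.

Let H0 n u : (0 <= H n u)%E.
Proof. by rewrite /H patchE; case: ifP. Qed.

Let om := fine omega.
Let om0 : 0 < om.
Proof. by apply: fine_gt0; rewrite omega_gt0 omega_fin. Qed.
Let omE : omega = om%:E.
Proof. by rewrite fineK // ge0_fin_numE ?omega_fin // ltW // omega_gt0. Qed.

(** A weighted integral of [w] over the disc about [phi h] of radius [rad n h]. Its area is
    [om * nm (dphi h) ^+ 2 / (n + 1) ^+ 2], so for a good point this approximates
    [w (phi h) * nm (dphi h) ^+ 2]. *)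
Let A n p : \bar R := ((n.+1%:R ^+ 2 / om)%:E * \int[mu2]_q H n (p, q))%E.

Let c0 n : (0 <= (n.+1%:R ^+ 2 / om)%:E)%E.
Proof. by rewrite lee_fin divr_ge0 ?sqr_ge0 // ltW. Qed.

Let mA n : measurable_fun setT (A n).
Proof.
apply: emeasurable_funM; first exact: measurable_cst.
exact: (measurable_fun_fubini_tonelli_F (m2 := mu2) (H n) (mH n) (H0 n)).
Qed.

(** After the integrals are exchanged, goodness confines the [h] belonging to a fixed [z] to the
    disc of radius [(1 + e) / (n + 1)] about [g z], whose area cancels the weight. *)
Lemma A_upper n : (\int[mu2]_(p in cx @^-1` O) A n p <= ((1 + e) ^+ 2)%:E * rhs)%E.
Proof.
apply: (@le_trans _ _ (\int[mu2]_p A n p)%E).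
  apply: ge0_subset_integral => //.
  by move=> p _; rewrite mule_ge0 //; apply: integral_ge0.
rewrite ge0_integralZl //; last 2 first.
- exact: (measurable_fun_fubini_tonelli_F (m2 := mu2) (H n) (mH n) (H0 n)).
- by move=> p _; apply: integral_ge0.
rewrite (fubini_tonelli (m1 := mu2) (m2 := mu2) (H n) (mH n) (H0 n)).
have e1 : 0 < 1 + e by rewrite addr_gt0.
have P q : (\int[mu2]_p H n (p, q) <= wt q * ((((1 + e) / n.+1%:R) ^+ 2)%:E * omega))%E.
  rewrite -(@disc_measure (g (cx q))) ?divr_gt0 //.
  rewrite -integral_cst; last exact: disc_measurable.
  rewrite [leRHS]integral_mkcond; apply: ge0_le_integral => //.
  - exact: (measurableT_comp (mH n) (measurable_pair2 q)).
  - exact: disc_cst_measurable.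
  move=> p _; rewrite /H !patchE; case: (boolP ((p, q) \in S n)); last first.
    by move=> _; case: ifP => // _; exact: wt0.
  move=> /set_mem[[Op Hg] [/= _ Dq hq]]; rewrite mem_set // /disc /=.
  have := Hg _ Dq hq; have [_ _ _ dn _] := phiP Op.
  have dp : 0 < nm (dphi (cx p)) by rewrite nm_gt0.
  rewrite nmBC -ler_pdivlMr // => /le_lt_trans; apply.
  rewrite ltr_pdivrMr // mulrAC ltr_pdivlMr ?ltr0n //.
  by move: hq; rewrite /rad ltr_pdivlMr ?ltr0n // => hq; rewrite -mulrA ltr_pM2l.
apply: (@le_trans _ _ ((n.+1%:R ^+ 2 / om)%:E * \int[mu2]_q (wt q * ((((1 + e) / n.+1%:R) ^+ 2)%:E * omega)))%E).
  apply: lee_wpmul2l => //; apply: ge0_le_integral => //.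
  - by move=> q _; apply: integral_ge0.
  - exact: (measurable_fun_fubini_tonelli_G (m1 := mu2) (H n) (mH n) (H0 n)).
  - by apply: emeasurable_funM => //; exact: measurable_cst.
rewrite omE -EFinM ge0_integralZr //; last by rewrite lee_fin mulr_ge0 ?sqr_ge0 // ltW.
rewrite /rhs [in leRHS]integral_mkcond -/wt.
rewrite [X in (_ * X)%E]muleC muleA -EFinM.
rewrite le_eqVlt; apply/orP; left; apply/eqP; congr (_%:E * _)%E; field.
by rewrite (gt_eqF om0) nat1r pnatr_eq0.
Qed.

(** Differentiability of [g] makes [h] good for large [n], and continuity of [w] bounds its mean
    over the disc from below. *)
Lemma A_lower p : O (cx p) -> ((w (phi (cx p)) * nm (dphi (cx p)) ^+ 2)%:E <= limn_einf (A ^~ p))%E.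
Proof.
move=> Op; set h := cx p in Op *.
have [Dz gz dph dn _] := phiP Op; set z := phi h in Dz gz *.
have dp : 0 < nm (dphi h) by rewrite nm_gt0.
apply/lee_addgt0Pr => t t0.
rewrite -leeBlDr // -EFinB.
pose t' := t / nm (dphi h) ^+ 2.
have t'0 : 0 < t' by rewrite divr_gt0 ?exprn_gt0.
have [d1 d10 H1] := oD Dz; have [d2 d20 H2] := wc Dz t'0.
have [_ _ dg] := gP Dz; rewrite -/z gz in dg.
have [d3 d30 H3] := dg (e / nm (dphi h)) (divr_gt0 e0 dp).
pose d := Num.min (Num.min d1 d2) d3.
have dd : 0 < d by rewrite !lt_min d10 d20.
have [N HN] := @nat_small (d / nm (dphi h)) (divr_gt0 dd dp).
apply: (@le_limn_einf _ _ N) => n Nn.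
have rd : rad n h < d.
  rewrite /rad mulrC -ltr_pdivlMr //; apply: le_lt_trans HN.
  by rewrite lef_pV2 ?posrE ?ltr0n // ler_nat ltnS.
have gd : good n h.
  split=> // z' Dz' hz'.
  have /H3 : nm (z' - z) < d3 by apply: lt_trans hz' (lt_le_trans rd _); rewrite ge_min lexx orbT.
  rewrite -/z gz => B; rewrite -ler_pdivlMr //.
  have -> : g z' - h = (g z' - h - (dphi h)^-1 * (z' - z)) + (dphi h)^-1 * (z' - z) by ring.
  apply: le_trans (nmD _ _) _; rewrite nmM nmV mulrDl mul1r mulrDl.
  move: B; rewrite mulrAC (mulrC (nm (z' - z))); lra.
have rp : 0 < rad n h by rewrite divr_gt0.
have -> : w z * nm (dphi h) ^+ 2 - t = (w z - t') * nm (dphi h) ^+ 2.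
  by rewrite mulrBl /t' divfK // expf_neq0 // gt_eqF.
have [wt'|wt'] := leP (w z) t'.
  apply: (@le_trans _ _ 0%E); last by rewrite /A mule_ge0 //; apply: integral_ge0.
  by rewrite lee_fin mulr_le0_ge0 ?sqr_ge0 // subr_le0.
apply: (@le_trans _ _ ((n.+1%:R ^+ 2 / om)%:E * \int[mu2]_(q in disc z (rad n h)) (w z - t')%:E)%E).
  rewrite integral_cst; last exact: disc_measurable.
  rewrite [X in (_ * (_ * X))%E](disc_measure z rp) omE -!EFinM lee_fin le_eqVlt; apply/orP; left; apply/eqP.
  by rewrite /rad; field; rewrite (gt_eqF om0) nat1r pnatr_eq0.
apply: lee_wpmul2l => //; rewrite integral_mkcond; apply: ge0_le_integral => //.
- by move=> q _; rewrite patchE; case: ifP => // _; rewrite lee_fin subr_ge0 ltW.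
- exact: disc_cst_measurable.
- exact: (measurableT_comp (mH n) (pair1_measurable p)).
move=> q _; rewrite /H !patchE; case: ifPn => [/set_mem /= hq|_]; last by case: ifP.
have Dq : D (cx q) by apply: H1; apply: lt_trans hq (lt_le_trans rd _); rewrite !ge_min lexx.
rewrite mem_set //= /wt patchE mem_set // lee_fin.
have : `|w (cx q) - w z| < t' by apply: H2; apply: lt_trans hq (lt_le_trans rd _); rewrite !ge_min lexx orbT.
by rewrite ltr_norml => /andP[? _]; lra.
Qed.

Let wphic h : O h -> rcont_at (fun h => w (phi h) * nm (dphi h) ^+ 2) h.
Proof.
move=> Oh; have [Dz _ _ _ _] := phiP Oh.
have r1 : rcont_at (fun h => w (phi h)) h.
  move=> t t0; have [d d0 Hd] := wc Dz t0; have [d' d'0 Hd'] := phic Oh d0.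
  by exists d' => // z /Hd'/Hd.
have r2 := nmc Oh.
have M (f1 f2 : C -> R) : rcont_at f1 h -> rcont_at f2 h -> rcont_at (fun z => f1 z * f2 z) h.
  move=> c1 c2 t t0.
  have A0 : 0 < 1 + `|f1 h| + `|f2 h| by rewrite !ltr_wpDr.
  set k := Num.min 1 (t / (1 + `|f1 h| + `|f2 h|)).
  have k0 : 0 < k by rewrite lt_min ltr01 divr_gt0.
  have [d d0 Hd] := c1 k k0; have [d' d'0 Hd'] := c2 k k0.
  exists (Num.min d d'); first by rewrite lt_min d0.
  move=> z; rewrite lt_min => /andP[/Hd a1 /Hd' a2].
  have -> : f1 z * f2 z - f1 h * f2 h = (f1 z - f1 h) * (f2 z - f2 h) +
     ((f1 z - f1 h) * f2 h + f1 h * (f2 z - f2 h)) by ring.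
  have k1 : k <= 1 by rewrite ge_min lexx.
  have k2 : k * (1 + `|f1 h| + `|f2 h|) <= t by rewrite -ler_pdivlMr // ge_min lexx orbT.
  apply: le_lt_trans (ler_normD _ _) _; rewrite normrM.
  have := ler_normD ((f1 z - f1 h) * f2 h) (f1 h * (f2 z - f2 h)); rewrite !normrM => T.
  have t1 : `|f1 z - f1 h| * `|f2 z - f2 h| <= 1 * `|f2 z - f2 h|.
    by rewrite ler_wpM2r // (le_trans (ltW a1)).
  have t2 : `|f1 z - f1 h| * `|f2 h| <= k * `|f2 h| by rewrite ler_wpM2r // ltW.
  have t3 : `|f1 h| * `|f2 z - f2 h| <= `|f1 h| * k by rewrite ler_wpM2l // ltW.
  rewrite !mulrDr mulr1 in k2.
  rewrite (mulrC `|f1 h| k) in t3; move: t1 t2 t3 T a2 k2; rewrite mul1r.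
  move: (_ * _) (_ * _) (_ * _) (`|f2 z - f2 h|) => a b c a'; lra.
exact: (M _ _ r1 (M _ _ r2 r2)).
Qed.

Let mlim : measurable_fun (cx @^-1` O) (fun p => limn_einf (A ^~ p)).
Proof.
apply: measurableT_comp; first exact: oppe_measurable.
apply: measurable_fun_limn_esup => n; apply: measurableT_comp; first exact: oppe_measurable.
exact: measurable_funTS (mA n).
Qed.

(** Fatou's lemma combines the pointwise lower bound with the integrated upper bound. *)
Lemma change_eps : (lhs <= ((1 + e) ^+ 2)%:E * rhs)%E.
Proof.
apply: (@le_trans _ _ (\int[mu2]_(p in cx @^-1` O) limn_einf (A ^~ p))%E).
  apply: ge0_le_integral => //.
  - by move=> p Op; rewrite lee_fin mulr_ge0 ?sqr_ge0 // w0 //; have [] := phiP Op.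
  - apply/measurable_EFinP.
    exact: (rcont_at_measurable (w := fun h => w (phi h) * nm (dphi h) ^+ 2) oO wphic).
  - exact: A_lower.
apply: le_trans (fatou mu2 mO _ _) _.
- by move=> n; exact: measurable_funTS (mA n).
- by move=> n p _; rewrite /A mule_ge0 //; apply: integral_ge0.
by apply: limn_einf_le => n; exact: A_upper.
Qed.

End Epsilon.

(** Serves twice in this direction: the energy over the sheets is at most the energy over their
    image in the disk, and the energy near a pole is at most an integral over a neighbourhood of
    infinity. *)
Lemma change_of_variables : (lhs <= rhs)%E.
Proof.
have r0 : (0 <= rhs)%E by apply: integral_ge0 => p Dp; rewrite lee_fin w0.
have [rf|] := boolP (rhs \is a fin_num); last first.
  by rewrite ge0_fin_numE // -leNgt leye_eq => /eqP ->; rewrite leey.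
rewrite -(fineK rf); set r := fine rhs.
have r1 : 0 <= r by apply: fine_ge0.
apply/lee_addgt0Pr => t t0.
(* Since [(1 + e) ^+ 2 <= 1 + 3 * e] for [e <= 1], this [e] leaves an excess of at most [t]. *)
pose e := Num.min 1 (t / (3 * (r + 1))).
have e0 : 0 < e by rewrite lt_min ltr01 divr_gt0 // mulr_gt0 // ltr_wpDl.
have e1 : e <= 1 by rewrite ge_min lexx.
have et : e * (3 * (r + 1)) <= t by rewrite -ler_pdivlMr ?mulr_gt0 ?ltr_wpDl // ge_min lexx orbT.
apply: le_trans (change_eps e0) _; rewrite -(fineK rf) -/r -EFinM -EFinD lee_fin.
clearbody e r; nra.
Qed.

End ChangeOfVariables.

End PlaneMeasure.

(** * Zeros of holomorphic functions *)

Section IsolatedZeros.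
Context {R : realType}.
Local Notation C := R[i].
Implicit Types (F : C -> C) (z c : C).

Lemma hol_quot F F' c (r : R) : 0 < r -> holo F F' c r -> F c = 0 ->
  exists m m', holo m m' c r /\ forall z, nm (z - c) < r -> F z = (z - c) * m z.
Proof.
move=> r0 HF Fc; have [r' r'0 [m [m' [Hm E]]]] := hol_factor r0 HF.
pose M z := if z == c then m c else F z / (z - c).
have ME z : nm (z - c) < r' -> M z = m z.
  move=> hz; rewrite /M; case: eqVneq => [->//|zc].
  by rewrite E // Fc add0r mulrC mulKf // subr_eq0.
have ex z : exists l, nm (z - c) < r -> cder M z l.
  have [->|zc] := eqVneq z c.
    exists (m' c) => _; apply: (@cder_ext _ m); last by apply: Hm; rewrite subrr nm0.
    by exists r' => // w /ME.
  have [hz|_] := ltP (nm (z - c)) r; last by exists 0.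
  eexists => _; apply: (@cder_ext _ (fun w => F w / (w - c))); last first.
    apply: cder_div; [exact: HF|exact: cderB (cder_id _) (cder_cst _ _)|].
    by rewrite subr_eq0.
  exists (nm (z - c)); first by rewrite nm_gt0 subr_eq0.
  move=> w hw; rewrite /M; case: eqVneq => // wc.
  by move: hw; rewrite wc nmBC ltxx.
have [M' HM] := choice ex; exists M, M'; split=> [z hz|z hz]; first exact: HM.
rewrite /M; case: eqVneq => [->|zc]; first by rewrite Fc subrr mul0r.
by rewrite mulrC divfK // subr_eq0.
Qed.

(** If zeros accumulate at [c], then [F] is divisible by every power of [z - c]. The Cauchy formula
    on a contour at distance at least [s] from [c] then bounds the value at [a] by a constant times
    [(nm (a - c) / s) ^+ n], where [nm (a - c) < s / 2]. *)
Lemma isolated_zero F F' c (r : R) : 0 < r -> holo F F' c r -> F c = 0 ->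
  (exists2 d : R, 0 < d & forall z, nm (z - c) < d -> F z = 0) \/
  (exists2 d : R, 0 < d & forall z, nm (z - c) < d -> z != c -> F z != 0).
Proof.
move=> r0 HF Fc; have Hc : cder F c (F' c) by apply: HF; rewrite subrr nm0.
have [[d d0 Hd]|nI] := pselect (exists2 d : R, 0 < d & forall z, nm (z - c) < d -> z != c -> F z != 0).
  by right; exists d.
left; have fac n : exists G G', [/\ holo G G' c r, G c = 0 & forall z, nm (z - c) < r -> F z = (z - c) ^+ n * G z].
  elim: n => [|n [G [G' [HG Gc E]]]].
    by exists F, F'; split=> // z _; rewrite expr0 mul1r.
  have [m [m' [Hm Em]]] := hol_quot r0 HG Gc; exists m, m'; split=> //; last first.
    by move=> z hz; rewrite E // Em // mulrA exprSr.
  apply: contrapT => /eqP mc; apply: nI.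
  have mc0 : 0 < nm (m c) by rewrite nm_gt0.
  have [d d0 Hd] := cder_cont (Hm c (eq_ind_r (fun x => nm x < r) (eq_ind_r (fun x : R => x < r) r0 (@nm0 _)) (subrr c))) mc0.
  exists (Num.min d r); first by rewrite lt_min d0.
  move=> z; rewrite lt_min => /andP[/Hd h hr] zc.
  rewrite E // Em //; apply: mulf_neq0; first by rewrite expf_neq0 // subr_eq0.
  apply: mulf_neq0; first by rewrite subr_eq0.
  by apply: contraTneq h => ->; rewrite sub0r nmN ltxx.
have [d d0 Hd] := cder_cont Hc ltr01.
pose s := Num.min r d / 3; have s0 : 0 < s by rewrite divr_gt0 // lt_min r0.
have sr : 3 * s <= r by rewrite /s mulrC divfK // ge_min lexx.
have sd : 3 * s <= d by rewrite /s mulrC divfK // ge_min lexx orbT.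
clearbody s; exists (s / 2); first by rewrite divr_gt0.
move=> a ha; have W0 := winding_neq0 s0 ha.
apply/eqP; rewrite -(inj_eq (mulIf W0)) mul0r; apply/eqP; apply: nm_small => e e0.
have small n : nm (F a * cauchyT (fun=> 1) c s 1 a) <= 2^-1 ^+ n * 32.
  have [G [G' [HG Gc E]]] := fac n.
  rewrite E; last by order_lra.
  rewrite -mulrA (cauchy_formula s0 sr HG ha) nmM nmX.
  have B : nm (cauchyT G c s 1 a) <= 16 * (2 / s * s^-1 ^+ n) * s.
    have ann z : annulus c s z -> s <= nm (z - c) /\ nm (z - c) < r by move=> /andP[h1 h2]; order_lra.
    apply: bsq_le => // z hz; have [z1 z2] := ann z hz; have da := ann_dist hz ha.
    - apply: ccontM; first exact: cder_cont (HG z z2).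
      by apply: ccont_pole; rewrite -subr_eq0 -nm_gt0; apply: lt_le_trans da; rewrite divr_gt0.
    have Fz : nm (F z) <= 1.
      have /Hd : nm (z - c) < d by move/andP: hz => [_ ?]; order_lra.
      by rewrite Fc subr0 => /ltW.
    rewrite nmM nmV expr1 mulrC; apply: ler_pM; rewrite ?invr_ge0 ?nm_ge0 //.
      by rewrite -[2 / s]invf_div lef_pV2 ?posrE ?divr_gt0 //; apply: lt_le_trans da; rewrite divr_gt0.
    move: Fz; rewrite E // nmM nmX => h.
    have p : 0 < s ^+ n by rewrite exprn_gt0.
    rewrite exprVn -(ler_pM2l p) divff ?gt_eqF //; apply: le_trans h.
    by rewrite ler_wpM2r ?nm_ge0 // lerXn2r ?nnegrE ?nm_ge0 // ltW.
  apply: le_trans (ler_wpM2l (exprn_ge0 _ (nm_ge0 _)) B) _.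
  have -> : nm (a - c) ^+ n * (16 * (2 / s * s^-1 ^+ n) * s) = (nm (a - c) / s) ^+ n * 32.
    by rewrite exprMn; field; rewrite gt_eqF.
  rewrite ler_wpM2r // lerXn2r ?nnegrE ?divr_ge0 ?nm_ge0 ?(ltW s0) //.
  by rewrite ler_pdivrMr //; order_lra.
have [n hn] := exists_pow2 (ler0n R 32) e0.
by apply: le_trans (small n) _; rewrite exprVn mulrC ltW.
Qed.

(** An isolated zero is the only one in some rational square, and this assigns different squares to
    different zeros. *)
Lemma countable_zeros (H : set C) F F' : (forall z, H z -> exists2 r : R, 0 < r & holo F F' z r) ->
  countable [set z | [/\ H z, F z = 0 & forall d : R, 0 < d -> exists2 w, nm (w - z) < d & F w != 0]].
Proof.
move=> HF; set Z := (X in countable X).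
have P z : exists q, Z z -> rsq q (complex.Re z, complex.Im z) /\ forall w, Z w -> rsq q (complex.Re w, complex.Im w) -> w = z.
  have [[Hz Fz nz]|nZ] := pselect (Z z); last by exists ((0, 0), 0%N).
  have [r r0 Hr] := HF z Hz.
  case: (isolated_zero r0 Hr Fz) => [[d d0 Hd]|[d d0 Hd]].
    by have [w /Hd -> /eqP] := nz d d0.
  have [q q1 q2] := @rsq_basis R (complex.Re z, complex.Im z) d d0.
  exists q => _; split=> // w [_ Fw _] /q2; rewrite !cx_surj => hw.
  by apply: contrapT => /eqP wz; have := Hd w hw wz; rewrite Fw eqxx.
have [q Hq] := choice P.
have [g Hg] : exists g : (rat * rat * nat)%type -> C, forall z, Z z -> g (q z) = z.
  have /choice[g Hg] k : exists z', (exists z, Z z /\ q z = k) -> Z z' /\ q z' = k.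
    have [[z [Zz qz]]|n] := pselect (exists z, Z z /\ q z = k); last by exists 0.
    by exists z.
  exists g => z Zz; have [Zg qg] := Hg (q z) (ex_intro _ z (conj Zz erefl)).
  have [_ U] := Hq _ Zz; apply: U => //.
  by have [V _] := Hq _ Zg; rewrite qg in V.
apply: (@sub_countable _ _ _ (g @` setT)).
  by apply: subset_card_le => z Zz; exists (q z) => //; exact: Hg.
apply: card_le_trans (card_image_le _ _) _; exact: countableP.
Qed.
End IsolatedZeros.

(** * Continuation of inverse branches along horizontal rays *)

Section Sheets.
Context {R : realType}.
Local Notation C := R[i].
Variables (H : set C) (g g' : C -> C) (y0 R0 : R) (finf : C -> C).
Hypothesis R0_gt0 : 0 < R0.
Hypothesis HH : forall z, H z -> [/\ nm z < 1, complex.Im (g z) != y0 &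
  exists2 r : R, 0 < r & (forall w, nm (w - z) < r -> H w) /\ holo g g' z r].
(** A closedness condition: a limit point inside the disk, with limit value off the height [y0],
    stays in [H]. A continuation along a ray can therefore stop only at the circle or at a critical
    point. *)
Hypothesis Hcl : forall z c, nm z < 1 -> complex.Im c != y0 ->
  (forall e : R, 0 < e -> exists w, [/\ H w, nm (w - z) < e & nm (g w - c) < e]) -> H z /\ g z = c.
Hypothesis Hinf : forall h, R0 < nm h -> complex.Im h != y0 ->
  [/\ H (finf h), g (finf h) = h, g' (finf h) != 0 & ccont finf h].
Implicit Types (h z : C) (s t x y : R) (V : set C) (psi : C -> C).

(* Clearing a section hypothesis would make [lra] fail. *)
Ltac sheet_lra := first [order_lra_except ltac:(fun X => lazymatch X with HH => fail | Hcl => fail | Hinf => fail | _ => idtac end) | lra].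
(** Continuity is enough to ask for: with [g' != 0] the inverse function theorem makes a continuous
    local inverse holomorphic. *)
Definition slift psi h := [/\ H (psi h), g (psi h) = h, g' (psi h) != 0 & ccont psi h].

(* A branch of the inverse of [g] on a set which is a union of rays towards [s * oo], equal to the
   given inverse [finf] of [g] near infinity on the part [R0 < s * Re h] of its domain. *)
Definition sheet s V psi := [/\ copen V, (forall h t, V h -> 0 <= t -> V (h + (s * t)%:C%C)),
  (forall h, V h -> slift psi h) & forall h, V h -> R0 < s * complex.Re h -> psi h = finf h].

Lemma slift_local_inj z : H z -> g' z != 0 -> exists2 r : R, 0 < r &
  forall a b, nm (a - z) < r -> nm (b - z) < r -> g a = g b -> a = b.
Proof.
move=> /HH[_ _ [r r0 [_ Hg]]] gz; have [r' [d [i [/andP[r'0 _] _ I _ _]]]] := inverse_function r0 Hg gz.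
by exists r'.
Qed.

(** Consider the supremum [u] of the times of disagreement. If the curves agree at [u], local
    injectivity of [g] forces agreement just before; if they differ at [u], they differ just after.
    Both contradict the choice of [u]. *)
Lemma slift_unique (k1 k2 : R -> C) (T : R) : 0 <= T ->
  (forall t, 0 <= t <= T -> [/\ H (k1 t), g' (k1 t) != 0, g (k1 t) = g (k2 t), rcont k1 t & rcont k2 t]) ->
  k1 T = k2 T -> k1 0 = k2 0.
Proof.
move=> T0 K kT; apply: contrapT => k0.
pose E := [set t | 0 <= t <= T /\ k1 t <> k2 t].
have E0 : E 0 by split=> //; rewrite lexx.
have hE : has_sup E by split; [exists 0|exists T => t [/andP[]]].
have s0 : 0 <= sup E by apply: ub_le_sup => //; exists T => t [/andP[]].
have sT : sup E <= T by apply: ge_sup; [exists 0|move=> t [/andP[]]].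
set u := sup E in s0 sT *.
have [Hu gu _ c1 c2] : [/\ H (k1 u), g' (k1 u) != 0, g (k1 u) = g (k2 u), rcont k1 u & rcont k2 u].
  by apply: K; rewrite s0.
have [e12|n12] := pselect (k1 u = k2 u).
  have [r r0 I] := slift_local_inj Hu gu.
  have [d1 d10 D1] := c1 r r0; have [d2 d20 D2] := c2 r r0.
  have d0 : 0 < Num.min d1 d2 by rewrite lt_min d10.
  have [t [/andP[t0 tT] nt] ut] := sup_adherent d0 hE.
  have tu : t <= u by apply: ub_le_sup => //; [by exists T => x [/andP[]]|by split=> //; rewrite t0].
  apply: nt; have [_ _ gg _ _] : [/\ H (k1 t), g' (k1 t) != 0, g (k1 t) = g (k2 t), rcont k1 t & rcont k2 t].
    by apply: K; rewrite t0.
  have au : `|t - u| < Num.min d1 d2 by rewrite ltr_norml; apply/andP; rewrite -/u in ut; split; sheet_lra.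
  move: au; rewrite lt_min => /andP[/D1 h1 /D2 h2]; apply: I => //.
  by rewrite e12.
have uT : u < T by rewrite lt_neqAle sT andbT; apply/eqP => uT; apply: n12; rewrite uT.
have p0 : 0 < nm (k1 u - k2 u) by rewrite nm_gt0 subr_eq0; apply/eqP.
have p2 : 0 < nm (k1 u - k2 u) / 2 by rewrite divr_gt0.
have [d1 d10 D1] := c1 _ p2; have [d2 d20 D2] := c2 _ p2.
pose d := Num.min (Num.min d1 d2) (T - u).
have d0 : 0 < d by rewrite !lt_min d10 d20 subr_gt0.
have : u + d / 2 <= u.
  apply: ub_le_sup; first by exists T => x [/andP[]].
  have : d <= T - u by rewrite ge_min lexx orbT.
  split; first by apply/andP; split; sheet_lra.
  have au : `|u + d / 2 - u| < d by rewrite addrC addKr gtr0_norm ?divr_gt0 //; sheet_lra.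
  have /D1 a1 : `|u + d / 2 - u| < d1 by apply: lt_le_trans au _; rewrite !ge_min lexx.
  have /D2 a2 : `|u + d / 2 - u| < d2 by apply: lt_le_trans au _; rewrite !ge_min lexx orbT.
  move=> e12; rewrite e12 nmBC in a1.
  by have := nmBD (k2 (u + d / 2)) (k1 u) (k2 u); sheet_lra.
by move: d0; clearbody d u; sheet_lra.
Qed.

Lemma Re_shift h t : complex.Re (h + t%:C%C) = complex.Re h + t.
Proof. by case: h. Qed.
Lemma Im_shift h t : complex.Im (h + t%:C%C) = complex.Im h.
Proof. by case: h => a b /=; rewrite addr0. Qed.

Lemma rcont_ray psi h s t : s * s = 1 -> ccont psi (h + (s * t)%:C%C) ->
  rcont (fun t => psi (h + (s * t)%:C%C)) t.
Proof.
move=> ss cp e e0; have [d d0 Hd] := cp e e0; exists d => // u hu; apply: Hd.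
have -> : h + (s * u)%:C%C - (h + (s * t)%:C%C) = (s * (u - t))%:C%C.
  by apply: cplx_eq; rewrite !ReImE /=; ring.
rewrite nm_real normrM; suff -> : `|s| = 1 by rewrite mul1r.
by apply/eqP; rewrite -(@pexpr_eq1 _ _ 2) // -normrX expr2 ss normr1.
Qed.

Lemma slift_ray psi1 psi2 h s (T : R) : s * s = 1 -> 0 <= T ->
  (forall t, 0 <= t <= T -> slift psi1 (h + (s * t)%:C%C) /\ slift psi2 (h + (s * t)%:C%C)) ->
  psi1 (h + (s * T)%:C%C) = psi2 (h + (s * T)%:C%C) -> psi1 h = psi2 h.
Proof.
move=> ss T0 L e.
have := @slift_unique (fun t => psi1 (h + (s * t)%:C%C)) (fun t => psi2 (h + (s * t)%:C%C)) T T0 _ e.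
rewrite /= mulr0 addr0; apply=> t /L[[? e1 ? ?] [? e2 ? ?]].
by split=> //; [rewrite e1 e2|exact: rcont_ray|exact: rcont_ray].
Qed.

(** Far out on the ray both branches are [finf]; uniqueness of lifts carries the equality back to
    [h]. *)
Lemma sheet_agree s V1 psi1 V2 psi2 h : s * s = 1 -> sheet s V1 psi1 -> sheet s V2 psi2 ->
  V1 h -> V2 h -> psi1 h = psi2 h.
Proof.
move=> ss [_ u1 l1 f1] [_ u2 l2 f2] h1 h2.
pose T := `|s * complex.Re h| + R0.
have T0 : 0 <= T by rewrite addr_ge0 // ltW.
apply: (slift_ray (s := s) (T := T)) => //.
  by move=> t /andP[t0 _]; split; [apply: l1; apply: u1|apply: l2; apply: u2].
have far : R0 < s * complex.Re (h + (s * (T + 1))%:C%C).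
  rewrite Re_shift mulrDr mulrA ss mul1r /T.
  by have := ler_norm (- (s * complex.Re h)); rewrite normrN; sheet_lra.
clearbody T.
have E t : T + 1 <= t -> psi1 (h + (s * t)%:C%C) = psi2 (h + (s * t)%:C%C).
  move=> tT; have t0 : 0 <= t by sheet_lra.
  have far' : R0 < s * complex.Re (h + (s * t)%:C%C).
    by move: far; rewrite !Re_shift !mulrDr !mulrA ss !mul1r; sheet_lra.
  by rewrite f1 // ?f2 //; [apply: u2|apply: u1].
apply: (slift_ray (s := s) (T := 1)) => //.
  move=> t /andP[t0 _]; have -> : h + (s * T)%:C%C + (s * t)%:C%C = h + (s * (T + t))%:C%C.
    by apply: cplx_eq; rewrite !ReImE /=; ring.
  have Tt : 0 <= T + t by rewrite addr_ge0.
  by split; [apply: l1; apply: u1|apply: l2; apply: u2].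
have -> : h + (s * T)%:C%C + (s * 1)%:C%C = h + (s * (T + 1))%:C%C.
  by apply: cplx_eq; rewrite !ReImE /=; ring.
exact: E.
Qed.

Lemma slift_eq psi1 psi2 h : (exists2 d : R, 0 < d & forall w, nm (w - h) < d -> psi1 w = psi2 w) ->
  slift psi1 h -> slift psi2 h.
Proof.
move=> [d d0 E] [a b c e]; have Eh : psi1 h = psi2 h by apply: E; rewrite subrr nm0.
by split; rewrite -?Eh //; apply: ccont_ext e; exists d.
Qed.

Definition maximal_sheet s V psi := sheet s V psi /\ forall V' psi', sheet s V' psi' -> V' `<=` V.

(** The union of all sheets; [sheet_agree] makes their values consistent. *)
Lemma max_sheet s : s * s = 1 -> exists V psi, maximal_sheet s V psi.
Proof.
move=> ss; pose V := [set h | exists V' psi', sheet s V' psi' /\ V' h].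
have /choice[psi P] h : exists z, forall V' psi', sheet s V' psi' -> V' h -> psi' h = z.
  have [[V' [psi' [S Vh]]]|n] := pselect (V h).
    by exists (psi' h) => V1 psi1 S1 V1h; exact: sheet_agree ss S1 S V1h Vh.
  by exists 0 => V' psi' S Vh; case: n; exists V', psi'.
exists V, psi; split; last by move=> V' psi' S h Vh; exists V', psi'.
split.
- move=> h [V' [psi' [S Vh]]]; have [oV' _ _ _] := S; have [d d0 Hd] := oV' h Vh.
  by exists d => // w /Hd Vw; exists V', psi'.
- move=> h t [V' [psi' [S Vh]]] t0; have [_ u _ _] := S.
  by exists V', psi'; split=> //; exact: u.
- move=> h [V' [psi' [S Vh]]]; have [oV' _ l _] := S; have [d d0 Hd] := oV' h Vh.
  apply: slift_eq (l h Vh); exists d => // w /Hd Vw.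
  exact: P S Vw.
- move=> h [V' [psi' [S Vh]]] far; have [_ _ _ f] := S.
  by rewrite -(P h _ _ S Vh) f.
Qed.

Lemma outer_sheet s : s * s = 1 ->
  sheet s [set h | (R0 < s * complex.Re h \/ R0 < `|complex.Im h|) /\ complex.Im h != y0] finf.
Proof.
move=> ss.
have big h : R0 < s * complex.Re h \/ R0 < `|complex.Im h| -> R0 < nm h.
  have s1 : `|s| = 1 by apply/eqP; rewrite -(@pexpr_eq1 _ _ 2) // -normrX expr2 ss normr1.
  move=> [h1|h1]; last exact: lt_le_trans h1 (Im_le_nm _).
  apply: lt_le_trans h1 _; apply: le_trans (ler_norm _) _.
  by rewrite normrM s1 mul1r; exact: Re_le_nm.
have s1 : `|s| = 1 by apply/eqP; rewrite -(@pexpr_eq1 _ _ 2) // -normrX expr2 ss normr1.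
split.
- move=> h [hR hI].
  have i0 : 0 < `|complex.Im h - y0| by rewrite normr_gt0 subr_eq0.
  have cI w : `|complex.Im w - complex.Im h| <= nm (w - h) by rewrite -ImN -ImD; exact: Im_le_nm.
  have cR w : `|complex.Re w - complex.Re h| <= nm (w - h) by rewrite -ReN -ReD; exact: Re_le_nm.
  have nI w : nm (w - h) < `|complex.Im h - y0| -> complex.Im w != y0.
    move=> hw; apply: contraTneq hw => e; rewrite -leNgt distrC -e; exact: cI.
  case: hR => hR.
    exists (Num.min (s * complex.Re h - R0) `|complex.Im h - y0|); first by rewrite lt_min subr_gt0 hR.
    move=> w; rewrite lt_min => /andP[w1 /nI w2]; split=> //; left.
    have : `|s * (complex.Re w - complex.Re h)| <= nm (w - h) by rewrite normrM s1 mul1r.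
    by rewrite ler_norml mulrBr => /andP[? _]; sheet_lra.
  exists (Num.min (`|complex.Im h| - R0) `|complex.Im h - y0|); first by rewrite lt_min subr_gt0 hR.
  move=> w; rewrite lt_min => /andP[w1 /nI w2]; split=> //; right.
  have := cI w; have := lerB_dist (complex.Im h) (complex.Im w); rewrite distrC; sheet_lra.
- move=> h t [hR hI] t0; split; last by rewrite Im_shift.
  case: hR => hR; last by right; rewrite Im_shift.
  by left; rewrite Re_shift mulrDr mulrA ss mul1r; sheet_lra.
- by move=> h [/big hb hI]; exact: Hinf.
- by [].
Qed.

(** Zeros of [g'] that are limits of nonzeros. Only such a zero can be a limit of lifts, along which
    [g'] does not vanish, and there are countably many of them. *)
Definition crit := [set z | [/\ H z, g' z = 0 & forall d : R, 0 < d -> exists2 w, nm (w - z) < d & g' w != 0]].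

Lemma crit_countable : countable [set complex.Im (g z) | z in crit].
Proof.
apply: card_le_trans (card_image_le _ _) _; apply: (@countable_zeros _ H g' (fun z => xget 0 [set l | cder g' z l])).
move=> z /HH[_ _ [r r0 [_ Hg]]]; have [r' r'0 [g'' Hg'']] := hol_deriv r0 Hg.
exists r' => // w /Hg'' D.
exact: (@xgetI _ 0 [set l | cder g' w l] _ D).
Qed.

(** [X] and [Y] measure the position along and across the ray, and [B] is a thin box around the
    missing end of the ray, on which the local inverse [i] is defined. Uniqueness of lifts along
    rays makes [psi] and [i] agree where both are defined. *)
Lemma box_extension s V psi i (X Y : C -> R) h1 (q t1 : R) : s * s = 1 -> sheet s V psi -> 0 < q -> 0 < t1 ->
  (forall h t, X (h + (s * t)%:C%C) = X h + t) -> (forall h t, Y (h + (s * t)%:C%C) = Y h) ->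
  (forall h, nm (h - h1) <= `|X h - t1| + `|Y h|) ->
  (forall w h, `|X w - X h| <= nm (w - h)) -> (forall w h, `|Y w - Y h| <= nm (w - h)) ->
  (forall h, nm (h - h1) < 2 * q -> V h) ->
  let B := [set h | `|Y h| < q /\ - q < X h < t1 + q] in
  (forall h, B h -> nm (h - h1) < 2 * q -> psi h = i h) -> (forall h, B h -> slift i h) ->
  (forall h, B h -> R0 < s * complex.Re h -> V h) -> exists psi', sheet s (V `|` B) psi'.
Proof.
move=> ss [oV uV lV fV] q0 t10 RT IT BRe XL YL near B nearE Bi BVout.
have mid (x y t : R) : t - x <= q -> x - t <= q -> y < q -> `|x - t| + y < 2 * q.
  by move=> a b c; have : `|x - t| <= q by [rewrite ler_norml; apply/andP; split; sheet_lra]; sheet_lra.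
have in_box (x t : R) : - q < x -> 0 <= t -> x + t < t1 + q -> - q < x + t < t1 + q.
  by move=> a b c; apply/andP; split=> //; sheet_lra.
have BV h : B h -> V h -> psi h = i h.
  move=> Bh Vh; have [b1 /andP[b2 b3]] := Bh.
  have [le|gt] := leP (X h) t1; last first.
    by apply: nearE => //; apply: le_lt_trans (BRe h) _; apply: mid => //; sheet_lra.
  have Bt t : 0 <= t -> X h + t <= t1 -> B (h + (s * t)%:C%C).
    by move=> t0 tT; rewrite /B /= RT IT; split=> //; apply: in_box => //; apply: le_lt_trans tT _; rewrite ltrDl.
  have T0 : 0 <= t1 - X h by rewrite subr_ge0.
  apply: (slift_ray ss T0).
    move=> t /andP[t0 tT]; split; first by apply: lV; exact: uV.
    by apply: Bi; apply: Bt => //; rewrite addrC -lerBrDr.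
  apply: nearE; first by apply: Bt => //; rewrite addrC subrK.
  apply: le_lt_trans (BRe _) _; rewrite RT IT (addrC (X h)) subrK subrr normr0 add0r.
  by apply: lt_trans b1 _; rewrite ltr_pMl // ltr1n.
have oB : copen B.
  move=> h [b1 /andP[b2 b3]].
  exists (Num.min (q - `|Y h|) (Num.min (X h + q) (t1 + q - X h))).
    by rewrite !lt_min !subr_gt0 b1 b3 addrC -ltrBlDl sub0r b2.
  move=> w; rewrite !lt_min => /and3P[w1 w2 w3].
  have hI := YL w h; have := XL w h; rewrite ler_norml => /andP[hR1 hR2].
  split; first by have := lerB_dist (Y w) (Y h); sheet_lra.
  by apply/andP; split; sheet_lra.
(* A ray leaves the box through its far end, which lies in the ball about [h1] contained in [V]. *)
have UB h t : B h -> 0 <= t -> (V `|` B) (h + (s * t)%:C%C).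
  move=> [b1 /andP[b2 b3]] t0; have [lt|ge] := ltP (X h + t) (t1 + q).
    by right; rewrite /B /= RT IT; split=> //; exact: in_box.
  left; have [h'|h'] := leP (X h) (t1 + q / 2).
    have -> : h + (s * t)%:C%C = h + (s * (t1 + q / 2 - X h))%:C%C + (s * (t - (t1 + q / 2 - X h)))%:C%C.
      by apply: cplx_eq; rewrite !ReImE /=; ring.
    apply: uV; last by sheet_lra.
    apply: near; apply: le_lt_trans (BRe _) _; rewrite RT IT.
    by apply: mid => //; sheet_lra.
  apply: uV => //; apply: near; apply: le_lt_trans (BRe _) _.
  by apply: mid => //; sheet_lra.
exists (fun h => if pselect (V h) then psi h else i h); split.
- by move=> h [/oV[e1 e10 E1]|/oB[e1 e10 E1]]; exists e1 => // w /E1 ?; [left|right].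
- by move=> h t [Vh|Bh] t0; [left; exact: uV|exact: UB].
- move=> h [Vh|Bh].
    have [e1 e10 E1] := oV h Vh; apply: slift_eq (lV h Vh).
    by exists e1 => // w /E1 Vw; case: pselect.
  have [e1 e10 E1] := oB h Bh; apply: slift_eq (Bi h Bh).
  by exists e1 => // w /E1 Bw; case: pselect => // Vw; rewrite BV.
- move=> h VB far; have Vh : V h by case: VB => // Bh; exact: BVout.
  by case: pselect => // ?; exact: fV.
Qed.

(** Otherwise the lifts stay in a compact part of the disk and accumulate at some [z], with
    [g z = h0] by [Hcl]. This [z] is not critical, as no critical value has the height of [h0], so
    the local inverse at [z] extends the sheet over [h0], against maximality. *)
Lemma sheet_end s V psi h0 (e : R) : s * s = 1 -> maximal_sheet s V psi ->
  complex.Im h0 != y0 -> ~ [set complex.Im (g z) | z in crit] (complex.Im h0) ->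
  ~ V h0 -> (forall t, 0 < t -> V (h0 + (s * t)%:C%C)) -> 0 < e ->
  exists t, [/\ 0 < t, t < e & 1 - e < nm (psi (h0 + (s * t)%:C%C))].
Proof.
move=> ss [S M] hy nc nV ray e0; have [oV uV lV fV] := S.
apply: contrapT => nex.
have far t : 0 < t -> t < e -> nm (psi (h0 + (s * t)%:C%C)) <= 1 - e.
  by move=> t0 te; rewrite leNgt; apply/negP => h; apply: nex; exists t.
have nms t : nm (s * t)%:C%C = `|t|.
  have s1 : `|s| = 1 by apply/eqP; rewrite -(@pexpr_eq1 _ _ 2) // -normrX expr2 ss normr1.
  by rewrite nm_real normrM s1 mul1r.
pose tn n : R := e / 2 * n.+1%:R^-1.
have tn0 n : 0 < tn n by rewrite mulr_gt0 ?divr_gt0 // invr_gt0.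
have tne n : tn n < e.
  have : tn n <= e / 2 by rewrite ler_piMr ?divr_ge0 ?(ltW e0) // invf_le1 // ler1n.
  by move: (tn n) => x; sheet_lra.
have tsm (d : R) : 0 < d -> exists N, forall n, (N <= n)%N -> tn n < d.
  move=> d0; have [N HN] := @nat_small R (d / e) (divr_gt0 d0 e0).
  exists N => n Nn; have : n.+1%:R^-1 <= N.+1%:R^-1 :> R by rewrite lef_pV2 ?posrE ?ltr0n // ler_nat.
  move: HN; rewrite ltr_pdivlMr // /tn; move: (n.+1%:R^-1 : R) (N.+1%:R^-1 : R) => x x' h1 h2.
  have h3 : x * e <= x' * e by rewrite ler_wpM2r // ltW.
  by rewrite mulrAC mulrC; sheet_lra.
pose u n := psi (h0 + (s * tn n)%:C%C).
have [z Hz] := @bolzano_weierstrass R u (1 - e) (fun n => far _ (tn0 n) (tne n)).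
have z1 : nm z < 1.
  have [n _ h] := Hz _ (divr_gt0 e0 (ltr0n R 2)) 0%N.
  have := far _ (tn0 n) (tne n); rewrite -/(u n); have := nm_sub_ge z (u n); rewrite nmBC; sheet_lra.
have uV' n : slift psi (h0 + (s * tn n)%:C%C) by apply: lV; exact: ray.
have [Hz0 gz] : H z /\ g z = h0.
  apply: Hcl => // d d0; have [N HN] := tsm d d0; have [n Nn h] := Hz d d0 N.
  have [Hu gu _ _] := uV' n; exists (u n); split=> //.
  by rewrite /u gu addrC addKr nms gtr0_norm // HN.
have gz0 : g' z != 0.
  apply/eqP => g0; apply: nc; exists z; last by rewrite gz.
  split=> // d d0; have [n _ h] := Hz d d0 0%N; have [_ _ gu _] := uV' n.
  by exists (u n).
have [_ _ [r r0 [Hr Hg]]] := HH Hz0.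
have [r' [d [i [/andP[r'0 r'r] d0 I I' Hi]]]] := inverse_function r0 Hg gz0.
rewrite gz in Hi.
have [N HN] := tsm (d / 2) (divr_gt0 d0 (ltr0n R 2)).
have [n Nn hn] := Hz r' r'0 N.
have t1d := HN n Nn; have t10 := tn0 n.
move: (uV' n) hn (ray _ t10); rewrite /u; move: (tn n) t1d t10 => t1 t1d t10 [Hu gu g'u cu] hn Vh1.
clear HN Nn uV' Hz far; clear u; clear tsm tne tn0; clear tn.
set h1 := h0 + (s * t1)%:C%C in Hu gu g'u cu hn Vh1.
have [d1 d10 D1] := oV _ Vh1.
have pr0 : 0 < r' - nm (psi h1 - z) by rewrite subr_gt0.
have [d2 d20 D2] := cu _ pr0.
pose q := Num.min (Num.min (d1 / 2) (d2 / 2)) (d / 4).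
have q0 : 0 < q by rewrite !lt_min !divr_gt0.
have [q1 q2 q3] : [/\ 2 * q <= d1, 2 * q <= d2 & 4 * q <= d].
  have a1 : q <= d1 / 2 by rewrite !ge_min lexx.
  have a2 : q <= d2 / 2 by rewrite !ge_min lexx orbT.
  have a3 : q <= d / 4 by rewrite !ge_min lexx !orbT.
  by split; sheet_lra.
clearbody q.
have near h : nm (h - h1) < 2 * q -> V h /\ (nm (h - h0) < d -> psi h = i h).
  move=> hh; have Vh : V h by apply: D1; sheet_lra.
  split=> // hd; have [i1 i2 _] := Hi h hd; have [_ gp _ _] := lV h Vh.
  apply: I => //; last by rewrite i2.
  have /D2 := lt_le_trans hh q2; have := nmBD (psi h1) (psi h) z; sheet_lra.
have [X [Y [[RT IT] [BRe B0] [XL YL] [X0 Y0]]]] : exists X Y : C -> R, [/\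
    (forall h t, X (h + (s * t)%:C%C) = X h + t) /\ (forall h t, Y (h + (s * t)%:C%C) = Y h),
    (forall h, nm (h - h1) <= `|X h - t1| + `|Y h|) /\ (forall h, nm (h - h0) <= `|X h| + `|Y h|),
    (forall w h, `|X w - X h| <= nm (w - h)) /\ (forall w h, `|Y w - Y h| <= nm (w - h)) &
    X h0 = 0 /\ Y h0 = 0].
  have s1 : `|s| = 1 by apply/eqP; rewrite -(@pexpr_eq1 _ _ 2) // -normrX expr2 ss normr1.
  have sR (x : R) : `|s * x| = `|x| by rewrite normrM s1 mul1r.
  have B0 h : nm (h - h0) <= `|s * complex.Re (h - h0)| + `|complex.Im (h - h0)|.
    by rewrite sR; exact: nm_le_ReIm.
  exists (fun h => s * complex.Re (h - h0)), (fun h => complex.Im (h - h0)); split.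
  - split=> h t; rewrite addrAC ?Im_shift //.
    by rewrite Re_shift mulrDr mulrA ss mul1r.
  - split=> // h; apply: le_trans (nm_le_ReIm _) _; rewrite -(sR (complex.Re (h - h1))).
    have -> : h - h1 = h - h0 + (- (s * t1))%:C%C by rewrite rmorphN /= /h1; ring.
    by rewrite Im_shift Re_shift mulrDr mulrN mulrA ss mul1r.
  - have E w h : w - h0 - (h - h0) = w - h by ring.
    split=> w h; last by rewrite -ImN -ImD E; exact: Im_le_nm.
    by rewrite -mulrBr sR -ReN -ReD E; exact: Re_le_nm.
  - by rewrite subrr /= mulr0.
clearbody h1.
pose B := [set h | `|Y h| < q /\ - q < X h < t1 + q].
have Bd h : B h -> nm (h - h0) < d.
  move=> [b1 /andP[b2 b3]]; apply: le_lt_trans (B0 h) _.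
  have : `|X h| < t1 + q by rewrite ltr_norml; apply/andP; split; sheet_lra.
  sheet_lra.
have Bi h : B h -> slift i h.
  move=> /Bd hd; have [i1 i2 i3] := Hi h hd; split=> //.
  - by apply: Hr; exact: lt_le_trans r'r.
  - exact: I'.
  - exact: cder_cont i3.
have out := M _ _ (outer_sheet ss).
have BVout h : B h -> R0 < s * complex.Re h -> V h.
  by move=> Bh far; apply: out; split; [left|have [Hi1 <- _ _] := Bi h Bh; have [] := HH Hi1].
have [psi' S'] := box_extension ss S q0 t10 RT IT BRe XL YL (fun h hh => proj1 (near h hh))
  (fun h Bh hh => proj2 (near h hh) (Bd h Bh)) Bi BVout.
apply: nV; apply: (M _ _ S'); right; rewrite /= X0 Y0 normr0; split=> //.
by rewrite oppr_lt0 q0 addr_gt0.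
Qed.

Lemma slift_cder psi h d : 0 < d -> (forall w, nm (w - h) < d -> g (psi w) = w) -> slift psi h ->
  cder psi h (g' (psi h))^-1.
Proof.
move=> d0 gd [Hp gp g'p cp]; have [_ _ [r r0 [_ Hg]]] := HH Hp.
have [r' [e [i [/andP[r'0 _] e0 I _ Hi]]]] := inverse_function r0 Hg g'p.
rewrite gp in Hi; have [d1 d10 D1] := cp r' r'0.
have E w : nm (w - h) < Num.min (Num.min d d1) e -> i w = psi w.
  rewrite !lt_min -andbA => /and3P[w1 /D1 w2 /Hi[w3 w4 _]]; apply: I => //.
  by rewrite w4 gd.
have m0 : 0 < Num.min (Num.min d d1) e by rewrite !lt_min d0 d10.
have ih : i h = psi h by apply: E; rewrite subrr nm0.
have [|_ _] := Hi h; first by rewrite subrr nm0.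
by rewrite ih; apply: cder_ext; exists (Num.min (Num.min d d1) e).
Qed.

Lemma slift_open psi (V : set C) : copen V -> (forall h, V h -> slift psi h) -> copen (psi @` V).
Proof.
move=> oV L _ [h Vh <-]; have [Hp gp g'p cp] := L h Vh.
have [_ _ [r r0 [_ Hg]]] := HH Hp; have [d d0 D] := oV h Vh.
have [r' [e [i [/andP[r'0 r'r] e0 I _ Hi]]]] := inverse_function r0 Hg g'p.
have [d1 d10 D1] := cp r' r'0.
have m0 : 0 < Num.min d d1 by rewrite lt_min d0.
have ph : nm (psi h - psi h) < r by rewrite subrr nm0.
have [d2 d20 D2] := cder_cont (Hg _ ph) m0.
exists (Num.min r' d2); first by rewrite lt_min r'0.
move=> z; rewrite lt_min => /andP[z1 /D2]; rewrite gp lt_min => /andP[/D z2 /D1 z3].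
exists (g z) => //; apply: I => //.
by have [_ -> _ _] := L _ z2.
Qed.

Variables (V1 V2 : set C) (psi1 psi2 : C -> C).
Hypotheses (S1 : maximal_sheet 1 V1 psi1) (S2 : maximal_sheet (-1) V2 psi2).
(** Ties the continuations from +oo and -oo together; [rays_agree] derives it from
    one-sheetedness. *)
Hypothesis OS : forall h, V1 h -> V2 h -> psi1 h = psi2 h.

Definition Om := V1 `|` V2.
Definition phi h := if pselect (V1 h) then psi1 h else psi2 h.

Lemma phi1 h : V1 h -> phi h = psi1 h.
Proof. by rewrite /phi; case: pselect. Qed.

Lemma phi2 h : V2 h -> phi h = psi2 h.
Proof. by rewrite /phi; case: pselect => // *; exact: OS. Qed.

Lemma Om_open : copen Om.
Proof.
have [ [oo1 _ _ _] _] := S1; have [ [oo2 _ _ _] _] := S2.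
by move=> h [/oo1[d d0 D]|/oo2[d d0 D]]; exists d => // w /D ?; [left|right].
Qed.

Lemma phi_slift h : Om h -> slift phi h.
Proof.
have [ [oo1 _ l1 _] _] := S1; have [ [oo2 _ l2 _] _] := S2.
case=> Vh.
  have [d d0 D] := oo1 h Vh; apply: slift_eq (l1 h Vh).
  by exists d => // w /D /phi1.
have [d d0 D] := oo2 h Vh; apply: slift_eq (l2 h Vh).
by exists d => // w /D /phi2.
Qed.

Lemma phi_cder h : Om h -> cder phi h (g' (phi h))^-1.
Proof.
move=> Oh; have [d d0 D] := Om_open Oh; apply: (slift_cder d0); last exact: phi_slift.
by move=> w /D /phi_slift[].
Qed.

Lemma phi_dcont h : Om h -> ccont (fun w => (g' (phi w))^-1) h.
Proof.
move=> /phi_slift[Hp _ g'p cp]; have [_ _ [r r0 [_ Hg]]] := HH Hp.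
have [r' r'0 [g'' Hg'']] := hol_deriv r0 Hg.
apply: (@ccont_invf _ (fun w => g' (phi w))) => //; apply: ccont_comp cp _.
by apply: cder_cont (Hg'' _ _); rewrite subrr nm0.
Qed.

Lemma phi_range_open : copen (phi @` Om).
Proof. by apply: slift_open; [exact: Om_open|exact: phi_slift]. Qed.

Lemma phi_range_inv z : (phi @` Om) z -> [/\ Om (g z), phi (g z) = z, H z & cder g z (g' z)].
Proof.
move=> [h Oh <-]; have [Hp gp _ _] := phi_slift Oh; rewrite gp; split=> //.
by have [_ _ [r r0 [_ Hg]]] := HH Hp; apply: Hg; rewrite subrr nm0.
Qed.

Lemma phi_far h : complex.Im h != y0 -> R0 < `|complex.Re h| \/ R0 < `|complex.Im h| -> Om h /\ phi h = finf h.
Proof.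
move=> hy; have [ [oo1 u1 l1 f1] M1] := S1; have [ [oo2 u2 l2 f2] M2] := S2.
have ss2 : -1 * -1 = 1 :> R by rewrite mulrNN mulr1.
have out1 := outer_sheet (mulr1 1); have out2 := outer_sheet ss2.
have [r1|r1] := ltP R0 (complex.Re h).
  have Vh : V1 h by apply: (M1 _ _ out1); split=> //; left; rewrite mul1r.
  by split; [left|rewrite phi1 // f1 // mul1r].
have [r2|r2] := ltP R0 (- complex.Re h).
  have Vh : V2 h by apply: (M2 _ _ out2); split=> //; left; rewrite mulN1r.
  by split; [right|rewrite phi2 // f2 // mulN1r].
case=> hb; first by move: hb; rewrite ltNge ler_norml r1 lerNl r2.
have hO : [set h | (R0 < 1 * complex.Re h \/ R0 < `|complex.Im h|) /\ complex.Im h != y0] h by split=> //; right.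
have Vh : V1 h by apply: (M1 _ _ out1).
split; first by left.
by rewrite phi1 //; apply: sheet_agree (mulr1 1) (proj1 S1) out1 Vh hO.
Qed.

(** On this line the domain of the sheet is an open half-line; its end [inf A] is a boundary point
    to which [sheet_end] applies. *)
Lemma ray_end s V psi y (L : R) : s * s = 1 -> maximal_sheet s V psi -> y != y0 ->
  ~ [set complex.Im (g z) | z in crit] y -> (forall u, V ((s * u) +i* y)%C -> L <= u) ->
  forall e : R, 0 < e -> exists u, [/\ V ((s * u) +i* y)%C, u <= R0 + 1 & 1 - e < nm (psi ((s * u) +i* y)%C)].
Proof.
move=> ss S hy nc hL e e0; pose A := [set u | V ((s * u) +i* y)%C].
have [[oV uV lV _] M] := S; have out := M _ _ (outer_sheet ss).
have sh u t : ((s * u) +i* y)%C + (s * t)%:C%C = ((s * (u + t)) +i* y)%C.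
  by apply: cplx_eq; rewrite !ReImE /=; ring.
have Au u t : A u -> 0 <= t -> A (u + t) by rewrite /A /= -sh; exact: uV.
have AR u : R0 < u -> A u by move=> h; apply: out; split=> //=; left; rewrite mulrA ss mul1r.
have hA : has_inf A by split; [exists (R0 + 1); apply: AR; rewrite ltrDl|exists L => u; exact: hL].
have Ai t : 0 < t -> A (inf A + t).
  move=> t0; have [u Au' hu] := inf_adherent t0 hA.
  by have -> : inf A + t = u + (inf A + t - u) by [ring]; apply: Au; rewrite // subr_ge0 ltW.
have Ani : ~ A (inf A).
  move=> /oV[d d0 D]; have : inf A <= inf A - d / 2.
    apply: ge_inf; first by case: hA.
    apply: D; have -> : ((s * (inf A - d / 2)) +i* y)%C - ((s * inf A) +i* y)%C = (s * - (d / 2))%:C%C.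
      by apply: cplx_eq; rewrite !ReImE /=; ring.
    have s1 : `|s| = 1 by apply/eqP; rewrite -(@pexpr_eq1 _ _ 2) // -normrX expr2 ss normr1.
    by rewrite nm_real normrM s1 mul1r normrN gtr0_norm ?divr_gt0 //; lra.
  by move=> le; rewrite -subr_ge0 addrAC subrr add0r oppr_ge0 leNgt divr_gt0 in le.
have iR : inf A <= R0 + 2^-1 by apply: ge_inf; [case: hA|apply: AR; lra].
(* The bound 1/2 on the step [t] gives [u <= R0 + 1] in view of [iR]. *)
have m0 : 0 < Num.min e 2^-1 by rewrite lt_min e0 invr_gt0 ltr0n.
have [|t [t0 tm h]] := sheet_end (h0 := ((s * inf A) +i* y)%C) ss S hy nc Ani _ m0.
  by move=> t t0; rewrite sh; exact: Ai.
exists (inf A + t); move: tm; rewrite lt_min => /andP[te t2]; split; first exact: Ai.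
  lra.
by rewrite -sh; apply: le_lt_trans h; rewrite lerD2l lerN2 ge_min lexx.
Qed.

(** Either the rays from the two sides overlap, and a common point serves as both ends, or neither
    covers the line and both must stop, close to the circle. *)
Lemma line_split y (e : R) : y != y0 -> ~ [set complex.Im (g z) | z in crit] y -> 0 < e ->
  exists a b : R, [/\ b <= a, - (R0 + 1) <= b /\ a <= R0 + 1, forall x, a <= x -> V1 (x +i* y)%C,
    forall x, x <= b -> V2 (x +i* y)%C &
    a = b \/ (1 - e < nm (phi (a +i* y)%C) /\ 1 - e < nm (phi (b +i* y)%C))].
Proof.
move=> hy nc e0; have [ [oo1 u1 l1 f1] M1] := S1; have [ [oo2 u2 l2 f2] M2] := S2.
have ss2 : -1 * -1 = 1 :> R by rewrite mulrNN mulr1.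
have out1 := M1 _ _ (outer_sheet (mulr1 1)); have out2 := M2 _ _ (outer_sheet ss2).
have up a x : V1 (a +i* y)%C -> a <= x -> V1 (x +i* y)%C.
  move=> Va ax; have -> : (x +i* y)%C = (a +i* y)%C + (1 * (x - a))%:C%C by apply: cplx_eq; rewrite !ReImE /=; ring.
  by apply: u1 => //; rewrite subr_ge0.
have dn b x : V2 (b +i* y)%C -> x <= b -> V2 (x +i* y)%C.
  move=> Va ax; have -> : (x +i* y)%C = (b +i* y)%C + (-1 * (b - x))%:C%C by apply: cplx_eq; rewrite !ReImE /=; ring.
  by apply: u2 => //; rewrite subr_ge0.
have A1 x : R0 < x -> V1 (x +i* y)%C by move=> h; apply: out1; split=> //=; left; rewrite mul1r.
have A2 x : x < - R0 -> V2 (x +i* y)%C by move=> h; apply: out2; split=> //=; left; rewrite mulN1r ltrNr.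
have [[x [x1 x2]]|nx] := pselect (exists x, V1 (x +i* y)%C /\ V2 (x +i* y)%C).
  (* The common point [x], clamped into the interval from [- (R0 + 1)] to [R0 + 1], where both
     sheets still contain it. *)
  pose c := Num.max (- (R0 + 1)) (Num.min x (R0 + 1)).
  have [c1 c2] : - (R0 + 1) <= c /\ c <= R0 + 1.
    by rewrite /c le_max lexx ge_max ge_min lexx orbT; split=> //; move: R0_gt0; lra.
  have V1c : V1 (c +i* y)%C.
    have [h|h] := ltP R0 x.
      have [h'|h'] := leP x (R0 + 1).
        by rewrite /c min_l // max_r //; move: R0_gt0; lra.
      rewrite /c min_r ?ltW // max_r; last by move: R0_gt0; lra.
      by apply: A1; rewrite ltrDl.
    by apply: up x1 _; rewrite /c le_max (_ : Num.min x _ = x) ?lexx ?orbT // min_l //; lra.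
  have V2c : V2 (c +i* y)%C.
    have [h|h] := leP (- (R0 + 1)) (Num.min x (R0 + 1)); last first.
      by rewrite /c max_l ?ltW //; apply: A2; lra.
    by apply: dn x2 _; rewrite /c max_r // ge_min lexx.
  by exists c, c; split=> //; [move=> z; exact: up|move=> z; exact: dn|left].
have [u [u0 uR ue]] : exists u, [/\ V1 ((1 * u) +i* y)%C, u <= R0 + 1 & 1 - e < nm (psi1 ((1 * u) +i* y)%C)].
  apply: (@ray_end 1 V1 psi1 y (- (R0 + 1)) (mulr1 1) S1) => // u; rewrite mul1r => Vu.
  rewrite leNgt; apply/negP => h; apply: nx; exists (- (R0 + 1)); split; first exact: up Vu (ltW h).
  by apply: A2; lra.
have [v [v0 vR ve]] : exists u, [/\ V2 ((-1 * u) +i* y)%C, u <= R0 + 1 & 1 - e < nm (psi2 ((-1 * u) +i* y)%C)].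
  apply: (@ray_end (-1) V2 psi2 y (- (R0 + 1)) ss2 S2) => // v; rewrite mulN1r => Vu.
  rewrite leNgt; apply/negP => h; apply: nx; exists (R0 + 1); split; first by apply: A1; lra.
  by apply: dn Vu _; lra.
rewrite mul1r in u0 ue; rewrite mulN1r in v0 ve.
have vu : - v <= u.
  by rewrite leNgt; apply/negP => h; apply: nx; exists u; split=> //; apply: dn v0 (ltW h).
exists u, (- v); split=> //; [by split=> //; lra|move=> x; exact: up|move=> x; exact: dn|].
by right; rewrite phi1 // phi2.
Qed.
End Sheets.

(** * The lower bound on a horizontal line *)

Section Cutoff.
Context {R : realType}.
Local Notation C := R[i].
Local Notation mu := (@lebesgue_measure R).
Implicit Types (s x u v : R) (h z : C).

Definition pos u : R := Num.max u 0.

Lemma pos_sq_taylor u v : 0 <= pos v ^+ 2 - pos u ^+ 2 - 2 * pos u * (v - u) <= (v - u) ^+ 2.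
Proof.
have q := sqr_ge0 (v - u); have qu := sqr_ge0 u; have qv := sqr_ge0 v.
have E : (v - u) ^+ 2 = v ^+ 2 - 2 * (u * v) + u ^+ 2 by ring.
rewrite /pos; case: (leP u 0) => hu; case: (leP v 0) => hv.
- by rewrite expr0n subrr mulr0 mul0r subr0 lexx.
- have := mulr_le0_ge0 hu (ltW hv); rewrite E in q *.
  by rewrite expr0n mulr0 mul0r !subr0 qv /=; order_lra.
- have := mulr_ge0_le0 (ltW hu) hv; rewrite E in q *; rewrite expr0n /= => p.
  have -> : 0 - u ^+ 2 - 2 * u * (v - u) = u ^+ 2 - 2 * (u * v) by ring.
  by apply/andP; split; order_lra.
- have -> : v ^+ 2 - u ^+ 2 - 2 * u * (v - u) = (v - u) ^+ 2 by ring.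
  by rewrite q lexx.
Qed.

Lemma pos_lip u v : `|pos v - pos u| <= `|v - u|.
Proof.
rewrite /pos; case: (leP u 0) => hu; case: (leP v 0) => hv; rewrite ?subrr ?normr0 ?normr_ge0 //.
- rewrite !ger0_norm; order_lra.
- rewrite !ler0_norm; order_lra.
Qed.

(** A quadratic spline with knots 1, 3/2 and 2, falling from 1 to 0. Its derivative is Lipschitz,
    which yields the second-order estimate [cut_taylor] with an explicit constant. *)
Definition cut s : R := 1 - 2 * pos (s - 1) ^+ 2 + 4 * pos (s - 3 / 2) ^+ 2 - 2 * pos (s - 2) ^+ 2.
Definition dcut s : R := - 4 * pos (s - 1) + 8 * pos (s - 3 / 2) - 4 * pos (s - 2).

Ltac cases_pos s := rewrite /cut /dcut /pos;
  case: (leP (s - 1) 0) => ?; case: (leP (s - 3 / 2) 0) => ?; case: (leP (s - 2) 0) => ?.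

Lemma cut_le1 s : s <= 1 -> cut s = 1 /\ dcut s = 0.
Proof. by move=> h; cases_pos s; split; order_lra. Qed.

Lemma cut_ge2 s : 2 <= s -> cut s = 0 /\ dcut s = 0.
Proof. by move=> h; cases_pos s; split; try order_lra; nra. Qed.

Lemma cut_bounds s : [/\ 0 <= cut s, cut s <= 1, -2 <= dcut s & dcut s <= 0].
Proof. by cases_pos s; split; try order_lra; nra. Qed.

Lemma dcut_mid s : 6 / 5 <= s <= 9 / 5 -> dcut s <= - 4 / 5.
Proof. by move=> /andP[? ?]; cases_pos s; order_lra. Qed.

Lemma cut_taylor s s' : `|cut s' - cut s - dcut s * (s' - s)| <= 8 * (s' - s) ^+ 2.
Proof.
have /andP[a1 a2] := pos_sq_taylor (s - 1) (s' - 1).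
have /andP[b1 b2] := pos_sq_taylor (s - 3 / 2) (s' - 3 / 2).
have /andP[c1 c2] := pos_sq_taylor (s - 2) (s' - 2).
have E c : s' - c - (s - c) = s' - s by ring.
move: a1 a2 b1 b2 c1 c2; rewrite /cut /dcut !E.
move: (pos _) (pos _) (pos _) (pos _) (pos _) (pos _) => p1 p2 p3 p4 p5 p6.
set D := s' - s; move: D => D; rewrite ler_norml => *; apply/andP; split; order_lra.
Qed.

Lemma dcut_lip s s' : `|dcut s' - dcut s| <= 16 * `|s' - s|.
Proof.
have := pos_lip (s - 1) (s' - 1); have := pos_lip (s - 3 / 2) (s' - 3 / 2); have := pos_lip (s - 2) (s' - 2).
have E c : s' - c - (s - c) = s' - s by ring.
rewrite !E /dcut; move: (pos _) (pos _) (pos _) (pos _) (pos _) (pos _) `|s' - s| => p1 p2 p3 p4 p5 p6 D.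
by rewrite !ler_norml => /andP[? ?] /andP[? ?] /andP[? ?]; apply/andP; split; order_lra.
Qed.

Lemma cut_derive s : is_derive s 1 cut (dcut s).
Proof.
apply: is_derive_eps => e e0; exists (e / 8); first by rewrite divr_gt0.
move=> s' h; apply: le_trans (cut_taylor s s') _.
rewrite -real_normK ?num_real // expr2 mulrA ler_wpM2r // -ler_pdivlMl // mulrC.
exact: ltW.
Qed.

Lemma cut_continuous : continuous cut.
Proof.
move=> s; apply: continuous_eps => e e0; pose d := Num.min 1 (e / 20).
exists d; first by rewrite lt_min ltr01 divr_gt0.
move=> s'; rewrite lt_min => /andP[h1 h2]; have := cut_taylor s s'.
have [_ _ c1 c2] := cut_bounds s.
have a : `|dcut s * (s' - s)| <= 2 * `|s' - s|.
  by rewrite normrM ler_wpM2r // ler_norml; apply/andP; split; order_lra.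
have b : (s' - s) ^+ 2 <= `|s' - s|.
  by rewrite -real_normK ?num_real // expr2 ler_piMl // ltW.
have := ler_normD (cut s' - cut s - dcut s * (s' - s)) (dcut s * (s' - s)); rewrite subrK; order_lra.
Qed.

Lemma dcut_continuous : continuous dcut.
Proof.
move=> s; apply: continuous_eps => e e0; exists (e / 16); first by rewrite divr_gt0.
move=> s' h; apply: le_lt_trans (dcut_lip s s') _.
by rewrite -ltr_pdivlMl // mulrC.
Qed.

(** The real inner product of the plane; it arises from differentiating [nm ^+ 2]. *)
Definition Rcj z w : R := complex.Re z * complex.Re w + complex.Im z * complex.Im w.

Lemma Rcj_le z w : `|Rcj z w| <= nm z * nm w.
Proof.
have -> : Rcj z w = complex.Re (z^* * w) by rewrite conjCE !ReImE /= /Rcj; ring.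
by apply: le_trans (Re_le_nm _) _; rewrite nmM nmJ.
Qed.

Lemma RcjDr z w w' : Rcj z (w + w') = Rcj z w + Rcj z w'.
Proof. by rewrite /Rcj !ReImE; ring. Qed.
Lemma RcjDl z w w' : Rcj (w + w') z = Rcj w z + Rcj w' z.
Proof. by rewrite /Rcj !ReImE; ring. Qed.
Lemma Rcjzz z : Rcj z z = nm z ^+ 2.
Proof. by rewrite nm_sqr /Rcj; ring. Qed.

(* With |P|^2 = |h|^2 + 2 Re(conj h d / h) + ... the first-order terms combine through
   conj h / h - 2 Re h / h = -1, which leaves only the real part of d. *)
Lemma cut_asymptotics (d : C) (B : R) : 0 <= B -> exists K M1 : R, [/\ 0 <= K, 1 <= M1 &
  forall M h E0 E1, M1 <= M -> 1 <= nm h -> nm (E0 - d / h) <= B / nm h ^+ 2 -> nm (E1 - d) <= B / nm h ->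
  cut (nm h ^+ 2 / M ^+ 2) - 2 * complex.Re d * dcut (nm h ^+ 2 / M ^+ 2) / M ^+ 2 - K / M ^+ 3 <=
  cut (nm (h + E0) ^+ 2 / M ^+ 2) - 2 * (dcut (nm (h + E0) ^+ 2 / M ^+ 2) *
    (2 * Rcj (h + E0) (1 - E1 / h ^+ 2)) / M ^+ 2) * complex.Re E0].
Proof.
move=> B0; pose A := nm d + B; have A0 : 0 <= A by rewrite addr_ge0 ?nm_ge0.
pose A2 := 2 * A + A ^+ 2; have A20 : 0 <= A2 by rewrite addr_ge0 ?mulr_ge0 ?sqr_ge0.
(* Collects the coefficients of the error bounds [U1], [U2] and [U3] below. *)
pose K := 8 * A2 ^+ 2 + 4 * (2 * B + A ^+ 2) + 64 * A2 * (A + A * A2) + 16 * (A * A2 + B).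
have AA := mulr_ge0 A0 A20; have qA := sqr_ge0 A; have qA2 := sqr_ge0 A2.
have K0 : 0 <= K.
  by have := mulr_ge0 A20 (addr_ge0 A0 AA); rewrite /K; order_lra.
exists K, (1 + 4 * A); split=> //; first by rewrite lerDl mulr_ge0.
move=> M h E0 E1 hM h1 e0 e1.
have M1 : 1 <= M by apply: le_trans hM; rewrite lerDl mulr_ge0.
have h0 : 0 < nm h by apply: lt_le_trans h1.
have hn0 : h != 0 by rewrite -nm_gt0.
have M0 : 0 < M by apply: lt_le_trans M1.
set H := nm h in h1 e0 e1 h0 *; set b := H^-1.
have b0 : 0 < b by rewrite invr_gt0.
have b1 : b <= 1 by rewrite invf_le1.
have bH : b * H = 1 by rewrite mulVf // gt_eqF.
have bB : B / H ^+ 2 = B * b ^+ 2 by rewrite -exprVn.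
have nE1 : nm E1 <= A.
  have := nm_sub_ge E1 d; have : B * b <= B by rewrite ler_piMr.
  by move: e1; rewrite -/b /A; order_lra.
have ndh : nm (d / h) = nm d * b by rewrite nm_div.
have nE0 : nm E0 <= A * b.
  have := nm_sub_ge E0 (d / h); rewrite ndh; move: e0; rewrite bB => e0.
  have : B * b ^+ 2 <= B * b by rewrite ler_wpM2l // expr2 ler_piMr // ltW.
  by rewrite /A mulrDl; order_lra.
have nE0A : nm E0 <= A by apply: le_trans nE0 _; rewrite ler_piMr.
have E00 := nm_ge0 E0; have E10 := nm_ge0 E1.
set s := H ^+ 2 / M ^+ 2; set s' := nm (h + E0) ^+ 2 / M ^+ 2.
have KM : 0 <= K / M ^+ 3 by rewrite divr_ge0 // exprn_ge0 // ltW.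
(* For [H <= M / 2] both cut-offs equal 1, since [nm E0 <= A] and [4 * A <= M]. Otherwise
   [1 / H <= 2 / M], and all errors become multiples of [m ^+ 3]. *)
have [hsmall|hbig] := leP H (M / 2).
  have sq1 (x : R) : 0 <= x -> x <= M -> x ^+ 2 / M ^+ 2 <= 1.
    by move=> x0 xM; rewrite ler_pdivrMr ?exprn_gt0 // mul1r lerXn2r ?nnegrE // ltW.
  have [-> ->] : cut s = 1 /\ dcut s = 0 by apply: cut_le1; apply: sq1; order_lra.
  have [-> ->] : cut s' = 1 /\ dcut s' = 0.
    by apply: cut_le1; apply: sq1; [exact: nm_ge0|have := nmD h E0; rewrite -/H; order_lra].
  by rewrite !(mul0r, mulr0, subr0); order_lra.
set m := M^-1; have m0 : 0 < m by rewrite invr_gt0.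
have mM : m * M = 1 by rewrite mulVf // gt_eqF.
have m1 : m <= 1 by rewrite invf_le1.
have bm : b <= 2 * m.
  have -> : 2 * m = (M / 2)^-1 by rewrite invf_div.
  by rewrite lef_pV2 ?posrE ?divr_gt0 // ltW.
have sE : s' - s = (2 * Rcj h E0 + nm E0 ^+ 2) * m ^+ 2.
  rewrite /s /s' -exprVn -mulrBl -!Rcjzz RcjDr !RcjDl; congr (_ * _).
  by rewrite /Rcj; ring.
have r0 : `|Rcj h E0| <= A.
  apply: le_trans (Rcj_le _ _) _; rewrite -/H.
  have : H * nm E0 <= H * (A * b) by rewrite ler_wpM2l // ltW.
  by rewrite mulrCA (mulrC H b) bH mulr1.
have sA : `|s' - s| <= A2 * m ^+ 2.
  rewrite sE normrM (ger0_norm (sqr_ge0 m)) ler_wpM2r ?sqr_ge0 //.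
  apply: le_trans (ler_normD _ _) _; rewrite normrM (ger0_norm (sqr_ge0 _)) ger0_norm // /A2.
  have : nm E0 ^+ 2 <= A ^+ 2 by rewrite lerXn2r.
  by move: r0; order_lra.
pose D1 := Rcj h (d / h).
have D1E : `|Rcj h E0 - D1| <= B * b.
  have -> : Rcj h E0 - D1 = Rcj h (E0 - d / h) by rewrite RcjDr /D1; congr (_ + _); rewrite /Rcj !(ReN, ImN); ring.
  apply: le_trans (Rcj_le _ _) _; rewrite -/H; apply: le_trans (ler_wpM2l (ltW h0) e0) _.
  by rewrite bB expr2 mulrCA (mulrA H) (mulrC H b) bH mul1r.
pose x := complex.Re h; pose y := complex.Re (d / h).
have xy : D1 - 2 * x * y = - complex.Re d.
  rewrite /D1 /x /y.
  have -> : d = d / h * h by rewrite divfK.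
  by rewrite mulfK //; move: (d / h) => q; rewrite !ReImE /Rcj; ring.
pose Q := Rcj (h + E0) (1 - E1 / h ^+ 2).
have hh2 : nm (E1 / h ^+ 2) <= A * b ^+ 2.
  by rewrite nm_div nmX -exprVn ler_wpM2r // exprn_ge0 // ltW.
have Qx : `|Q - x| <= A2 * b.
  have -> : Q - x = Rcj E0 1 + Rcj h (- (E1 / h ^+ 2)) + Rcj E0 (- (E1 / h ^+ 2)).
    by rewrite /Q RcjDr !RcjDl /x {1}/Rcj /=; ring.
  apply: le_trans (ler_normD _ _) _; apply: le_trans (lerD (ler_normD _ _) (lexx _)) _.
  have q1 : `|Rcj E0 1| <= A * b by apply: le_trans (Rcj_le _ _) _; rewrite nm1 mulr1.
  have q2 : `|Rcj h (- (E1 / h ^+ 2))| <= A * b.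
    apply: le_trans (Rcj_le _ _) _; rewrite nmN -/H; apply: le_trans (ler_wpM2l (ltW h0) hh2) _.
    by rewrite expr2 mulrCA (mulrA H) (mulrC H b) bH mul1r.
  have q3 : `|Rcj E0 (- (E1 / h ^+ 2))| <= A ^+ 2 * b.
    apply: le_trans (Rcj_le _ _) _; rewrite nmN.
    apply: le_trans (ler_pM E00 (nm_ge0 _) nE0A hh2) _.
    by rewrite mulrA -expr2 ler_wpM2l ?sqr_ge0 // expr2 ler_piMr // ltW.
  by rewrite /A2; clear -q1 q2 q3; lra.
have ey : `|complex.Re E0 - y| <= B * b ^+ 2.
  by rewrite -bB; apply: le_trans e0; rewrite -ReN -ReD; exact: Re_le_nm.
have eA : `|complex.Re E0| <= A * b by apply: le_trans (Re_le_nm _) nE0.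
have xH : `|x| <= H by exact: Re_le_nm.
set e := complex.Re E0 in ey eA *.
have Qe1 : `|Q * e - x * y| <= (A * A2 + B) * b.
  have -> : Q * e - x * y = (Q - x) * e + x * (e - y) by ring.
  apply: le_trans (ler_normD _ _) _; rewrite !normrM.
  have q1 : `|Q - x| * `|e| <= A2 * b * (A * b) by apply: ler_pM.
  have q2 : `|x| * `|e - y| <= H * (B * b ^+ 2) by apply: ler_pM.
  have -> : (A * A2 + B) * b = A2 * A * b + B * b by ring.
  apply: lerD.
    apply: le_trans q1 _; have -> : A2 * b * (A * b) = A2 * A * b * b by ring.
    by rewrite ler_piMr // !mulr_ge0 // ltW.
  apply: le_trans q2 _; rewrite expr2 (_ : H * (B * (b * b)) = b * H * (B * b)); last by ring.
  by rewrite bH mul1r.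
have Qe2 : `|Q * e| <= A + A * A2.
  have q : `|Q| <= H + A2 * b.
    by have := ler_normD (Q - x) x; rewrite subrK; clear -Qx xH; lra.
  rewrite normrM; apply: le_trans (ler_pM (normr_ge0 _) (normr_ge0 _) q eA) _.
  have -> : (H + A2 * b) * (A * b) = A * (b * H) + A * A2 * (b * b) by ring.
  rewrite bH mulr1 lerD2l -expr2; apply: ler_piMr; first exact: mulr_ge0.
  by rewrite exprn_ile1 // ltW.
have dl : `|dcut s' - dcut s| <= 16 * (A2 * m ^+ 2).
  by apply: le_trans (dcut_lip _ _) _; rewrite ler_wpM2l.
have /ler_normlP[tl _] := cut_taylor s s'.
have [_ _ dc1 dc2] := cut_bounds s.
have ds2 : `|dcut s| <= 2 by rewrite ler_norml dc1 (le_trans dc2).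
have -> : K / M ^+ 3 = K * m ^+ 3 by rewrite -exprVn.
have -> : 2 * complex.Re d * dcut s / M ^+ 2 = 2 * complex.Re d * dcut s * m ^+ 2 by rewrite -exprVn.
have -> : 2 * (dcut s' * (2 * Q) / M ^+ 2) * e = 4 * (dcut s' * (Q * e)) * m ^+ 2 by rewrite -exprVn -/m; ring.
have T1 : dcut s * (s' - s) >= dcut s * (2 * D1) * m ^+ 2 - 2 * (2 * (B * b) + A ^+ 2 * b) * m ^+ 2.
  have -> : dcut s * (s' - s) = dcut s * (2 * Rcj h E0 + nm E0 ^+ 2) * m ^+ 2 by rewrite sE mulrA.
  rewrite -mulrBl ler_wpM2r ?sqr_ge0 //.
  have z0 : nm E0 ^+ 2 <= A ^+ 2 * b.
    have : nm E0 ^+ 2 <= (A * b) ^+ 2 by rewrite lerXn2r ?nnegrE // mulr_ge0 // ltW.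
    move=> h'; apply: le_trans h' _; rewrite exprMn ler_wpM2l ?sqr_ge0 // expr2.
    by rewrite ler_piMr // ltW.
  have z1 : `|2 * Rcj h E0 + nm E0 ^+ 2 - 2 * D1| <= 2 * (B * b) + A ^+ 2 * b.
    have -> : 2 * Rcj h E0 + nm E0 ^+ 2 - 2 * D1 = 2 * (Rcj h E0 - D1) + nm E0 ^+ 2 by ring.
    apply: le_trans (ler_normD _ _) _; rewrite normrM ger0_norm // (ger0_norm (sqr_ge0 _)).
    by clear -z0 D1E; lra.
  have z2 : `|dcut s * (2 * Rcj h E0 + nm E0 ^+ 2 - 2 * D1)| <= 2 * (2 * (B * b) + A ^+ 2 * b).
    by rewrite normrM; apply: ler_pM.
  by move: z2 => /ler_normlP[z2 _]; rewrite mulrBr in z2; clear -z2; lra.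
have T2 : `|dcut s' * (Q * e) - dcut s * (x * y)| <= 16 * (A2 * m ^+ 2) * (A + A * A2) + 2 * ((A * A2 + B) * b).
  have -> : dcut s' * (Q * e) - dcut s * (x * y) = (dcut s' - dcut s) * (Q * e) + dcut s * (Q * e - x * y) by ring.
  apply: le_trans (ler_normD _ _) _; rewrite (normrM (dcut s' - dcut s)) (normrM (dcut s)).
  by apply: lerD; apply: ler_pM.
have T3 : 8 * (s' - s) ^+ 2 <= 8 * (A2 ^+ 2 * m ^+ 4).
  rewrite ler_wpM2l // -[A2 ^+ 2 * _]/(_) (_ : A2 ^+ 2 * m ^+ 4 = (A2 * m ^+ 2) ^+ 2); last by ring.
  by rewrite -real_normK ?num_real // lerXn2r ?nnegrE // mulr_ge0 // sqr_ge0.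
have T2' : 4 * (dcut s' * (Q * e)) * m ^+ 2 <= 4 * (dcut s * (x * y)) * m ^+ 2 +
    4 * (16 * (A2 * m ^+ 2) * (A + A * A2) + 2 * ((A * A2 + B) * b)) * m ^+ 2.
  rewrite -mulrDl ler_wpM2r ?sqr_ge0 //; move: T2 => /ler_normlP[_ T2].
  by clear -T2; lra.
have F : dcut s * (2 * D1) * m ^+ 2 - 4 * (dcut s * (x * y)) * m ^+ 2 = - (2 * complex.Re d * dcut s * m ^+ 2).
  have -> : complex.Re d = - (D1 - 2 * x * y) by rewrite xy opprK.
  by ring.
have bm2 (c : R) : 0 <= c -> c * b * m ^+ 2 <= 2 * c * m ^+ 3.
  move=> c0; have -> : 2 * c * m ^+ 3 = c * (2 * m) * m ^+ 2 by ring.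
  by rewrite ler_wpM2r ?sqr_ge0 // ler_wpM2l.
have m43 (c : R) : 0 <= c -> c * m ^+ 4 <= c * m ^+ 3.
  by move=> c0; rewrite ler_wpM2l // (exprS m 3) ler_piMl // exprn_ge0 // ltW.
have U1 : 8 * (A2 ^+ 2 * m ^+ 4) <= 8 * A2 ^+ 2 * m ^+ 3.
  by rewrite mulrA; apply: m43; rewrite mulr_ge0 ?sqr_ge0.
have U2 : 2 * (2 * (B * b) + A ^+ 2 * b) * m ^+ 2 <= 4 * (2 * B + A ^+ 2) * m ^+ 3.
  have -> : 2 * (2 * (B * b) + A ^+ 2 * b) * m ^+ 2 = 2 * (2 * B + A ^+ 2) * b * m ^+ 2 by ring.
  have -> : 4 * (2 * B + A ^+ 2) * m ^+ 3 = 2 * (2 * (2 * B + A ^+ 2)) * m ^+ 3 by ring.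
  by apply: bm2; rewrite mulr_ge0 // addr_ge0 ?mulr_ge0 ?sqr_ge0.
have U3 : 4 * (16 * (A2 * m ^+ 2) * (A + A * A2) + 2 * ((A * A2 + B) * b)) * m ^+ 2 <=
    (64 * A2 * (A + A * A2) + 16 * (A * A2 + B)) * m ^+ 3.
  have -> : 4 * (16 * (A2 * m ^+ 2) * (A + A * A2) + 2 * ((A * A2 + B) * b)) * m ^+ 2 =
    64 * A2 * (A + A * A2) * m ^+ 4 + 8 * (A * A2 + B) * b * m ^+ 2 by ring.
  rewrite [leRHS]mulrDl; apply: lerD; first by apply: m43; rewrite !mulr_ge0 // addr_ge0 // mulr_ge0.
  have -> : 16 * (A * A2 + B) * m ^+ 3 = 2 * (8 * (A * A2 + B)) * m ^+ 3 by ring.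
  by apply: bm2; rewrite mulr_ge0 // addr_ge0 // mulr_ge0.
have KE : K * m ^+ 3 = 8 * A2 ^+ 2 * m ^+ 3 + 4 * (2 * B + A ^+ 2) * m ^+ 3 +
   (64 * A2 * (A + A * A2) + 16 * (A * A2 + B)) * m ^+ 3 by rewrite /K; ring.
move: tl T1 T2' T3 F U1 U2 U3 KE; clear; move: (K * m ^+ 3) (8 * A2 ^+ 2 * m ^+ 3) (4 * (2 * B + A ^+ 2) * m ^+ 3)
  ((64 * A2 * (A + A * A2) + 16 * (A * A2 + B)) * m ^+ 3)
  (4 * (16 * (A2 * m ^+ 2) * (A + A * A2) + 2 * ((A * A2 + B) * b)) * m ^+ 2)
  (2 * (2 * (B * b) + A ^+ 2 * b) * m ^+ 2) (8 * (A2 ^+ 2 * m ^+ 4))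
  (2 * complex.Re d * dcut s * m ^+ 2) (4 * (dcut s' * (Q * e)) * m ^+ 2)
  (4 * (dcut s * (x * y)) * m ^+ 2) (dcut s * (2 * D1) * m ^+ 2)
  (8 * (s' - s) ^+ 2) (dcut s * (s' - s)) (cut s) (cut s').
move=> *; lra.
Qed.
End Cutoff.

(** * Real integrals and the energy along a horizontal line *)

Section RealCalculus.
Context {R : realType}.
Local Notation C := R[i].
Local Notation mu := (@lebesgue_measure R).
Implicit Types (f g F : R -> R) (k : R -> C) (a b c t x y : R).

Definition rint f a b := (\int[mu]_(t in `[a, b]) f t)%R.

Lemma rint_FTC f F a b : a <= b -> (forall t, a <= t <= b -> {for t, continuous f}) ->
  (forall t, a <= t <= b -> is_derive t 1 F (f t)) -> rint f a b = F b - F a.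
Proof.
rewrite le_eqVlt => /predU1P[<- _ _|ab cf dF].
  by rewrite /rint set_itv1 Rintegral_set1 subrr.
rewrite /rint /Rintegral (continuous_FTC2 (F := F)) //.
- exact: within_eps.
- have cF t : a <= t <= b -> {for t, continuous F}.
    by move=> /dF [/derivable1_diffP/differentiable_continuous].
  split.
  + by move=> t /subset_itv_oo_cc; rewrite in_itv /= => /dF[].
  + by apply: cvg_at_right_filter; apply: cF; rewrite lexx ltW.
  + by apply: cvg_at_left_filter; apply: cF; rewrite lexx ltW.
- move=> t /subset_itv_oo_cc; rewrite in_itv /= => /dF D.
  by rewrite derive1E; apply: derive_val.
Qed.

Lemma rintD f g a b : (forall t, a <= t <= b -> {for t, continuous f}) ->
  (forall t, a <= t <= b -> {for t, continuous g}) -> rint (fun t => f t + g t) a b = rint f a b + rint g a b.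
Proof. by move=> cf cg; rewrite /rint RintegralD //; exact: cont_integrable. Qed.

Lemma rint_le f g a b : (forall t, a <= t <= b -> {for t, continuous f}) ->
  (forall t, a <= t <= b -> {for t, continuous g}) -> (forall t, a <= t <= b -> f t <= g t) ->
  rint f a b <= rint g a b.
Proof. by move=> cf cg fg; apply: le_Rintegral => //; exact: cont_integrable. Qed.

Lemma rint_cst r a b : a <= b -> rint (fun=> r) a b = r * (b - a).
Proof.
move=> ab; rewrite /rint Rintegral_cst //= lebesgue_measure_itv /= lte_fin.
by move: ab; rewrite le_eqVlt => /predU1P[->|->] //; rewrite ltxx subrr.
Qed.

Lemma rint_split f a c b : a <= c <= b -> (forall t, a <= t <= b -> {for t, continuous f}) ->
  rint f a b = rint f a c + rint f c b.
Proof.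
move=> /andP[ac cb] cf; apply/eqP; rewrite addrC -subr_eq; apply/eqP.
rewrite /rint Rintegral_itvB ?bnd_simp //; last exact: cont_integrable.
rewrite Rintegral_itv_obnd_cbnd //; apply: integrableS (cont_integrable (a := c) (b := b) _) => //.
  by move=> x /=; rewrite !in_itv /= => /andP[/ltW -> ->].
by move=> t /andP[h1 h2]; apply: cf; rewrite h2 (le_trans ac).
Qed.

Lemma contD f g t : {for t, continuous f} -> {for t, continuous g} -> {for t, continuous (fun x => f x + g x)}.
Proof. by move=> cf cg; apply: cvgD. Qed.
Lemma contN f t : {for t, continuous f} -> {for t, continuous (fun x => - f x)}.
Proof. by move=> cf; apply: cvgN. Qed.
Lemma contM f g t : {for t, continuous f} -> {for t, continuous g} -> {for t, continuous (fun x => f x * g x)}.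
Proof. by move=> cf cg; apply: cvgM. Qed.
Lemma contC c t : {for t, continuous (fun=> c)}.
Proof. exact: cvg_cst. Qed.
Lemma contI t : {for t, continuous (fun x : R => x)}.
Proof. exact: cvg_id. Qed.
Lemma contcomp f g t : {for t, continuous f} -> {for f t, continuous g} -> {for t, continuous (fun x => g (f x))}.
Proof. by move=> cf cg; apply: (@continuous_comp _ _ _ f g). Qed.

Lemma is_derive_ext f F l l' t : is_derive t 1 f l -> (forall x, f x = F x) -> l = l' -> is_derive t 1 F l'.
Proof. by move=> D /funext <- <-. Qed.

Lemma nm2_derive k t l : rder k t l -> is_derive t 1 (fun s => nm (k s) ^+ 2) (2 * Rcj (k t) l).
Proof.
move=> H; have dR := rder_Re H; have dI := rder_Im H.
apply: (is_derive_ext (is_deriveD (is_deriveM dR dR) (is_deriveM dI dI))) => [s|].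
  by rewrite nm_sqr !expr2.
by rewrite /Rcj -![_ *: _]/(_ * _); ring.
Qed.

Lemma nm2_cont k t : rcont k t -> {for t, continuous (fun s => nm (k s) ^+ 2)}.
Proof.
move=> H; have cR := rcont_Re H; have cI := rcont_Im H.
have -> : (fun s => nm (k s) ^+ 2) = (fun s => complex.Re (k s) * complex.Re (k s) + complex.Im (k s) * complex.Im (k s)).
  by apply/funext => s; rewrite nm_sqr !expr2.
by apply: contD; apply: contM.
Qed.

Lemma Rcj_cont (k1 k2 : R -> C) t : rcont k1 t -> rcont k2 t -> {for t, continuous (fun s => Rcj (k1 s) (k2 s))}.
Proof.
move=> H1 H2; apply: contD; apply: contM; (exact: rcont_Re) || exact: rcont_Im.
Qed.

Lemma line_piece k k' (w b : R -> R) (M a c : R) : a <= c ->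
  (forall t, a <= t <= c -> rder k t (k' t)) -> (forall t, a <= t <= c -> rcont k' t) ->
  (forall t, a <= t <= c -> {for t, continuous b}) ->
  (forall t, w t = cut (nm (k t) ^+ 2 / M ^+ 2) * nm (k' t) ^+ 2) ->
  (forall t, a <= t <= c -> b t <= cut (nm (k t) ^+ 2 / M ^+ 2) -
     2 * (dcut (nm (k t) ^+ 2 / M ^+ 2) * (2 * Rcj (k t) (k' t)) / M ^+ 2) * (complex.Re (k t) - t)) ->
  (forall t, a <= t <= c -> {for t, continuous w}) /\
  rint b a c + 2 * (cut (nm (k c) ^+ 2 / M ^+ 2) * (complex.Re (k c) - c) -
    cut (nm (k a) ^+ 2 / M ^+ 2) * (complex.Re (k a) - a)) <= rint w a c.
Proof.
move=> ac dk ck' cb wE bw.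
(* Integration by parts: [2 * Re k' - 1] is 1 plus twice the derivative of [Re k - t]. The
   derivative that falls on the cut-off produces the term allowed for in the bound on [b]. *)
pose G t := cut (nm (k t) ^+ 2 / M ^+ 2) * (complex.Re (k t) - t).
pose G' t := (dcut (nm (k t) ^+ 2 / M ^+ 2) * (2 * Rcj (k t) (k' t)) / M ^+ 2) * (complex.Re (k t) - t) +
   cut (nm (k t) ^+ 2 / M ^+ 2) * (complex.Re (k' t) - 1).
have ck t : a <= t <= c -> rcont k t by move=> /dk/rder_cont.
have cs t : a <= t <= c -> {for t, continuous (fun t => nm (k t) ^+ 2 / M ^+ 2)}.
  by move=> /ck h; apply: contM; [exact: nm2_cont|exact: contC].
have ccut t : a <= t <= c -> {for t, continuous (fun t => cut (nm (k t) ^+ 2 / M ^+ 2))}.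
  by move=> /cs h; apply: (contcomp h); exact: cut_continuous.
have cdcut t : a <= t <= c -> {for t, continuous (fun t => dcut (nm (k t) ^+ 2 / M ^+ 2))}.
  by move=> /cs h; apply: (contcomp h); exact: dcut_continuous.
have cw t : a <= t <= c -> {for t, continuous w}.
  move=> ht; rewrite (_ : w = (fun t => cut (nm (k t) ^+ 2 / M ^+ 2) * nm (k' t) ^+ 2)); last exact/funext.
  by apply: contM; [exact: ccut|apply: nm2_cont; exact: ck'].
have cG' t : a <= t <= c -> {for t, continuous G'}.
  move=> ht; apply: contD; apply: contM.
  - apply: contM; last exact: contC; apply: contM; first exact: cdcut.
    by apply: contM; [exact: contC|apply: Rcj_cont; [exact: ck|exact: ck']].
  - by apply: contD; [apply: rcont_Re; exact: ck|apply: contN; exact: contI].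
  - exact: ccut.
  - by apply: contD; [apply: rcont_Re; exact: ck'|exact: contC].
have dG t : a <= t <= c -> is_derive t 1 G (G' t).
  move=> /dk h; have dR := rder_Re h.
  have dn : is_derive t 1 (fun s => nm (k s) ^+ 2 / M ^+ 2) (2 * Rcj (k t) (k' t) / M ^+ 2).
    apply: (is_derive_ext (is_deriveZ (M ^+ 2)^-1 (nm2_derive h))) => [s|].
      by rewrite mulrC.
    by rewrite -[_ *: _]/(_ * _) mulrC.
  have dc := @is_derive1_comp R cut (fun s => nm (k s) ^+ 2 / M ^+ 2) t _ _ (cut_derive (nm (k t) ^+ 2 / M ^+ 2)) dn.
  apply: (is_derive_ext (is_deriveM dc (is_deriveB dR (is_derive_id t 1)))) => [s|] //.
  change (cut (nm (k t) ^+ 2 / M ^+ 2) * (complex.Re (k' t) - 1) + (complex.Re (k t) - t) *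
    (dcut (nm (k t) ^+ 2 / M ^+ 2) * (2 * Rcj (k t) (k' t) / M ^+ 2)) = G' t).
  by rewrite /G'; ring.
split=> //.
have -> : cut (nm (k c) ^+ 2 / M ^+ 2) * (complex.Re (k c) - c) -
    cut (nm (k a) ^+ 2 / M ^+ 2) * (complex.Re (k a) - a) = rint G' a c.
  by rewrite (rint_FTC ac cG' dG).
rewrite mulr_natl mulr2n -!rintD //; last by move=> t ht; apply: contD; exact: cG'.
apply: rint_le => // t ht; first by apply: contD; [exact: cb|apply: contD; exact: cG'].
rewrite wE; have := bw t ht; have [c0 _ _ _] := cut_bounds (nm (k t) ^+ 2 / M ^+ 2).
have k2 : 2 * complex.Re (k' t) - 1 <= nm (k' t) ^+ 2.
  by rewrite nm_sqr; have := sqr_ge0 (complex.Im (k' t)); have := sqr_ge0 (complex.Re (k' t) - 1); rewrite sqrrB expr1n mulr1 -mulr_natl; lra.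
have := ler_wpM2l c0 k2; rewrite /G'; lra.
Qed.

(** The missing interval from [c] to [a] costs at most [2 * (a - c)] in the integral of [b], as
    [b <= 2]. The boundary terms at its ends enter doubled, and the last hypothesis says that they
    return this amount up to [e]. *)
Lemma two_pieces k k' (w b : R -> R) (M L a c e : R) : - L <= c -> c <= a -> a <= L ->
  (forall t, t <= c \/ a <= t -> rder k t (k' t) /\ rcont k' t) -> (forall t, {for t, continuous b}) ->
  (forall t, w t = cut (nm (k t) ^+ 2 / M ^+ 2) * nm (k' t) ^+ 2) ->
  (forall t, t <= c \/ a <= t -> b t <= cut (nm (k t) ^+ 2 / M ^+ 2) -
     2 * (dcut (nm (k t) ^+ 2 / M ^+ 2) * (2 * Rcj (k t) (k' t)) / M ^+ 2) * (complex.Re (k t) - t)) ->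
  (forall t, b t <= 2) -> cut (nm (k L) ^+ 2 / M ^+ 2) = 0 -> cut (nm (k (- L)) ^+ 2 / M ^+ 2) = 0 ->
  a - c - e / 2 <= cut (nm (k c) ^+ 2 / M ^+ 2) * (complex.Re (k c) - c) -
    cut (nm (k a) ^+ 2 / M ^+ 2) * (complex.Re (k a) - a) ->
  [/\ forall t, - L <= t <= c -> {for t, continuous w}, forall t, a <= t <= L -> {for t, continuous w} &
   rint b (- L) L <= rint w (- L) c + rint w a L + e].
Proof.
move=> cL ca aL dk cb wE bw b2 e1 e2 gap.
have A t : a <= t <= L -> t <= c \/ a <= t by case/andP; right.
have C t : - L <= t <= c -> t <= c \/ a <= t by case/andP; left.
have [cw1 I1] := line_piece aL (fun t ht => proj1 (dk t (A t ht))) (fun t ht => proj2 (dk t (A t ht))) (fun t _ => cb t)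
  wE (fun t ht => bw t (A t ht)).
have [cw2 I2] := line_piece cL (fun t ht => proj1 (dk t (C t ht))) (fun t ht => proj2 (dk t (C t ht))) (fun t _ => cb t)
  wE (fun t ht => bw t (C t ht)).
split=> //; rewrite e1 mul0r in I1; rewrite e2 mul0r in I2.
have cL' : c <= L by exact: le_trans ca aL.
rewrite (@rint_split b (- L) c L) ?cL // (@rint_split b c a L) ?ca //.
have h : rint b c a <= 2 * (a - c) by rewrite -(rint_cst 2 ca); apply: rint_le => // *; exact: contC.
by clear -h I1 I2 gap; lra.
Qed.
End RealCalculus.

(** * Continuity of real functions of a complex variable *)

Section PlaneContinuity.
Context {R : realType}.
Local Notation C := R[i].
Implicit Types (u v : C -> R) (F : C -> C) (z : C).

Lemma rcont_at_nm F z : ccont F z -> rcont_at (fun w => nm (F w)) z.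
Proof.
move=> cF e /cF[r r0 Hr]; exists r => // w /Hr; apply: le_lt_trans.
have := nm_sub_ge (F w) (F z); have := nm_sub_ge (F z) (F w); rewrite (nmBC (F z)) ler_norml => *.
by apply/andP; split; lra.
Qed.

Lemma rcont_at_Re F z : ccont F z -> rcont_at (fun w => complex.Re (F w)) z.
Proof.
by move=> cF e /cF[r r0 Hr]; exists r => // w /Hr; apply: le_lt_trans; rewrite -ReN -ReD Re_le_nm.
Qed.

Lemma rcont_at_Im F z : ccont F z -> rcont_at (fun w => complex.Im (F w)) z.
Proof.
by move=> cF e /cF[r r0 Hr]; exists r => // w /Hr; apply: le_lt_trans; rewrite -ImN -ImD Im_le_nm.
Qed.

Lemma rcont_at_comp u (v : R -> R) z : rcont_at u z -> {for u z, continuous v} -> rcont_at (fun w => v (u w)) z.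
Proof.
move=> cu /cvgrPdist_lt cv e e0; have /= [r /= r0 Hr] := cv e e0.
have [r' r'0 Hr'] := cu r r0; exists r' => // w /Hr' hw.
by rewrite distrC; apply: Hr; rewrite /= distrC.
Qed.

Lemma rcont_at_cst c z : rcont_at (fun=> c) z.
Proof. by move=> e e0; exists 1 => // w _; rewrite subrr normr0. Qed.

Lemma rcont_atD u v z : rcont_at u z -> rcont_at v z -> rcont_at (fun w => u w + v w) z.
Proof.
move=> cu cv e e0; have e2 : 0 < e / 2 by rewrite divr_gt0.
have [r1 r10 H1] := cu _ e2; have [r2 r20 H2] := cv _ e2.
exists (Num.min r1 r2); first by rewrite lt_min r10.
move=> w; rewrite lt_min => /andP[/H1 h1 /H2 h2].
have -> : u w + v w - (u z + v z) = (u w - u z) + (v w - v z) by ring.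
by apply: le_lt_trans (ler_normD _ _) _; lra.
Qed.

Lemma rcont_atM u v z : rcont_at u z -> rcont_at v z -> rcont_at (fun w => u w * v w) z.
Proof.
move=> cu cv e e0.
have K0 : 0 < 1 + `|u z| + `|v z| by rewrite -addrA ltr_wpDr ?addr_ge0.
pose k := Num.min 1 (e / (1 + `|u z| + `|v z|)).
have k0 : 0 < k by rewrite lt_min ltr01 divr_gt0.
have [r1 r10 H1] := cu k k0; have [r2 r20 H2] := cv k k0.
exists (Num.min r1 r2); first by rewrite lt_min r10.
move=> w; rewrite lt_min => /andP[/H1 h1 /H2 h2].
have -> : u w * v w - u z * v z = (u w - u z) * (v w - v z) + u z * (v w - v z) + (u w - u z) * v z by ring.
apply: le_lt_trans (ler_normD _ _) _; apply: le_lt_trans (lerD (ler_normD _ _) (lexx _)) _; rewrite !normrM.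
have k1 : k <= 1 by rewrite ge_min lexx.
have k2 : k * (1 + `|u z| + `|v z|) <= e by rewrite -ler_pdivlMr // ge_min lexx orbT.
have a1 : `|u w - u z| * `|v w - v z| < k * 1.
  by apply: lt_le_trans (ltr_pM (normr_ge0 _) (normr_ge0 _) h1 h2) _; rewrite ler_wpM2l // ltW.
have a2 : `|u z| * `|v w - v z| <= `|u z| * k by rewrite ler_wpM2l // ltW.
have a3 : `|u w - u z| * `|v z| <= k * `|v z| by rewrite ler_wpM2r // ltW.
by rewrite !mulrDr in k2; lra.
Qed.

Lemma rcont_at_sqr u z : rcont_at u z -> rcont_at (fun w => u w ^+ 2) z.
Proof. by move=> cu; have := rcont_atM cu cu. Qed.

Lemma rcont_at_cut F (M : R) z : ccont F z -> rcont_at (fun w => cut (nm (F w) ^+ 2 / M ^+ 2)) z.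
Proof.
move=> cF; apply: (@rcont_at_comp (fun w => nm (F w) ^+ 2 / M ^+ 2)); last exact: cut_continuous.
by apply: rcont_atM; [apply: rcont_at_sqr; exact: rcont_at_nm|exact: rcont_at_cst].
Qed.

Lemma rcont_at_dcut F (M : R) z : ccont F z -> rcont_at (fun w => dcut (nm (F w) ^+ 2 / M ^+ 2)) z.
Proof.
move=> cF; apply: (@rcont_at_comp (fun w => nm (F w) ^+ 2 / M ^+ 2)); last exact: dcut_continuous.
by apply: rcont_atM; [apply: rcont_at_sqr; exact: rcont_at_nm|exact: rcont_at_cst].
Qed.

Lemma rcont_at_line u (k : R -> C) t : rcont k t -> rcont_at u (k t) -> {for t, continuous (fun s => u (k s))}.
Proof.
move=> ck cu; apply: continuous_eps => e e0; have [r r0 Hr] := cu e e0.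
by have [r' r'0 Hr'] := ck r r0; exists r' => // s /Hr'/Hr.
Qed.

Lemma rcont_at_Rcj (F G : C -> C) z : ccont F z -> ccont G z -> rcont_at (fun w => Rcj (F w) (G w)) z.
Proof.
move=> cF cG; apply: rcont_atD; apply: rcont_atM;
  do [exact: rcont_at_Re | exact: rcont_at_Im].
Qed.
End PlaneContinuity.

(** * The lower bound for one pole on almost every line *)

Section Side.
Context {R : realType}.
Local Notation C := R[i].
Local Notation mu := (@lebesgue_measure R).
Variables (H : set C) (g g' : C -> C) (y0 R0 : R) (finf : C -> C).
Hypothesis R0_ge1 : 1 <= R0.
Hypothesis HH : forall z, H z -> [/\ nm z < 1, complex.Im (g z) != y0 &
  exists2 r : R, 0 < r & (forall w, nm (w - z) < r -> H w) /\ holo g g' z r].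
Hypothesis Hcl : forall z c, nm z < 1 -> complex.Im c != y0 ->
  (forall e : R, 0 < e -> exists w, [/\ H w, nm (w - z) < e & nm (g w - c) < e]) -> H z /\ g z = c.
Hypothesis Hinf : forall h, R0 < nm h -> complex.Im h != y0 ->
  [/\ H (finf h), g (finf h) = h, g' (finf h) != 0 & ccont finf h].
Variables (V1 V2 : set C) (psi1 psi2 : C -> C).
Hypotheses (S1 : maximal_sheet H g g' R0 finf 1 V1 psi1) (S2 : maximal_sheet H g g' R0 finf (-1) V2 psi2).
Hypothesis OS : forall h, V1 h -> V2 h -> psi1 h = psi2 h.
Local Notation Om := (Om V1 V2).
Local Notation phi := (phi V1 psi1 psi2).

Variables (p p' : C -> C) (d : C) (B M0 : R).
Hypothesis B_ge0 : 0 <= B.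
Hypothesis Hp : forall z, H z -> cder p z (p' z) /\ ccont p' z.
Hypothesis Hbd : forall e : R, 0 < e -> exists2 r : R, 0 < r & forall z, nm z < 1 -> 1 - r < nm z ->
  `|complex.Re (p z)| <= e /\ nm (p z) <= M0.
Hypothesis Hcore : forall z, H z -> nm (g z) <= 2 * R0 -> nm (p z) <= M0.
(** In the coordinate [h] of the pole: [p = h + d / h + O(h^-2)], and the derivative of [p] with
    respect to [h] is [1 - d / h^2 + O(h^-3)]. *)
Hypothesis Hasym : forall h, R0 < nm h -> complex.Im h != y0 -> exists E0 E1,
  [/\ p (finf h) = h + E0, p' (finf h) / g' (finf h) = 1 - E1 / h ^+ 2,
     nm (E0 - d / h) <= B / nm h ^+ 2 & nm (E1 - d) <= B / nm h].

Let R0_gt0 : 0 < R0. Proof. by apply: lt_le_trans R0_ge1. Qed.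

(** The lower bound of [cut_asymptotics], a function of [h] alone; the pole enters only through
    [Re d] and the error constant. *)
Definition blow K M h := cut (nm h ^+ 2 / M ^+ 2) - 2 * complex.Re d * dcut (nm h ^+ 2 / M ^+ 2) / M ^+ 2 - K / M ^+ 3.
Definition wt M z := cut (nm (p z) ^+ 2 / M ^+ 2) * nm (p' z) ^+ 2.
(** By the chain rule, the energy density of the composite of [p] with the branch [phi]. *)
Definition wO M h := wt M (phi h) * nm ((g' (phi h))^-1) ^+ 2.
Definition line M y := (\int[mu]_x ((fun q => (wO M (cx q))%:E) \_ (cx @^-1` Om)) (x, y))%E.

Lemma blow_cont K M y t : {for t, continuous (fun x => blow K M (x +i* y)%C)}.
Proof.
have cs : {for t, continuous (fun x => nm (x +i* y)%C ^+ 2 / M ^+ 2)}.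
  by apply: contM; [apply: nm2_cont; exact: rder_cont (rder_h y t)|exact: contC].
apply: contD; last exact: contC; apply: contD.
  by apply: (contcomp cs); exact: cut_continuous.
apply: contN; apply: contM; last exact: contC; apply: contM; first exact: contC.
by apply: (contcomp cs); exact: dcut_continuous.
Qed.

Lemma wO_cont M h : 0 < M -> Om h -> rcont_at (wO M) h.
Proof.
move=> M0'  Oh; have [Hz gz g'z cz] := phi_slift S1 S2 OS Oh.
have [Hpz cp'] := Hp Hz; have cp := cder_cont Hpz.
have c1 := ccont_comp cz cp; have c2 := ccont_comp cz cp'; have c3 := phi_dcont HH S1 S2 OS Oh.
apply: rcont_atM; last by apply: rcont_at_sqr; exact: rcont_at_nm c3.
apply: rcont_atM; last by apply: rcont_at_sqr; exact: rcont_at_nm c2.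
exact: (rcont_at_cut M c1).
Qed.

Lemma wO_ge0 M h : 0 <= wO M h.
Proof.
have [c0 _ _ _] := cut_bounds (nm (p (phi h)) ^+ 2 / M ^+ 2).
by rewrite /wO /wt; apply: mulr_ge0; [apply: mulr_ge0|]; rewrite // sqr_ge0.
Qed.

Lemma gap_bound (u v a c e : R) : `|u| <= e / 4 -> `|v| <= e / 4 -> a - c - e / 2 <= 1 * (u - c) - 1 * (v - a).
Proof. by rewrite !ler_norml => /andP[? ?] /andP[? ?]; lra. Qed.

Ltac side_lra := first [order_lra_except ltac:(fun X => lazymatch X with HH => fail | Hcl => fail | Hinf => fail | S1 => fail
  | S2 => fail | OS => fail | Hp => fail | Hbd => fail | Hcore => fail | Hasym => fail | _ => idtac end) | lra].

Lemma blow_le2 K M h : 0 <= K -> 1 <= M -> 4 * nm d <= M -> blow K M h <= 2.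
Proof.
move=> K0 M1 dM; have Mp : 0 < M by apply: lt_le_trans M1.
rewrite /blow; have [_ c1 c2 c3] := cut_bounds (nm h ^+ 2 / M ^+ 2).
have k0 : 0 <= K / M ^+ 3 by rewrite divr_ge0 // exprn_ge0 // ltW.
have : - (2 * complex.Re d * dcut (nm h ^+ 2 / M ^+ 2) / M ^+ 2) <= 1.
  rewrite -mulNr ler_pdivrMr ?exprn_gt0 // mul1r.
  have MM : M <= M ^+ 2 by rewrite expr2 ler_peMr // ltW.
  apply: le_trans (ler_norm _) _; rewrite normrN !normrM (ger0_norm (ler0n R 2)).
  have a1 : `|dcut (nm h ^+ 2 / M ^+ 2)| <= 2 by rewrite ler_norml c2 (le_trans c3).
  have a2 := Re_le_nm d.
  have : `|complex.Re d| * `|dcut (nm h ^+ 2 / M ^+ 2)| <= nm d * 2 by apply: ler_pM.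
  by rewrite -mulrA; side_lra.
by side_lra.
Qed.

Lemma line_lower : exists K M1 : R, [/\ 0 <= K, 1 <= M1 & forall M y, M1 <= M -> y != y0 ->
  ~ [set complex.Im (g z) | z in crit H g'] y ->
  measurable_fun setT (fun x : R => ((fun q => (wO M (cx q))%:E) \_ (cx @^-1` Om)) (x, y)) ->
  ((rint (fun x => blow K M (x +i* y)%C) (- (3 * M)) (3 * M))%:E <= line M y)%E].
Proof.
have [K [M1 [K0 M11 HK]]] := @cut_asymptotics R d B B_ge0.
have nd0 := nm_ge0 d; have nM0 := normr_ge0 M0.
(* The summands of the threshold pay for the inequalities [HM1] to [HM5], the remaining ones being
   nonnegative. *)
exists K, (M1 + 4 * R0 + `|M0| + 4 * nm d + B + 1); split=> //.
  by move: M11 R0_ge1 B_ge0 nd0 nM0; side_lra.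
move=> M y hM hy ncr mf.
have [HM1 HM2 HM3 HM4 HM5] : [/\ M1 <= M, 4 * R0 <= M, `|M0| <= M, 4 * nm d <= M & nm d + B <= M].
  by move: hM M11 R0_ge1 B_ge0; split; side_lra.
have R2 : 1 <= 2 * R0 by move: R0_ge1; side_lra.
have M1' : 1 <= M by apply: le_trans HM1.
have Mp : 0 < M by apply: lt_le_trans M1'.
pose k x := p (phi (x +i* y)%C); pose k' x := p' (phi (x +i* y)%C) / g' (phi (x +i* y)%C).
pose b x := blow K M (x +i* y)%C; pose w x := wO M (x +i* y)%C.
have oneM x : 0 <= x -> x <= M -> x ^+ 2 / M ^+ 2 <= 1.
  by move=> x0 xM; rewrite ler_pdivrMr ?exprn_gt0 // mul1r lerXn2r ?nnegrE // ltW.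
have M0M x : nm x <= M0 -> nm x <= M by move=> h; apply: le_trans h (le_trans (ler_norm _) HM3).
have dk x : Om (x +i* y)%C -> rder k x (k' x) /\ rcont k' x.
  move=> Oh; have [Hz gz g'z cz] := phi_slift S1 S2 OS Oh; have [Hpz cp'] := Hp Hz.
  have D := cder_comp (phi_cder HH S1 S2 OS Oh) Hpz.
  split; first by have := cder_rder (rder_h y x) D; rewrite mulr1.
  apply: (@ccont_rcont _ (fun h => p' (phi h) / g' (phi h)) (fun x => (x +i* y)%C)).
    exact: rder_cont (rder_h y x).
  by apply: ccontM; [exact: ccont_comp cz cp'|exact: (phi_dcont HH S1 S2 OS Oh)].
have wE x : w x = cut (nm (k x) ^+ 2 / M ^+ 2) * nm (k' x) ^+ 2.
  rewrite /w /wO /wt /k /k'; rewrite [nm (_ / _)]nmM exprMn; ring.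
have far0 := phi_far R0_gt0 HH Hinf S1 S2 OS.
have far x : 2 * R0 < nm (x +i* y)%C -> Om (x +i* y)%C /\ exists E0 E1, [/\ k x = (x +i* y)%C + E0,
    k' x = 1 - E1 / (x +i* y)%C ^+ 2, nm (E0 - d / (x +i* y)%C) <= B / nm (x +i* y)%C ^+ 2 &
    nm (E1 - d) <= B / nm (x +i* y)%C].
  move=> hb; have [|Oh fE] := far0 (x +i* y)%C hy.
    have [h|h] := ltP R0 `|x|; first by left.
    by right=> /=; have := pair_nm x y; side_lra.
  split=> //; have [|E0 [E1 [e1 e2 e3 e4]]] := Hasym (h := (x +i* y)%C) _ hy.
    by apply: lt_trans hb; rewrite ltr_pMl // ltr1n.
  by exists E0, E1; rewrite /k /k' fE.
(* For [nm h <= 2 * R0] both cut-offs are 1 and the bound is immediate; beyond that radius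
   [cut_asymptotics] applies. *)
have bw x : Om (x +i* y)%C -> b x <= cut (nm (k x) ^+ 2 / M ^+ 2) -
     2 * (dcut (nm (k x) ^+ 2 / M ^+ 2) * (2 * Rcj (k x) (k' x)) / M ^+ 2) * (complex.Re (k x) - x).
  move=> Oh; have [hs|hb] := leP (nm (x +i* y)%C) (2 * R0); last first.
    have [_ [E0 [E1 [-> -> e3 e4]]]] := far x hb.
    have -> : complex.Re ((x +i* y)%C + E0) - x = complex.Re E0 by case: (E0) => ? ? /=; ring.
    by apply: HK => //; exact: le_trans R2 (ltW hb).
  have [Hz gz g'z cz] := phi_slift S1 S2 OS Oh.
  have kM : nm (k x) <= M by apply: M0M; apply: Hcore; rewrite ?gz.
  have [-> ->] := cut_le1 (oneM _ (nm_ge0 (k x)) kM).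
  rewrite /b /blow; have hM' : nm (x +i* y)%C <= M by side_lra.
  have [-> ->] := cut_le1 (oneM _ (nm_ge0 _) hM').
  have : 0 <= K / M ^+ 3 by rewrite divr_ge0 // exprn_ge0 // ltW.
  by rewrite !(mul0r, mulr0, subr0); side_lra.
have b2 x : b x <= 2 by exact: blow_le2.
have cb t : {for t, continuous b} by exact: blow_cont.
(* There [nm h >= 3 * M] while [p] differs from [h] by at most [M], so [nm p >= 2 * M], outside the
   support of the cut-off. *)
have edge x : 3 * M <= `|x| -> cut (nm (k x) ^+ 2 / M ^+ 2) = 0.
  move=> hx; have hn : 3 * M <= nm (x +i* y)%C by apply: le_trans hx _; exact: (Re_le_nm (x +i* y)%C).
  have n0 : 0 < nm (x +i* y)%C by apply: lt_le_trans hn; side_lra.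
  have [|_ [E0 [E1 [-> _ e3 _]]]] := far x; first by side_lra.
  have n1 : 1 <= nm (x +i* y)%C by side_lra.
  have bn : B / nm (x +i* y)%C ^+ 2 <= B.
    by rewrite ler_pdivrMr ?exprn_gt0 // ler_peMr // exprn_ege1.
  have dn : nm (d / (x +i* y)%C) <= nm d by rewrite nm_div ler_pdivrMr // ler_peMr.
  have nE : nm E0 <= M by have := nm_sub_ge E0 (d / (x +i* y)%C); side_lra.
  have nk : 2 * M <= nm ((x +i* y)%C + E0) by have := nm_sub_ge (x +i* y)%C (- E0); rewrite nmN opprK; side_lra.
  apply: (proj1 (cut_ge2 _)); rewrite ler_pdivlMr ?exprn_gt0 //.
  have : (2 * M) ^+ 2 <= nm ((x +i* y)%C + E0) ^+ 2 by rewrite lerXn2r ?nnegrE ?nm_ge0 ?mulr_ge0 // ltW.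
  by rewrite exprMn; have : 0 < M ^+ 2 by [rewrite exprn_gt0]; side_lra.
apply/lee_addgt0Pr => e e0.
have [r r0 Hr] := Hbd (divr_gt0 e0 (ltr0n R 4)).
have [a [c [ca [c1 a1] Va Vc ac]]] := line_split R0_gt0 HH Hcl Hinf S1 S2 OS hy ncr r0.
have Oa x : a <= x -> Om (x +i* y)%C by move=> /Va; left.
have Oc x : x <= c -> Om (x +i* y)%C by move=> /Vc; right.
have aM : a <= 3 * M by side_lra.
have cM : - (3 * M) <= c by side_lra.
(* At the ends of a slit the branch is close to the circle: [nm p <= M] makes both cut-offs 1, and
   [Re p] is at most [e / 4] in modulus. *)
have gap : cut (nm (k c) ^+ 2 / M ^+ 2) * (complex.Re (k c) - c) - cut (nm (k a) ^+ 2 / M ^+ 2) * (complex.Re (k a) - a) >=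
   (a - c) - e / 2.
  case: ac => [->|[na nc']]; first by rewrite !subrr; side_lra.
  have [[Ha ga _ _] [Hc gc _ _]] := (phi_slift S1 S2 OS (Oa a (lexx a)), phi_slift S1 S2 OS (Oc c (lexx c))).
  have [za _ _] := HH Ha; have [zc _ _] := HH Hc.
  have [q1 q2] := Hr _ za na; have [q3 q4] := Hr _ zc nc'.
  have [-> _] := cut_le1 (oneM _ (nm_ge0 (k a)) (M0M _ q2)).
  have [-> _] := cut_le1 (oneM _ (nm_ge0 (k c)) (M0M _ q4)).
  exact: gap_bound q3 q1.
have O t : t <= c \/ a <= t -> Om (t +i* y)%C by case=> [/Oc|/Oa].
have M3 : `|3 * M| = 3 * M by rewrite gtr0_norm ?mulr_gt0.
have eL : cut (nm (k (3 * M)) ^+ 2 / M ^+ 2) = 0 by apply: edge; rewrite M3.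
have eR : cut (nm (k (- (3 * M))) ^+ 2 / M ^+ 2) = 0 by apply: edge; rewrite normrN M3.
have [cw2 cw1 real_low] := two_pieces cM ca aM (fun t ht => dk t (O t ht)) cb wE (fun t ht => bw t (O t ht)) b2 eL eR gap.
apply: (@le_trans _ _ ((rint w (- (3 * M)) c + rint w a (3 * M))%:E + e%:E)%E).
  by rewrite -EFinD lee_fin.
apply: leeD2r; set f := (fun x : R => _ : \bar R) in mf *.
have f0 x : (0 <= f x)%E.
  by rewrite /f patchE; case: ifP => // _; rewrite lee_fin; exact: wO_ge0.
have fE x : Om (x +i* y)%C -> f x = (w x)%:E by move=> Oh; rewrite /f patchE mem_set.
have piece u v : (forall t, u <= t <= v -> Om (t +i* y)%C /\ {for t, continuous w}) ->
    (rint w u v)%:E = (\int[mu]_(t in `[u, v]) f t)%E.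
  move=> hOm; rewrite /rint /Rintegral fineK; last first.
    by apply: integrable_fin_num => //; apply: cont_integrable => t /hOm[].
  by apply: eq_integral => t; rewrite inE /= in_itv /= => /hOm[Ot _]; rewrite fE.
rewrite EFinD (piece _ c); last by move=> t ht; split; [apply: Oc; case/andP: ht|exact: cw2].
rewrite (piece a); last by move=> t ht; split; [apply: Oa; case/andP: ht|exact: cw1].
rewrite -(@integral_itv_bndo_bndc R (BLeft (- (3 * M))) c); last exact: measurable_funS mf.
rewrite -ge0_integral_setU //; last 2 first.
- exact: measurable_funS mf.
- apply/disj_setPS => t /= [] /=; rewrite !in_itv /= => /andP[_ h1] /andP[h2 _].
  by have := lt_le_trans h1 (le_trans ca h2); rewrite ltxx.
by apply: ge0_subset_integral => //; exact: measurableU.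
Qed.
End Side.

(** * The upper bound by the divergence theorem *)

Section PlaneIntegral.
Context {R : realType}.
Local Notation C := R[i].
Local Notation RT := (measurableTypeR R).
Local Notation mu := (@lebesgue_measure R).
Implicit Types (D : set C) (f : RT * RT -> \bar R) (G F : R -> R).

Lemma plane_int_x f : measurable_fun setT f -> (forall q, 0 <= f q)%E ->
  (\int[plane]_q f q = \int[mu]_x \int[mu]_y f (x, y))%E.
Proof. by move=> mf f0; exact: (@fubini_tonelli1 _ _ _ _ R mu mu f mf f0). Qed.

Lemma plane_int_y f : measurable_fun setT f -> (forall q, 0 <= f q)%E ->
  (\int[plane]_q f q = \int[mu]_y \int[mu]_x f (x, y))%E.
Proof. by move=> mf f0; exact: (@fubini_tonelli2 _ _ _ _ R mu mu f mf f0). Qed.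

Lemma slice_x_measurable f : measurable_fun setT f -> (forall q, 0 <= f q)%E ->
  measurable_fun setT (fun x => \int[mu]_y f (x, y))%E.
Proof. by move=> mf f0; exact: (@measurable_fun_fubini_tonelli_F _ _ _ _ R mu f mf f0). Qed.

Lemma slice_y_measurable f : measurable_fun setT f -> (forall q, 0 <= f q)%E ->
  measurable_fun setT (fun y => \int[mu]_x f (x, y))%E.
Proof. by move=> mf f0; exact: (@measurable_fun_fubini_tonelli_G _ _ _ _ R mu f mf f0). Qed.

Lemma le_integral_off_countable (N E : set R) (f1 f2 : RT -> \bar R) : countable N -> measurable (E : set RT) ->
  (forall y, E y -> 0 <= f1 y)%E -> (forall y, E y -> 0 <= f2 y)%E ->
  measurable_fun E f1 -> measurable_fun E f2 ->
  (forall y, E y -> ~ N y -> f1 y <= f2 y)%E -> (\int[mu]_(y in E) f1 y <= \int[mu]_(y in E) f2 y)%E.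
Proof.
move=> cN mE f10 f20 mf1 mf2 f12; apply: ae_ge0_le_integral => //.
exists N; split; [|exact: countable_lebesgue_measure0|].
  by apply: countable_measurable => // t; exact: measurable_set1.
move=> y /= h; apply: contrapT => nN; apply: h => Ey; exact: f12.
Qed.

Lemma eq_integral_off_countable (N : set R) (f1 f2 : RT -> \bar R) : countable N ->
  (forall y, 0 <= f1 y)%E -> (forall y, 0 <= f2 y)%E -> measurable_fun setT f1 -> measurable_fun setT f2 ->
  (forall y, ~ N y -> f1 y = f2 y) -> (\int[mu]_y f1 y = \int[mu]_y f2 y)%E.
Proof.
move=> cN f10 f20 mf1 mf2 f12; apply/eqP; rewrite eq_le; apply/andP; split;
  by apply: (le_integral_off_countable cN) => // y _ nN; rewrite f12.
Qed.

Lemma zero_flux G F (K c : R) : 0 <= c ->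
  (forall t, - c <= t <= c -> {for t, continuous G}) ->
  (forall t, - c <= t <= c -> is_derive t 1 F (G t)) -> F c = F (- c) ->
  (\int[mu]_(t in `](- c)%R, c%R[) (G t + K)%:E = \int[mu]_(t in `](- c)%R, c%R[) K%:E)%E.
Proof.
move=> c0 cG dF Fc.
have cc : - c <= c by order_lra.
have closed (h : R -> R) : (forall t, - c <= t <= c -> {for t, continuous h}) ->
    (\int[mu]_(t in `](- c)%R, c%R[) (h t)%:E = (rint h (- c) c)%:E)%E.
  move=> ch; have ih := cont_integrable ch.
  have mh : measurable_fun `[(- c), c] (EFin \o h) by exact: measurable_int ih.
  rewrite integral_itv_bndo_bndc; last first.
    by apply: measurable_funS mh => //; exact: subset_itv_oo_cc.
  rewrite integral_itv_obnd_cbnd; last first.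
    by apply: measurable_funS mh => // t /=; rewrite !in_itv /= => /andP[/ltW -> ->].
  by rewrite /rint /Rintegral fineK //; exact: integrable_fin_num.
rewrite !closed; last 2 first.
- by move=> t ht; apply: contD; [exact: cG|exact: contC].
- by move=> t _; exact: contC.
rewrite rintD //; last by move=> t _; exact: contC.
by rewrite (rint_FTC cc cG dF) Fc subrr add0r.
Qed.

Lemma copen_patch_measurable D (G : C -> R) : copen D -> (forall z, D z -> rcont_at G z) ->
  measurable_fun setT ((fun q : RT * RT => (G (cx q))%:E) \_ (cx @^-1` D)).
Proof.
move=> oD cG; apply/(measurable_restrictT _ (copen_measurable oD)); apply/measurable_EFinP.
exact: rcont_at_measurable.
Qed.

Lemma copenT : copen (@setT C).
Proof. by move=> z _; exists 1. Qed.

Lemma plane_measurable (G : C -> R) : (forall z, rcont_at G z) ->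
  measurable_fun setT (fun q : RT * RT => (G (cx q))%:E).
Proof.
move=> cG; apply/measurable_EFinP.
have := rcont_at_measurable copenT (fun z _ => cG z).
by rewrite preimage_setT.
Qed.

Lemma patch_ge0 D (G : C -> R) q : (forall z, D z -> 0 <= G z) ->
  (0 <= ((fun q : RT * RT => (G (cx q))%:E) \_ (cx @^-1` D)) q)%E.
Proof. by move=> G0; rewrite patchE; case: ifP => // /set_mem Dq; rewrite lee_fin G0. Qed.

(** The interval is symmetric because a horizontal or vertical chord of the unit disk has its
    midpoint on a coordinate axis. *)
Definition flux_slice (K : R) (S : set R) G := S = set0 \/ exists c F, [/\ 0 <= c, S = `](- c), c[%classic,
  (forall t, - c <= t <= c -> {for t, continuous G}), (forall t, - c <= t <= c -> is_derive t 1 F (G t)) &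
  F c = F (- c)].

Lemma flux_slice_int (K : R) (S : set RT) G : flux_slice K S G ->
  (\int[mu]_t ((fun t => (G t + K)%:E) \_ S) t = \int[mu]_t ((fun=> K%:E) \_ S) t)%E.
Proof.
rewrite -!integral_mkcond; case=> [->|[c [F [c0 -> cG dF Fc]]]]; first by rewrite !integral_set0.
exact: zero_flux.
Qed.

(** The constant [K] makes the integrand nonnegative, so that Tonelli's theorem applies in either
    order; on each slice the derivative integrates to zero. *)
Lemma zero_divergence D (G : C -> R) (K : R) (N : set R) : copen D -> (forall z, D z -> rcont_at G z) ->
  (forall z, D z -> 0 <= G z + K) -> 0 <= K -> countable N ->
  (forall y, ~ N y -> flux_slice K [set x | D (x +i* y)%C] (fun x => G (x +i* y)%C)) \/
  (forall x, ~ N x -> flux_slice K [set y | D (x +i* y)%C] (fun y => G (x +i* y)%C)) ->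
  (\int[plane]_(q in cx @^-1` D) (G (cx q) + K)%:E = \int[plane]_(q in cx @^-1` D) K%:E)%E.
Proof.
move=> oD cG GK K0 cN H.
have m1 := @copen_patch_measurable D (fun z => G z + K) oD (fun z Dz => rcont_atD (cG z Dz) (@rcont_at_cst _ K z)).
have m2 := @copen_patch_measurable D (fun=> K) oD (fun z _ => @rcont_at_cst _ K z).
have p1 q := @patch_ge0 D (fun z => G z + K) q GK.
have p2 q := @patch_ge0 D (fun=> K) q (fun _ _ => K0).
rewrite integral_mkcond [RHS]integral_mkcond.
case: H => H.
  rewrite (plane_int_y m1 p1) (plane_int_y m2 p2).
  apply: (eq_integral_off_countable cN).
  - by move=> y; apply: integral_ge0 => x _; exact: p1.
  - by move=> y; apply: integral_ge0 => x _; exact: p2.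
  - exact: slice_y_measurable.
  - exact: slice_y_measurable.
  - move=> y /H/flux_slice_int E.
    by transitivity (\int[mu]_x ((fun x => (G (x +i* y)%C + K)%:E) \_ [set x | D (x +i* y)%C]) x)%E;
      [|rewrite E]; apply: eq_integral => x _;
      rewrite !patchE; congr (if _ then _ else _); apply/idP/idP => /set_mem ?; exact/mem_set.
rewrite (plane_int_x m1 p1) (plane_int_x m2 p2).
apply: (eq_integral_off_countable cN).
- by move=> x; apply: integral_ge0 => y _; exact: p1.
- by move=> x; apply: integral_ge0 => y _; exact: p2.
- exact: slice_x_measurable.
- exact: slice_x_measurable.
- move=> x /H/flux_slice_int E.
  by transitivity (\int[mu]_y ((fun y => (G (x +i* y)%C + K)%:E) \_ [set y | D (x +i* y)%C]) y)%E;
    [|rewrite E]; apply: eq_integral => y _;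
    rewrite !patchE; congr (if _ then _ else _); apply/idP/idP => /set_mem ?; exact/mem_set.
Qed.
End PlaneIntegral.

(** * The comparison function p and its cut-off Dirichlet integral *)

Section PoleSum.
Context {R : realType}.
Local Notation C := R[i].
Local Notation RT := (measurableTypeR R).
Implicit Types (a al z u : C) (r M : R).

(* [pterm al a] has residue [al] at its pole [a], and its real part vanishes on [|z| = 1]. *)
Definition pterm al a z := al / (z - a) - al^* * (z / (1 - a^* * z)).
Definition pterm' al a z := - al / (z - a) ^+ 2 - al^* / (1 - a^* * z) ^+ 2.
Definition pterm'' al a z := 2 * al / (z - a) ^+ 3 - 2 * a^* * al^* / (1 - a^* * z) ^+ 3.

Lemma pden a z : nm a < 1 -> nm z <= 1 -> 1 - nm a <= nm (1 - a^* * z) /\ 1 - a^* * z != 0.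
Proof.
move=> ha hz; have h : 1 - nm a <= nm (1 - a^* * z).
  have := nm_sub_ge 1 (a^* * z); rewrite nm1 nmM nmJ.
  by have : nm a * nm z <= nm a by [rewrite ler_piMr ?nm_ge0]; order_lra.
by split=> //; rewrite -nm_gt0; apply: lt_le_trans h; rewrite subr_gt0.
Qed.

Lemma pterm_der al a z : z != a -> 1 - a^* * z != 0 -> cder (pterm al a) z (pterm' al a z).
Proof.
move=> za d0; have za' : z - a != 0 by rewrite subr_eq0.
have D1 := cderZ al (cder_invf (cderB (cder_id z) (cder_cst a z)) za').
have D2 := cderZ (al^*) (cder_div (cder_id z) (cderB (cder_cst 1 z) (cderZ (a^*) (cder_id z))) d0).
have -> : pterm' al a z = al * (- (1 - 0) / (z - a) ^+ 2) -
   al^* * ((1 * (1 - a^* * z) - z * (0 - a^* * 1)) / (1 - a^* * z) ^+ 2).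
  by rewrite /pterm'; field; rewrite za' d0.
exact: (cderB D1 D2).
Qed.

Lemma pterm'_der al a z : z != a -> 1 - a^* * z != 0 -> cder (pterm' al a) z (pterm'' al a z).
Proof.
move=> za d0; have za' : z - a != 0 by rewrite subr_eq0.
have D1 := cderZ (- al) (cder_invf (cderX 1 (cderB (cder_id z) (cder_cst a z))) (expf_neq0 2 za')).
have D2 := cderZ (al^*) (cder_invf (cderX 1 (cderB (cder_cst 1 z) (cderZ (a^*) (cder_id z)))) (expf_neq0 2 d0)).
have -> : pterm'' al a z = - al * (- (2 * (z - a) ^+ 1 * (1 - 0)) / ((z - a) ^+ 2) ^+ 2) -
   al^* * (- (2 * (1 - a^* * z) ^+ 1 * (0 - a^* * 1)) / ((1 - a^* * z) ^+ 2) ^+ 2).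
  by rewrite /pterm''; field; rewrite za' d0.
exact: (cderB D1 D2).
Qed.

Lemma pterm''_cont al a z : z != a -> 1 - a^* * z != 0 -> ccont (pterm'' al a) z.
Proof.
move=> za d0; have za' : z - a != 0 by rewrite subr_eq0.
have D1 := cderZ (2 * al) (cder_invf (cderX 2 (cderB (cder_id z) (cder_cst a z))) (expf_neq0 3 za')).
have D2 := cderZ (2 * a^* * al^*) (cder_invf (cderX 2 (cderB (cder_cst 1 z) (cderZ (a^*) (cder_id z)))) (expf_neq0 3 d0)).
exact: cder_cont (cderB D1 D2).
Qed.

(** On the circle [1 / z] is the conjugate of [z], which makes the second summand the conjugate of
    the first. *)
Lemma pterm_circle al a z : nm a < 1 -> nm z = 1 -> complex.Re (pterm al a z) = 0.
Proof.
move=> ha hz; have [_ d0] := pden ha (eq_ind_r (fun x => x <= 1) (lexx 1) hz).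
have zz : z * z^* = 1 by rewrite mulCJ hz expr1n.
have z0 : z != 0 by rewrite -nm_gt0 hz.
have za : z - a != 0.
  by rewrite subr_eq0; apply: contraTneq ha => <-; rewrite hz ltxx.
rewrite /pterm; have -> : al^* * (z / (1 - a^* * z)) = (al / (z - a))^*.
  rewrite rmorphM fmorphV rmorphB /=; congr (_ * _).
  have -> : z^* = z^-1 by rewrite -[LHS]mul1r -(mulVf z0) -mulrA zz mulr1.
  have -> : z^-1 - a^* = (1 - a^* * z) / z by field.
  by rewrite invf_div.
by case: (_ / _) => x y; rewrite conjCE /=; ring.
Qed.

Lemma pterm_bound al a r : nm a < 1 -> 0 < r -> exists K, 0 <= K /\ forall z, nm z <= 1 -> r <= nm (z - a) ->
  [/\ nm (pterm al a z) <= K, nm (pterm' al a z) <= K & nm (pterm'' al a z) <= K].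
Proof.
move=> ha r0; pose s := 1 - nm a; have s0 : 0 < s by rewrite subr_gt0.
have A0 := nm_ge0 al; have i0 : 0 <= r^-1 by rewrite invr_ge0 ltW.
have j0 : 0 <= s^-1 by rewrite invr_ge0 ltW.
exists (2 * nm al * (r^-1 + r^-1 ^+ 2 + r^-1 ^+ 3 + s^-1 + s^-1 ^+ 2 + s^-1 ^+ 3)); split.
  by rewrite mulr_ge0 ?mulr_ge0 // !addr_ge0 ?exprn_ge0.
move=> z hz hr; have [d1 d0] := pden ha hz.
have b1 n : (nm (z - a) ^+ n)^-1 <= r^-1 ^+ n.
  rewrite -exprVn; apply: lerXn2r; rewrite ?nnegrE ?invr_ge0 ?nm_ge0 ?(ltW r0) //.
  by rewrite lef_pV2 ?posrE //; exact: lt_le_trans hr.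
have b2 n : (nm (1 - a^* * z) ^+ n)^-1 <= s^-1 ^+ n.
  rewrite -exprVn; apply: lerXn2r; rewrite ?nnegrE ?invr_ge0 ?nm_ge0 ?(ltW s0) //.
  by rewrite lef_pV2 ?posrE //; exact: lt_le_trans d1.
have c1 n : nm al * (nm (z - a) ^+ n)^-1 <= nm al * r^-1 ^+ n by rewrite ler_wpM2l.
have c2 n : nm al * (nm (1 - a^* * z) ^+ n)^-1 <= nm al * s^-1 ^+ n by rewrite ler_wpM2l.
have e2 : nm (2 : C) = 2 by rewrite -[2 : C]/(2%:R) -(rmorph_nat (real_complex R)) nm_real ger0_norm.
have pos (x y : R) n : 0 <= x -> 0 <= y -> 0 <= x * y ^+ n by move=> *; rewrite mulr_ge0 ?exprn_ge0.
have q n := pos _ _ n A0 i0; have q' n := pos _ _ n A0 j0.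
have := q 1%N; have := q 2%N; have := q 3%N; have := q' 1%N; have := q' 2%N; have := q' 3%N.
have u1 := c1 1%N; have u2 := c1 2%N; have u3 := c1 3%N.
have v1 := c2 1%N; have v2 := c2 2%N; have v3 := c2 3%N.
rewrite !expr1 in u1 v1 *.
have w1 : nm al * (nm z * (nm (1 - a^* * z))^-1) <= nm al * (nm (1 - a^* * z))^-1.
  by rewrite ler_wpM2l // ler_piMl // invr_ge0 nm_ge0.
have w3 : nm a * (nm al * (nm (1 - a^* * z) ^+ 3)^-1) <= nm al * (nm (1 - a^* * z) ^+ 3)^-1.
  by apply: ler_piMl; [rewrite mulr_ge0 // invr_ge0 exprn_ge0 // nm_ge0|exact: ltW].
rewrite !mulrDr; split.
- by apply: le_trans (nmB _ _) _; rewrite !nmM !nmV nmJ; order_lra.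
- by apply: le_trans (nmB _ _) _; rewrite !nmM !nmV !nmX nmJ nmN; order_lra.
- apply: le_trans (nmB _ _) _; rewrite !nmM !nmV !nmX !nmJ e2.
  have -> : 2 * nm a * nm al / nm (1 - a^* * z) ^+ 3 = 2 * (nm a * (nm al / nm (1 - a^* * z) ^+ 3)) by ring.
  by rewrite -mulrA; order_lra.
Qed.

Variables (z1 z2 a1 a2 : C).
Hypotheses (z11 : nm z1 < 1) (z21 : nm z2 < 1) (z12 : z1 != z2) (a10 : a1 != 0) (a20 : a2 != 0).

Definition psum z := pterm a1 z1 z + pterm a2 z2 z.
Definition psum' z := pterm' a1 z1 z + pterm' a2 z2 z.
Definition psum'' z := pterm'' a1 z1 z + pterm'' a2 z2 z.
Local Notation p := psum.
Local Notation p' := psum'.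
Local Notation p'' := psum''.

Definition pdisk := [set z : C | [/\ nm z < 1, z != z1 & z != z2]].

Lemma psum_der z : nm z <= 1 -> z != z1 -> z != z2 -> [/\ cder p z (p' z), cder p' z (p'' z) & ccont p'' z].
Proof.
move=> hz n1 n2; have [_ d1] := pden z11 hz; have [_ d2] := pden z21 hz; split.
- by apply: cderD; exact: pterm_der.
- by apply: cderD; exact: pterm'_der.
- by apply: ccontD; exact: pterm''_cont.
Qed.

Lemma psum_circle z : nm z = 1 -> complex.Re (p z) = 0.
Proof. by move=> hz; rewrite /p ReD !pterm_circle // addr0. Qed.

Lemma psum_bound r : 0 < r -> exists K, 0 <= K /\ forall z, nm z <= 1 -> r <= nm (z - z1) -> r <= nm (z - z2) ->
  [/\ nm (p z) <= K, nm (p' z) <= K & nm (p'' z) <= K].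
Proof.
move=> r0; have [K1 [K10 H1]] := pterm_bound a1 z11 r0; have [K2 [K20 H2]] := pterm_bound a2 z21 r0.
exists (K1 + K2); split; first exact: addr_ge0.
move=> z hz h1 h2; have [b1 b2 b3] := H1 z hz h1; have [c1 c2 c3] := H2 z hz h2.
by split; (apply: le_trans (nmD _ _) _); apply: lerD.
Qed.

Lemma pole_blowup al a b be (L : R) : nm a < 1 -> nm b < 1 -> a != b -> al != 0 ->
  exists r : R, [/\ 0 < r, r <= nm (a - b) / 2 & forall z, nm z < 1 -> z != a -> nm (z - a) < r ->
    L < nm (pterm al a z + pterm be b z)].
Proof.
move=> ha hb ab al0; have ab0 : 0 < nm (a - b) / 2 by rewrite divr_gt0 // nm_gt0 subr_eq0.
have [K [K0 HK]] := pterm_bound be hb ab0.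
pose s := 1 - nm a; have s0 : 0 < s by rewrite subr_gt0.
pose Q := `|L| + K + nm al / s + 1.
have Q0 : 0 < Q by rewrite ltr_wpDl // !addr_ge0 // divr_ge0 ?nm_ge0 ?ltW.
have A0 : 0 < nm al by rewrite nm_gt0.
exists (Num.min (nm (a - b) / 2) (nm al / Q)); split; [by rewrite lt_min ab0 divr_gt0|by rewrite ge_min lexx|].
move=> z hz za; rewrite lt_min => /andP[h1 h2].
have zb : nm (a - b) / 2 <= nm (z - b) by have := nmBD z a b; rewrite (nmBC a z); order_lra.
have [q1 _ _] := HK z (ltW hz) zb.
have [d1 d0] := pden ha (ltW hz).
have za0 : 0 < nm (z - a) by rewrite nm_gt0 subr_eq0.
have big : Q < nm (al / (z - a)) by rewrite nm_div ltr_pdivlMr // mulrC -ltr_pdivlMr.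
have sm : nm (al^* * (z / (1 - a^* * z))) <= nm al / s.
  rewrite nmM nmJ nmM nmV ler_wpM2l ?nm_ge0 //.
  apply: le_trans (_ : (nm (1 - a^* * z))^-1 <= _).
    by rewrite ler_piMl ?invr_ge0 ?nm_ge0 // ltW.
  by rewrite lef_pV2 ?posrE // (lt_le_trans s0).
have := ler_norm L; move: big; rewrite /Q.
have -> : pterm al a z + pterm be b z = al / (z - a) - (al^* * (z / (1 - a^* * z)) - pterm be b z) by rewrite /pterm; ring.
have := nm_sub_ge (al / (z - a)) (al^* * (z / (1 - a^* * z)) - pterm be b z).
have := nmB (al^* * (z / (1 - a^* * z))) (pterm be b z).
by move: (nm al / s) sm => x sm; order_lra.
Qed.

Lemma psum_blowup (L : R) : exists2 r : R, 0 < r & forall z, pdisk z -> nm (z - z1) < r \/ nm (z - z2) < r -> L < nm (p z).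
Proof.
have [r1 [r10 _ H1]] := pole_blowup a2 L z11 z21 z12 a10.
have z21' : z2 != z1 by rewrite eq_sym.
have [r2 [r20 _ H2]] := pole_blowup a1 L z21 z11 z21' a20.
exists (Num.min r1 r2); first by rewrite lt_min r10.
move=> z [hz n1 n2]; rewrite !lt_min => -[/andP[h _]|/andP[_ h]]; first exact: H1.
by rewrite /p addrC; exact: H2.
Qed.

Variable M : R.
Hypothesis M_gt0 : 0 < M.

Definition cutp z := cut (nm (p z) ^+ 2 / M ^+ 2).
Definition dcutp z := dcut (nm (p z) ^+ 2 / M ^+ 2).

(* [fluxA u] is the derivative of [fluxF u] in the direction [u]; summing over u = 1, i
   gives the divergence of the field cut(|p|^2/M^2) Re p grad(Re p). *)
Definition fluxF u z := cutp z * (complex.Re (p z) * complex.Re (u * p' z)).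
Definition fluxA u z := dcutp z * (2 * Rcj (p z) (u * p' z)) / M ^+ 2 * (complex.Re (p z) * complex.Re (u * p' z)) +
  cutp z * (complex.Re (u * p' z) ^+ 2 + complex.Re (p z) * complex.Re (u * (u * p'' z))).

(** [Re p] is harmonic: the terms with [p''] cancel because [u ^+ 2] is 1 for one direction and -1
    for the other. *)
Lemma fluxA_sum z : fluxA 1 z + fluxA 'i%C z =
  cutp z * nm (p' z) ^+ 2 - (- 2 * complex.Re (p z) ^+ 2 * dcutp z / M ^+ 2) * nm (p' z) ^+ 2.
Proof.
rewrite /fluxA nm_sqr !mul1r; case: (p z) => X Y; case: (p' z) => v w; case: (p'' z) => s t.
by rewrite /Rcj !ReImE /=; ring.
Qed.

Lemma fluxA_cont u z : nm z <= 1 -> z != z1 -> z != z2 -> rcont_at (fluxA u) z.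
Proof.
move=> hz n1 n2; have [D D' c''] := psum_der hz n1 n2.
have c := cder_cont D; have c' := cder_cont D'.
have cu' : ccont (fun z => u * p' z) z by apply: ccontM => //; exact: ccont_cst.
have cu'' : ccont (fun z => u * (u * p'' z)) z.
  by apply: ccontM; [exact: ccont_cst|apply: ccontM; [exact: ccont_cst|]].
apply: rcont_atD; apply: rcont_atM.
- apply: rcont_atM; last exact: rcont_at_cst; apply: rcont_atM; first exact: rcont_at_dcut.
  by apply: rcont_atM; [exact: rcont_at_cst|exact: rcont_at_Rcj].
- by apply: rcont_atM; exact: rcont_at_Re.
- exact: rcont_at_cut.
- by apply: rcont_atD; [apply: rcont_at_sqr; exact: rcont_at_Re|apply: rcont_atM; exact: rcont_at_Re].
Qed.

Lemma fluxF_derive u (k : R -> C) t : rder k t u -> nm (k t) <= 1 -> k t != z1 -> k t != z2 ->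
  is_derive t 1 (fun s => fluxF u (k s)) (fluxA u (k t)).
Proof.
move=> dk hz n1 n2; have [D D' c''] := psum_der hz n1 n2.
have dp := cder_rder dk D; have dp' := cder_rder dk (cderZ u D').
have dn : is_derive t 1 (fun s => nm (p (k s)) ^+ 2 / M ^+ 2) (2 * Rcj (p (k t)) (p' (k t) * u) / M ^+ 2).
  apply: (is_derive_ext (is_deriveZ (M ^+ 2)^-1 (nm2_derive dp))) => [s|]; first by rewrite mulrC.
  by rewrite -[_ *: _]/(_ * _) mulrC.
have dc := @is_derive1_comp R (@cut R) (fun s => nm (p (k s)) ^+ 2 / M ^+ 2) t _ _ (cut_derive (nm (p (k t)) ^+ 2 / M ^+ 2)) dn.
apply: (is_derive_ext (is_deriveM dc (is_deriveM (rder_Re dp) (rder_Re dp')))) => [s|] //.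
change (cutp (k t) * (complex.Re (p (k t)) * complex.Re (u * p'' (k t) * u) + complex.Re (u * p' (k t)) * complex.Re (p' (k t) * u)) +
  complex.Re (p (k t)) * complex.Re (u * p' (k t)) * (dcutp (k t) * (2 * Rcj (p (k t)) (p' (k t) * u) / M ^+ 2)) = fluxA u (k t)).
rewrite /fluxA (mulrC (p' (k t)) u) (mulrC (u * p'' (k t)) u).
ring.
Qed.

(** Close to the poles the cut-off and its derivative vanish; elsewhere [p] and its derivatives are
    bounded. *)
Lemma fluxA_bound u : exists K, 0 <= K /\ forall z, pdisk z -> `|fluxA u z| <= K.
Proof.
have [r r0 Hr] := psum_blowup (2 * M).
have [K [K0 HK]] := psum_bound r0.
pose U := nm u.
exists (4 * (K * (U * K)) / M ^+ 2 * (K * (U * K)) + ((U * K) ^+ 2 + K * (U * (U * K)))); split.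
  have U0 := nm_ge0 u; have UK := mulr_ge0 U0 K0; have KUK := mulr_ge0 K0 UK.
  apply: addr_ge0; last by rewrite addr_ge0 ?sqr_ge0 // mulr_ge0 // mulr_ge0.
  by rewrite mulr_ge0 // divr_ge0 ?sqr_ge0 // mulr_ge0.
move=> z Dz; have [hz n1 n2] := Dz.
have UK : 0 <= U * K by rewrite mulr_ge0 ?nm_ge0.
have KUK : 0 <= K * (U * K) by rewrite mulr_ge0.
have UUK : 0 <= U * (U * K) by rewrite mulr_ge0 ?nm_ge0.
have B0 : 0 <= 4 * (K * (U * K)) / M ^+ 2 * (K * (U * K)).
  by rewrite mulr_ge0 // divr_ge0 ?sqr_ge0 // mulr_ge0.
have B1 : 0 <= (U * K) ^+ 2 + K * (U * (U * K)).
  by apply: addr_ge0; [exact: sqr_ge0|exact: mulr_ge0].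
have [near|] := pselect (nm (z - z1) < r \/ nm (z - z2) < r).
  have big := Hr z Dz near.
  have [c0 dc0] : cutp z = 0 /\ dcutp z = 0.
    apply: cut_ge2; rewrite ler_pdivlMr ?exprn_gt0 //.
    have : (2 * M) ^+ 2 <= nm (p z) ^+ 2 by rewrite lerXn2r ?nnegrE ?nm_ge0 ?mulr_ge0 ?ltW.
    by rewrite exprMn; have : 0 < M ^+ 2 by [rewrite exprn_gt0]; order_lra.
  by rewrite /fluxA c0 dc0 !mul0r addr0 normr0 addr_ge0.
move=> /not_orP[/negP]; rewrite -leNgt => f1 /negP; rewrite -leNgt => f2.
have [b1 b2 b3] := HK z (ltW hz) f1 f2.
have [c0 c1 c2 c3] := cut_bounds (nm (p z) ^+ 2 / M ^+ 2).
have ub : nm (u * p' z) <= U * K by rewrite nmM ler_wpM2l ?nm_ge0.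
have ub' : nm (u * (u * p'' z)) <= U * (U * K) by rewrite nmM ler_wpM2l ?nm_ge0 // nmM ler_wpM2l ?nm_ge0.
have r1 : `|complex.Re (p z)| <= K by apply: le_trans (Re_le_nm _) _.
have r2 : `|complex.Re (u * p' z)| <= U * K by apply: le_trans (Re_le_nm _) _.
have r3 : `|complex.Re (u * (u * p'' z))| <= U * (U * K) by apply: le_trans (Re_le_nm _) _.
have rr : `|Rcj (p z) (u * p' z)| <= K * (U * K).
  by apply: le_trans (Rcj_le _ _) _; apply: ler_pM; rewrite ?nm_ge0.
have [_ _ dc1 dc2] := cut_bounds (nm (p z) ^+ 2 / M ^+ 2).
have dcb : `|dcutp z| <= 2 by rewrite ler_norml dc1 (le_trans dc2).
have ccb : `|cutp z| <= 1 by rewrite ger0_norm.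
apply: le_trans (ler_normD _ _) _; apply: lerD.
  rewrite normrM; apply: ler_pM => //; last by rewrite normrM; apply: ler_pM.
  rewrite normrM normrV ?unitfE ?gt_eqF ?exprn_gt0 // (ger0_norm (sqr_ge0 M)).
  rewrite ler_wpM2r ?invr_ge0 ?sqr_ge0 // normrM (_ : 4 * _ = 2 * (2 * (K * (U * K)))); last by ring.
  by apply: ler_pM => //; rewrite normrM ger0_norm // ler_wpM2l.
rewrite normrM -[leRHS]mul1r; apply: ler_pM => //.
apply: le_trans (ler_normD _ _) _; apply: lerD.
  by rewrite normrX lerXn2r.
by rewrite normrM; apply: ler_pM.
Qed.

Lemma pdisk_open : copen pdisk.
Proof.
move=> z [hz n1 n2]; pose r := Num.min (1 - nm z) (Num.min (nm (z - z1)) (nm (z - z2))).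
exists r; first by rewrite !lt_min subr_gt0 hz !nm_gt0 !subr_eq0 n1.
move=> w; rewrite !lt_min => /and3P[w1 w2 w3]; split.
- by have := nm_sub_ge w z; order_lra.
- by apply: contraTneq w2 => ->; rewrite nmBC ltxx.
- by apply: contraTneq w3 => ->; rewrite nmBC ltxx.
Qed.

(** [fluxF] has the factor [Re p], which vanishes at both ends of a chord. *)
Lemma disk_flux u (k : R -> C) (b K : R) : (forall t, rder k t u) -> (forall t, nm (k t) ^+ 2 = t ^+ 2 + b ^+ 2) ->
  (forall t, k t != z1 /\ k t != z2) -> flux_slice K [set t | pdisk (k t)] (fun t => fluxA u (k t)).
Proof.
move=> dk nk nz.
have [b1|b1] := leP 1 (b ^+ 2).
  left; apply/seteqP; split => t //= [h _ _].
  have : nm (k t) ^+ 2 < 1 by rewrite expr_lt1 ?nm_ge0.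
  by rewrite nk; have := sqr_ge0 t; order_lra.
right; pose c := Num.sqrt (1 - b ^+ 2).
have c2 : c ^+ 2 = 1 - b ^+ 2 by rewrite sqr_sqrtr // subr_ge0 ltW.
have c0 : 0 <= c by exact: sqrtr_ge0.
have disk t : (nm (k t) < 1) = (- c < t < c).
  rewrite -ltr_norml -(@expr_lt1 _ 2) ?nm_ge0 // nk -ltrBrDr -c2 -(real_normK (num_real t)).
  by rewrite ltr_pXn2r ?nnegrE.
have cdisk t : - c <= t <= c -> nm (k t) <= 1.
  rewrite -ler_norml -(@expr_le1 _ 2) ?nm_ge0 // nk -lerBrDr -c2 -(real_normK (num_real t)) => h.
  by rewrite lerXn2r ?nnegrE.
have edge t : t ^+ 2 = c ^+ 2 -> fluxF u (k t) = 0.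
  move=> tc; have h : nm (k t) = 1.
    by apply/eqP; rewrite -(@pexpr_eq1 _ _ 2) ?nm_ge0 // nk tc c2 subrK.
  by rewrite /fluxF (psum_circle h) mul0r mulr0.
exists c, (fun t => fluxF u (k t)); split; first exact: c0.
- apply/seteqP; split => t /=; rewrite in_itv /= -disk; first by case.
  by have [? ?] := nz t.
- move=> t /cdisk ht; have [n1 n2] := nz t; apply: rcont_at_line; first exact: rder_cont (dk t).
  exact: fluxA_cont.
- by move=> t /cdisk ht; have [n1 n2] := nz t; apply: fluxF_derive.
- by rewrite !edge // sqrrN.
Qed.

Lemma flux_zero u K : u = 1 \/ u = 'i%C -> 0 <= K -> (forall z, pdisk z -> `|fluxA u z| <= K) ->
  (\int[plane]_(q in cx @^-1` pdisk) (fluxA u (cx q) + K)%:E = \int[plane]_(q in cx @^-1` pdisk) K%:E)%E.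
Proof.
(* Coordinates of the poles: the lines through a pole are left out. *)
move=> hu K0 HK; pose N := [set complex.Im z1; complex.Im z2; complex.Re z1; complex.Re z2].
apply: (@zero_divergence _ _ _ _ N); first exact: pdisk_open.
- by move=> z [hz n1 n2]; apply: fluxA_cont => //; exact: ltW.
- by move=> z /HK; rewrite ler_norml => /andP[? _]; order_lra.
- by [].
- by apply: finite_set_countable; rewrite /N; do ! (rewrite finite_setU; split => //).
- case: hu => ->; [left|right] => y nN; apply: (@disk_flux _ _ y).
  + exact: rder_h.
  + by move=> t; rewrite nm_sqr.
  + move=> t; split; apply/eqP => e; apply: nN; rewrite /N /= -e /=; tauto.
  + exact: rder_v.
  + by move=> t; rewrite nm_sqr /= addrC.
  + move=> t; split; apply/eqP => e; apply: nN; rewrite /N /= -e /=; tauto.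
Qed.

(** With [x = Re P], this is [- x] times the [x]-derivative of [cut (|P|^2 / M^2)]; it vanishes
    unless [M^2 < |P|^2 < 2 M^2]. *)
Definition wsum (P : C) := - 2 * complex.Re P ^+ 2 * dcut (nm P ^+ 2 / M ^+ 2) / M ^+ 2.

Lemma wsum_ge0 P : 0 <= wsum P.
Proof.
have [_ _ _ h] := cut_bounds (nm P ^+ 2 / M ^+ 2).
rewrite /wsum; apply: divr_ge0; last exact: sqr_ge0.
by apply: mulr_le0 => //; rewrite mulNr oppr_le0; apply: mulr_ge0 => //; exact: sqr_ge0.
Qed.

Lemma wsum_cont F z : ccont F z -> rcont_at (fun w => wsum (F w)) z.
Proof.
move=> cF; apply: rcont_atM; last exact: rcont_at_cst; apply: rcont_atM; last exact: rcont_at_dcut.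
by apply: rcont_atM; [exact: rcont_at_cst|apply: rcont_at_sqr; exact: rcont_at_Re].
Qed.

(** The directions 1 and [i] each contribute a zero flux. The constant [K], added for nonnegativity,
    cancels because the disk has finite area. *)
Lemma energy : (\int[plane]_(q in cx @^-1` pdisk) (cutp (cx q) * nm (p' (cx q)) ^+ 2)%:E =
  \int[plane]_(q in cx @^-1` pdisk) (wsum (p (cx q)) * nm (p' (cx q)) ^+ 2)%:E)%E.
Proof.
have [K1 [K10 H1]] := fluxA_bound 1; have [K2 [K20 H2]] := fluxA_bound 'i%C.
pose K := K1 + K2; have K0 : 0 <= K by exact: addr_ge0.
have B1 z : pdisk z -> `|fluxA 1 z| <= K by move=> /H1 h; rewrite (le_trans h) // lerDl.
have B2 z : pdisk z -> `|fluxA 'i%C z| <= K by move=> /H2 h; rewrite (le_trans h) // lerDr.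
have mD := copen_measurable pdisk_open.
have meas (G : C -> R) : (forall z, pdisk z -> rcont_at G z) ->
    measurable_fun (cx @^-1` pdisk) (fun q => (G (cx q))%:E).
  by move=> cG; apply/measurable_EFinP; apply: rcont_at_measurable cG; exact: pdisk_open.
have cp z : pdisk z -> ccont p z /\ ccont p' z.
  by move=> [hz n1 n2]; have [D D' _] := psum_der (ltW hz) n1 n2; split; [exact: cder_cont D|exact: cder_cont D'].
have cA u z : pdisk z -> rcont_at (fun z => fluxA u z + K) z.
  by move=> [hz n1 n2]; apply: rcont_atD (@rcont_at_cst _ K z); apply: fluxA_cont => //; exact: ltW.
have cN z : pdisk z -> rcont_at (fun z => nm (p' z) ^+ 2) z.
  by move=> /cp[_ c']; apply: rcont_at_sqr; exact: rcont_at_nm.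
have cE z : pdisk z -> rcont_at (fun z => cutp z * nm (p' z) ^+ 2) z.
  by move=> Dz; apply: rcont_atM (cN z Dz); apply: rcont_at_cut; have [] := cp z Dz.
have cW z : pdisk z -> rcont_at (fun z => wsum (p z) * nm (p' z) ^+ 2) z.
  by move=> Dz; apply: rcont_atM (cN z Dz); apply: wsum_cont; have [] := cp z Dz.
have cK z : pdisk z -> rcont_at (fun=> K) z by move=> _; exact: rcont_at_cst.
have pA u z : (forall z, pdisk z -> `|fluxA u z| <= K) -> pdisk z -> 0 <= fluxA u z + K.
  by move=> h /h; rewrite ler_norml => /andP[? _]; order_lra.
have finK : (\int[plane]_(q in cx @^-1` pdisk) K%:E)%E \is a fin_num.
  rewrite integral_cst //; apply: fin_numM => //; rewrite ge0_fin_numE //.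
  apply: le_lt_trans (omega_fin (R := R)); apply: le_measure; rewrite ?inE //; first exact: disc_measurable.
  by move=> q [h _ _]; rewrite /disc /= subr0.
have sum1 : (\int[plane]_(q in cx @^-1` pdisk) (cutp (cx q) * nm (p' (cx q)) ^+ 2)%:E +
   (\int[plane]_(q in cx @^-1` pdisk) K%:E + \int[plane]_(q in cx @^-1` pdisk) K%:E) =
   \int[plane]_(q in cx @^-1` pdisk) (wsum (p (cx q)) * nm (p' (cx q)) ^+ 2)%:E +
   (\int[plane]_(q in cx @^-1` pdisk) K%:E + \int[plane]_(q in cx @^-1` pdisk) K%:E))%E.
  rewrite -[X in (_ = _ + (X + _))%E](flux_zero (or_introl erefl) K0 B1).
  rewrite -[X in (_ = _ + (_ + X))%E](flux_zero (or_intror erefl) K0 B2).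
  have cut0 z : 0 <= cutp z by have [] := cut_bounds (nm (p z) ^+ 2 / M ^+ 2).
  have e0 z : 0 <= cutp z * nm (p' z) ^+ 2 by rewrite mulr_ge0 ?sqr_ge0.
  have w0 z : 0 <= wsum (p z) * nm (p' z) ^+ 2 by rewrite mulr_ge0 ?sqr_ge0 // wsum_ge0.
  rewrite -!ge0_integralD //.
  - apply: eq_integral => q _; rewrite -!EFinD; congr EFin.
    rewrite [X in _ = _ + X]addrACA fluxA_sum /wsum /dcutp; ring.
  - by move=> q Dq; rewrite lee_fin w0.
  - by apply: (meas (fun z => wsum (p z) * nm (p' z) ^+ 2)).
  - by move=> q Dq; rewrite -EFinD lee_fin addr_ge0 // pA.
  - by apply: emeasurable_funD; apply: (meas (fun z => _ + K)) => z; exact: cA.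
  - by move=> q Dq; rewrite lee_fin pA.
  - by apply: (meas (fun z => _ + K)) => z; exact: cA.
  - by move=> q Dq; rewrite lee_fin pA.
  - by apply: (meas (fun z => _ + K)) => z; exact: cA.
  - by move=> q Dq; rewrite lee_fin e0.
  - by apply: (meas (fun z => cutp z * nm (p' z) ^+ 2)).
  - by move=> q Dq; rewrite -EFinD lee_fin addr_ge0.
set I := (\int[plane]_(q in cx @^-1` pdisk) K%:E)%E in finK sum1.
have fin2 : (I + I)%E \is a fin_num by rewrite fin_numD finK.
by rewrite -[LHS](addeK _ fin2) sum1 addeK.
Qed.
End PoleSum.

(** * The poles as charts at infinity *)

Section PoleCharts.
Context {R : realType}.
Local Notation C := R[i].
Local Notation RT := (measurableTypeR R).

Lemma psumC (z1 z2 a1 a2 z : C) : psum z1 z2 a1 a2 z = psum z2 z1 a2 a1 z.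
Proof. exact: addrC. Qed.

(** [1 / p] extends holomorphically over [z1] with a simple zero, so near [z1] the inverse function
    theorem makes [p] a coordinate with image [nm P > L], and the integral can be transported to the
    plane of [P]. *)
Lemma pole_chart (z1 z2 a1 a2 : C) : nm z1 < 1 -> nm z2 < 1 -> z1 != z2 -> a1 != 0 ->
  exists (r L : R) (O : set C), [/\ 0 < r /\ 0 < L, copen O, O `<=` pdisk z1 z2,
    forall z, pdisk z1 z2 z -> nm (z - z1) < r -> L < nm (psum z1 z2 a1 a2 z) -> O z &
    forall w : C -> R, (forall P, 0 <= w P) -> (forall P, rcont_at w P) ->
    (\int[plane]_(q in cx @^-1` O) (w (psum z1 z2 a1 a2 (cx q)) * nm (psum' z1 z2 a1 a2 (cx q)) ^+ 2)%:E <=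
     \int[plane]_q (w (cx q))%:E)%E].
Proof.
move=> z11 z21 z12 a10; set p := psum z1 z2 a1 a2; set p' := psum' z1 z2 a1 a2.
(* [(z - z1) * p z] with its singularity at [z1] removed. *)
pose n z := a1 + (z - z1) * (- (a1^* * (z / (1 - z1^* * z))) + pterm a2 z2 z).
have nz1 : n z1 = a1 by rewrite /n subrr mul0r addr0.
have pn z : z != z1 -> p z = n z / (z - z1).
  move=> zz; rewrite /p /psum /n {1}/pterm.
  by move: (z / (1 - z1^* * z)) (pterm a2 z2 z) => q t; field; rewrite subr_eq0.
have dn z : nm z < 1 -> z != z2 -> exists l, cder n z l.
  move=> hz n2; have [_ d1] := pden z11 (ltW hz); have [_ d2] := pden z21 (ltW hz).
  eexists; apply: cderD; first exact: cder_cst.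
  apply: cderM; first exact: (cderB (cder_id z) (cder_cst z1 z)).
  apply: cderD; last exact: (pterm_der a2 n2 d2).
  apply: cderN; apply: cderZ.
  exact: (cder_div (cder_id z) (cderB (cder_cst 1 z) (cderZ (z1^*) (cder_id z))) d1).
have [l Hl] := dn z1 z11 z12.
have na : 0 < nm a1 by rewrite nm_gt0.
have [e e0 He] := cder_cont Hl na.
pose r1 := Num.min e (Num.min (1 - nm z1) (nm (z1 - z2))).
have r10 : 0 < r1 by rewrite !lt_min e0 subr_gt0 z11 nm_gt0 subr_eq0.
have ball z : nm (z - z1) < r1 -> [/\ n z != 0, nm z < 1 & z != z2].
  rewrite !lt_min => /and3P[/He h1 h2 h3]; split.
  - by apply: contraTneq h1 => ->; rewrite nz1 sub0r nmN ltxx.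
  - by have := nm_sub_ge z z1; order_lra.
  - by apply: contraTneq h3 => ->; rewrite nmBC ltxx.
pose V z := (z - z1) / n z.
have Vz1 : V z1 = 0 by rewrite /V subrr mul0r.
have Vp z : nm (z - z1) < r1 -> z != z1 -> V z = (p z)^-1.
  by move=> _ zz; rewrite pn // invf_div.
have [V' HV] : exists V', holo V V' z1 r1.
  have /choice[V' H] z : exists m, nm (z - z1) < r1 -> cder V z m.
    have [hz|_] := ltP (nm (z - z1)) r1; last by exists 0.
    have [n0 h1 h2] := ball z hz; have [m Hm] := dn z h1 h2.
    by eexists => _; exact: (cder_div (cderB (cder_id z) (cder_cst z1 z)) Hm n0).
  by exists V'.
have V'0 : V' z1 != 0.
  have h : nm (z1 - z1) < r1 by rewrite subrr nm0.
  have [n0 _ _] := ball z1 h.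
  have E := cder_unique (HV z1 h) (cder_div (cderB (cder_id z1) (cder_cst z1 z1)) Hl n0).
  rewrite E subrr mul0r !subr0 mul1r nz1 mulf_neq0 // invr_neq0 // expf_neq0 //.
have [r [d [i [/andP[r0 rr] d0 I I' Hi]]]] := inverse_function r10 HV V'0.
rewrite Vz1 in Hi.
pose L := d^-1; have L0 : 0 < L by rewrite invr_gt0.
pose O := [set z | [/\ pdisk z1 z2 z, nm (z - z1) < r & L < nm (p z)]].
have pd z : pdisk z1 z2 z -> cder p z (p' z) /\ ccont p' z.
  move=> [hz n1 n2]; have [D D' _] := psum_der a1 a2 z11 z21 (ltW hz) n1 n2.
  by split=> //; exact: cder_cont D'.
have inv_small P : L < nm P -> nm (P^-1 - 0) < d.
  move=> h; rewrite subr0 nmV -[d]invrK ltf_pV2 ?posrE // -/L.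
  exact: lt_trans h.
have oO : copen O.
  move=> z [Dz h1 h2]; have [D _] := pd z Dz.
  have [d1 d10 H1] := pdisk_open Dz.
  have e1 : 0 < nm (p z) - L by rewrite subr_gt0.
  have [d2 d20 H2] := cder_cont D e1.
  exists (Num.min (Num.min d1 d2) (r - nm (z - z1))); first by rewrite !lt_min d10 d20 subr_gt0.
  move=> w; rewrite !lt_min -andbA => /and3P[/H1 w1 /H2 w2 w3]; split=> //.
    by have := nmBD z w z1; order_lra.
  by have := nm_sub_ge (p z) (p w); rewrite nmBC; order_lra.
pose DP := [set P : C | L < nm P].
have oD : copen DP.
  move=> P hP; exists (nm P - L); first by rewrite subr_gt0.
  by move=> w; rewrite /DP /=; have := nm_sub_ge P w; rewrite nmBC; order_lra.
have chain z : O z -> V' z = - p' z / p z ^+ 2.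
  move=> [Dz h1 h2]; have [D _] := pd z Dz; have [_ zz _] := Dz.
  have hz : nm (z - z1) < r1 by apply: lt_le_trans rr.
  have p0 : p z != 0 by rewrite -nm_gt0; apply: lt_trans h2.
  apply: cder_unique (HV z hz) _; apply: cder_ext (cder_invf D p0).
  exists (Num.min (r1 - nm (z - z1)) (nm (z - z1))).
    by rewrite lt_min subr_gt0 hz nm_gt0 subr_eq0.
  move=> w; rewrite lt_min => /andP[w1 w2]; rewrite Vp //; first by have := nmBD z w z1; order_lra.
  by apply: contraTneq w2 => ->; rewrite nmBC ltxx.
exists r, L, O; split=> //; [by move=> z []|].
move=> w w0 cw.
have phiP z : O z -> [/\ DP (p z), i (p z)^-1 = z, cder p z (p' z), p' z != 0 & ccont p' z].
  move=> Oz; have [Dz h1 h2] := Oz; have [D cD] := pd z Dz; have [_ zz _] := Dz.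
  have hz : nm (z - z1) < r1 by apply: lt_le_trans rr.
  split=> //.
    have [i1 i2 _] := Hi _ (inv_small _ h2).
    by apply: I => //; rewrite i2 Vp.
  apply: contraNneq (I' z h1) => e'; rewrite chain // e' oppr0 mul0r //.
have gP P : DP P -> [/\ O (i P^-1), p (i P^-1) = P & cder (fun P => i P^-1) P (p' (i P^-1))^-1].
  move=> hP; have [i1 i2 i3] := Hi _ (inv_small _ hP).
  have P0 : P != 0 by rewrite -nm_gt0; apply: lt_trans hP.
  have hz : nm (i P^-1 - z1) < r1 by apply: lt_le_trans rr.
  have zz : i P^-1 != z1.
    by apply: contra_neq (invr_neq0 P0) => e'; rewrite -i2 e'.
  have pE : p (i P^-1) = P by apply: invr_inj; rewrite -Vp.
  have [_ h1 h2] := ball _ hz.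
  have Oz : O (i P^-1) by split=> //; rewrite pE.
  split=> //; have := cder_comp (cder_inv P0) i3; rewrite chain // pE.
  congr cder; rewrite -[RHS]mulr1; have [_ _ _ q _] := phiP _ Oz.
  by field; rewrite q P0.
apply: le_trans (change_of_variables oO oD phiP gP (fun P _ => w0 P) (fun P _ => cw P)) _.
apply: ge0_subset_integral => //.
- exact: copen_measurable.
- exact: plane_measurable.
- by move=> q _; rewrite lee_fin.
Qed.

(** The density [wsum] vanishes where [nm p <= M]. For large [M] what remains lies in the two
    charts, and each of them contributes at most the integral over the whole plane. *)
Lemma energy_upper (z1 z2 a1 a2 : C) : nm z1 < 1 -> nm z2 < 1 -> z1 != z2 -> a1 != 0 -> a2 != 0 ->
  exists M1 : R, forall M, 0 < M -> M1 <= M ->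
  (\int[plane]_(q in cx @^-1` pdisk z1 z2) (cutp z1 z2 a1 a2 M (cx q) * nm (psum' z1 z2 a1 a2 (cx q)) ^+ 2)%:E <=
   \int[plane]_q (wsum M (cx q))%:E + \int[plane]_q (wsum M (cx q))%:E)%E.
Proof.
move=> z11 z21 z12 a10 a20; have z21' : z2 != z1 by rewrite eq_sym.
have [r1 [L1 [B1 [[r10 L10] oO1 S1 H1 I1]]]] := pole_chart a2 z11 z21 z12 a10.
have [r2 [L2 [B2 [[r20 L20] oO2 S2 H2 I2]]]] := pole_chart a1 z21 z11 z21' a20.
have r0 : 0 < Num.min r1 r2 by rewrite lt_min r10.
have [K [K0 HK]] := psum_bound a1 a2 z11 z21 r0.
exists (L1 + L2 + K) => M M0 hM.
rewrite (energy z11 z21 z12 a10 a20 M0).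
have w0 P := @wsum_ge0 R M P.
have cw P : rcont_at (wsum M) P by apply: (@wsum_cont _ M id); exact: cder_cont (cder_id P).
pose f q := (wsum M (psum z1 z2 a1 a2 (cx q)) * nm (psum' z1 z2 a1 a2 (cx q)) ^+ 2)%:E.
have cf z : pdisk z1 z2 z -> rcont_at (fun z => wsum M (psum z1 z2 a1 a2 z) * nm (psum' z1 z2 a1 a2 z) ^+ 2) z.
  move=> [hz n1 n2]; have [D D' _] := psum_der a1 a2 z11 z21 (ltW hz) n1 n2.
  apply: rcont_atM; first by apply: wsum_cont; exact: cder_cont D.
  by apply: rcont_at_sqr; apply: rcont_at_nm; exact: cder_cont D'.
have f0 q : (0 <= f q)%E by rewrite lee_fin mulr_ge0 ?sqr_ge0.
have sub2 z : pdisk z2 z1 z -> pdisk z1 z2 z by case.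
have mO (O : set C) : copen O -> O `<=` pdisk z1 z2 -> measurable_fun setT (f \_ (cx @^-1` O)).
  move=> oO sO; exact: (@copen_patch_measurable R O
    (fun z => wsum M (psum z1 z2 a1 a2 z) * nm (psum' z1 z2 a1 a2 z) ^+ 2) oO (fun z h => cf z (sO z h))).
have mO1 := mO _ oO1 S1; have mO2 := mO _ oO2 (fun z h => sub2 z (S2 z h)).
have mD := mO _ (@pdisk_open _ z1 z2) (fun _ h => h).
have p0 (A : set C) q : (0 <= (f \_ (cx @^-1` A)) q)%E by rewrite patchE; case: ifP.
rewrite integral_mkcond; apply: (@le_trans _ _ (\int[plane]_q ((f \_ (cx @^-1` B1)) q + (f \_ (cx @^-1` B2)) q))%E).
  apply: ge0_le_integral => //; first by exact: emeasurable_funD.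
  move=> q _; rewrite {1}patchE; case: ifPn => [/set_mem Dq|_]; last by rewrite adde_ge0.
  have [big|small] := ltP M (nm (psum z1 z2 a1 a2 (cx q))).
    have [near1|far1] := ltP (nm (cx q - z1)) r1.
      have Oq : B1 (cx q) by apply: H1 => //; apply: lt_trans big; order_lra.
      by rewrite {1}patchE mem_set // leeDl.
    have [near2|far2] := ltP (nm (cx q - z2)) r2.
      have Oq : B2 (cx q).
        apply: H2 => //; last by rewrite psumC; apply: lt_trans big; order_lra.
        by case: Dq.
      by rewrite [X in (_ <= _ + X)%E]patchE mem_set // leeDr.
    have [hz n1 n2] := Dq.
    have [||b _ _] := HK (cx q) (ltW hz); rewrite ?ge_min ?far1 ?far2 ?orbT //.
    by exfalso; have := lt_le_trans big b; order_lra.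
  rewrite /f /wsum; have [_ ->] : cut (nm (psum z1 z2 a1 a2 (cx q)) ^+ 2 / M ^+ 2) = 1 /\
      dcut (nm (psum z1 z2 a1 a2 (cx q)) ^+ 2 / M ^+ 2) = 0.
    apply: cut_le1; rewrite ler_pdivrMr ?exprn_gt0 // mul1r.
    by apply: lerXn2r; rewrite ?nnegrE ?nm_ge0 // ltW.
  by rewrite mulr0 !mul0r adde_ge0.
rewrite ge0_integralD //; apply: leeD; rewrite -integral_mkcond.
  exact: I1.
apply: le_trans (I2 _ w0 cw); rewrite le_eqVlt; apply/orP; left; apply/eqP.
apply: eq_integral => q _; rewrite /f psumC; congr (_ * nm _ ^+ 2)%:E.
exact: addrC.
Qed.
End PoleCharts.

(** * Comparison of the two bounds *)

Section Core.
Context {R : realType}.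
Local Notation C := R[i].
Local Notation RT := (measurableTypeR R).
Local Notation mu := (@lebesgue_measure R).
Local Notation cut := (@cut R).
Local Notation dcut := (@dcut R).
Implicit Types (M x y t : R).

(* One pole: [s_g] is the coordinate there, [s_finf] its inverse near infinity with the continuations
   [s_psi1], [s_psi2] of it along the rays from +oo and -oo, and [d] is the coefficient of [1 / h] in [p]. *)
Record side (p p' : C -> C) (H : set C) (d : C) := Side {
  s_g : C -> C; s_g' : C -> C; s_y0 : R; s_R0 : R; s_finf : C -> C;
  s_V1 : set C; s_V2 : set C; s_psi1 : C -> C; s_psi2 : C -> C; s_B : R; s_M0 : R;
  s_R0_ge1 : 1 <= s_R0;
  s_open : forall z, H z -> [/\ nm z < 1, complex.Im (s_g z) != s_y0 &
    exists2 r : R, 0 < r & (forall w, nm (w - z) < r -> H w) /\ holo s_g s_g' z r];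
  s_closed : forall z c, nm z < 1 -> complex.Im c != s_y0 ->
    (forall e : R, 0 < e -> exists w, [/\ H w, nm (w - z) < e & nm (s_g w - c) < e]) -> H z /\ s_g z = c;
  s_inf : forall h, s_R0 < nm h -> complex.Im h != s_y0 ->
    [/\ H (s_finf h), s_g (s_finf h) = h, s_g' (s_finf h) != 0 & ccont s_finf h];
  s_S1 : maximal_sheet H s_g s_g' s_R0 s_finf 1 s_V1 s_psi1;
  s_S2 : maximal_sheet H s_g s_g' s_R0 s_finf (-1) s_V2 s_psi2;
  s_agree : forall h, s_V1 h -> s_V2 h -> s_psi1 h = s_psi2 h;
  s_B_ge0 : 0 <= s_B;
  s_p : forall z, H z -> cder p z (p' z) /\ ccont p' z;
  s_bd : forall e : R, 0 < e -> exists2 r : R, 0 < r & forall z, nm z < 1 -> 1 - r < nm z ->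
    `|complex.Re (p z)| <= e /\ nm (p z) <= s_M0;
  s_core : forall z, H z -> nm (s_g z) <= 2 * s_R0 -> nm (p z) <= s_M0;
  s_asym : forall h, s_R0 < nm h -> complex.Im h != s_y0 -> exists E0 E1,
    [/\ p (s_finf h) = h + E0, p' (s_finf h) / s_g' (s_finf h) = 1 - E1 / h ^+ 2,
       nm (E0 - d / h) <= s_B / nm h ^+ 2 & nm (E1 - d) <= s_B / nm h] }.

Lemma countableU (A B : set R) : countable A -> countable B -> countable (A `|` B).
Proof.
move=> cA cB; rewrite -bigcup2E; apply: bigcup_countable => // -[|[|i]] _ //=.
Qed.

(** Retains of one pole what the comparison uses. [N] collects the height [s_y0] and the heights of
    critical values; integrating the line bound over the remaining heights gives at most the energy
    over the image [D] of the branch, by the change of variables. *)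
Lemma side_summary p p' H d (S : side p p' H d) : exists K M1 : R, [/\ 0 <= K, 1 <= M1 & forall M, M1 <= M ->
  exists (N : set R) (D : set C) (line : RT -> \bar R), [/\ countable N, copen D /\ D `<=` H,
    measurable_fun setT line /\ (forall y, 0 <= line y)%E,
    (\int[mu]_y line y <= \int[plane]_(q in cx @^-1` D) (wt p p' M (cx q))%:E)%E &
    forall y, ~ N y -> ((rint (fun x => blow d K M (x +i* y)%C) (- (3 * M)) (3 * M))%:E <= line y)%E]].
Proof.
case: S => g g' y0 R0 finf V1 V2 psi1 psi2 B M0 R01 HH Hcl Hinf S1 S2 OS B0 Hp Hbd Hcore Hasym.
have [K [M1 [K0 M11 HK]]] := line_lower R01 HH Hcl Hinf S1 S2 OS B0 Hp Hbd Hcore Hasym.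
exists K, M1; split=> // M hM; have Mp : 0 < M by apply: lt_le_trans hM; apply: lt_le_trans M11.
pose Om := Om V1 V2; pose phi := phi V1 psi1 psi2.
pose f (q : RT * RT) := ((fun q => (wO g' V1 psi1 psi2 p p' M (cx q))%:E) \_ (cx @^-1` Om)) q.
have oOm : copen Om := Om_open S1 S2.
have w0 h : 0 <= wO g' V1 psi1 psi2 p p' M h by exact: wO_ge0.
have mf : measurable_fun setT f.
  by apply: (copen_patch_measurable oOm) => h Oh; apply: (wO_cont HH S1 S2 OS Hp Mp Oh).
have f0 q : (0 <= f q)%E := patch_ge0 q (fun h _ => w0 h).
exists ([set y0] `|` [set complex.Im (g z) | z in crit H g']), (phi @` Om), (fun y => \int[mu]_x f (x, y))%E.
split.
- by apply: countableU; [exact: finite_set_countable|exact: (crit_countable HH)].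
- split; first exact: (phi_range_open HH S1 S2 OS).
  by move=> z /(phi_range_inv HH S1 S2 OS)[].
- by split; [exact: slice_y_measurable|move=> y; exact: integral_ge0].
- rewrite -plane_int_y // -integral_mkcond.
  apply: (@change_of_variables R Om (phi @` Om) phi (fun h => (g' (phi h))^-1) g (wt p p' M)).
  + exact: oOm.
  + exact: (phi_range_open HH S1 S2 OS).
  + move=> h Oh; have [Hz gz g'z cz] := phi_slift S1 S2 OS Oh; split=> //.
    * exact: (phi_cder HH S1 S2 OS Oh).
    * by rewrite invr_eq0.
    * exact: (phi_dcont HH S1 S2 OS Oh).
  + move=> z /(phi_range_inv HH S1 S2 OS)[Oz pz Hz dz]; split=> //.
    by rewrite /phi pz invrK.
  + by move=> z _; rewrite /wt mulr_ge0 ?sqr_ge0 //; have [] := cut_bounds (nm (p z) ^+ 2 / M ^+ 2).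
  + move=> z /(phi_range_inv HH S1 S2 OS)[_ _ Hz _]; have [D D'] := Hp z Hz.
    apply: rcont_atM; first by apply: rcont_at_cut; exact: cder_cont D.
    by apply: rcont_at_sqr; exact: rcont_at_nm.
- move=> y nN; apply: HK => //.
  + by apply/eqP => e; apply: nN; left.
  + by move=> h; apply: nN; right.
  + exact: (measurableT_comp mf (pair2_measurable y)).
Qed.

Lemma rint_ge_box (f : R -> R) (a u v b m : R) : a <= u -> u <= v -> v <= b -> (forall t, {for t, continuous f}) ->
  (forall t, 0 <= f t) -> (forall t, u <= t <= v -> m <= f t) -> m * (v - u) <= rint f a b.
Proof.
move=> au uv vb cf f0 fm.
rewrite (@rint_split _ f a u b) ?au ?(le_trans uv) // (@rint_split _ f u v b) ?uv //.
have pos s t : 0 <= rint f s t by apply: Rintegral_ge0 => x _; exact: f0.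
have : m * (v - u) <= rint f u v.
  by rewrite -rint_cst //; apply: rint_le => // *; exact: contC.
by have := pos a u; have := pos v b; order_lra.
Qed.

Lemma cutline_cont M y t : {for t, continuous (fun x => cut (nm (x +i* y)%C ^+ 2 / M ^+ 2))} /\
  {for t, continuous (fun x => dcut (nm (x +i* y)%C ^+ 2 / M ^+ 2))}.
Proof.
have cs : {for t, continuous (fun x => nm (x +i* y)%C ^+ 2 / M ^+ 2)}.
  by apply: contM; [apply: nm2_cont; exact: rder_cont (rder_h y t)|exact: contC].
by split; apply: (contcomp cs); [exact: cut_continuous|exact: dcut_continuous].
Qed.

Lemma wsum_line_cont M y t : {for t, continuous (fun x => wsum M (x +i* y)%C)}.
Proof.
have [_ cd] := cutline_cont M y t; apply: contM; last exact: contC; apply: contM cd.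
by apply: contM; [exact: contC|apply: contM; exact: contI].
Qed.

(* Integrating d(x cut) = cut - wsum over a line that leaves the support of cut. *)
Lemma cut_flux M y : 0 < M -> rint (fun x => cut (nm (x +i* y)%C ^+ 2 / M ^+ 2) - wsum M (x +i* y)%C) (- (3 * M)) (3 * M) = 0.
Proof.
move=> M0; have le3 : - (3 * M) <= 3 * M by order_lra.
have F t : is_derive t 1 (fun x => x * cut (nm (x +i* y)%C ^+ 2 / M ^+ 2)) (cut (nm (t +i* y)%C ^+ 2 / M ^+ 2) - wsum M (t +i* y)%C).
  have dn : is_derive t 1 (fun s => nm (s +i* y)%C ^+ 2 / M ^+ 2) (2 * t / M ^+ 2).
    apply: (is_derive_ext (is_deriveZ (M ^+ 2)^-1 (nm2_derive (rder_h y t)))) => [s|]; first by rewrite mulrC.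
    by rewrite -[_ *: _]/(_ * _) mulrC /Rcj /=; ring.
  have dc := @is_derive1_comp R cut (fun s => nm (s +i* y)%C ^+ 2 / M ^+ 2) t _ _ (cut_derive (nm (t +i* y)%C ^+ 2 / M ^+ 2)) dn.
  apply: (is_derive_ext (is_deriveM (is_derive_id t 1) dc)) => [s|] //.
  change (t * (dcut (nm (t +i* y)%C ^+ 2 / M ^+ 2) * (2 * t / M ^+ 2)) + cut (nm (t +i* y)%C ^+ 2 / M ^+ 2) * 1 =
    cut (nm (t +i* y)%C ^+ 2 / M ^+ 2) - wsum M (t +i* y)%C).
  by rewrite /wsum /=; ring.
rewrite (rint_FTC le3 _ (fun t _ => F t)); last first.
  move=> t _; apply: contD; first by have [] := cutline_cont M y t.
  by apply: contN; exact: wsum_line_cont.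
have z t : 3 * M <= `|t| -> cut (nm (t +i* y)%C ^+ 2 / M ^+ 2) = 0.
  move=> ht; apply: (proj1 (cut_ge2 _)); rewrite ler_pdivlMr ?exprn_gt0 // nm_sqr /=.
  have : (3 * M) ^+ 2 <= t ^+ 2 by rewrite -(real_normK (num_real t)); apply: lerXn2r; rewrite ?nnegrE // mulr_ge0 // ltW.
  by rewrite exprMn; have := sqr_ge0 y; have : 0 < M ^+ 2 by [rewrite exprn_gt0]; order_lra.
by rewrite !z ?normrN ?gtr0_norm ?mulr_gt0 // !mulr0 subrr.
Qed.

(** By [cut_flux] the main term of each pole integrates to that of [wsum], the density of the upper
    bound; the errors [K / M ^+ 3] act over a length [6 * M]. *)
Lemma blow_pair M y (d1 d2 : C) (K1 K2 : R) : 0 < M ->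
  rint (fun x => blow d1 K1 M (x +i* y)%C) (- (3 * M)) (3 * M) + rint (fun x => blow d2 K2 M (x +i* y)%C) (- (3 * M)) (3 * M) =
  2 * rint (fun x => wsum M (x +i* y)%C) (- (3 * M)) (3 * M) +
  2 * (complex.Re d1 + complex.Re d2) * rint (fun x => - dcut (nm (x +i* y)%C ^+ 2 / M ^+ 2) / M ^+ 2) (- (3 * M)) (3 * M)
  - 6 * (K1 + K2) / M ^+ 2.
Proof.
move=> M0; have le3 : - (3 * M) <= 3 * M by order_lra.
pose w x := wsum M (x +i* y)%C; pose k x := - dcut (nm (x +i* y)%C ^+ 2 / M ^+ 2) / M ^+ 2.
pose G x := cut (nm (x +i* y)%C ^+ 2 / M ^+ 2) - wsum M (x +i* y)%C.
have F0 : rint G (- (3 * M)) (3 * M) = 0 by exact: cut_flux.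
have cw t : {for t, continuous w} by exact: wsum_line_cont.
have ck t : {for t, continuous k}.
  by apply: contM; [apply: contN; have [] := cutline_cont M y t|exact: contC].
have cG t : {for t, continuous G} by apply: contD; [have [] := cutline_cont M y t|apply: contN].
have rZ r (f : R -> R) : (forall t, {for t, continuous f}) -> rint (fun x => r * f x) (- (3 * M)) (3 * M) = r * rint f (- (3 * M)) (3 * M).
  by move=> cf; rewrite /rint RintegralZl //; apply: cont_integrable.
have one d K : rint (fun x => blow d K M (x +i* y)%C) (- (3 * M)) (3 * M) =
    rint w (- (3 * M)) (3 * M) + 2 * complex.Re d * rint k (- (3 * M)) (3 * M) - 6 * K / M ^+ 2.
  have cc (r : R) t : {for t, continuous (fun=> r)} by exact: contC.
  have -> : (fun x => blow d K M (x +i* y)%C) = (fun x => (G x + w x) + (2 * complex.Re d * k x + - (K / M ^+ 3))).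
    by apply/funext => x; rewrite /blow /G /w /k; ring.
  have ckk t : {for t, continuous (fun x => 2 * complex.Re d * k x)} by apply: contM => //; exact: contC.
  rewrite (@rintD _ (fun x => G x + w x)); last 2 first.
  - by move=> t _; exact: contD.
  - by move=> t _; exact: contD.
  rewrite (@rintD _ G w); [|by move=> t _|by move=> t _].
  rewrite (@rintD _ (fun x => 2 * complex.Re d * k x) (fun=> - (K / M ^+ 3))); [|by move=> t _|by move=> t _].
  rewrite F0 add0r rZ // rint_cst //.
  by field; rewrite gt_eqF.
by rewrite !one; ring.
Qed.

(** For [x] between [11/10 * M] and [13/10 * M] and [|y| <= M / 4] the argument of [dcut] lies
    between 6/5 and 9/5, where [dcut_mid] applies; 4/25 is 4/5 times 2/10. *)
Lemma kappa_lower M y : 0 < M -> `|y| <= M / 4 ->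
  4 / 25 / M <= rint (fun x => - dcut (nm (x +i* y)%C ^+ 2 / M ^+ 2) / M ^+ 2) (- (3 * M)) (3 * M).
Proof.
move=> Mp hy.
have -> : 4 / 25 / M = 4 / 5 / M ^+ 2 * (13 / 10 * M - 11 / 10 * M) by field; rewrite gt_eqF.
have M2 : 0 < M ^+ 2 by rewrite exprn_gt0.
have [b1 b2 b3] : [/\ - (3 * M) <= 11 / 10 * M, 11 / 10 * M <= 13 / 10 * M & 13 / 10 * M <= 3 * M] by split; order_lra.
apply: rint_ge_box => // [t|x|x /andP[x1 x2]].
- by apply: contM; [apply: contN; have [] := cutline_cont M y t|exact: contC].
- by have [_ _ _ h] := cut_bounds (nm (x +i* y)%C ^+ 2 / M ^+ 2); rewrite divr_ge0 ?sqr_ge0 // oppr_ge0.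
rewrite ler_wpM2r ?invr_ge0 ?sqr_ge0 //.
suff /dcut_mid h : 6 / 5 <= nm (x +i* y)%C ^+ 2 / M ^+ 2 <= 9 / 5 by move: h; clear; order_lra.
have x0 : 0 <= x by apply: le_trans x1; rewrite mulr_ge0 // ?divr_ge0 // ltW.
have hy2 : y ^+ 2 <= (M / 4) ^+ 2.
  by rewrite -(real_normK (num_real y)); apply: lerXn2r; rewrite ?nnegrE // divr_ge0 // ltW.
have hx1 : (11 / 10 * M) ^+ 2 <= x ^+ 2 by apply: lerXn2r; rewrite ?nnegrE ?mulr_ge0 ?(ltW Mp) ?divr_ge0.
have hx2 : x ^+ 2 <= (13 / 10 * M) ^+ 2 by apply: lerXn2r; rewrite ?nnegrE ?mulr_ge0 ?(ltW Mp) ?divr_ge0.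
rewrite nm_sqr /= ler_pdivlMr // ler_pdivrMr //.
move: hy2 hx1 hx2 (sqr_ge0 y) M2; rewrite !exprMn; clear.
by move: (M ^+ 2) (x ^+ 2) (y ^+ 2) => m a b *; apply/andP; split; order_lra.
Qed.

Lemma int_patch_cst (c a : R) : 0 < a ->
  (\int[mu]_y ((fun=> c%:E) \_ (`[(- a)%R, a%R]%classic : set RT)) y = (c * (2 * a))%:E)%E.
Proof.
have mI : measurable (`[(- a), a]%classic : set RT) by exact: measurable_itv.
move=> a0; rewrite -integral_mkcond (integral_cst mu mI) /=.
rewrite lebesgue_measure_itv /= lte_fin ifT; last by order_lra.
by rewrite -EFinB -EFinM; congr EFin; ring.
Qed.

Lemma wsum_integral_fin M : 0 < M -> (\int[plane]_q (wsum M (cx q))%:E)%E \is a fin_num.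
Proof.
move=> Mp; pose W (q : RT * RT) := (wsum M (cx q))%:E.
have mW : measurable_fun setT W.
  by apply: plane_measurable => z; apply: (@wsum_cont _ M id); exact: cder_cont (cder_id z).
have W0 q : (0 <= W q)%E by rewrite lee_fin wsum_ge0.
have bW (q : RT * RT) : (W q <= ((fun=> (36 : R)%:E) \_ (disc 0%R (3 * M))) q)%E.
  rewrite patchE; case: ifPn => [_|]; last first.
    rewrite notin_setE /disc /= subr0 => /negP; rewrite -leNgt => h.
    have [_ dz] : cut (nm (cx q) ^+ 2 / M ^+ 2) = 0 /\ dcut (nm (cx q) ^+ 2 / M ^+ 2) = 0.
      apply: cut_ge2; rewrite ler_pdivlMr ?exprn_gt0 //.
      have h3 : (3 * M) ^+ 2 <= nm (cx q) ^+ 2 by apply: lerXn2r; rewrite ?nnegrE ?nm_ge0 ?mulr_ge0 ?(ltW Mp).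
      apply: le_trans h3; rewrite exprMn; have : 0 < M ^+ 2 by rewrite exprn_gt0.
      by move: (M ^+ 2) => m; order_lra.
    by rewrite /W /wsum dz mulr0 mul0r.
  rewrite lee_fin /wsum; have [s2|s2] := leP 2 (nm (cx q) ^+ 2 / M ^+ 2).
    by have [_ ->] := cut_ge2 s2; rewrite mulr0 mul0r.
  have [_ _ h1 h2] := cut_bounds (nm (cx q) ^+ 2 / M ^+ 2).
  have x2 : complex.Re (cx q) ^+ 2 <= 2 * M ^+ 2.
    move: s2; rewrite ltr_pdivrMr ?exprn_gt0 // nm_sqr; have := sqr_ge0 (complex.Im (cx q)); order_lra.
  rewrite ler_pdivrMr ?exprn_gt0 //.
  have := sqr_ge0 (complex.Re (cx q)); move: (dcut (nm (cx q) ^+ 2 / M ^+ 2)) h1 h2 => b h1 h2.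
  move: (complex.Re (cx q) ^+ 2) (M ^+ 2) x2 => a m x2 a0.
  have : a * (- b) <= a * 2 by rewrite ler_wpM2l //; order_lra.
  by rewrite mulrN; order_lra.
rewrite ge0_fin_numE; last by apply: integral_ge0 => q _; exact: W0.
apply: le_lt_trans (_ : (\int[plane]_q ((fun=> (36 : R)%:E) \_ (disc 0%R (3 * M))) q < +oo)%E).
  by apply: ge0_le_integral => //; first [exact: disc_cst_measurable | move=> q _; exact: W0 | move=> q _; exact: bW | exact: mW].
rewrite -integral_mkcond integral_cst; last exact: disc_measurable.
have M3 : 0 < 3 * M by rewrite mulr_gt0.
rewrite [X in (_ * X)%E](disc_measure (0 : C) M3); have := omega_fin (R := R); have := omega_gt0 (R := R).
by case: omega => [a| |] //= _ _; rewrite -!EFinM ltry.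
Qed.

Lemma large_constant (M1 M2 M3 K1 K2 dlt : R) : 0 <= K1 -> 0 <= K2 -> 0 < dlt -> 1 <= M1 -> 1 <= M2 ->
  exists M, [/\ M1 <= M, M2 <= M, M3 <= M, 225 * (K1 + K2) / dlt < M & 1 <= M].
Proof.
move=> K10 K20 dl h1 h2; have q0 : 0 <= 225 * (K1 + K2) / dlt.
  by apply: divr_ge0 (ltW dl); apply: mulr_ge0; [exact: ler0n|exact: addr_ge0].
exists (M1 + M2 + `|M3| + 225 * (K1 + K2) / dlt).
have := ler_norm M3; have := normr_ge0 M3; move: (225 * (K1 + K2) / dlt) q0 `|M3| => q q0 m *.
by split; order_lra.
Qed.

(** The gain [4/25 * dlt] is at most the error [36 * K / M], and 225 is 36 times 25/4. *)
Lemma contradict_constants (M K dlt : R) : 0 < M -> 0 < dlt ->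
  2 * dlt * (4 / 25 / M) * (M / 2) <= 6 * K / M ^+ 2 * (6 * M) -> (225 * K / dlt < M) = false.
Proof.
move=> Mp dl; have -> : 2 * dlt * (4 / 25 / M) * (M / 2) = 4 / 25 * dlt by field; rewrite gt_eqF.
have -> : 6 * K / M ^+ 2 * (6 * M) = 36 * K / M by field; rewrite gt_eqF.
rewrite ler_pdivlMr // => fin; apply/negbTE; rewrite -leNgt ler_pdivlMr //.
have E : 4 / 25 * dlt * M = 4 / 25 * (M * dlt) by ring.
by rewrite E in fin; order_lra.
Qed.

Lemma core_inequality (z1 z2 a1 a2 d1 d2 : C) (H1 H2 : set C) :
  nm z1 < 1 -> nm z2 < 1 -> z1 != z2 -> a1 != 0 -> a2 != 0 ->
  side (psum z1 z2 a1 a2) (psum' z1 z2 a1 a2) H1 d1 -> side (psum z1 z2 a1 a2) (psum' z1 z2 a1 a2) H2 d2 ->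
  H1 `<=` pdisk z1 z2 -> H2 `<=` pdisk z1 z2 -> H1 `&` H2 = set0 ->
  complex.Re d1 + complex.Re d2 <= 0.
Proof.
move=> z11 z21 z12 a10 a20 S1 S2 HD1 HD2 H12.
have [K1 [M1 [K10 M11 Q1]]] := side_summary S1; have [K2 [M2 [K20 M21 Q2]]] := side_summary S2.
have [M3 Q3] := energy_upper z11 z21 z12 a10 a20.
rewrite leNgt; apply/negP => dl; set dlt := complex.Re d1 + complex.Re d2 in dl *.
have [M [hM1 hM2 hM3 hM4 M1']] := @large_constant M1 M2 M3 _ _ _ K10 K20 dl M11 M21.
have Mp : 0 < M by apply: lt_le_trans M1'.
have {Q1} [N1 [D1 [l1 [cN1 [oD1 sD1] [ml1 l10] I1 L1]]]] := Q1 M hM1.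
have {Q2} [N2 [D2 [l2 [cN2 [oD2 sD2] [ml2 l20] I2 L2]]]] := Q2 M hM2.
have {Q3} up := Q3 M Mp hM3.
have M43 : M / 4 <= 3 * M by move: (Mp); clear -R; order_lra.
set p := psum z1 z2 a1 a2 in I1 I2 up *; set p' := psum' z1 z2 a1 a2 in I1 I2 up *.
pose e (q : RT * RT) := (wt p p' M (cx q))%:E.
have e0 q : (0 <= e q)%E.
  by rewrite lee_fin /wt mulr_ge0 ?sqr_ge0 //; have [] := cut_bounds (nm (p (cx q)) ^+ 2 / M ^+ 2).
have me : measurable_fun (cx @^-1` pdisk z1 z2) e.
  apply/measurable_EFinP; apply: (rcont_at_measurable (@pdisk_open _ z1 z2)) => z [hz n1 n2].
  have [D D' _] := psum_der a1 a2 z11 z21 (ltW hz) n1 n2.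
  apply: rcont_atM; first by apply: rcont_at_cut; exact: cder_cont D.
  by apply: rcont_at_sqr; apply: rcont_at_nm; exact: cder_cont D'.
have mD1 := copen_measurable oD1; have mD2 := copen_measurable oD2.
have mpd := copen_measurable (@pdisk_open _ z1 z2).
have sub1 q : D1 (cx q) -> pdisk z1 z2 (cx q) by move=> /sD1/HD1.
have sub2 q : D2 (cx q) -> pdisk z1 z2 (cx q) by move=> /sD2/HD2.
(* [H1] and [H2] are disjoint, so the two energies add up within the punctured disk. *)
have sum12 : (\int[plane]_(q in cx @^-1` D1) e q + \int[plane]_(q in cx @^-1` D2) e q <=
    \int[plane]_(q in cx @^-1` pdisk z1 z2) e q)%E.
  have sU : (cx @^-1` D1 `|` cx @^-1` D2) `<=` cx @^-1` pdisk z1 z2 by move=> q [/sub1|/sub2].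
  rewrite -ge0_integral_setU //.
  - by apply: ge0_subset_integral => //; exact: measurableU.
  - exact: measurable_funS me.
  - apply/disj_setPS => q [/sD1 h1 /sD2 h2].
    by have : (H1 `&` H2) (cx q) by []; rewrite H12.
have {}up : (\int[mu]_y l1 y + \int[mu]_y l2 y <= \int[plane]_q (wsum M (cx q))%:E + \int[plane]_q (wsum M (cx q))%:E)%E.
  by apply: le_trans (leeD I1 I2) _; apply: le_trans sum12 _; exact: up.
pose W (q : RT * RT) := (wsum M (cx q))%:E.
have mW : measurable_fun setT W.
  by apply: plane_measurable => z; apply: (@wsum_cont _ M id); exact: cder_cont (cder_id z).
have W0 q : (0 <= W q)%E by rewrite lee_fin wsum_ge0.
pose Wy y := (\int[mu]_x W (x, y))%E.
have mWy : measurable_fun setT Wy by exact: slice_y_measurable.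
have Wy0 y : (0 <= Wy y)%E by exact: integral_ge0.
have Wout (x y : R) : 3 * M < `|x| \/ 3 * M < `|y| -> W (x, y) = 0%E.
  move=> hxy; have [_ dz] : cut (nm (x +i* y)%C ^+ 2 / M ^+ 2) = 0 /\ dcut (nm (x +i* y)%C ^+ 2 / M ^+ 2) = 0.
    apply: cut_ge2; rewrite ler_pdivlMr ?exprn_gt0 //.
    have h3 : (3 * M) ^+ 2 <= nm (x +i* y)%C ^+ 2.
      apply: lerXn2r; rewrite ?nnegrE ?nm_ge0 ?mulr_ge0 ?(ltW Mp) //.
      by case: hxy => /ltW h; apply: le_trans h _; [exact: (Re_le_nm (x +i* y)%C)|exact: (Im_le_nm (x +i* y)%C)].
    apply: le_trans h3; rewrite exprMn; have m0 : 0 < M ^+ 2 by rewrite exprn_gt0.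
    by rewrite ler_pM2r // -natrX ler_nat.
  by rewrite /W /wsum /cx /= dz mulr0 mul0r.
have WyE y : Wy y = (rint (fun x => wsum M (x +i* y)%C) (- (3 * M)) (3 * M))%:E.
  have ci : mu.-integrable `[(- (3 * M)), (3 * M)] (EFin \o (fun x => wsum M (x +i* y)%C)).
    by apply: cont_integrable => t _; exact: wsum_line_cont.
  rewrite /rint /Rintegral fineK; last exact: integrable_fin_num.
  rewrite [RHS]integral_mkcond; apply: eq_integral => x _; rewrite patchE.
  case: ifPn => [//|]; rewrite notin_setE /= in_itv /= => /negP; rewrite -ler_norml -ltNge => h.
  by rewrite Wout //; left.
pose Y := `[(- (3 * M)), (3 * M)]%classic : set RT; pose J := `[(- (M / 4)), (M / 4)]%classic : set RT.
(* Per line, [c0] is the error for [|y| <= 3 * M] and [c1] the gain for [|y| <= M / 4]. Each stands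
   on the side where it is added, so that only nonnegative functions are integrated. *)
pose c0 := 6 * (K1 + K2) / M ^+ 2; pose c1 := 2 * dlt * (4 / 25 / M).
have c00 : 0 <= c0 by rewrite divr_ge0 ?sqr_ge0 // mulr_ge0 // addr_ge0.
have c10 : 0 <= c1.
  by rewrite /c1; apply: mulr_ge0; [apply: mulr_ge0 => //; exact: ltW|rewrite !divr_ge0 // ltW].
have mpatch (c : R) (A : set RT) : measurable A -> measurable_fun setT ((fun=> c%:E) \_ A).
  by move=> mA; apply/(measurable_restrictT _ mA); exact: measurable_cst.
have patch0 (c : R) (A : set RT) y : 0 <= c -> (0 <= ((fun=> c%:E) \_ A) y)%E.
  by move=> cc; rewrite patchE; case: ifP.
have mY : measurable Y by exact: measurable_itv.
have mJ : measurable J by exact: measurable_itv.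
pose f1 y := (l1 y + l2 y + ((fun=> c0%:E) \_ Y) y)%E; pose f2 y := (Wy y + Wy y + ((fun=> c1%:E) \_ J) y)%E.
have cmp : (\int[mu]_y f2 y <= \int[mu]_y f1 y)%E.
  apply: (@le_integral_off_countable _ (N1 `|` N2)) => //.
  - exact: countableU.
  - by move=> y _; apply: adde_ge0; [exact: adde_ge0|exact: patch0].
  - by move=> y _; apply: adde_ge0; [exact: adde_ge0|exact: patch0].
  - by apply: emeasurable_funD; [exact: emeasurable_funD|exact: mpatch].
  - by apply: emeasurable_funD; [exact: emeasurable_funD|exact: mpatch].
  move=> y _ nN; have [n1 n2] : ~ N1 y /\ ~ N2 y by split=> h; apply: nN; [left|right].
  have [yY|yY] := boolP (y \in Y); last first.
    have yJ : y \notin J.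
      move: yY; rewrite !notin_setE => h h'; apply: h; move: h'; rewrite /J /Y /= !in_itv /= -!ler_norml.
      by move=> h; apply: le_trans h M43.
    rewrite /f2 /f1 !patchE (negbTE yY) (negbTE yJ) !adde0.
    have -> : Wy y = 0%E.
      apply: integral0_eq => x _; apply: Wout; right.
      by move: yY; rewrite notin_setE /Y /= in_itv /= => /negP; rewrite -ler_norml -ltNge.
    by rewrite adde0 adde_ge0.
  have := leeD (L1 y n1) (L2 y n2); rewrite -EFinD blow_pair // => low.
  rewrite /f1 /f2 [((fun=> c0%:E) \_ Y) y]patchE yY; apply: le_trans (leeD low (lexx c0%:E)).
  rewrite WyE patchE; set w := rint _ _ _; set k := rint _ _ _; rewrite -/dlt.
  have kpos x : 0 <= - dcut (nm (x +i* y)%C ^+ 2 / M ^+ 2) / M ^+ 2.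
    by have [_ _ _ h] := cut_bounds (nm (x +i* y)%C ^+ 2 / M ^+ 2); rewrite divr_ge0 ?sqr_ge0 // oppr_ge0.
  have ck t : {for t, continuous (fun x => - dcut (nm (x +i* y)%C ^+ 2 / M ^+ 2) / M ^+ 2)}.
    by apply: contM; [apply: contN; have [] := cutline_cont M y t|exact: contC].
  have k0 : 0 <= k by apply: Rintegral_ge0 => x _; exact: kpos.
  have kJ : y \in J -> 4 / 25 / M <= k.
    by rewrite inE /J /= in_itv /= -ler_norml => hy; exact: kappa_lower.
  have dl2 : 0 <= 2 * dlt by rewrite mulr_ge0 // ltW.
  have E : 2 * w + 2 * dlt * k - 6 * (K1 + K2) / M ^+ 2 + c0 = w + w + 2 * dlt * k by rewrite /c0; ring.
  have -> : (if y \in J then c1%:E else point) = (if y \in J then c1 else 0)%:E by case: ifP.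
  rewrite -!EFinD E lee_fin lerD2l; case: ifPn => [/kJ kk|_]; last exact: mulr_ge0.
  by rewrite /c1 ler_wpM2l.
have i1 : (\int[mu]_y f1 y = \int[mu]_y l1 y + \int[mu]_y l2 y + (c0 * (6 * M))%:E)%E.
  rewrite ge0_integralD //; last 4 first.
  - by move=> y _; rewrite adde_ge0.
  - exact: emeasurable_funD.
  - by move=> y _; rewrite patch0.
  - exact: mpatch.
  rewrite ge0_integralD // (@int_patch_cst c0 (3 * M)) ?mulr_gt0 //.
  by congr (_ + _)%E; congr EFin; ring.
have i2 : (\int[mu]_y f2 y = \int[plane]_q W q + \int[plane]_q W q + (c1 * (M / 2))%:E)%E.
  rewrite ge0_integralD //; last 4 first.
  - by move=> y _; rewrite adde_ge0.
  - exact: emeasurable_funD.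
  - by move=> y _; rewrite patch0.
  - exact: mpatch.
  rewrite ge0_integralD // -plane_int_y // (@int_patch_cst c1 (M / 4)) ?divr_gt0 //.
  by congr (_ + _)%E; congr EFin; field.
(* Finiteness lets the common main term, twice the integral of [W], be cancelled. *)
have Wfin : (\int[plane]_q W q)%E \is a fin_num by exact: wsum_integral_fin.
have fin : ((c1 * (M / 2))%:E <= (c0 * (6 * M))%:E)%E.
  have : (\int[plane]_q W q + \int[plane]_q W q + (c1 * (M / 2))%:E <=
    \int[plane]_q W q + \int[plane]_q W q + (c0 * (6 * M))%:E)%E.
    by rewrite -i2; apply: le_trans cmp _; rewrite i1; apply: leeD2r.
  by rewrite leeD2lE // fin_numD Wfin.
move: fin; rewrite lee_fin /c0 /c1.
by move/(contradict_constants Mp dl); rewrite hM4.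
Qed.
End Core.

(** * The Schwarzian derivative and the expansion at a pole *)

Section Bridge.
Context {R : realType}.
Local Notation C := R[i].
Implicit Types (z u : C) (G : C -> C).

(** In the order of [R[i]] a positive element is real, which turns the radii of the norm topology
    into real ones. *)
Lemma posC (e : C) : 0 < e -> exists2 r : R, 0 < r & e = r%:C%C.
Proof.
by case: e => a b; rewrite ltcE /= => /andP[/eqP -> a0]; exists a.
Qed.

Lemma nearC z (P : C -> Prop) : (\forall u \near z, P u) <-> exists2 r : R, 0 < r & forall u, nm (u - z) < r -> P u.
Proof.
split=> [/nbhs_ballP[e /= /posC[r r0 ->] H]|[r r0 H]].
  exists r => // u hu; apply: H; rewrite /ball /=.
  by rewrite normE ltcR nmBC.
apply/nbhs_ballP; exists r%:C%C => /=; first by rewrite ltcR.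
by move=> u; rewrite /ball /= normE ltcR nmBC => /H.
Qed.

Lemma near'C z (P : C -> Prop) : (\forall u \near z^', P u) <-> exists2 r : R, 0 < r & forall u, nm (u - z) < r -> u != z -> P u.
Proof.
split=> [H|[r r0 H]].
  have /nearC[r r0 H'] : \forall u \near z, (u != z -> P u) := H.
  by exists r.
suff : \forall u \near z, (u != z -> P u) by [].
by apply/nearC; exists r.
Qed.

Lemma cder_derivable G z l : cder G z l -> derivable G z 1 /\ derive1 G z = l.
Proof.
move=> H.
suff L : h^-1 *: ((G \o shift z) (h *: 1) - G z) @[h --> 0^'] --> l.
  split; first exact: cvgP L.
  by rewrite derive1E; apply: cvg_lim L.
apply/cvgrPdist_le => /= e /posC[r r0 ->]; have [d d0 Hd] := H r r0.
apply/near'C; exists d => // h; rewrite subr0 => hd h0.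
rewrite normE lecR nmBC /shift /= -[h *: 1]/(h * 1) mulr1 -[_ *: _]/(_ * _).
have nh : 0 < nm h by rewrite nm_gt0.
have := Hd (h + z); rewrite addrK => /(_ hd) Hh.
rewrite -(ler_pM2r nh) -nmM; apply: le_trans Hh.
by rewrite le_eqVlt; apply/orP; left; apply/eqP; congr nm; field.
Qed.

Lemma derivable_cder G z : derivable G z 1 -> cder G z (derive1 G z).
Proof.
move=> D; have L : h^-1 *: ((G \o shift z) (h *: 1) - G z) @[h --> 0^'] --> derive1 G z.
  by rewrite derive1E; exact: D.
move=> e e0; have eC : (0 : C) < e%:C%C by rewrite ltcR.
move/cvgrPdist_le : L => /(_ _ eC)/near'C[d d0 Hd].
exists d => // w hw; have [->|wz] := eqVneq w z.
  by rewrite !subrr mulr0 subrr nm0 mulr0.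
have := Hd (w - z); rewrite subr0 subr_eq0 => /(_ hw wz) h.
rewrite normE lecR nmBC /shift /= -[_ *: 1]/(_ * 1) mulr1 -[_ *: _]/(_ * _) subrK in h.
have nh : 0 < nm (w - z) by rewrite nm_gt0 subr_eq0.
rewrite -(ler_pM2r nh) -nmM in h; apply: le_trans h.
by rewrite le_eqVlt; apply/orP; left; apply/eqP; congr nm; field; rewrite subr_eq0.
Qed.

Lemma holomorphicE G z : holomorphic_at G z <-> exists r G', 0 < r /\ holo G G' z r.
Proof.
split=> [/nearC[r r0 H]|[r [G' [r0 H]]]].
  by exists r, (derive1 G); split=> // u /H; exact: derivable_cder.
by apply/nearC; exists r => // u /H/cder_derivable[].
Qed.

Lemma holo_derive1 G G' z (r : R) : holo G G' z r -> forall u, nm (u - z) < r -> derive1 G u = G' u.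
Proof. by move=> H u /H/cder_derivable[]. Qed.
End Bridge.

(** * Taylor coefficients and the normal form at a pole *)

Section LocalExpansion.
Context {R : realType}.
Local Notation C := R[i].
Implicit Types (z u : C) (G m : C -> C) (r : R).

Lemma holoS G G' z r r' : r' <= r -> holo G G' z r -> holo G G' z r'.
Proof. by move=> h H w hw; apply: H; apply: lt_le_trans h. Qed.

Lemma local_expansion G G' z0 r : 0 < r -> holo G G' z0 r -> exists r' m, exists m1 m2 m3 : C -> C,
  [/\ 0 < r' <= r, holo m m1 z0 r', holo m1 m2 z0 r', holo m2 m3 z0 r' &
  forall z, nm (z - z0) < r' -> G z = G z0 + (z - z0) * m z].
Proof.
move=> r0 HG; have [r1 r10 [m [m1 [H1 E]]]] := hol_factor r0 HG.
have [r2 r20 [m2 H2]] := hol_deriv r10 H1; have [r3 r30 [m3 H3]] := hol_deriv r20 H2.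
pose q := Num.min (Num.min r r1) (Num.min r2 r3).
have [q0 q1 q2 q3 q4] : [/\ 0 < q, q <= r, q <= r1, q <= r2 & q <= r3].
  by rewrite /q !lt_min !ge_min r0 r10 r20 r30 !lexx !orbT.
exists q, m, m1, m2, m3; split; rewrite ?q0 ?q1 //; try exact: holoS; try exact: holoS H1 || exact: holoS H2 || exact: holoS H3.
by move=> z hz; apply: E; apply: lt_le_trans q2.
Qed.

Lemma lin_der z0 z : cder (fun w => w - z0) z 1.
Proof. by have := cderB (cder_id z) (cder_cst z0 z); rewrite subr0. Qed.

Lemma holo_factorD m m1 z0 r : holo m m1 z0 r -> forall c, holo (fun z => c + (z - z0) * m z) (fun z => m z + (z - z0) * m1 z) z0 r.
Proof.
move=> H c z hz; have := cderD (cder_cst c z) (cderM (lin_der z0 z) (H z hz)).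
by rewrite add0r mul1r.
Qed.

Lemma holo_factorD' m m1 m2 z0 r : holo m m1 z0 r -> holo m1 m2 z0 r -> forall k : C,
  holo (fun z => k * m z + (z - z0) * m1 z) (fun z => (k + 1) * m1 z + (z - z0) * m2 z) z0 r.
Proof.
move=> H H1 k z hz; have := cderD (cderZ k (H z hz)) (cderM (lin_der z0 z) (H1 z hz)).
by congr cder; ring.
Qed.

Lemma loc_ball z0 z r : nm (z - z0) < r -> exists2 d : R, 0 < d & forall w, nm (w - z) < d -> nm (w - z0) < r.
Proof.
move=> hz; exists (r - nm (z - z0)); first by rewrite subr_gt0.
by move=> w; have := nmBD z w z0; order_lra.
Qed.

Lemma holo_ext F G F' z0 r : (forall z, nm (z - z0) < r -> F z = G z) -> holo F F' z0 r -> holo G F' z0 r.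
Proof.
move=> E H z hz; have [d d0 Hd] := loc_ball hz; apply: cder_ext (H z hz).
by exists d => // w /Hd/E.
Qed.

(** For [G = G z0 + (z - z0) * m] the first three derivatives at [z0] are [m], [2 m'] and [3 m''],
    and this is the Schwarzian [G''' / G' - 3/2 (G'' / G')^2] there. *)
Definition sch (m m1 m2 : C -> C) z0 := 3 * m2 z0 / m z0 - 6 * (m1 z0 / m z0) ^+ 2.

Lemma deriv_schwarzian (F : C -> sphere R) G m m1 m2 m3 z0 r : 0 < r ->
  (forall z, nm (z - z0) < r -> F z = fin_pt (G z)) -> (forall z, nm (z - z0) < r -> G z = G z0 + (z - z0) * m z) ->
  holo m m1 z0 r -> holo m1 m2 z0 r -> holo m2 m3 z0 r ->
  Defs.deriv F z0 = m z0 /\ (m z0 != 0 -> schwarzian F z0 = sch m m1 m2 z0).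
Proof.
move=> r0 FG GE H H1 H2; have z00 : nm (z0 - z0) < r by rewrite subrr nm0.
pose f1 z := m z + (z - z0) * m1 z; pose f2 z := 2 * m1 z + (z - z0) * m2 z; pose f3 z := 3 * m2 z + (z - z0) * m3 z.
have D0 : holo (finite_part F) f1 z0 r.
  by apply: holo_ext (holo_factorD H (G z0)) => z hz; rewrite /finite_part FG //= -GE.
have E1 z : nm (z - z0) < r -> derive1 (finite_part F) z = f1 z by exact: holo_derive1.
have D1 : holo (derive1 (finite_part F)) f2 z0 r.
  have := holo_factorD' H H1 1; have -> : (1 + 1 : C) = 2 by [].
  by apply: holo_ext => z hz; rewrite E1 // /f1 mul1r.
have E2 z : nm (z - z0) < r -> derive1n 2 (finite_part F) z = f2 z by exact: holo_derive1.
split=> [|m0]; first by rewrite /Defs.deriv E1 // /f1 subrr mul0r addr0.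
have D2 : cder f2 z0 (f3 z0).
  have := holo_factorD' H1 H2 2 z00; have -> : (2 + 1 : C) = 3 by ring.
  by [].
have D1' : cder f1 z0 (f2 z0) by apply: cder_ext (D1 z0 z00); exists r.
have f10 : f1 z0 = m z0 by rewrite /f1 subrr mul0r addr0.
have f20 : f2 z0 = 2 * m1 z0 by rewrite /f2 subrr mul0r addr0.
have f30 : f3 z0 = 3 * m2 z0 by rewrite /f3 subrr mul0r addr0.
have f1n : f1 z0 != 0 by rewrite f10.
have DT := cder_div D2 D1' f1n.
rewrite /schwarzian; set T := (fun u => _).
have [_ ->] : derivable T z0 1 /\ derive1 T z0 = (f3 z0 * f1 z0 - f2 z0 * f2 z0) / f1 z0 ^+ 2.
  apply: cder_derivable; apply: cder_ext DT; exists r => // w hw.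
  by rewrite /T E1 // E2.
by rewrite /T E1 // E2 // f10 f20 f30 /sch; field.
Qed.

(** With [1 / v = al / (z - z0) + N2] and [p = al / (z - z0) + rho], the difference
    [p - 1 / v = rho - N2] is holomorphic at [z0]. Its value there is the shift [be], and its
    derivative times [al] is [d], because [z - z0] is [al / h] to first order. The Schwarzian enters
    through the derivative of [N2]. *)
Lemma pole_normal_form (G m m1 m2 m3 rho rho' : C -> C) (z0 w2 : C) (r e : R) : 0 < r -> 0 < e ->
  (forall z, nm (z - z0) < r -> G z = G z0 + (z - z0) * m z) ->
  holo m m1 z0 r -> holo m1 m2 z0 r -> holo m2 m3 z0 r -> holo rho rho' z0 r ->
  m z0 != 0 -> w2 - G z0 != 0 ->
  let D := w2 - G z0 in let v z := ((2 * G z - G z0 - w2) / D) ^+ 2 - 1 in let al := - (D / 4) / m z0 in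
  exists (be d : C) (R0 B : R) (i : C -> C),
  [/\ d = al * rho' z0 - 1 / 16 + D ^+ 2 / 96 * sch m m1 m2 z0 / m z0 ^+ 2, 1 <= R0 /\ 0 <= B,
   (exists2 e' : R, 0 < e' & forall z, nm (z - z0) < e' -> z != z0 -> v z != 0 /\ 2 * R0 < nm ((v z)^-1 + be)),
   (forall e' : R, 0 < e' -> exists T : R, forall h, T < nm h -> nm (i h^-1 - z0) < e') &
   forall h, R0 < nm h -> [/\ nm (i h^-1 - z0) < e /\ i h^-1 != z0, v (i h^-1) != 0 /\ (v (i h^-1))^-1 + be = h,
     ccont (fun h => i h^-1) h &
     exists gd E0 E1, [/\ cder (fun z => (v z)^-1) (i h^-1) gd, gd != 0, al / (i h^-1 - z0) + rho (i h^-1) = h + E0,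
      (- al / (i h^-1 - z0) ^+ 2 + rho' (i h^-1)) / gd = 1 - E1 / h ^+ 2 &
      nm (E0 - d / h) <= B / nm h ^+ 2 /\ nm (E1 - d) <= B / nm h]]].
Proof.
move=> r0 e0 GE H H1 H2 Hrho m0 D0 D v al.
have z00 : nm (z0 - z0) < r by rewrite subrr nm0.
have DG := holo_ext (fun z hz => esym (GE z hz)) (holo_factorD H (G z0)).
pose G1 z := m z + (z - z0) * m1 z; pose G2 z := 2 * m1 z + (z - z0) * m2 z.
have DG1 : holo G1 G2 z0 r.
  by have := holo_factorD' H H1 1; apply: holo_ext => z hz; rewrite /G1 mul1r.
(* [v] is [om - 1] times [om + 1], that is [k * (G - G z0) * (G - w2)], so [n] is [v] divided by
   [z - z0]. *)
pose k : C := 4 / D ^+ 2.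
pose n z := k * (m z * (G z - w2)); pose n1 z := k * (m1 z * (G z - w2) + m z * G1 z).
pose n2 z := k * (m2 z * (G z - w2) + m1 z * G1 z + (m1 z * G1 z + m z * G2 z)).
have DGw z : nm (z - z0) < r -> cder (fun z => G z - w2) z (G1 z).
  by move=> hz; have := cderB (DG z hz) (cder_cst w2 z); rewrite subr0.
have Dn : holo n n1 z0 r by move=> z hz; apply: cderZ; exact: cderM (H z hz) (DGw z hz).
have Dn1 : holo n1 n2 z0 r.
  by move=> z hz; apply: cderZ; apply: cderD; [exact: cderM (H1 z hz) (DGw z hz)|exact: cderM (H z hz) (DG1 z hz)].
have nz0 : n z0 = - (4 * m z0 / D).
  by rewrite /n /k /D; field.
have n0 : n z0 != 0 by rewrite nz0 oppr_eq0 mulf_neq0 ?invr_eq0 // mulf_neq0 // pnatr_eq0.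
have nn0 : 0 < nm (n z0) by rewrite nm_gt0.
have [q1 q10 Q1] := cder_cont (Dn z0 z00) nn0.
pose r1 := Num.min r q1; have r10 : 0 < r1 by rewrite lt_min r0.
have nN z : nm (z - z0) < r1 -> n z != 0.
  by rewrite lt_min => /andP[_ /Q1]; apply: contraTneq => ->; rewrite sub0r nmN ltxx.
have r1r : r1 <= r by rewrite ge_min lexx.
clearbody r1.
pose N z := (n z)^-1; pose N1 z := - n1 z / n z ^+ 2.
have DN : holo N N1 z0 r1.
  by move=> z hz; apply: cder_invf (nN z hz); apply: Dn; apply: lt_le_trans r1r.
have [r2 r20 [N2 [N2' [DN2 NE]]]] := hol_factor r10 DN.
have [r3 r30 [N2'' DN2']] := hol_deriv r20 DN2.
have Nal : N z0 = al by rewrite /N nz0 /al /D; field; rewrite m0.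
(* [N2' z0] is half the second derivative of [N], found by differentiating
   [N = N z0 + (z - z0) * N2] twice. *)
have N2v : N2' z0 = al * (m z0 ^+ 2 / D ^+ 2 - sch m m1 m2 z0 / 6).
  have E : forall z, nm (z - z0) < Num.min r1 r2 -> N1 z = N2 z + (z - z0) * N2' z.
    move=> z; rewrite lt_min => /andP[h1 h2]; apply: cder_unique (DN z h1) _.
    exact: (holo_ext (fun z hz => esym (NE z hz)) (holo_factorD DN2 (N z0)) h2).
  have z03 : nm (z0 - z0) < r3 by rewrite subrr nm0.
  have z02 : nm (z0 - z0) < r2 by rewrite subrr nm0.
  have L := cderD (DN2 z0 z02) (cderM (lin_der z0 z0) (DN2' z0 z03)).
  have L2 := cder_div (cderN (Dn1 z0 z00)) (cderX 1 (Dn z0 z00)) (expf_neq0 2 n0).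
  have E2 : N2' z0 + (1 * N2' z0 + (z0 - z0) * N2'' z0) = ((- n2 z0) * n z0 ^+ 2 - (- n1 z0) * (2 * n z0 ^+ 1 * n1 z0)) / (n z0 ^+ 2) ^+ 2.
    apply: cder_unique L _; apply: cder_ext L2; exists (Num.min r1 r2); first by rewrite lt_min r10.
    by move=> w /E.
  have -> : N2' z0 = (N2' z0 + (1 * N2' z0 + (z0 - z0) * N2'' z0)) / 2 by field.
  have gw : G z0 - w2 = - D by rewrite /D; ring.
  rewrite E2 /n2 /n1 /n /G1 /G2 subrr !mul0r !addr0 gw /al /k /sch.
  by field; rewrite D0 m0.
pose r4 := Num.min (Num.min r1 r2) (Num.min r e); have r40 : 0 < r4 by rewrite !lt_min r10 r20 r0.
have [r41 r42 r4r r4e] : [/\ r4 <= r1, r4 <= r2, r4 <= r & r4 <= e].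
  by rewrite /r4 !ge_min !lexx !orbT.
clearbody r4.
pose E z := rho z - N2 z; pose E' z := rho' z - N2' z.
have DE : holo E E' z0 r4 by move=> z hz; apply: cderB; [apply: Hrho|apply: DN2]; apply: lt_le_trans hz _.
pose be := E z0.
have al0 : al != 0 by rewrite -Nal invr_eq0.
pose P z := N z + be * (z - z0).
have DP z : nm (z - z0) < r1 -> cder P z (N1 z + be * 1).
  by move=> hz; apply: cderD; [exact: DN|apply: cderZ; exact: lin_der].
have Pz0 : P z0 = al by rewrite /P subrr mulr0 addr0 Nal.
have nal : 0 < nm (P z0) by rewrite Pz0 nm_gt0.
have z01 : nm (z0 - z0) < r1 by rewrite subrr nm0.
have [q2 q20 Q2] := cder_cont (DP z0 z01) nal.
pose r5 := Num.min r4 q2; have r50 : 0 < r5 by rewrite lt_min r40.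
have r54 : r5 <= r4 by rewrite ge_min lexx.
have PN z : nm (z - z0) < r5 -> P z != 0.
  by rewrite lt_min => /andP[_ /Q2]; apply: contraTneq => ->; rewrite sub0r nmN ltxx.
(* [V] is [1 / h] for [h = 1 / v + be], a local coordinate vanishing at the pole. *)
pose V z := (z - z0) / P z; pose V' z := (1 * P z - (z - z0) * (N1 z + be * 1)) / P z ^+ 2.
have DV : holo V V' z0 r5.
  move=> z hz; apply: cder_div (lin_der z0 z) _ (PN z hz); apply: DP.
  by apply: lt_le_trans hz _; apply: le_trans r41.
have Vz0 : V z0 = 0 by rewrite /V subrr mul0r.
have V'z0 : V' z0 = al^-1 by rewrite /V' subrr mul0r subr0 mul1r Pz0; field.
have V'0 : V' z0 != 0 by rewrite V'z0 invr_eq0.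
have vE z : nm (z - z0) < r5 -> v z = (z - z0) * n z.
  by move=> hz; rewrite /v /n (GE z) /k /D; [field|apply: lt_le_trans hz _; exact: le_trans r4r].
have vN z : nm (z - z0) < r5 -> z != z0 -> [/\ v z != 0, V z != 0 & (v z)^-1 = (V z)^-1 - be].
  move=> hz zz; have zz' : z - z0 != 0 by rewrite subr_eq0.
  have nz : n z != 0 by apply: nN; apply: lt_le_trans hz _; exact: le_trans r41.
  split; [by rewrite vE // mulf_neq0|by rewrite /V mulf_neq0 ?invr_eq0 // PN|].
  rewrite vE // /V invf_div /P /N; move: (n z) nz (z - z0) zz' => q q0' t t0.
  by field; rewrite q0' t0.
have pE z : nm (z - z0) < r5 -> z != z0 -> al / (z - z0) + rho z = (v z)^-1 + E z.
  move=> hz zz; have zz' : z - z0 != 0 by rewrite subr_eq0.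
  have h2 : nm (z - z0) < r2 by apply: lt_le_trans hz _; exact: le_trans r42.
  rewrite vE // invfM -/(N z) NE // Nal /E; field.
  by [].
have [r' [d0 [i [/andP[r'0 r'5] d00 I I' Hi]]]] := inverse_function r50 DV V'0.
rewrite Vz0 in Hi.
have i0 : i 0 = z0.
  have [|i1 i2 _] := Hi 0; first by rewrite subrr nm0.
  by apply: I; rewrite ?i2 ?Vz0 // subrr nm0.
have Di : holo i (fun u => (V' (i u))^-1) 0 d0 by move=> u hu; have [] := Hi u hu.
have DEi : holo (fun u => E (i u)) (fun u => E' (i u) * (V' (i u))^-1) 0 d0.
  move=> u hu; have [i1 _ _] := Hi u hu; apply: cder_comp (Di u hu) _; apply: DE.
  by apply: lt_le_trans i1 _; exact: le_trans r54.
have [d1 [B [d10 B0 HB]]] := holo_taylor d00 DEi.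
rewrite i0 V'z0 invrK in HB.
(* For [nm h > R0] the point [1 / h] lies both in the domain of the inverse [i], of radius [d0], and
   in the disc of the Taylor bound, of radius [d1]. *)
pose d := E' z0 * al; pose R0 := 1 + d0^-1 + d1^-1.
have di0 : 0 < d0^-1 by rewrite invr_gt0.
have di1 : 0 < d1^-1 by rewrite invr_gt0.
have small (T : R) h : 0 < T -> T^-1 < nm h -> nm (h^-1 - 0) < T.
  move=> T0 hT; rewrite subr0 nmV -[ltRHS]invrK ltf_pV2 ?posrE ?invr_gt0 //.
  by apply: lt_trans hT; rewrite invr_gt0.
have z05 : nm (z0 - z0) < r5 by rewrite subrr nm0.
exists be, d, R0, B, i; split.
- by rewrite /d /E' N2v /al; field; rewrite m0.
- by split=> //; rewrite /R0; clear -di0 di1; lra.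
- have R00 : 0 < (2 * R0)^-1 by rewrite invr_gt0 mulr_gt0 // /R0; clear -di0 di1; lra.
  have [q3 q30 Q3] := cder_cont (DV z0 z05) R00.
  exists (Num.min r5 q3); first by rewrite lt_min r50.
  move=> z; rewrite lt_min => /andP[h1 /Q3]; rewrite Vz0 subr0 => h3 zz.
  have [v1 v2 ->] := vN z h1 zz; split=> //; rewrite subrK nmV -[ltLHS]invrK ltf_pV2 ?posrE ?nm_gt0 //.
- move=> e' e'0; have h00 : nm (0 - 0 : C) < d0 by rewrite subrr nm0.
  have [q3 q30 Q3] := cder_cont (Di 0 h00) e'0; exists q3^-1 => h hh.
  by rewrite -i0; apply: Q3; exact: small.
move=> h hh; have h0 : h != 0 by rewrite -nm_gt0; apply: lt_trans hh; rewrite /R0; clear -di0 di1; lra.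
have hd0 : nm (h^-1 - 0) < d0 by apply: small => //; move: hh; rewrite /R0; clear -di0 di1; lra.
have hd1 : nm (h^-1 - 0) < d1 by apply: small => //; move: hh; rewrite /R0; clear -di0 di1; lra.
have [i1 i2 i3] := Hi _ hd0.
have iz : i h^-1 != z0 by apply: contra_neq (invr_neq0 h0) => e1; rewrite -i2 e1.
have h5 : nm (i h^-1 - z0) < r5 by apply: lt_le_trans r'5.
have [v1 v2 v3] := vN _ h5 iz.
split.
- by split=> //; apply: lt_le_trans h5 _; exact: le_trans r4e.
- by split=> //; rewrite v3 subrK i2 invrK.
- exact: cder_cont (cder_comp (cder_inv h0) i3).
pose z := i h^-1; pose gd := - V' z / V z ^+ 2.
have near (F1 F2 : C -> C) l : (forall w, nm (w - z0) < r5 -> w != z0 -> F1 w = F2 w) -> cder F1 z l -> cder F2 z l.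
  move=> F12; apply: cder_ext; exists (Num.min (r5 - nm (z - z0)) (nm (z - z0))).
    by rewrite lt_min subr_gt0 h5 nm_gt0 subr_eq0.
  move=> w; rewrite lt_min => /andP[hw1 hw2]; apply: F12; first by have := nmBD z w z0; clear -h5 hw1; lra.
  by apply: contraTneq hw2 => ->; rewrite nmBC ltxx.
have Dg : cder (fun z => (v z)^-1) z gd.
  apply: (near (fun w => (V w)^-1 - be)) => [w hw1 hw2|]; first by have [_ _ ->] := vN w hw1 hw2.
  by have := cderB (cder_invf (DV z h5) v2) (cder_cst be z); rewrite subr0.
have V'z : V' z != 0 by exact: I'.
have gd0 : gd != 0 by rewrite /gd mulf_neq0 ?oppr_eq0 // invr_neq0 // expf_neq0.
have h4 : nm (z - z0) < r4 by apply: lt_le_trans h5 _.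
have pd : - al / (z - z0) ^+ 2 + rho' z = gd + E' z.
  have zz' : z - z0 != 0 by rewrite subr_eq0.
  apply: cder_unique (cderD Dg (DE z h4)).
  apply: (near (fun w => al / (w - z0) + rho w)); first exact: pE.
  have hr : nm (z - z0) < r by apply: lt_le_trans h4 _.
  have := cderD (cderZ al (cder_invf (lin_der z0 z) zz')) (Hrho z hr).
  by congr cder; rewrite mulrA mulrN1.
exists gd, (E z - be), (E' z / V' z); split=> //.
- by rewrite pE // v3 i2 invrK; ring.
- by rewrite pd /gd i2; field; rewrite h0 V'z.
have [b1 b2] := HB _ hd1; split.
  have -> : d / h = E' z0 * al * (h^-1 - 0) by rewrite subr0.
  by apply: le_trans b2 _; rewrite subr0 nmV exprVn.
by apply: le_trans b1 _; rewrite subr0 nmV.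
Qed.
End LocalExpansion.

(** * The function g and the set on which it is inverted *)

Section Meromorphic.
Context {R : realType}.
Local Notation C := R[i].
Implicit Types (F : C -> sphere R) (G : C -> C) (z u w : C).

Lemma mero_finite F z w : meromorphic_at F z -> F z = fin_pt w ->
  exists r G G', [/\ 0 < r, holo G G' z r & forall u, nm (u - z) < r -> F u = fin_pt (G u)].
Proof.
move=> [G [/holomorphicE[r [G' [r0 HG]]] H]] Fz.
have z0 (e : R) : 0 < e -> nm (z - z) < e by rewrite subrr nm0.
case: H => [/nearC[d d0 Hd]|[/nearC[d d0 Hd] _]].
  exists (Num.min r d), G, G'; split; first by rewrite lt_min r0.
    by apply: holoS HG; rewrite ge_min lexx.
  by move=> u; rewrite lt_min => /andP[_ /Hd].
have Gz : G z != 0.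
  by apply/eqP => Gz; move: Fz; rewrite Hd ?z0 // /inv_sphere Gz eqxx.
have nG : 0 < nm (G z) by rewrite nm_gt0.
have [e e0 He] := cder_cont (HG z (z0 _ r0)) nG.
have nz u : nm (u - z) < e -> G u != 0.
  by move=> /He; apply: contraTneq => ->; rewrite sub0r nmN ltxx.
exists (Num.min (Num.min r d) e), (fun u => (G u)^-1), (fun u => - G' u / G u ^+ 2); split.
- by rewrite !lt_min r0 d0.
- move=> u; rewrite !lt_min -andbA => /and3P[h1 h2 h3].
  by apply: cder_invf; [exact: HG|exact: nz].
- move=> u; rewrite !lt_min -andbA => /and3P[h1 h2 h3].
  by rewrite Hd // /inv_sphere (negbTE (nz u h3)).
Qed.

Lemma mero_infinite F z : meromorphic_at F z -> F z = infty R ->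
  exists r G, [/\ 0 < r, ccont G z, G z = 0 & forall u, nm (u - z) < r -> u != z -> G u != 0 /\ F u = fin_pt (G u)^-1].
Proof.
move=> [G [/holomorphicE[r [G' [r0 HG]]] H]] Fz.
have z0 (e : R) : 0 < e -> nm (z - z) < e by rewrite subrr nm0.
case: H => [/nearC[d d0 Hd]|[/nearC[d d0 Hd] /near'C[e e0 He]]].
  by move: Fz; rewrite Hd ?z0.
exists (Num.min d e), G; split; first by rewrite lt_min d0.
- by apply: cder_cont (HG z (z0 _ r0)).
- apply/eqP; apply: contraT => Gz; move: Fz; rewrite Hd ?z0 // /inv_sphere (negbTE Gz) //.
- move=> u; rewrite lt_min => /andP[h1 h2] uz; have Gu := He u h2 uz; split=> //.
  by rewrite Hd // /inv_sphere (negbTE Gu).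
Qed.

Variables (F : C -> sphere R) (w1 w2 : C).
Hypothesis w12 : w1 != w2.
Local Notation D := (w2 - w1).
Let D0 : D != 0. Proof. by rewrite subr_eq0 eq_sym. Qed.

(* The curves of Delta(w1, w2) are the level curves Im gval = const <> 0. *)
Definition omg (w : C) := (2 * w - w1 - w2) / D.
(** At a pole of [F] the value 0 is the true limit. At the zeros of [om ^+ 2 - 1], which are the
    poles of [g], the convention for the inverse of 0 gives a real value as well, so that these
    points fall outside [hset]. *)
Definition gval z := if F z is Some w then (omg w ^+ 2 - 1)^-1 else 0.
Definition dgval z := xget 0 [set l | cder gval z l].
(** [om] and [- om] give the same [g]; the half-plane selects the root on the side of [w1].
    Exchanging [w1] and [w2] for the other pole selects the opposite one. *)
Definition hset := [set z | [/\ nm z < 1, complex.Im (gval z) != 0 & complex.Re (omg (finite_part F z)) < 0]].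

Lemma gval_fin z w : F z = fin_pt w -> gval z = (omg w ^+ 2 - 1)^-1.
Proof. by rewrite /gval => ->. Qed.

Lemma omg_der z : cder omg z (2 / D).
Proof.
have := cderZ (D^-1) (cderB (cderB (cderZ 2 (cder_id z)) (cder_cst w1 z)) (cder_cst w2 z)).
rewrite !subr0 mulr1 mulrC; apply: cder_ext; exists 1 => // u _.
by rewrite /omg mulrC.
Qed.

Lemma gval_holo z w : meromorphic_at F z -> F z = fin_pt w -> omg w ^+ 2 - 1 != 0 ->
  exists r G, [/\ 0 < r, ccont G z, forall u, nm (u - z) < r -> F u = fin_pt (G u) /\ omg (G u) ^+ 2 - 1 != 0 &
    holo gval dgval z r].
Proof.
move=> mz Fz v0; have [r [G [G' [r0 HG HF]]]] := mero_finite mz Fz.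
have z0 (e : R) : 0 < e -> nm (z - z) < e by rewrite subrr nm0.
have Gz : G z = w by have := HF z (z0 _ r0); rewrite Fz => -[].
pose v u := omg (G u) ^+ 2 - 1.
have dv u : nm (u - z) < r -> exists l, cder v u l.
  by move=> hu; eexists; apply: cderB (cder_cst 1 u); apply: (cderX 1); apply: cder_comp (HG u hu) (omg_der _).
have [l Hl] := dv z (z0 _ r0).
have nv : 0 < nm (v z) by rewrite nm_gt0 /v Gz.
have [e e0 He] := cder_cont Hl nv.
have nz u : nm (u - z) < e -> v u != 0.
  by move=> /He; apply: contraTneq => ->; rewrite sub0r nmN ltxx.
exists (Num.min r e), G; split; first by rewrite lt_min r0.
- exact: cder_cont (HG z (z0 _ r0)).
- by move=> u; rewrite lt_min => /andP[h1 h2]; split; [exact: HF|exact: nz].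
- move=> u hu; have := hu; rewrite lt_min => /andP[h1 h2]; have [m Hm] := dv u h1.
  suff D' : cder gval u (- m / v u ^+ 2) by exact: (@xgetI _ 0 [set l | cder gval u l] _ D').
  apply: cder_ext (cder_invf Hm (nz u h2)).
  have [d d0 Hd] := loc_ball h1; exists d => // t /Hd ht.
  by rewrite (gval_fin (HF t ht)).
Qed.

Lemma gval_infinite z : meromorphic_at F z -> F z = infty R -> ccont gval z /\ gval z = 0.
Proof.
move=> mz Fz; have gz : gval z = 0 by rewrite /gval Fz.
split=> //; have [r [G [r0 cG Gz HG]]] := mero_infinite mz Fz.
(* [g] expressed in the coordinate [t = 1 / w] at infinity. *)
pose K (t : C) := D ^+ 2 * t ^+ 2 / (4 * ((1 - w1 * t) * (1 - w2 * t))).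
have l1 (w t : C) : exists l, cder (fun t => 1 - w * t) t l.
  by eexists; exact: (cderB (cder_cst 1 t) (cderZ w (cder_id t))).
have [a Ha] := l1 w1 0; have [b Hb] := l1 w2 0.
have cK : ccont K 0.
  have := cder_div (cderZ (D ^+ 2) (cderX 1 (cder_id 0))) (cderZ 4 (cderM Ha Hb)) _.
  by rewrite !mulr0 !subr0 !mulr1 pnatr_eq0 => /(_ isT)/cder_cont.
have cGK : ccont (fun u => K (G u)) z by apply: ccont_comp cG _; rewrite Gz.
have near1 (w : C) : exists2 d : R, 0 < d & forall u, nm (u - z) < d -> 1 - w * G u != 0.
  have c : ccont (fun u => 1 - w * G u) z.
    by have [l Hl] := l1 w (G z); apply: ccont_comp cG (cder_cont Hl).
  have [d d0 Hd] := c _ (ltr01); exists d => // u /Hd; rewrite Gz mulr0 subr0.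
  by apply: contraTneq => ->; rewrite sub0r nmN nm1 ltxx.
have [d1 d10 H1] := near1 w1; have [d2 d20 H2] := near1 w2.
apply: ccont_ext cGK; exists (Num.min r (Num.min d1 d2)); first by rewrite !lt_min r0 d10.
move=> u; rewrite !lt_min => /and3P[hr /H1 n1 /H2 n2].
have [->|uz] := eqVneq u z; first by rewrite gz /K Gz expr0n /= mulr0 mul0r.
have [Gu Fu] := HG u hr uz; rewrite (gval_fin Fu) /K /omg.
have -> : ((2 * (G u)^-1 - w1 - w2) / D) ^+ 2 - 1 = 4 * ((1 - w1 * G u) * (1 - w2 * G u)) / (D ^+ 2 * G u ^+ 2).
  by field; rewrite Gu D0.
by rewrite invf_div.
Qed.

(** For imaginary [om] the number [om ^+ 2 - 1] is real, hence so is [g]: the imaginary axis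
    separates the two halves of the set [Im g <> 0]. *)
Lemma omg_Re z w : F z = fin_pt w -> complex.Im (gval z) != 0 -> complex.Re (omg w) != 0.
Proof.
move=> Fz; rewrite (gval_fin Fz); apply: contraNneq; case: (omg w) => a b; rewrite [complex.Re _]/= => ->.
have -> : ((0 +i* b)%C ^+ 2 - 1 : C) = (- b ^+ 2 - 1)%:C%C.
  by apply: cplx_eq; rewrite expr2 !ReImE /=; ring.
by rewrite -fmorphV.
Qed.

Lemma gval_notinf z : complex.Im (gval z) != 0 -> exists2 w, F z = fin_pt w & omg w ^+ 2 - 1 != 0.
Proof.
rewrite /gval; case: (F z) => [w|] /=; last by rewrite eqxx.
by move=> b; exists w => //; apply: contraNneq b => ->; rewrite invr0.
Qed.

Hypothesis mF : meromorphic_on (@unit_disk R) F.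

Lemma diskE z : unit_disk z <-> nm z < 1.
Proof. by rewrite /unit_disk /= normE -[1]/(1%:C%C) ltcR. Qed.

Lemma hset_open z : hset z -> complex.Im (gval z) != 0 /\ exists2 r : R, 0 < r &
  (forall w, nm (w - z) < r -> hset w) /\ holo gval dgval z r.
Proof.
move=> [hz Iz Rz]; split=> //; have [w Fz v0] := gval_notinf Iz.
have [r [G [r0 cG HG Hg]]] := gval_holo (mF (proj2 (diskE z) hz)) Fz v0.
have z00 : nm (z - z) < r by rewrite subrr nm0.
have cg := cder_cont (Hg z z00).
have I0 : 0 < `|complex.Im (gval z)| by rewrite normr_gt0.
have [d1 d10 H1] := cg _ I0.
have Gz : G z = w by have [] := HG z z00; rewrite Fz => -[].
have co : ccont (fun u => omg (G u)) z by apply: ccont_comp cG (cder_cont (omg_der _)).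
have R0 : 0 < - complex.Re (omg (G z)) by move: Rz; rewrite /finite_part Fz /= Gz oppr_gt0.
have [d2 d20 H2] := co _ R0.
pose q := Num.min (Num.min r d1) (Num.min d2 (1 - nm z)).
exists q; first by rewrite !lt_min r0 d10 d20 subr_gt0.
split; last by apply: holoS Hg; rewrite /q !ge_min lexx.
move=> u; rewrite !lt_min -!andbA => /and4P[h1 h2 h3 h4]; split.
- by have := nm_sub_ge u z; lra.
- move: (H1 u h2); apply: contraTneq => e; rewrite -leNgt -normrN -[- complex.Im _]add0r -e -ImN -ImD.
  exact: Im_le_nm.
- have [Fu _] := HG u h1; rewrite /finite_part Fu /=.
  have := le_lt_trans (Re_le_nm _) (H2 u h3); rewrite ReD ReN ltr_norml => /andP[? ?]; lra.
Qed.

(** A pole of [F] would give the real limit 0, and a zero of [om ^+ 2 - 1] would make [g] unbounded.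
    At any other point [g] is continuous, and [Re om < 0] survives in the limit because [Re om]
    cannot vanish there. *)
Lemma hset_closed z c : nm z < 1 -> complex.Im c != 0 ->
  (forall e : R, 0 < e -> exists w, [/\ hset w, nm (w - z) < e & nm (gval w - c) < e]) -> hset z /\ gval z = c.
Proof.
move=> hz Ic cl; have mz := mF (proj2 (diskE z) hz).
have lim : ccont gval z -> gval z = c.
  move=> cg; apply/eqP; rewrite -subr_eq0; apply/eqP; apply: nm_small => e e0.
  have [d d0 Hd] := cg (e / 2) (divr_gt0 e0 (ltr0n R 2)).
  have m0 : 0 < Num.min d (e / 2) by rewrite lt_min d0 divr_gt0.
  have [w [_ w1' w2']] := cl _ m0.
  have /Hd a1 : nm (w - z) < d by apply: lt_le_trans w1' _; rewrite ge_min lexx.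
  have a2 : nm (gval w - c) < e / 2 by apply: lt_le_trans w2' _; rewrite ge_min lexx orbT.
  by have := nmBD (gval w) (gval z) c; rewrite (nmBC (gval z) (gval w)); lra.
case Fz : (F z) => [w|]; last first.
  have [cg gz] := gval_infinite mz Fz; move: Ic; rewrite -(lim cg) gz /= eqxx //.
have [v0|v0] := eqVneq (omg w ^+ 2 - 1) 0.
  have [r [G [G' [r0 HG HF]]]] := mero_finite mz Fz.
  have z00 : nm (z - z) < r by rewrite subrr nm0.
  have Gz : G z = w by have := HF z z00; rewrite Fz => -[].
  have cv : ccont (fun u => omg (G u) ^+ 2 - 1) z.
    apply: (@ccont_comp _ G (fun w => omg w ^+ 2 - 1)); first exact: cder_cont (HG z z00).
    by apply: cder_cont (cderB (cderX 1 (omg_der _)) (cder_cst 1 _)).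
  have q0 : 0 < (nm c + 1)^-1 by rewrite invr_gt0 ltr_wpDl ?nm_ge0.
  have [d d0 Hd] := cv _ q0.
  have m0 : 0 < Num.min (Num.min r d) 1 by rewrite !lt_min r0 d0 ltr01.
  have [u [[_ Iu _] u1 u2]] := cl _ m0; move: u1; rewrite !lt_min -andbA => /and3P[u1 u3 _].
  have u4 : nm (gval u - c) < 1 by apply: lt_le_trans u2 _; rewrite ge_min lexx orbT.
  have := Hd u u3; rewrite Gz v0 subr0.
  have gu := gval_fin (HF u u1); have g0 : gval u != 0 by apply: contraNneq Iu => ->.
  have -> : omg (G u) ^+ 2 - 1 = (gval u)^-1 by rewrite gu invrK.
  rewrite nmV ltf_pV2 ?posrE ?nm_gt0 //; last by rewrite ltr_wpDl ?nm_ge0.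
  by have := nm_sub_ge (gval u) c; move=> *; exfalso; lra.
have [r [G [r0 cG HG Hg]]] := gval_holo mz Fz v0.
have z00 : nm (z - z) < r by rewrite subrr nm0.
have gz := lim (cder_cont (Hg z z00)).
have Iz : complex.Im (gval z) != 0 by rewrite gz.
have Gz : G z = w by have [] := HG z z00; rewrite Fz => -[].
split=> //; split=> //; have nR := omg_Re Fz Iz.
rewrite /finite_part Fz /= lt_neqAle nR /= leNgt; apply/negP => Rp.
have co : ccont (fun u => omg (G u)) z by apply: ccont_comp cG (cder_cont (omg_der _)).
have [d d0 Hd] := co _ Rp.
have m0 : 0 < Num.min r d by rewrite lt_min r0.
have [u [[_ _ Ru]]] := cl _ m0; rewrite lt_min => /andP[u1 u2] _.
have [Fu _] := HG u u1; move: Ru; rewrite /finite_part Fu /=.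
have := le_lt_trans (Re_le_nm _) (Hd u u2); rewrite Gz ReD ReN ltr_norml => /andP[? ?]; lra.
Qed.
End Meromorphic.

(** * One-sheetedness *)

Section OneSheeted.
Context {R : realType}.
Local Notation C := R[i].
Implicit Types (F : C -> sphere R) (z w : C).

Lemma rcont_cvg (k : R -> C) t : rcont k t -> {for t, continuous k}.
Proof.
move=> H; apply/cvgrPdist_lt => /= e /posC[r r0 ->]; have [d d0 Hd] := H r r0.
by exists d => //= s /=; rewrite distrC => /Hd; rewrite normE ltcR nmBC.
Qed.

Lemma lift_continuous F (k : R -> C) t w : rcont k t -> meromorphic_at F (k t) -> F (k t) = fin_pt w ->
  {for t, continuous (fun s => Defs.lift F (k s))} /\ {for t, continuous (fun s => finite_part F (k s))}.
Proof.
move=> ck mk Fk; have [r [G [G' [r0 HG HF]]]] := mero_finite mk Fk.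
have k0 : nm (k t - k t) < r by rewrite subrr nm0.
have cG : rcont (fun s => G (k s)) t := ccont_rcont ck (cder_cont (HG _ k0)).
have near_eq : \forall s \near t, F (k s) = fin_pt (G (k s)).
  have [d d0 Hd] := ck r r0; exists d => //= s /=; rewrite distrC => /Hd; exact: HF.
split.
- have ckt : k @ t --> k t := rcont_cvg ck.
  suff cFt : (F \o k) @ t --> F (k t) by exact: (cvg_pair ckt cFt).
  rewrite /= HF //; apply: cvg_trans (continuous_comp (rcont_cvg cG) _).
  + by apply: near_eq_cvg; near=> s; rewrite /=; have -> : F (k s) = fin_pt (G (k s)) by near: s.
  + exact: one_point_compactification_some_continuous.
- have E : finite_part F (k t) = G (k t) by rewrite /finite_part HF.
  suff : (fun s => finite_part F (k s)) @ t --> finite_part F (k t) by [].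
  rewrite E; apply: cvg_trans (rcont_cvg cG).
  apply: near_eq_cvg; near=> s; rewrite /finite_part /=.
  by have -> : F (k s) = fin_pt (G (k s)) by near: s.
Unshelve. all: by end_near. Qed.

Lemma far_right (A B D E T S : R) : D + A + S + 2 < B -> - E <= D -> T <= A -> 0 < S -> T < E + (B - 1).
Proof. lra. Qed.

Lemma far_left (A B D E T S : R) : D + A + S + 2 < - B -> E <= D -> T <= A -> 0 < S -> T < - (E + (B + 1)).
Proof. lra. Qed.

Lemma omg_inj w1 w2 a b : w1 != w2 -> omg w1 w2 a = omg w1 w2 b -> a = b.
Proof.
move=> w12; have D0 : w2 - w1 != 0 by rewrite subr_eq0 eq_sym.
move/(divIf D0) => e; have e2 : 2 * (a - b) = 0.
  have -> : 2 * (a - b) = (2 * a - w1 - w2) - (2 * b - w1 - w2) by ring.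
  by rewrite e subrr.
by apply/eqP; rewrite -subr_eq0; move/eqP: e2; rewrite mulf_eq0 pnatr_eq0.
Qed.

Lemma hset_F_inj F w1 w2 a b : w1 != w2 -> hset F w1 w2 a -> hset F w1 w2 b ->
  gval F w1 w2 a = gval F w1 w2 b -> F a = F b.
Proof.
move=> w12 [_ Ia Ra] [_ Ib Rb]; have [u Fa _] := gval_notinf Ia; have [w Fb _] := gval_notinf Ib.
rewrite (gval_fin _ _ Fa) (gval_fin _ _ Fb) Fa Fb => /invr_inj/addIr/eqP.
move: Ra Rb; rewrite /finite_part Fa Fb /= => Ra Rb; rewrite eqf_sqr => /orP[/eqP/(omg_inj w12)->//|/eqP e].
by exfalso; move: Ra; rewrite e ReN; lra.
Qed.

(** With [v = om ^+ 2 - 1], the equation [|v - i t| = |t|] amounts to [|v|^2 = 2 t Im v], that is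
    [Im (1 / v) = - 1 / (2 t)]. *)
Lemma gval_level F w1 w2 z w y : F z = fin_pt w -> complex.Im (gval F w1 w2 z) = y -> y != 0 ->
  level_curves w1 w2 (- (2 * y)^-1) w.
Proof.
move=> Fz; rewrite (gval_fin _ _ Fz) => <- y0; rewrite /level_curves /= -/(omg w1 w2 w).
move: (omg w1 w2 w ^+ 2 - 1) y0 => v y0.
rewrite !normE; congr (_ %:C)%C.
have v0 : v != 0 by apply: contraNneq y0 => ->; rewrite invr0.
have n0 : nm v ^+ 2 != 0 by rewrite expf_neq0 // nm_eq0.
apply/eqP; rewrite -(@eqrXn2 _ 2) ?nm_ge0 //; apply/eqP; rewrite !nm_sqr.
have Ev : complex.Im v^-1 = - complex.Im v / nm v ^+ 2.
  have -> : v^-1 = (v : C)^* * ((nm v ^+ 2)^-1)%:C%C.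
    by rewrite fmorphV /= -mulCJ; field; rewrite v0 conjC_eq0 andbT.
  by rewrite (conjCE (v : C)) ImM /=; ring.
rewrite Ev in y0 *; rewrite nm_sqr in n0 y0 *.
case: v v0 y0 n0 {Ev} => a b /= v0 y0 n0.
have b0 : b != 0 by apply: contraNneq y0 => ->; rewrite oppr0 mul0r.
by field; rewrite n0 b0.
Qed.

Variables (F : C -> sphere R) (z1 w1 w2 : C).
Hypotheses (mF : meromorphic_on (@unit_disk R) F) (w12 : w1 != w2).
Hypotheses (z11 : nm z1 < 1) (Fz1 : F z1 = fin_pt w1) (dF1 : Defs.deriv F z1 != 0).
Hypothesis one : forall J : set (C * sphere R), jordan_curve R J -> J `<=` surface F -> J (Defs.lift F z1) ->
  J `&` ramification F = set0 -> (exists2 G, Delta w1 w2 G & lies_over J G) -> one_sheeted J.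
Local Notation H := (hset F w1 w2).
Local Notation gv := (gval F w1 w2).
Local Notation gv' := (dgval F w1 w2).

Lemma omg1 : omg w1 w2 w1 ^+ 2 - 1 = 0.
Proof. by rewrite /omg; field; rewrite subr_eq0 eq_sym. Qed.

Lemma gval_z1 : gv z1 = 0.
Proof. by rewrite (gval_fin _ _ Fz1) omg1 invr0. Qed.

Lemma z1_notin : ~ H z1.
Proof. by case; rewrite gval_z1 eqxx. Qed.

Lemma loc_inj_z1 : locally_injective_at F z1.
Proof.
have [r [G [G' [r0 HG HF]]]] := mero_finite (mF (proj2 (diskE z1) z11)) Fz1.
have G1 : G' z1 != 0.
  have <- : Defs.deriv F z1 = G' z1; last exact: dF1.
  apply: (@holo_derive1 _ _ _ z1 r); last by rewrite subrr nm0.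
  by apply: holo_ext HG => z hz; rewrite /finite_part HF.
have [r' [d [i [/andP[r'0 r'r] _ I _ _]]]] := inverse_function r0 HG G1.
exists [set z | nm (z - z1) < r']; first by apply/nearC; exists r'.
move=> a b; rewrite !inE /= => ha hb; rewrite !HF; [|exact: lt_le_trans r'r|exact: lt_le_trans r'r].
by case=> /(I _ _ ha hb).
Qed.

Variables (be : C) (R0 : R) (finf : C -> C).
Local Notation g := (fun z => gv z + be).
Hypothesis finf_z1 : forall e : R, 0 < e -> exists T : R, forall h, T < nm h -> nm (finf h - z1) < e.

Lemma hset_shift_open : forall z, H z -> [/\ nm z < 1, complex.Im (g z) != complex.Im be &
  exists2 r : R, 0 < r & (forall w, nm (w - z) < r -> H w) /\ holo g gv' z r].
Proof.
move=> z Hz; have [Iz [r r0 [Hr Hg]]] := hset_open mF Hz; have [hz _ _] := Hz; split=> //.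
- by rewrite ImD -subr_eq0 addrK.
- exists r => //; split=> // u hu; have := cderD (Hg u hu) (cder_cst be u).
  by rewrite addr0.
Qed.

Lemma loc_inj_H z : H z -> gv' z != 0 -> locally_injective_at F z.
Proof.
move=> Hz gz; have [r r0 Hr] := slift_local_inj hset_shift_open Hz gz.
exists [set u | nm (u - z) < r]; first by apply/nearC; exists r.
by move=> a b; rewrite !inE /= => ha hb e; apply: Hr => //; rewrite /gval e.
Qed.

Lemma ray_rcont (psi : C -> C) (h : C) (s t : R) : t != 0 -> ccont psi (h + ((t^-1 - s))%:C%C) ->
  rcont (fun t => psi (h + ((t^-1 - s))%:C%C)) t.
Proof.
move=> t0 cp; apply: (@ccont_rcont _ psi (fun t => h + ((t^-1 - s))%:C%C)) => // e e0.
have c : {for t, continuous (fun t : R => t^-1)} by exact: inv_continuous.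
move/cvgrPdist_lt : c => /(_ _ e0)[d /= d0 Hd]; exists d => // u hu.
have -> : h + (u^-1 - s)%:C%C - (h + (t^-1 - s)%:C%C) = (u^-1 - t^-1)%:C%C.
  by apply: cplx_eq; rewrite !ReImE /=; ring.
by rewrite nm_real distrC; apply: Hd; rewrite /= distrC.
Qed.

Variables (V1 V2 : set C) (psi1 psi2 : C -> C).
Hypothesis R0_gt0 : 0 < R0.
Hypotheses (S1 : sheet H g gv' R0 finf 1 V1 psi1) (S2 : sheet H g gv' R0 finf (-1) V2 psi2).

(** Both rays in one parameter: [1 / t - 1] runs from 0 to +oo as [t] falls from 1 to 0, and
    [1 / t + 1] from 0 to -oo as [t] rises from -1 to 0; the two ends at infinity are joined at the
    pole [z1]. *)
Definition ray_pair (h : C) (t : R) : C :=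
  if 0 < t then psi1 (h + (t^-1 - 1)%:C%C) else if t < 0 then psi2 (h + (t^-1 + 1)%:C%C) else z1.

Lemma ray1 h t : V1 h -> 0 < t <= 1 -> slift H g gv' psi1 (h + (t^-1 - 1)%:C%C).
Proof.
have [_ u l _] := S1; move=> Vh /andP[t0 t1]; apply: l.
have := u h (t^-1 - 1) Vh; rewrite mul1r; apply; by rewrite subr_ge0 invf_ge1.
Qed.

Lemma ray2 h t : V2 h -> -1 <= t < 0 -> slift H g gv' psi2 (h + (t^-1 + 1)%:C%C).
Proof.
have [_ u l _] := S2; move=> Vh /andP[t1 t0]; apply: l.
have := u h (- (t^-1 + 1)) Vh; rewrite mulN1r opprK; apply.
have : 1 <= (- t)^-1 by rewrite invf_ge1 ?oppr_gt0 //; lra.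
by rewrite invrN; lra.
Qed.

Lemma ray_pairP h t : V1 h -> V2 h -> -1 <= t <= 1 -> t != 0 ->
  [/\ H (ray_pair h t), gv' (ray_pair h t) != 0 & gv (ray_pair h t) = h - be + (t^-1 - Num.sg t)%:C%C].
Proof.
move=> v1 v2 /andP[t1 t2] t0; rewrite /ray_pair; have [tp|tn] := ltP 0 t.
  have [] := @ray1 h t v1 _; first by rewrite tp.
  by move=> a b c _; split=> //; rewrite gtr0_sg // -[LHS](addrK be) b; ring.
have tn' : t < 0 by rewrite lt_neqAle t0.
rewrite tn'; have [] := @ray2 h t v2 _; first by rewrite t1.
by move=> a b c _; split=> //; rewrite ltr0_sg // -[LHS](addrK be) b opprK; ring.
Qed.

Lemma ray_pair_cont h t : V1 h -> V2 h -> -1 <= t <= 1 -> rcont (ray_pair h) t.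
Proof.
move=> v1 v2 /andP[t1 t2].
have loc (k : R -> C) : t != 0 -> rcont k t -> (forall u : R, 0 < u * t -> k u = ray_pair h u) -> rcont (ray_pair h) t.
  move=> t0 ck E e /ck[d d0 Hd]; exists (Num.min d `|t|); first by rewrite lt_min d0 normr_gt0.
  have tt : 0 < t * t by rewrite -expr2 exprn_even_gt0.
  move=> u; rewrite lt_min => /andP[h1 h2]; rewrite -!E //; first exact: Hd.
  have [tp|tn] := ltP 0 t.
    by move: h2; rewrite (gtr0_norm tp) ltr_distl => /andP[? ?]; rewrite pmulr_lgt0 //; lra.
  move: h2; rewrite (ler0_norm tn) ltr_distl => /andP[? ?].
  have tn' : t < 0 by rewrite lt_neqAle t0.
  by rewrite nmulr_lgt0 //; lra.
have [->|t0] := eqVneq t 0.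
  move=> e e0; have [T HT] := finf_z1 e0; have [_ u1 l1 f1] := S1; have [_ u2 l2 f2] := S2.
  have K2 : 0 <= `|complex.Re h| + `|T| + R0 by rewrite !addr_ge0 // ltW.
  pose K := `|complex.Re h| + `|T| + R0 + 2; have K0 : 0 < K by apply: ltr_wpDl.
  have K1 : K^-1 < 1 by rewrite invf_lt1 //; apply: ltr_wpDl => //; rewrite ltr1n.
  have h1 := ler_norm (complex.Re h); have h2 := ler_norm (- complex.Re h); have h3 := ler_norm T; have h4 := normr_ge0 T; rewrite normrN in h2.
  have big (u : R) : 0 < u -> u < K^-1 -> K < u^-1 by move=> up uK; rewrite -[ltLHS]invrK ltf_pV2 ?posrE ?invr_gt0.
  exists K^-1; first by rewrite invr_gt0.
  move=> u; rewrite subr0 /ray_pair ltxx; have [up|un] := ltP 0 u.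
    rewrite gtr0_norm // => hu; have := big u up hu; rewrite /K => bu.
    have a1 : V1 (h + (u^-1 - 1)%:C%C) by have := u1 h (u^-1 - 1) v1; rewrite mul1r; apply; lra.
    have a2 : R0 < 1 * complex.Re (h + (u^-1 - 1)%:C%C) by rewrite mul1r Re_shift; lra.
    rewrite f1 //; apply: HT; apply: lt_le_trans (Re_le_nm _); apply: lt_le_trans (ler_norm _).
    by rewrite Re_shift; exact: far_right bu h2 h3 R0_gt0.
  case: ifP => [un' hu|_ _]; last by rewrite subrr nm0.
  have up : 0 < - u by rewrite oppr_gt0.
  have := big _ up; rewrite -{1}(ltr0_norm un') => /(_ hu); rewrite invrN /K => bu.
  have a1 : V2 (h + (u^-1 + 1)%:C%C) by have := u2 h (- (u^-1 + 1)) v2; rewrite mulN1r opprK; apply; lra.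
  have a2 : R0 < -1 * complex.Re (h + (u^-1 + 1)%:C%C) by rewrite mulN1r Re_shift; lra.
  rewrite f2 //; apply: HT; apply: lt_le_trans (Re_le_nm _); rewrite -normrN; apply: lt_le_trans (ler_norm _).
  by rewrite Re_shift; exact: far_left bu h1 h3 R0_gt0.
have [tp|tn] := ltP 0 t.
  apply: (loc (fun u => psi1 (h + (u^-1 - 1)%:C%C)) t0).
    by apply: (ray_rcont (s := 1)) => //; have [] := @ray1 h t v1 _ => //; rewrite tp.
  by move=> u; rewrite pmulr_lgt0 // /ray_pair => ->.
have tn' : t < 0 by rewrite lt_neqAle t0.
apply: (loc (fun u => psi2 (h + (u^-1 + 1)%:C%C)) t0).
  have := @ray_rcont psi2 h (-1) t t0; rewrite opprK.
  by apply; have [] := @ray2 h t v2 _ => //; rewrite t1.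
by move=> u; rewrite nmulr_lgt0 // /ray_pair => un; rewrite un ltNge (ltW un).
Qed.

(** [g] separates the nonzero parameters except 1 and -1, which both lie over [h] and where the
    branches differ by assumption; the pole itself is outside [hset]. *)
Lemma ray_pair_inj h : V1 h -> V2 h -> psi1 h <> psi2 h ->
  forall s t, -1 <= s <= 1 -> -1 <= t <= 1 -> ray_pair h s = ray_pair h t -> s = t.
Proof.
move=> v1 v2 ne s t hs ht e.
have [s0|s0] := eqVneq s 0.
  have [->//|t0] := eqVneq t 0; have [Ht _ _] := ray_pairP v1 v2 ht t0.
  by move: Ht; rewrite -e s0 /ray_pair ltxx => /z1_notin.
have [t0|t0] := eqVneq t 0.
  have [Hs _ _] := ray_pairP v1 v2 hs s0.
  by move: Hs; rewrite e t0 /ray_pair ltxx => /z1_notin.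
have [_ _ gs] := ray_pairP v1 v2 hs s0; have [_ _ gt] := ray_pairP v1 v2 ht t0.
move: gs; rewrite e gt => /addrI/(@complexI R) E.
case/andP: hs => hs1 hs2; case/andP: ht => ht1 ht2.
have p1 (u : R) : 0 < u -> u <= 1 -> 1 <= u^-1 by move=> *; rewrite invf_ge1.
have n1 (u : R) : u < 0 -> -1 <= u -> u^-1 <= -1.
  by move=> un u1; have := p1 (- u); rewrite oppr_gt0 invrN => /(_ un); lra.
have [sp|sn] := ltP 0 s; have [tp|tn] := ltP 0 t.
- by move: E; rewrite !gtr0_sg // => /addIr/invr_inj ->.
- have tn' : t < 0 by rewrite lt_neqAle t0.
  have a1 := p1 s sp hs2; have a2 := n1 t tn' ht1; rewrite (gtr0_sg sp) (ltr0_sg tn') in E.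
  have s1 : s^-1 = 1 by lra. have t1' : t^-1 = -1 by lra.
  by move: e; rewrite /ray_pair sp ltNge tn /= tn' s1 t1' subrr addNr addr0 => /ne.
- have sn' : s < 0 by rewrite lt_neqAle s0.
  have a1 := p1 t tp ht2; have a2 := n1 s sn' hs1; rewrite (gtr0_sg tp) (ltr0_sg sn') in E.
  have t1' : t^-1 = 1 by lra. have s1 : s^-1 = -1 by lra.
  by move: e; rewrite /ray_pair tp ltNge sn /= sn' s1 t1' subrr addNr addr0 => /esym/ne.
- have tn' : t < 0 by rewrite lt_neqAle t0. have sn' : s < 0 by rewrite lt_neqAle s0.
  by move: E; rewrite !ltr0_sg // => /addIr/invr_inj ->.
Qed.

(* If the two rays over h ended at different points, both rays together with the pole z1 would
   form a simple arc through f(z1) over a curve of Delta(w1, w2) which covers a point twice. *)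
Lemma rays_agree h : V1 h -> V2 h -> psi1 h = psi2 h.
Proof.
move=> v1 v2; apply: contrapT => ne.
pose k (u : R) := ray_pair h (1 - 2 * u).
have I (u : R) : `[(0:R), 1]%classic u -> -1 <= 1 - 2 * u <= 1 by rewrite /= in_itv /= => /andP[? ?]; apply/andP; split; lra.
have kc (u : R) : `[(0:R), 1]%classic u -> rcont k u.
  move=> /I hu e /(ray_pair_cont v1 v2 hu)[d d0 Hd]; exists (d / 2); first by rewrite divr_gt0.
  move=> s hs; apply: Hd; have -> : 1 - 2 * s - (1 - 2 * u) = - (2 * (s - u)) by ring.
  by rewrite normrN normrM ger0_norm //; move: hs; lra.
have kF (u : R) : `[(0:R), 1]%classic u -> nm (k u) < 1 /\ exists w, F (k u) = fin_pt w.
  move=> /I hu; have [e|n0] := eqVneq (1 - 2 * u) 0.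
    by rewrite /k e /ray_pair ltxx; split=> //; exists w1.
  have [Hk _ _] := ray_pairP v1 v2 hu n0; have [a b _] := Hk; split=> //.
  by have [w Fw _] := gval_notinf b; exists w.
have mk (u : R) : `[(0:R), 1]%classic u -> meromorphic_at F (k u) by move=> /kF[/diskE/mF].
have half : `[(0:R), 1]%classic (1 / 2) by rewrite /= in_itv /=; apply/andP; split; lra.
have khalf : k (1 / 2) = z1.
  by rewrite /k (_ : 1 - 2 * (1 / 2) = 0 :> R) ?/ray_pair ?ltxx //; lra.
pose J := (fun u => Defs.lift F (k u)) @` `[(0:R), 1]%classic.
have JJ : jordan_curve R J.
  left; exists (fun u => Defs.lift F (k u)); split=> //.
  - apply: continuous_in_subspaceT => u; rewrite inE => hu; have [_ [w Fw]] := kF u hu.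
    by have [] := lift_continuous (kc u hu) (mk u hu) Fw.
  - move=> u s; rewrite !inE => hu hs -[e _].
    by have := ray_pair_inj v1 v2 ne (I _ hu) (I _ hs) e; lra.
have JS : J `<=` surface F by move=> _ [u hu <-]; exists (k u) => //; apply/diskE; have [] := kF u hu.
have J1 : J (Defs.lift F z1) by exists (1 / 2); rewrite ?khalf.
have JR : J `&` ramification F = set0.
  rewrite -subset0 => _ [[u hu <-] [z [_ nl] [e _]]]; apply: nl; rewrite e.
  have [e0|n0] := eqVneq (1 - 2 * u) 0; first by rewrite /k e0 /ray_pair ltxx; exact: loc_inj_z1.
  by have [Hk gk _] := ray_pairP v1 v2 (I u hu) n0; exact: loc_inj_H.
pose y := complex.Im (h - be).
have y0 : y != 0.
  have h1 : -1 <= (1:R) <= 1 by rewrite lexx andbT; lra.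
  have [[_ + _] _] := ray_pairP v1 v2 h1 (oner_neq0 _); move=> + gk; rewrite gk invr1 gtr0_sg // subrr addr0 //.
(* At [w1] itself [om ^+ 2 = 1], so every level set contains [w1]. *)
have D1 : level_curves w1 w2 (- (2 * y)^-1) w1.
  by rewrite /level_curves /= -/(omg w1 w2 w1) omg1 // sub0r normrN normrM normCi mul1r.
have JD : exists2 G, Delta w1 w2 G & lies_over J G.
  exists (connected_component (level_curves w1 w2 (- (2 * y)^-1)) w1).
    exists (- (2 * y)^-1), w1; split=> //; first by rewrite oppr_eq0 invr_eq0 mulf_neq0 // pnatr_eq0.
  (* The projection of the arc is connected and contains [w1], so it stays within one component of
     the level set, a single member of [Delta]. *)
  pose B := (fun u => finite_part F (k u)) @` `[(0:R), 1]%classic.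
  have cB : connected B.
    apply: connected_continuous_connected; first exact: segment_connected.
    apply: continuous_in_subspaceT => u; rewrite inE => hu; have [_ [w Fw]] := kF u hu.
    by have [] := lift_continuous (kc u hu) (mk u hu) Fw.
  have Bw : B w1 by exists (1 / 2) => //; rewrite khalf /finite_part Fz1.
  have BL : B `<=` level_curves w1 w2 (- (2 * y)^-1).
    move=> _ [u hu <-]; have [_ [w Fw]] := kF u hu; rewrite /finite_part Fw /=.
    have [e0|n0] := eqVneq (1 - 2 * u) 0.
      by move: Fw; rewrite /k e0 /ray_pair ltxx Fz1 => -[<-].
    apply: gval_level Fw _ y0; have [_ _ gk] := ray_pairP v1 v2 (I u hu) n0.
    by rewrite -/(k u) in gk; rewrite gk Im_shift.
  move=> _ [_ [u hu <-] <-]; have [_ [w Fw]] := kF u hu.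
  exists w; last by rewrite /pr /Defs.lift /= Fw.
  by apply: (connected_component_max Bw BL cB); exists u; rewrite // /finite_part Fw.
have p0 : `[(0:R), 1]%classic 0 by rewrite /= in_itv /= lexx ler01.
have p1 : `[(0:R), 1]%classic 1 by rewrite /= in_itv /= lexx ler01.
have k0 : k 0 = psi1 h.
  by rewrite /k mulr0 subr0 /ray_pair ltr01 invr1 subrr addr0.
have k1 : k 1 = psi2 h.
  rewrite /k mulr1 (_ : 1 - 2 = -1 :> R); last by lra.
  by rewrite /ray_pair ltrN10 ltNge lerN10 /= invrN1 addNr addr0.
have [h1 gh1 _ _] : slift H g gv' psi1 h by have [_ _ l _] := S1; exact: l.
have [h2 gh2 _ _] : slift H g gv' psi2 h by have [_ _ l _] := S2; exact: l.
(* The ends of the arc have the same [g], hence the same projection, but differ as points of the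
   surface. *)
apply: (one JJ JS J1 JR JD (W' := Defs.lift F (psi1 h)) (W'' := Defs.lift F (psi2 h))).
- by exists 0; rewrite ?k0.
- by exists 1; rewrite ?k1.
- by case.
- by rewrite /pr /Defs.lift /=; apply: (hset_F_inj w12) => //; apply: (addIr be); rewrite gh1 gh2.
Qed.
End OneSheeted.

(** * Assembling the data of one pole *)

Section BuildSide.
Context {R : realType}.
Local Notation C := R[i].
Implicit Types (z w : C).

Section Boundary.
Variables (z1 z2 a1 a2 : C).
Hypotheses (z11 : nm z1 < 1) (z21 : nm z2 < 1).
Local Notation p := (psum z1 z2 a1 a2).

Lemma away_from (a z : C) (r : R) : nm a < 1 -> 1 - r < nm z -> r <= (1 - nm a) / 2 -> (1 - nm a) / 2 <= nm (z - a).
Proof. by move=> ha hz hr; have := nm_sub_ge z a; lra. Qed.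

(** Compare [z] with its radial projection to the circle, where [Re p = 0]: [p'] is bounded near the
    circle, so the difference is at most a constant times [1 - nm z]. *)
Lemma psum_boundary : exists2 K : R, 0 <= K & forall e : R, 0 < e -> exists2 r : R, 0 < r & forall z, nm z < 1 -> 1 - r < nm z ->
  `|complex.Re (p z)| <= e /\ nm (p z) <= K.
Proof.
pose r0 := Num.min ((1 - nm z1) / 2) ((1 - nm z2) / 2).
have r00 : 0 < r0 by rewrite lt_min !divr_gt0 ?subr_gt0.
have [ra rb] : r0 <= (1 - nm z1) / 2 /\ r0 <= (1 - nm z2) / 2 by rewrite !ge_min !lexx orbT.
have [K [K0 HK]] := psum_bound a1 a2 z11 z21 r00.
exists K => // e e0; have K1 : 0 < K + 1 by lra.
pose r := Num.min r0 (e / (K + 1)); have r_gt0 : 0 < r by rewrite lt_min r00 divr_gt0.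
have rr : r <= r0 by rewrite /r ge_min lexx.
have re : r <= e / (K + 1) by rewrite /r ge_min lexx orbT.
exists r => // z hz zr.
have B u : 1 - r < nm u -> nm u <= 1 -> [/\ nm (p u) <= K, nm (psum' z1 z2 a1 a2 u) <= K, u != z1 & u != z2].
  move=> u1 u2; have c1 := away_from z11 u1 (le_trans rr ra); have c2 := away_from z21 u1 (le_trans rr rb).
  have [|b1 b2 _] := HK u u2 (le_trans ra c1); first exact: le_trans rb c2.
  by split=> //; rewrite -subr_eq0 -nm_gt0; [apply: lt_le_trans c1|apply: lt_le_trans c2]; rewrite divr_gt0 // subr_gt0.
have [b1 _ _ _] := B z zr (ltW hz); split=> //.
have n0 : 0 < nm z.
  by apply: le_lt_trans zr; have := nm_ge0 z1; move: rr ra; lra.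
pose z' : C := z / (nm z)%:C%C.
have nz : nm z' = 1 by rewrite nm_div nm_real gtr0_norm // divff // gt_eqF.
have E t : z + t%:C%C * (z' - z) = (1 + t * ((nm z)^-1 - 1))%:C%C * z.
  by rewrite /z' -fmorphV /=; apply: cplx_eq; rewrite !ReImE /=; ring.
have i1 : 1 <= (nm z)^-1 by rewrite invf_ge1 // ltW.
have bd t : 0 <= t <= 1 -> 1 - r < nm (z + t%:C%C * (z' - z)) /\ nm (z + t%:C%C * (z' - z)) <= 1.
  move=> /andP[t0 t1]; rewrite E nmM nm_real ger0_norm; last by rewrite addr_ge0 // mulr_ge0 // subr_ge0.
  have -> : (1 + t * ((nm z)^-1 - 1)) * nm z = nm z + t * (1 - nm z) by field; rewrite gt_eqF.
  have q0 : 0 <= t * (1 - nm z) by rewrite mulr_ge0 // subr_ge0 ltW.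
  have q1 : t * (1 - nm z) <= 1 - nm z by rewrite ler_piMl // subr_ge0 ltW.
  by split; lra.
have L : nm (p z' - p z) <= K * nm (z' - z).
  apply: (@cderMVT _ _ (psum' z1 z2 a1 a2)) => t /bd[t1 t2]; have [_ c1 c2 c3] := B _ t1 t2.
  by have [D _ _] := psum_der a1 a2 z11 z21 t2 c2 c3.
have zz : nm (z' - z) = 1 - nm z.
  have -> : z' - z = ((nm z)^-1 - 1)%:C%C * z by rewrite /z' -fmorphV /=; apply: cplx_eq; rewrite !ReImE /=; ring.
  by rewrite nmM nm_real ger0_norm ?subr_ge0 //; field; rewrite gt_eqF.
have -> : complex.Re (p z) = complex.Re (p z - p z') by rewrite (ReD (p z) (- p z')) (ReN (p z')) (psum_circle a1 a2 z11 z21 nz) subr0.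
apply: le_trans (Re_le_nm _) _; rewrite nmBC; apply: le_trans L _; rewrite zz.
have h1 : K * (1 - nm z) <= K * r by rewrite ler_wpM2l //; lra.
have h2 : (K + 1) * r <= e by rewrite mulrC -ler_pdivlMr.
by move: h1 h2 r_gt0; rewrite mulrDl mul1r; lra.
Qed.
End Boundary.

Variables (F : C -> sphere R) (z1 z2 w1 w2 a2 : C).
Hypotheses (mF : meromorphic_on (@unit_disk R) F) (w12 : w1 != w2).
Hypotheses (z11 : nm z1 < 1) (z21 : nm z2 < 1) (Fz1 : F z1 = fin_pt w1) (Fz2 : F z2 = fin_pt w2).
Hypotheses (dF1 : Defs.deriv F z1 != 0).
Hypothesis one : forall J : set (C * sphere R), jordan_curve R J -> J `<=` surface F -> J (Defs.lift F z1) ->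
  J `&` ramification F = set0 -> (exists2 G, Delta w1 w2 G & lies_over J G) -> one_sheeted J.
Local Notation H := (hset F w1 w2).
Local Notation D := (w2 - w1).

(** The residue of [g] at [z1], where [om ^+ 2 - 1] has a zero with derivative
    [- 4 f' / (w2 - w1)]. *)
Definition resid := - (D / 4) / Defs.deriv F z1.
(** [p] without its polar part at [z1]: the [rho] of [pole_normal_form]. *)
Definition regpart z := - (resid^* * (z / (1 - z1^* * z))) + pterm a2 z2 z.
Definition regpart' z := - (resid^* / (1 - z1^* * z) ^+ 2) + pterm' a2 z2 z.
(** The coefficient [d] of [pole_normal_form] for [rho = regpart]; the quantity whose real parts are
    summed over both poles. *)
Definition residue_shift := resid * regpart' z1 - 1 / 16 + D ^+ 2 / 96 * schwarzian F z1 / Defs.deriv F z1 ^+ 2.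

Lemma poles_distinct : z1 != z2.
Proof. by apply: contra_neq w12 => e; have := Fz2; rewrite -e Fz1 => -[]. Qed.

Lemma regpart_der z : nm z <= 1 -> z != z2 -> cder regpart z (regpart' z).
Proof.
move=> hz n2; have [_ d1] := pden z11 hz; have [_ d2] := pden z21 hz.
have D2 := cderN (cderZ (resid^*) (cder_div (cder_id z) (cderB (cder_cst 1 z) (cderZ (z1^*) (cder_id z))) d1)).
have -> : regpart' z = - (resid^* * ((1 * (1 - z1^* * z) - z * (0 - z1^* * 1)) / (1 - z1^* * z) ^+ 2)) + pterm' a2 z2 z.
  by congr (- _ + _); field.
exact: (cderD D2 (pterm_der a2 n2 d2)).
Qed.

Lemma omg_z2 : omg w1 w2 w2 = 1.
Proof. by rewrite /omg; field; rewrite subr_eq0 eq_sym. Qed.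

Lemma omg_z1 : omg w1 w2 w1 = -1.
Proof. by rewrite /omg; field; rewrite subr_eq0 eq_sym. Qed.

(* Near z_k the sign of Re omg is that of omg(w_k) = -1, 1. *)
Lemma omg_sign z w (s : R) : nm z < 1 -> F z = fin_pt w -> omg w1 w2 w = s%:C%C -> `|s| = 1 ->
  exists2 r : R, 0 < r & forall u, nm (u - z) < r -> 0 < s * complex.Re (omg w1 w2 (finite_part F u)).
Proof.
move=> hz Fz Ow s1; have [r [G [G' [r0 HG HF]]]] := mero_finite (mF (proj2 (diskE z) hz)) Fz.
have z00 : nm (z - z) < r by rewrite subrr nm0.
have Gz : G z = w by have := HF z z00; rewrite Fz => -[].
have co : ccont (fun u => omg w1 w2 (G u)) z by apply: ccont_comp (cder_cont (HG z z00)) (cder_cont (omg_der _ _ _)).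
have [d d0 Hd] := co 1 ltr01; exists (Num.min r d); first by rewrite lt_min r0.
move=> u; rewrite lt_min => /andP[u1 u2]; rewrite /finite_part HF //=.
have := le_lt_trans (Re_le_nm _) (Hd u u2); rewrite Gz Ow ReD ReN /=.
move: s1; case: (ltP 0 s) => hs; [rewrite gtr0_norm //|rewrite ler0_norm //] => s1.
  by rewrite s1 mul1r ltr_norml => /andP[? _]; lra.
have -> : s = -1 by lra.
by rewrite mulN1r ltr_norml => /andP[_ ?]; lra.
Qed.

Lemma build_side : inhabited (side (psum z1 z2 resid a2) (psum' z1 z2 resid a2) H residue_shift).
Proof.
have mz1 := mF (proj2 (diskE z1) z11).
have [r [G [G' [r0 HG HF]]]] := mero_finite mz1 Fz1.
have z10 (e : R) : 0 < e -> nm (z1 - z1) < e by rewrite subrr nm0.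
have Gz : G z1 = w1 by have := HF z1 (z10 r r0); rewrite Fz1 => -[].
have [r' [m [m1 [m2 [m3 [/andP[r'0 r'r] Hm Hm1 Hm2 GE]]]]]] := local_expansion r0 HG.
have HF' z : nm (z - z1) < r' -> F z = fin_pt (G z) by move=> h; apply: HF; apply: lt_le_trans r'r.
have [dm sm] := deriv_schwarzian r'0 HF' GE Hm Hm1 Hm2.
have m0 : m z1 != 0 by rewrite -dm.
have [s s0 Hs] : exists2 s : R, 0 < s & forall u, nm (u - z1) < s -> 0 < (-1) * complex.Re (omg w1 w2 (finite_part F u)).
  by apply: omg_sign Fz1 _ _ => //; [rewrite omg_z1 rmorphN1|rewrite normrN1].
have [s2 s20 Hs2] : exists2 s : R, 0 < s & forall u, nm (u - z2) < s -> 0 < 1 * complex.Re (omg w1 w2 (finite_part F u)).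
  by apply: omg_sign Fz2 _ _ => //; [rewrite omg_z2|rewrite normr1].
pose q := Num.min (Num.min r' s) (Num.min (1 - nm z1) (nm (z1 - z2))).
have [q0 q1 q2 q3 q4] : [/\ 0 < q, q <= r', q <= s, q <= 1 - nm z1 & q <= nm (z1 - z2)].
  by rewrite /q !lt_min !ge_min r'0 s0 !lexx !orbT subr_gt0 z11 nm_gt0 subr_eq0 poles_distinct.
have qd z : nm (z - z1) < q -> nm z < 1 /\ z != z2.
  move=> hz; split; first by have := nm_sub_ge z z1; lra.
  by apply: contraTneq hz => ->; rewrite nmBC -leNgt.
have Hrho : holo regpart regpart' z1 q by move=> z /qd[h1 h2]; apply: regpart_der => //; exact: ltW.
have GE' z : nm (z - z1) < q -> G z = G z1 + (z - z1) * m z by move=> h; apply: GE; apply: lt_le_trans q1.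
have D0 : w2 - G z1 != 0 by rewrite Gz subr_eq0 eq_sym.
have [be [d [R0 [B [i [dE [R01 B0] [e' e'0 He'] Hi HI]]]]]] :=
  pole_normal_form q0 q0 GE' (holoS q1 Hm) (holoS q1 Hm1) (holoS q1 Hm2) Hrho m0 D0.
rewrite Gz in dE He' HI.
have al : - (D / 4) / m z1 = resid by rewrite /resid dm.
have ds : residue_shift = d by rewrite dE /residue_shift (sm m0) dm al.
have gvE z : nm (z - z1) < q -> gval F w1 w2 z = (omg w1 w2 (G z) ^+ 2 - 1)^-1.
  by move=> h; rewrite (gval_fin _ _ (HF' z (lt_le_trans h q1))).
have HH := @hset_shift_open _ F w1 w2 mF be.
have Hinf h : R0 < nm h -> complex.Im h != complex.Im be ->
    [/\ H (i h^-1), gval F w1 w2 (i h^-1) + be = h, dgval F w1 w2 (i h^-1) != 0 & ccont (fun h => i h^-1) h] /\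
    exists E0 E1, [/\ psum z1 z2 resid a2 (i h^-1) = h + E0,
      psum' z1 z2 resid a2 (i h^-1) / dgval F w1 w2 (i h^-1) = 1 - E1 / h ^+ 2,
      nm (E0 - residue_shift / h) <= B / nm h ^+ 2 & nm (E1 - residue_shift) <= B / nm h].
  move=> hR hI; have [[h1 h2] [h3 h4] h5 [gd [E0 [E1 [Dg gd0 pE pE' [b1 b2]]]]]] := HI h hR.
  have gz : gval F w1 w2 (i h^-1) + be = h by rewrite gvE.
  have Hz : H (i h^-1).
    split; first by have [] := qd _ h1.
      by move: hI; rewrite -{1}gz ImD -subr_eq0 addrK.
    by have := Hs _ (lt_le_trans h1 q2); rewrite mulN1r oppr_gt0.
  have gdE : dgval F w1 w2 (i h^-1) = gd.
    have [_ [rr rr0 [_ Hg]]] := hset_open mF Hz.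
    apply: (cder_unique (Hg _ _)); first by rewrite subrr nm0.
    apply: cder_ext Dg; have [dd dd0 Hd] := loc_ball h1; exists dd => // z /Hd hz.
    by rewrite gvE.
  split; first by rewrite gdE.
  rewrite al in pE pE'; exists E0, E1; rewrite gdE; split=> //.
  - by rewrite -pE; exact: esym (addrA _ _ _).
  - by rewrite -pE'; congr (_ / _); exact: esym (addrA _ _ _).
  - by rewrite ds.
  - by rewrite ds.
have finf_z1 : forall e : R, 0 < e -> exists T : R, forall h, T < nm h -> nm (i h^-1 - z1) < e by exact: Hi.
have R00 : 0 < R0 := lt_le_trans ltr01 R01.
have [V1 [psi1 S1]] := max_sheet (fun h => i h^-1) R00 HH (mulr1 1).
have ss2 : -1 * -1 = 1 :> R by rewrite mulrNN mulr1.
have [V2 [psi2 S2]] := max_sheet (fun h => i h^-1) R00 HH ss2.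
have agree h : V1 h -> V2 h -> psi1 h = psi2 h.
  exact: (@rays_agree R F z1 w1 w2 mF w12 z11 Fz1 dF1 one be R0 (fun h => i h^-1) finf_z1 V1 V2 psi1 psi2 R00 (proj1 S1) (proj1 S2)).
have [Kb Kb0 Hb] := psum_boundary resid a2 z11 z21.
pose e1 := Num.min e' q; have e10 : 0 < e1 by rewrite lt_min e'0.
have e20 : 0 < Num.min e1 s2 by rewrite lt_min e10.
have [Kc [Kc0 Hc]] := psum_bound resid a2 z11 z21 e20.
have HP z : H z -> [/\ nm z < 1, z != z1 & z != z2].
  move=> Hz; have [hz _ Re0] := Hz; split=> //.
    by apply: contraPneq Hz => ->; exact: z1_notin.
  by apply: contraTneq Re0 => ->; rewrite /finite_part Fz2 /= omg_z2 /= -leNgt ler01.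
constructor.
(* [Kb] bounds [p] near the circle and [Kc] on the core; the record takes one common bound. *)
apply: (@Side _ _ _ _ _ (fun z => gval F w1 w2 z + be) (dgval F w1 w2) (complex.Im be) R0 (fun h => i h^-1) V1 V2 psi1 psi2 B (Kb + Kc)) => //.
- move=> z c hz hc cl; have hc' : complex.Im (c - be) != 0 by rewrite ImD ImN subr_eq0.
  have [|h1 h2] := hset_closed w12 mF hz hc'; last by split=> //; rewrite h2 subrK.
  move=> e /cl[w [k1 k2 k3]]; exists w; split=> //; move: k3; congr (is_true (nm _ < _)); ring.
- by move=> h h1 h2; have [] := Hinf h h1 h2.
- by move=> z /HP[h1 h2 h3]; have [k1 k2 _] := psum_der resid a2 z11 z21 (ltW h1) h2 h3; split=> //; exact: cder_cont k2.
- move=> e /Hb[rr rr0 Hr]; exists rr => // z h1 h2; have [k1 k2] := Hr z h1 h2; split=> //.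
  by apply: le_trans k2 _; rewrite lerDl.
- move=> z Hz hg; have [h1 h2 h3] := HP z Hz; have [_ _ Re0] := Hz.
  (* Near [z1] the coordinate exceeds [2 * R0] by [He'], and near [z2] one has [Re om > 0], which
     [H] excludes. Away from both poles [p] is bounded. *)
  have far1 : e1 <= nm (z - z1).
    rewrite leNgt; apply/negP; rewrite lt_min => /andP[hz1 hz2]; have [_] := He' z hz1 h2.
    by rewrite -/(omg w1 w2 (G z)) -gvE // ltNge hg.
  have far2 : s2 <= nm (z - z2).
    by rewrite leNgt; apply/negP => /Hs2; rewrite mul1r ltNge (ltW Re0).
  have minl (a b : R) : Num.min a b <= a by rewrite ge_min lexx.
  have minr (a b : R) : Num.min a b <= b by rewrite ge_min lexx orbT.
  have [k1 _ _] := Hc z (ltW h1) (le_trans (minl _ _) far1) (le_trans (minr _ _) far2).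
  by apply: le_trans k1 _; rewrite lerDr.
- by move=> h h1 h2; have [] := Hinf h h1 h2.
Qed.
End BuildSide.

(** * From the inequality for d_1 + d_2 to the Schwarzian inequality *)

Section Inequality.
Context {R : realType}.
Local Notation C := R[i].
Implicit Types (F : C -> sphere R) (z w : C).

Lemma omg_swap w1 w2 w : omg w2 w1 w = - omg w1 w2 w.
Proof. by rewrite /omg -(opprB w1 w2) invrN mulrN opprK; congr (_ * _); ring. Qed.

Lemma level_curves_swap w1 w2 : level_curves w2 w1 = level_curves w1 w2.
Proof.
apply/funext => t; apply/funext => w; rewrite /level_curves /mkset.
by rewrite -/(omg w2 w1 w) -/(omg w1 w2 w) omg_swap sqrrN.
Qed.

(** Exchanging the points changes the sign of [om] but not its square, so the family of curves stays
    the same. *)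
Lemma admissible_swap F z1 z2 w1 w2 : admissible F z1 z2 w1 w2 -> admissible F z2 z1 w2 w1.
Proof.
move=> [mF [h1 h2] [e1 e2 w12] [d1 d2] H]; split=> //; first by split=> //; exact: nesym.
move=> J J1 J2 J3 J4 J5; apply: H => //; first by case: J3; [right|left].
by move: J5; rewrite /Delta level_curves_swap.
Qed.

Lemma admissible_side F z1 z2 w1 w2 (a2 : C) : admissible F z1 z2 w1 w2 ->
  let a1 := resid F z1 w1 w2 in
  inhabited (side (psum z1 z2 a1 a2) (psum' z1 z2 a1 a2) (hset F w1 w2) (residue_shift F z1 z2 w1 w2 a2)).
Proof.
move=> [mF [/diskE h1 /diskE h2] [e1 e2 /eqP w12] [d1 d2] H] /=.
apply: build_side => // J J1 J2 J3 J4 J5; apply: H => //; by left.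
Qed.

Lemma resid_neq0 F z1 w1 w2 : w1 != w2 -> Defs.deriv F z1 != 0 -> resid F z1 w1 w2 != 0.
Proof.
move=> w12 d1; have D0 : w2 - w1 != 0 by rewrite subr_eq0 eq_sym.
have c4 : (4 : C) != 0 by rewrite pnatr_eq0.
have q : - ((w2 - w1) / 4) != 0 by rewrite oppr_eq0; exact: mulf_neq0 D0 (invr_neq0 c4).
exact: mulf_neq0 q (invr_neq0 d1).
Qed.

Lemma resid_swap F z2 w1 w2 : resid F z2 w2 w1 = ((w2 - w1) / 4) / Defs.deriv F z2.
Proof.
have e : w1 - w2 = - (w2 - w1) by rewrite opprB.
by rewrite /resid e (mulNr (w2 - w1) 4^-1) opprK.
Qed.

Lemma schwarzian_rhs_real F z1 z2 w1 w2 : exists x : R, schwarzian_rhs F z1 z2 w1 w2 = x%:C%C.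
Proof.
have t (a b c : C) : `|a| ^+ 2 / (`|b| ^+ 2 * (1 - `|c| ^+ 2) ^+ 2) \is Num.real.
  apply: rpred_div; first exact: rpredX (normr_real _).
  apply: rpredM; apply: rpredX; first exact: normr_real.
  by apply: rpredB; [exact: rpred1|apply: rpredX; exact: normr_real].
exists (complex.Re (schwarzian_rhs F z1 z2 w1 w2)); apply/esym/RRe_real.
by apply: rpredD; [apply: rpredD; [exact: realn|exact: t]|exact: t].
Qed.

Lemma Re_bound (x y q : C) (r : R) : complex.Re x + complex.Re y <= 0 ->
  'Re (r%:C%C + 16 * (x + y) + (q - q^*)) <= r%:C%C.
Proof.
move=> h; rewrite -complexRe lecR conjCE; case: x y q h => [a b] [c d] [e f] /= h.
by lra.
Qed.

Lemma conj_div (x y : C) : (x / y)^* = x^* / y^*.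
Proof. by rewrite fmorph_div. Qed.

Lemma conj_quotient (a b c x y : C) : (a * a^* / (b * c^* * (1 - x * y^*) ^+ 2))^* = a * a^* / (b^* * c * (1 - x^* * y) ^+ 2).
Proof.
have n : (a * a^*)^* = a * a^* by rewrite rmorphM /= conjCK mulrC.
have p : (1 - x * y^*)^* = 1 - x^* * y by rewrite rmorphB /= rmorph1 (rmorphM _ x) /= conjCK.
rewrite conj_div n; congr (_ / _).
by rewrite (rmorphM _ (b * c^*)) (rmorphM _ b) /= conjCK -p -rmorphXn.
Qed.

(** Conjugates are independent variables here, which makes this an identity of rational functions.
    The mixed term occurs on the left as [2 * Q], while [16 * (d1 + d2)] yields [Q + Q']; as [Q']
    will be the conjugate of [Q], the difference is imaginary. The three other terms on the right
    cancel against parts of [16 * (d1 + d2)]. *)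
Lemma shift_identity (K : fieldType) (D D' f1 f1' f2 f2' z1 z1' z2 z2' S1 S2 : K) :
  2%:R != 0 :> K -> 3%:R != 0 :> K ->
  f1 != 0 -> f2 != 0 -> f1' != 0 -> f2' != 0 -> z1 - z2 != 0 ->
  1 - z1 * z1' != 0 -> 1 - z2 * z2' != 0 -> 1 - z1 * z2' != 0 -> 1 - z1' * z2 != 0 ->
  let a1 := - (D / 4) / f1 in let a1' := - (D' / 4) / f1' in let a2 := (D / 4) / f2 in let a2' := (D' / 4) / f2' in
  let d1 := a1 * (- (a1' / (1 - z1' * z1) ^+ 2) + (- a2 / (z1 - z2) ^+ 2 - a2' / (1 - z2' * z1) ^+ 2)) - 1 / 16 + D ^+ 2 / 96 * S1 / f1 ^+ 2 in
  let d2 := a2 * (- (a2' / (1 - z2' * z2) ^+ 2) + (- a1 / (z2 - z1) ^+ 2 - a1' / (1 - z1' * z2) ^+ 2)) - 1 / 16 + D ^+ 2 / 96 * S2 / f2 ^+ 2 in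
  let Q := D * D' / (f1 * f2' * (1 - z1 * z2') ^+ 2) in
  let Q' := D * D' / (f1' * f2 * (1 - z1' * z2) ^+ 2) in
  S1 * D ^+ 2 / (6 * f1 ^+ 2) + S2 * D ^+ 2 / (6 * f2 ^+ 2) + 2 * D ^+ 2 / (f1 * f2 * (z1 - z2) ^+ 2) + 2 * (D * D') / (f1 * f2' * (1 - z1 * z2') ^+ 2) =
  (2 + D * D' / (f1 * f1' * (1 - z1 * z1') ^+ 2) + D * D' / (f2 * f2' * (1 - z2 * z2') ^+ 2)) + 16 * (d1 + d2) + (Q - Q').
Proof.
move=> n2 n3 h1 h2 h3 h4 h5 h6 h7 h8 h9 /=.
have n (a b c : nat) : (a * b)%N = c -> a%:R != 0 :> K -> b%:R != 0 :> K -> c%:R != 0 :> K.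
  by move=> <-; rewrite natrM => *; exact: mulf_neq0.
have n4 := n 2 2 4 erefl n2 n2; have n16 := n 4 4 16 erefl n4 n4; have n6 := n 2 3 6 erefl n2 n3.
have n96 := n 16 6 96 erefl n16 n6.
have h5' : z2 - z1 != 0 by rewrite -opprB oppr_eq0.
by field; rewrite h9 h2 h3 h8 h4 h1 n96 n16 n4 h5' (mulrC z2') h7 h5 (mulrC z1') h6 n6.
Qed.

Lemma schwarzian_decomposition (D f1 f2 z1 z2 S1 S2 a1 a2 : C) : nm z1 < 1 -> nm z2 < 1 -> z1 != z2 ->
  f1 != 0 -> f2 != 0 -> a1 = - (D / 4) / f1 -> a2 = (D / 4) / f2 -> exists q : C,
  S1 * D ^+ 2 / (6 * f1 ^+ 2) + S2 * D ^+ 2 / (6 * f2 ^+ 2) + 2 * D ^+ 2 / (f1 * f2 * (z1 - z2) ^+ 2) + 2 * `|D| ^+ 2 / (f1 * f2^* * (1 - z1 * z2^*) ^+ 2) =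
  (2 + `|D| ^+ 2 / (`|f1| ^+ 2 * (1 - `|z1| ^+ 2) ^+ 2) + `|D| ^+ 2 / (`|f2| ^+ 2 * (1 - `|z2| ^+ 2) ^+ 2)) +
  16 * ((a1 * (- (a1^* / (1 - z1^* * z1) ^+ 2) + (- a2 / (z1 - z2) ^+ 2 - a2^* / (1 - z2^* * z1) ^+ 2)) - 1 / 16 + D ^+ 2 / 96 * S1 / f1 ^+ 2) +
    (a2 * (- (a2^* / (1 - z2^* * z2) ^+ 2) + (- a1 / (z2 - z1) ^+ 2 - a1^* / (1 - z1^* * z2) ^+ 2)) - 1 / 16 + D ^+ 2 / 96 * S2 / f2 ^+ 2)) + (q - q^*).
Proof.
move=> h1 h2 n12 d1 d2 e1 e2.
have J0 (x : C) : x != 0 -> x^* != 0 by rewrite conjC_eq0.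
have den (x y : C) : nm x < 1 -> nm y < 1 -> 1 - x * y^* != 0.
  by move=> hx hy; have [_] := pden hy (ltW hx); rewrite mulrC.
have den' (x y : C) : nm x < 1 -> nm y < 1 -> 1 - x^* * y != 0 by move=> hx hy; rewrite mulrC den.
have zz : z1 - z2 != 0 by rewrite subr_eq0.
have c2 : 2%:R != 0 :> C by rewrite pnatr_eq0.
have c3 : 3%:R != 0 :> C by rewrite pnatr_eq0.
exists (D * D^* / (f1 * f2^* * (1 - z1 * z2^*) ^+ 2)); rewrite conj_quotient !normCK.
have four : (4 : C)^* = 4 by rewrite rmorph_nat.
have a1J : a1^* = - (D^* / 4) / f1^* by rewrite e1 conj_div rmorphN /= conj_div four.
have a2J : a2^* = (D^* / 4) / f2^* by rewrite e2 !conj_div four.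
rewrite a1J a2J e1 e2.
exact: (@shift_identity _ D D^* f1 f1^* f2 f2^* z1 z1^* z2 z2^* S1 S2 c2 c3 d1 d2
  (J0 _ d1) (J0 _ d2) zz (den _ _ h1 h1) (den _ _ h2 h2) (den _ _ h1 h2) (den' _ _ h1 h2)).
Qed.

(** The two sides differ by 16 times the real part of the sum of both residue shifts, which
    [core_inequality] bounds by zero. *)
Lemma schwarzian_inequality F z1 z2 w1 w2 : admissible F z1 z2 w1 w2 ->
  schwarzian_lhs F z1 z2 w1 w2 <= schwarzian_rhs F z1 z2 w1 w2.
Proof.
move=> A; have B := admissible_swap A.
have [mF [/diskE h1 /diskE h2] [e1 e2 /eqP w12] [d1 d2] H] := A.
pose a1 : C := resid F z1 w1 w2; pose a2 : C := resid F z2 w2 w1.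
have [S1] := admissible_side a2 A; have [S2] := admissible_side a1 B.
rewrite -/a1 -/a2 in S1 S2.
have n12 : z1 != z2 := poles_distinct w12 e1 e2.
have w21 : w2 != w1 by rewrite eq_sym.
have a10 : a1 != 0 := resid_neq0 w12 d1.
have a20 : a2 != 0 := resid_neq0 w21 d2.
have E1 : psum z2 z1 a2 a1 = psum z1 z2 a1 a2 by apply/funext => z; exact: psumC.
have E2 : psum' z2 z1 a2 a1 = psum' z1 z2 a1 a2 by apply/funext => z; exact: addrC.
rewrite E1 E2 in S2.
have sub (G : C -> sphere R) u1 u2 v1 v2 : G u1 = fin_pt v1 -> G u2 = fin_pt v2 -> v1 != v2 -> hset G v1 v2 `<=` pdisk u1 u2.
  move=> g1 g2 v12 z Hz; have [hz _ R0] := Hz; split=> //.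
    by apply: contraPneq Hz => ->; exact: z1_notin.
  by apply: contraTneq R0 => ->; rewrite /finite_part g2 /= omg_z2 // -leNgt ler01.
have disj : hset F w1 w2 `&` hset F w2 w1 = set0.
  rewrite -subset0 => z [[_ _ r1] [_ _ r2]]; move: r2; rewrite omg_swap ReN; lra.
have sub2 : hset F w2 w1 `<=` pdisk z1 z2.
  by move=> z /(sub F z2 z1 w2 w1 e2 e1 w21)[].
have core := core_inequality h1 h2 n12 a10 a20 S1 S2 (sub F z1 z2 w1 w2 e1 e2 w12) sub2 disj.
have [q E] := schwarzian_decomposition (schwarzian F z1) (schwarzian F z2) h1 h2 n12 d1 d2
  (erefl a1) (resid_swap F z2 w1 w2).
rewrite -/a2 in E.
have lhsE : schwarzian_lhs F z1 z2 w1 w2 = 'Re (schwarzian_rhs F z1 z2 w1 w2 + 16 * (residue_shift F z1 z2 w1 w2 a2 + residue_shift F z2 z1 w2 w1 a1) + (q - q^*)).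
  have sq : (w1 - w2) ^+ 2 = (w2 - w1) ^+ 2 by rewrite -sqrrN opprB.
  by rewrite /schwarzian_lhs E /schwarzian_rhs /residue_shift sq.
have [x xE] := schwarzian_rhs_real F z1 z2 w1 w2.
rewrite lhsE xE; exact: Re_bound.
Qed.
End Inequality.

(** * The extremal functions *)

Section Extremal.
Context {R : realType}.
Local Notation C := R[i].
Variable lam : R.
Hypotheses (lam0 : 0 < lam) (lam1 : lam < 1).
Implicit Types (u v z w : C).
Local Notation F := (extremal lam).

Definition xl : C := lam%:C%C.
Definition xk : C := 1 + xl ^+ 2.
Local Notation l := xl.
Local Notation k := xk.
Local Notation j := ('i : C).

Definition xnum z : C := z * k - j * l * z ^+ 2 - j * l.
Definition xden z : C := l * z ^+ 2 - j * k * z + l.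
Definition xnum' z : C := k - 2 * j * l * z.
Definition xden' z : C := 2 * l * z - j * k.

Lemma extremalE z : F z = if xden z == 0 then infty R else fin_pt (xnum z / xden z).
Proof. by []. Qed.

Lemma ii : j * j = -1.
Proof. by rewrite -expr2 sqrCi. Qed.

Lemma xl_neq0 : l != 0.
Proof. by rewrite -nm_gt0 nm_real normr_gt0 gt_eqF. Qed.

Lemma xkE : k = (1 + lam ^+ 2)%:C%C.
Proof. by rewrite /xk /xl rmorphD rmorph1 rmorphXn. Qed.

Lemma xk_neq0 : k != 0.
Proof.
rewrite xkE -nm_gt0 nm_real normr_gt0 gt_eqF // ltr_wpDr //; exact: sqr_ge0.
Qed.

Lemma two_neq0 : (2 : C) != 0.
Proof. by rewrite pnatr_eq0. Qed.

(** The factor [u * v - 1] reflects that the map depends on [z + 1 / z] alone; inside the disk only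
    [u = v] is left. *)
Lemma xcross u v : xnum u * xden v - xnum v * xden u = - (2 * l * k) * ((u - v) * (u * v - 1)).
Proof. by rewrite /xnum /xden; ring: ii. Qed.

Definition xwr z : C := 2 * l * k * (1 - z ^+ 2).

Lemma xwronskian z : xnum' z * xden z - xnum z * xden' z = xwr z.
Proof. by rewrite /xnum /xden /xnum' /xden' /xwr; ring: ii. Qed.

Lemma xnum_der z : cder xnum z (xnum' z).
Proof.
have := cderB (cderB (cderZ k (cder_id z)) (cderZ (j * l) (cderX 1 (cder_id z)))) (cder_cst (j * l) z).
have -> : k * 1 - j * l * (2 * z ^+ 1 * 1) - 0 = xnum' z by rewrite /xnum'; ring.
by apply: cder_ext; exists 1 => // w _; rewrite /xnum; ring.
Qed.

Lemma xden_der z : cder xden z (xden' z).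
Proof.
have := cderD (cderB (cderZ l (cderX 1 (cder_id z))) (cderZ (j * k) (cder_id z))) (cder_cst l z).
have -> : l * (2 * z ^+ 1 * 1) - j * k * 1 + 0 = xden' z by rewrite /xden'; ring.
by apply: cder_ext; exists 1.
Qed.

Lemma xden'_der z : cder xden' z (2 * l).
Proof.
have := cderB (cderZ (2 * l) (cder_id z)) (cder_cst (j * k) z); rewrite mulr1 subr0.
by apply: cder_ext; exists 1.
Qed.

Lemma xwr_der z : cder xwr z (- (4 * l * k) * z).
Proof.
have := cderZ (2 * l * k) (cderB (cder_cst 1 z) (cderX 1 (cder_id z))).
have -> : 2 * l * k * (0 - 2 * z ^+ 1 * 1) = - (4 * l * k) * z by ring.
by apply: cder_ext; exists 1.
Qed.

Lemma xwr'_der z : cder (fun z => - (4 * l * k) * z) z (- (4 * l * k)).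
Proof. by have := cderZ (- (4 * l * k)) (cder_id z); rewrite mulr1. Qed.

Lemma xnum_neq0 z : xden z = 0 -> xnum z != 0.
Proof.
move=> d; apply/eqP => n; have : xnum z + j * xden z = 2 * k * z by rewrite /xnum /xden; ring: ii.
rewrite n d mulr0 addr0 => /esym/eqP; rewrite !mulf_eq0 (negbTE two_neq0) (negbTE xk_neq0) /= => /eqP z0.
by move/eqP: d; rewrite z0 /xden expr0n /= !mulr0 subr0 add0r (negbTE xl_neq0).
Qed.

Lemma xwr_neq0 z : nm z < 1 -> xwr z != 0.
Proof.
move=> hz; rewrite !mulf_neq0 ?two_neq0 ?xl_neq0 ?xk_neq0 // subr_eq0 eq_sym.
by apply: contraTneq hz => e; rewrite -leNgt -(@expr_ge1 _ 2) ?nm_ge0 // -nmX e nm1.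
Qed.

Lemma xcross_inj u v : nm u < 1 -> nm v < 1 -> xnum u * xden v = xnum v * xden u -> u = v.
Proof.
move=> hu hv /eqP; rewrite -subr_eq0 xcross mulf_eq0 oppr_eq0 !mulf_eq0 (negbTE two_neq0) (negbTE xk_neq0) (negbTE xl_neq0) /=.
rewrite subr_eq0 => /orP[/eqP//|]; rewrite subr_eq0 => /eqP e.
have := nm_ge0 u; have := nm_ge0 v; have : nm (u * v) = 1 by rewrite e nm1.
by rewrite nmM => *; exfalso; nra.
Qed.

Lemma extremal_inj : set_inj (@unit_disk R) F.
Proof.
move=> u v; rewrite !inE => /diskE hu /diskE hv; rewrite !extremalE.
case: (eqVneq (xden u) 0) => [du|du]; case: (eqVneq (xden v) 0) => [dv|dv] //.
  by move=> _; apply: xcross_inj => //; rewrite du dv !mulr0.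
by case=> /eqP; rewrite eqr_div // => /eqP; exact: xcross_inj.
Qed.

Lemma xquot_der z : xden z != 0 -> cder (fun z => xnum z / xden z) z (xwr z / xden z ^+ 2).
Proof. by move=> d; rewrite -xwronskian; exact: cder_div (xnum_der z) (xden_der z) d. Qed.

Lemma xquotV_der z : xnum z != 0 -> cder (fun z => xden z / xnum z) z (- xwr z / xnum z ^+ 2).
Proof.
move=> n; have := cder_div (xden_der z) (xnum_der z) n; congr cder; congr (_ / _).
by rewrite -xwronskian; ring.
Qed.

Lemma cont_neq0 (G : C -> C) z : ccont G z -> G z != 0 -> exists2 r : R, 0 < r & forall u, nm (u - z) < r -> G u != 0.
Proof.
move=> cG Gz; have n : 0 < nm (G z) by rewrite nm_gt0.
have [d d0 Hd] := cG _ n; exists d => // u /Hd.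
by apply: contraTneq => ->; rewrite sub0r nmN ltxx.
Qed.

Lemma extremal_charts z : nm z < 1 -> exists r G G', [/\ 0 < r, holo G G' z r, G' z != 0 &
  (forall u, nm (u - z) < r -> F u = fin_pt (G u)) \/
  (forall u, nm (u - z) < r -> F u = inv_sphere (G u)) /\ (forall u, nm (u - z) < r -> u != z -> G u != 0)].
Proof.
move=> hz; have w0 := xwr_neq0 hz; have [d|d] := eqVneq (xden z) 0.
  have n := xnum_neq0 d; have [r r0 Hr] := cont_neq0 (cder_cont (xnum_der z)) n.
  pose q := Num.min r (1 - nm z).
  have q0 : 0 < q by rewrite lt_min r0 subr_gt0.
  have nr u : nm (u - z) < q -> xnum u != 0 by rewrite lt_min => /andP[/Hr].
  exists q, (fun z => xden z / xnum z), (fun z => - xwr z / xnum z ^+ 2); split=> //.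
  - by move=> u /nr nu; exact: xquotV_der.
  - by rewrite mulf_neq0 ?oppr_eq0 ?invr_eq0 ?expf_neq0.
  right; split=> [u hu|u hu uz].
    have nu := nr u hu; rewrite extremalE /inv_sphere invf_div mulf_eq0 invr_eq0 (negbTE nu) orbF //.
  (* A second zero of the denominator in the disk is ruled out by [xcross_inj]. *)
  have nu := nr u hu; rewrite mulf_neq0 ?invr_eq0 //; apply: contra_neq uz => du.
  have hu1 : nm u < 1 by move: hu; rewrite lt_min => /andP[_]; have := nm_sub_ge u z; lra.
  by apply: xcross_inj => //; rewrite d du !mulr0.
have [r r0 Hr] := cont_neq0 (cder_cont (xden_der z)) d.
exists r, (fun z => xnum z / xden z), (fun z => xwr z / xden z ^+ 2); split=> //.
- by move=> u /Hr du; exact: xquot_der.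
- by rewrite mulf_neq0 ?invr_eq0 ?expf_neq0.
- by left=> u /Hr du; rewrite extremalE (negbTE du).
Qed.

Lemma extremal_meromorphic : meromorphic_on (@unit_disk R) F.
Proof.
move=> z /diskE/extremal_charts[r [G [G' [r0 HG _ H]]]]; exists G; split.
  by apply/holomorphicE; exists r, G'.
case: H => [H|[H1 H2]]; [left|right; split]; first by apply/nearC; exists r.
  by apply/nearC; exists r.
by apply/near'C; exists r.
Qed.

Lemma extremal_conformal : conformal_on (@unit_disk R) F.
Proof.
move=> z /diskE/extremal_charts[r [G [G' [r0 HG G'0 H]]]]; exists G; split.
- by apply/holomorphicE; exists r, G'.
- by rewrite (holo_derive1 HG) // subrr nm0.
case: H => [H|[H1 _]]; [left|right]; by apply/nearC; exists r.
Qed.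

Lemma nm_xl : nm l < 1 /\ nm (- l) < 1.
Proof. by rewrite nmN nm_real gtr0_norm. Qed.

Lemma xden_l : xden l = l * k * (1 - j).
Proof. by rewrite /xden /xk; ring. Qed.
Lemma xden_Nl : xden (- l) = l * k * (1 + j).
Proof. by rewrite /xden /xk; ring. Qed.

Lemma ji_neq0 : 1 - j != 0 /\ 1 + j != 0.
Proof.
have e : (1 - j) * (1 + j) != 0.
  have -> : (1 - j) * (1 + j) = 2 by ring: ii.
  exact: two_neq0.
by move: e; rewrite mulf_eq0 negb_or => /andP.
Qed.

Lemma extremal_values : F (- l) = fin_pt (- 1) /\ F l = fin_pt 1.
Proof.
have [j1 j2] := ji_neq0; have [l0 k0] := (xl_neq0, xk_neq0).
rewrite !extremalE xden_l xden_Nl !mulf_eq0 (negbTE j1) (negbTE j2) (negbTE l0) (negbTE k0) /=.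
split; congr fin_pt.
- have -> : xnum (- l) = - (l * k * (1 + j)) by rewrite /xnum /xk; ring.
  by rewrite mulNr divff // !mulf_neq0.
- have -> : xnum l = l * k * (1 - j) by rewrite /xnum /xk; ring.
  by rewrite divff // !mulf_neq0.
Qed.

(** As [f' = xwr / xden ^+ 2], the quotient [f'' / f'] is the logarithmic derivative
    [xwr' / xwr - 2 * xden' / xden]; [q1], [r1] and [q2], [r2] are the quotients that occur in it
    and in its derivative. *)
Lemma extremal_schwarzian z : nm z < 1 -> xden z != 0 ->
  let q1 := - (4 * l * k) * z / xwr z in let q2 := - (4 * l * k) / xwr z in
  let r1 := xden' z / xden z in let r2 := 2 * l / xden z in
  Defs.deriv F z = xwr z / xden z ^+ 2 /\
  schwarzian F z = (q2 - q1 ^+ 2) - 2 * (r2 - r1 ^+ 2) - 2^-1 * (q1 - 2 * r1) ^+ 2.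
Proof.
move=> hz d q1 q2 r1 r2; have w0 := xwr_neq0 hz.
have [r r0 Hr] := cont_neq0 (cder_cont (xden_der z)) d.
have [s s0 Hs] := cont_neq0 (cder_cont (xwr_der z)) w0.
pose q := Num.min r s; have qp : 0 < q by rewrite lt_min r0.
have du u : nm (u - z) < q -> xden u != 0 by rewrite lt_min => /andP[/Hr].
have wu u : nm (u - z) < q -> xwr u != 0 by rewrite lt_min => /andP[_ /Hs].
clearbody q; have z0 : nm (z - z) < q by rewrite subrr nm0.
pose g1 u := xwr u / xden u ^+ 2.
pose g2 u := (- (4 * l * k) * u * xden u ^+ 2 - xwr u * (2 * xden u ^+ 1 * xden' u)) / (xden u ^+ 2) ^+ 2.
have D0 : holo (finite_part F) g1 z q.
  apply: (@holo_ext _ (fun z => xnum z / xden z)) => [u hu|u hu]; last exact: xquot_der (du u hu).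
  by rewrite /finite_part extremalE (negbTE (du u hu)).
have E1 u : nm (u - z) < q -> derive1 (finite_part F) u = g1 u by exact: holo_derive1.
have D1 : holo (derive1 (finite_part F)) g2 z q.
  apply: (@holo_ext _ g1) => [u hu|u hu]; first by rewrite E1.
  exact: cder_div (xwr_der u) (cderX 1 (xden_der u)) (expf_neq0 2 (du u hu)).
have E2 u : nm (u - z) < q -> derive1n 2 (finite_part F) u = g2 u by exact: holo_derive1.
split; first by rewrite /Defs.deriv E1.
pose T0 u := - (4 * l * k) * u / xwr u - 2 * (xden' u / xden u).
have TE u : nm (u - z) < q -> g2 u / g1 u = T0 u.
  by move=> hu; rewrite /g2 /g1 /T0; field; rewrite du // wu.
have DT := cderB (cder_div (xwr'_der z) (xwr_der z) w0) (cderZ 2 (cder_div (xden'_der z) (xden_der z) d)).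
rewrite /schwarzian; set T := (fun u => _).
have DT' := cder_ext (G := T) _ DT.
have [|_ ->] := cder_derivable (DT' _).
  by exists q => // w hw; rewrite -/(T0 w) -TE // /T E1 // E2.
rewrite /T E1 // E2 // TE // /T0 -/q1 -/r1; congr (_ - _).
by rewrite /q2 /q1 /r2 /r1; field; rewrite d w0.
Qed.

Lemma one_sub_sq : 1 - l ^+ 2 != 0.
Proof.
by have := xwr_neq0 (proj1 nm_xl); rewrite mulf_eq0 negb_or => /andP[].
Qed.

Lemma extremal_jet : let a : C := (1 - l ^+ 2) / (l * k) in
  [/\ Defs.deriv F (- l) = - j * a, Defs.deriv F l = j * a,
      schwarzian F (- l) = - 6 / (1 - l ^+ 2) ^+ 2 & schwarzian F l = - 6 / (1 - l ^+ 2) ^+ 2].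
Proof.
have [h1 h2] := nm_xl; have [j1 j2] := ji_neq0; have l0 := xl_neq0; have k0 := xk_neq0; have s0 := one_sub_sq; have t0 := two_neq0; move=> a.
have d1 : xden l != 0 by rewrite xden_l !mulf_neq0.
have d2 : xden (- l) != 0 by rewrite xden_Nl !mulf_neq0.
have [Dl Sl] := extremal_schwarzian h1 d1; have [Dn Sn] := extremal_schwarzian h2 d2.
(* Writing [1 / (1 - i)] as [(1 + i) / 2] leaves only [l] and [k] in the denominators. *)
have v1 : (xden l)^-1 = (1 + j) / (2 * l * k).
  by apply: (mulfI d1); rewrite divff // xden_l; field: ii; rewrite ?k0 ?l0 ?t0.
have v2 : (xden (- l))^-1 = (1 - j) / (2 * l * k).
  by apply: (mulfI d2); rewrite divff // xden_Nl; field: ii; rewrite ?k0 ?l0 ?t0.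
rewrite Dl Sl Dn Sn -!exprVn v1 v2 /xwr /xden' /a sqrrN; move: k0 => {Dl Sl Dn Sn v1 v2 d1 d2 h1 h2 a}; rewrite /xk; move: l l0 s0 => L l0 s0 k0.
by split; field: ii; rewrite ?k0 ?l0 ?s0 ?t0.
Qed.

Lemma conj_xl : l^* = l /\ k^* = k.
Proof.
have c : l^* = l by rewrite conjCE /= oppr0.
by split=> //; rewrite /xk rmorphD rmorph1 rmorphXn /= c.
Qed.

(** [F] is injective on the disk, so every subset of its surface is one-sheeted. *)
Lemma extremal_admissible : admissible F (- l) l (- 1) 1.
Proof.
have [e1 e2] := extremal_values; have [h1 h2] := nm_xl; have [D1 D2 _ _] := extremal_jet.
have a0 : (1 - l ^+ 2) / (l * k) != 0.
  by rewrite mulf_neq0 ?one_sub_sq // invr_eq0 mulf_neq0 ?xl_neq0 ?xk_neq0.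
have j0 : j != 0 by rewrite neq0Ci.
split; [exact: extremal_meromorphic|by split; apply/diskE|split=> //| |].
- by move/eqP; rewrite -subr_eq0 -opprD oppr_eq0 -[_ + _]/(2%:R) pnatr_eq0.
- by rewrite D1 D2; split; apply: mulf_neq0 => //; rewrite oppr_eq0.
move=> J _ JS _ _ _ W W' /JS[u hu <-] /JS[v hv <-] n; rewrite /pr /Defs.lift /= => e.
by apply: n; rewrite (extremal_inj _ _ e) // inE.
Qed.

Lemma extremal_equality : schwarzian_lhs F (- l) l (- 1) 1 = schwarzian_rhs F (- l) l (- 1) 1.
Proof.
have [D1 D2 S1 S2] := extremal_jet; have [cl ck] := conj_xl.
have l0 := xl_neq0; have k0 := xk_neq0; have s0 := one_sub_sq.
have [x xE] := schwarzian_rhs_real F (- l) l (- 1) 1.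
(* The right side is real, so it may be put under ['Re], and it is enough to compare the complex
   numbers inside. *)
suff E : schwarzian_lhs F (- l) l (- 1) 1 = 'Re (schwarzian_rhs F (- l) l (- 1) 1).
  by rewrite E xE -complexRe.
have ca : ((1 - l ^+ 2) / (l * k))^* = (1 - l ^+ 2) / (l * k).
  by rewrite conj_div rmorphB /= rmorph1 rmorphXn /= (rmorphM _ l) /= cl ck.
have cj : j^* = - j by rewrite conjCi.
have c1 : (- j * ((1 - l ^+ 2) / (l * k)))^* = j * ((1 - l ^+ 2) / (l * k)).
  by rewrite rmorphM /= ca rmorphN /= cj opprK.
have c2 : (j * ((1 - l ^+ 2) / (l * k)))^* = - j * ((1 - l ^+ 2) / (l * k)).
  by rewrite rmorphM /= ca cj.
have two : (1 - -1 : C)^* = 1 - -1 by rewrite rmorphB rmorphN /= rmorph1.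
have cn : (- l)^* = - l by rewrite rmorphN /= cl.
rewrite /schwarzian_lhs /schwarzian_rhs D1 D2 S1 S2 !normCK c1 c2 two cn cl; congr ('Re _).
rewrite /xk in k0 *; move: l l0 s0 k0 {D1 D2 S1 S2 cl ck xE ca c1 c2 cn} => L l0 s0 k0.
have k1 : 1 - - L * L != 0 by move: k0; congr (_ != 0); ring.
have s1 : 1 - L * L != 0 by rewrite -expr2.
have s2 : 1 - - L * - L != 0 by rewrite mulrNN -expr2.
have t : - L - L != 0 by rewrite -opprD oppr_eq0 -mulr2n -mulr_natr mulf_neq0 // pnatr_eq0.
by field: ii; rewrite ?l0 ?s0 ?k0 ?k1 ?s1 ?s2 ?t neq0Ci.
Qed.

(** The outer factor of the map: [F z = mobius (z + 1 / z)]. The inner one carries the disk onto the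
    complement of the segment [[-2, 2]]. *)
Definition mobius (x : C) : C := (k - j * l * x) / (l * x - j * k).

Lemma mobius_den (x : R) : l * x%:C%C - j * k != 0.
Proof.
have e : complex.Im (l * x%:C%C - j * k) = - (1 + lam ^+ 2).
  by rewrite xkE ImD ImN !ImM /=; ring.
apply/eqP => /(congr1 (@complex.Im R)); rewrite e /= => /eqP; rewrite oppr_eq0.
by apply/negP; rewrite gt_eqF // ltr_wpDr // sqr_ge0.
Qed.

(** For real [x] the numerator is [- i] times the conjugate of the denominator. *)
Lemma mobius_circle (x : R) : unit_circle (mobius x%:C%C).
Proof.
have [cl ck] := conj_xl; have cx : (x%:C%C : C)^* = x%:C%C by rewrite conjCE /= oppr0.
have e : k - j * l * x%:C%C = - j * (l * x%:C%C - j * k)^*.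
  rewrite rmorphB /= !rmorphM /= cl ck cx conjCi.
  by ring: ii.
rewrite /unit_circle /= /mobius e normf_div normrM normrN normCi mul1r norm_conjC divff //.
by rewrite normr_eq0 mobius_den.
Qed.

(** The imaginary part of the equation says that [z] is real or [x = 2 * Re z]. In the second case
    [|z|^2 = 1]; in the first [(1 - |z|)^2 <= 0]. *)
Lemma root_on_circle z (x : R) : -2 <= x <= 2 -> z ^+ 2 + 1 = x%:C%C * z -> ~ nm z < 1.
Proof.
case: z => p q /andP[x1 x2] e h; have := nm_sqr (p +i* q)%C; rewrite /= => n.
have n0 := nm_ge0 (p +i* q)%C.
have e1 := congr1 (@complex.Re R) e; have e2 := congr1 (@complex.Im R) e.
rewrite expr2 ReD !ReM /= mul0r subr0 in e1; rewrite expr2 ImD !ImM /= mul0r !addr0 in e2.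
have s : p ^+ 2 + q ^+ 2 < 1 by rewrite -n; nra.
have [q0|q0] := eqVneq q 0.
  rewrite q0 in e1 s; have : p ^+ 2 + 1 = x * p by rewrite -[RHS]e1; ring.
  move=> {}e1; have p1 : -1 < p /\ p < 1 by move: s; rewrite expr0n /= addr0 => s; split; nra.
  have [a1 a2] : 0 < (1 - p) ^+ 2 /\ 0 < (1 + p) ^+ 2 by rewrite !exprn_gt0 //; lra.
  by have [hp|hp] := leP 0 p; nra.
have x2p : x = 2 * p.
  by apply: (mulIf q0); rewrite -e2; ring.
by rewrite x2p in e1; nra.
Qed.

Lemma mobius_inj (x y : R) : mobius x%:C%C = mobius y%:C%C -> x = y.
Proof.
move/eqP; rewrite eqr_div ?mobius_den // -subr_eq0.
set u : C := x%:C%C; set v : C := y%:C%C.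
have -> : (k - j * l * u) * (l * v - j * k) - (k - j * l * v) * (l * u - j * k) = 2 * l * k * (v - u) by ring: ii.
rewrite !mulf_eq0 (negbTE two_neq0) (negbTE xk_neq0) (negbTE xl_neq0) /= subr_eq0 => /eqP.
by move/(@complexI R).
Qed.

(** [4 * t - 2] carries the unit interval onto [[-2, 2]], the segment omitted by [z + 1 / z]. *)
Lemma mobius_arc : simple_arc R ((fun t : R => mobius (4 * t - 2)%:C%C) @` `[0, 1]).
Proof.
exists (fun t : R => mobius (4 * t - 2)%:C%C); split=> //.
- apply: continuous_in_subspaceT => t _; apply: rcont_cvg.
  pose h (s : R) : C := (-2)%:C%C + s%:C%C * 4.
  have hE s : h s = (4 * s - 2)%:C%C by apply: cplx_eq; rewrite /h ?ReD ?ImD ?ReM ?ImM /=; ring.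
  have ch : rcont h t := rder_cont (rder_line _ _ _).
  have d : l * h t - j * k != 0 by rewrite hE mobius_den.
  have cm : ccont mobius (h t).
    exact: cder_cont (cder_div (cderB (cder_cst k _) (cderZ (j * l) (cder_id _))) (cderB (cderZ l (cder_id _)) (cder_cst (j * k) _)) d).
  have := ccont_rcont ch cm.
  by have -> : (fun s => mobius (h s)) = (fun s => mobius (4 * s - 2)%:C%C) by apply/funext => s; rewrite hE.
- by move=> s t _ _ /mobius_inj; lra.
Qed.

(** The two roots have product 1, so one lies in the disk unless both are on the circle; then
    [c = z + 1 / z] is twice the real part of [z], a number in [[-2, 2]]. *)
Lemma joukowski_root (c : C) : (forall x : R, -2 <= x <= 2 -> c <> x%:C%C) ->
  exists2 z, nm z < 1 & z ^+ 2 + 1 = c * z.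
Proof.
move=> nc; pose s := sqrtC (c ^+ 2 - 4); pose z := (c + s) / 2.
have e : z ^+ 2 + 1 = c * z.
  have ss : s * s = c ^+ 2 - 4 by rewrite -expr2 sqrtCK.
  by rewrite /z; field: ss.
have z0 : z != 0 by apply/eqP => z0; move/eqP: e; rewrite z0 expr0n /= add0r mulr0 oner_eq0.
have [h|h|h] := ltgtP (nm z) 1; first by exists z.
- exists z^-1; first by rewrite nmV invf_lt1 // (lt_trans _ h).
  apply: (mulIf (expf_neq0 2 z0)); rewrite mulrDl mul1r -exprMn mulVf // expr1n addrC e.
  by field.
- have zc : z * z^* = 1 by rewrite mulCJ h expr1n.
  have cE : c = (2 * complex.Re z)%:C%C.
    apply: (mulIf z0); rewrite -e.
    have -> : (2 * complex.Re z)%:C%C = z + z^* by rewrite conjCE; apply: cplx_eq; rewrite ?ReD ?ImD /=; ring.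
    by rewrite mulrDl (mulrC z^*) zc expr2.
  have := Re_le_nm z; rewrite h ler_norml => /andP[? ?].
  by case: (nc (2 * complex.Re z)) => //; apply/andP; split; lra.
Qed.

Lemma extremal_image : F @` @unit_disk R =
  ~` (@fin_pt R @` ((fun t : R => mobius (4 * t - 2)%:C%C) @` `[0, 1])).
Proof.
have [l0 k0] : l != 0 /\ k != 0 by rewrite xl_neq0 xk_neq0.
apply/seteqP; split=> [_ [z /diskE hz <-] [_ [t + <-]]|W nW].
  rewrite /= in_itv /= => /andP[t0 t1]; rewrite extremalE; case: eqVneq => // d; case.
  set x := 4 * t - 2; have dx := mobius_den x; move/eqP; rewrite eq_sym eqr_div // -subr_eq0.
  have -> : xnum z * (l * x%:C%C - j * k) - (k - j * l * x%:C%C) * xden z = 2 * k * l * (x%:C%C * z - (z ^+ 2 + 1)).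
    by rewrite /xnum /xden; ring: ii.
  rewrite !mulf_eq0 (negbTE two_neq0) (negbTE k0) (negbTE l0) /= subr_eq0 => /eqP/esym e.
  by apply: (root_on_circle _ e hz); apply/andP; rewrite /x; split; lra.
have num c z : z ^+ 2 + 1 = c * z -> xnum z = z * (k - j * l * c) /\ xden z = z * (l * c - j * k).
  move=> e; split.
    have -> : xnum z = z * k - j * l * (z ^+ 2 + 1) by rewrite /xnum; ring.
    by rewrite e; ring.
  have -> : xden z = l * (z ^+ 2 + 1) - z * (j * k) by rewrite /xden; ring.
  by rewrite e; ring.
case: W nW => [w|] nW; last first.
  (* The pole of [F] corresponds to the zero of the denominator of [mobius], which is not real. *)
  have [|z hz e] := @joukowski_root (j * k / l).
    move=> x _ e; have := mobius_den x; rewrite -e.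
    by apply/negP; rewrite negbK; apply/eqP; field.
  exists z; first exact/diskE.
  have [_ d] := num _ _ e; rewrite extremalE d ifT //.
  by apply/eqP; field.
(* [- j] is the value of [mobius] at infinity; [F] takes it at 0, where [z + 1 / z] is infinite. *)
have [->|wi] := eqVneq w (- j).
  exists 0; first by apply/diskE; rewrite nm0.
  have -> : F 0 = fin_pt (xnum 0 / xden 0).
    by rewrite extremalE /xden expr0n /= !mulr0 subr0 add0r (negbTE l0).
  congr Some; rewrite /xnum /xden; field; rewrite ?l0 //.
have wi' : w + j != 0 by rewrite -[j]opprK subr_eq0.
(* The preimage of [w] under [mobius]. *)
pose c : C := k * (1 + j * w) / (l * (w + j)).
have den : l * c - j * k = 2 * k / (w + j) by rewrite /c; field: ii; rewrite wi' l0.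
have den0 : l * c - j * k != 0 by rewrite den !mulf_neq0 ?invr_eq0 ?two_neq0.
have mc : (k - j * l * c) / (l * c - j * k) = w.
  by rewrite den /c; field: ii; rewrite l0 wi' k0.
have [|z hz e] := @joukowski_root c.
  move=> x /andP[x1 x2] e; apply: nW; exists w => //; exists ((x + 2) / 4).
    by rewrite /= in_itv /=; apply/andP; split; lra.
  have -> : 4 * ((x + 2) / 4) - 2 = x by field.
  by rewrite -e.
exists z; first exact/diskE.
have z0 : z != 0 by apply/eqP => z0; move/eqP: e; rewrite z0 expr0n /= add0r mulr0 oner_eq0.
have [n d] := num _ _ e; rewrite extremalE d mulf_eq0 (negbTE z0) (negbTE den0) /= n.
by congr Some; rewrite -mc -mulf_div divff // mul1r.
Qed.
End Extremal.

Theorem theorem2 (R : realType) :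
  (forall (F : R[i] -> sphere R) (z1 z2 w1 w2 : R[i]),
     admissible F z1 z2 w1 w2 ->
     schwarzian_lhs F z1 z2 w1 w2 <= schwarzian_rhs F z1 z2 w1 w2)
  /\
  (forall lam : R, 0 < lam -> lam < 1 ->
     let l : R[i] := (lam%:C)%C in
     let F := extremal lam in
     [/\ F (- l) = fin_pt (- 1) /\ F l = fin_pt 1,
         admissible F (- l) l (- 1) 1,
         schwarzian_lhs F (- l) l (- 1) 1 = schwarzian_rhs F (- l) l (- 1) 1,
         conformal_on (@unit_disk R) F /\ set_inj (@unit_disk R) F &
         exists A : set R[i],
           [/\ simple_arc R A, A `<=` @unit_circle R &
               F @` @unit_disk R = ~` (@fin_pt R @` A)]]).
Proof.
split=> [F z1 z2 w1 w2|lam lam0 lam1 l F]; first exact: schwarzian_inequality.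
split.
- exact: extremal_values.
- exact: extremal_admissible.
- exact: extremal_equality.
- by split; [exact: extremal_conformal|exact: extremal_inj].
exists ((fun t : R => mobius lam (4 * t - 2)%:C%C) @` `[0, 1]); split.
- exact: mobius_arc.
- by move=> _ [t _ <-]; exact: mobius_circle.
- exact: extremal_image.
Qed.
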